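(* Let $d\ge 2$, let $E\subset\mathbb{R}^d$ be compact with $\dim_{\mathcal H}(E)>d-1+\frac1d$, and let $\nu$ be a Frostman measure on $E$ (with exponent $s$ satisfying $d-1+\frac1d<s<\dim_{\mathcal H}(E)$). Then: (i) for every bounded set $T\subset\mathbb{R}$ there is a constant $C>0$ such that for all $t\in T$ and all $\epsilon>0$, $$(\nu\times\dots\times\nu)\{(x^1,\dots,x^{d+1})\in(\mathbb{R}^d)^{d+1}:\ |R(x^1,\dots,x^{d+1})-t|<\epsilon\}\le C\epsilon ;$$ (ii) the set $R(E\times\dots\times E)=\{R(x^1,\dots,x^{d+1}):x^1,\dots,x^{d+1}\in E\}\subset\mathbb{R}$ has positive one-dimensional Lebesgue measure. Moreover, when $d=2$ the threshold $d-1+\frac1d=\frac32$ in (i) is sharp, in the sense that the estimate in (i) does not generally hold when $\dim_{\mathcal H}(E)<\frac32$: for every $s_0<\frac32$ there exist a compact set $E\subset\mathbb{R}^2$ with $s_0<\dim_{\mathcal H}(E)<\frac32$ and a Frostman measure $\nu$ on $E$ with an exponent larger than $s_0$ for which the assertion (i) (with $d=2$) fails.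
   Context: $\dim_{\mathcal H}$ denotes Hausdorff dimension. A sphere ($(d-1)$-dimensional, in $\mathbb{R}^d$, of finite positive radius) is said to be determined by a $(d+1)$-tuple $(x^1,\dots,x^{d+1})$ of points of $\mathbb{R}^d$ if it is the unique sphere passing through all of the points $x^1,\dots,x^{d+1}$. $R(x^1,\dots,x^{d+1})$ denotes the radius of the $(d-1)$-dimensional sphere determined by $(x^1,\dots,x^{d+1})$, and $R(x^1,\dots,x^{d+1})=0$ if no sphere passes through all these points or if such a sphere is not unique. A Frostman measure on $E$ with exponent $s$ is a Borel probability measure $\nu$ supported on $E$ for which there is a constant $C_\nu$ with $\nu(B(x,r))\le C_\nu r^{s}$ for all $x\in\mathbb{R}^d$ and $r>0$. The product $\nu\times\dots\times\nu$ and the product $E\times\dots\times E$ have $d+1$ factors. *)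

(* Defs.v *)
From HB Require Import structures.
From mathcomp Require Import all_boot all_order all_algebra.
From mathcomp Require Import all_classical all_reals all_analysis.

Set Implicit Arguments.
Unset Strict Implicit.
Unset Printing Implicit Defensive.

Import Order.TTheory GRing.Theory Num.Theory.
Import numFieldNormedType.Exports.

Local Open Scope classical_set_scope.
Local Open Scope ring_scope.

(* The library norm on ['rV[R]_d] is the sup norm: it has the same topology as
   the Euclidean one, but spheres, balls and diameters have to be Euclidean. *)
Definition eucl_dist (R : realType) (d : nat) (x y : 'rV[R]_d) : R :=
  Num.sqrt (\sum_(i < d) (x ord0 i - y ord0 i) ^+ 2).

Definition eucl_ball (R : realType) (d : nat) (x : 'rV[R]_d) (r : R) :
  set 'rV[R]_d := [set y | eucl_dist x y < r].

(* The supremum is taken in [0, +oo], so that the diameter of [set0] is 0. *)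
Definition eucl_diam (R : realType) (d : nat) (A : set 'rV[R]_d) : \bar R :=
  ereal_sup (0%E |` [set (eucl_dist x y)%:E | x in A & y in A]).

Section hausdorff_dimension.
Context (R : realType) (d : nat).
Implicit Types (A : set 'rV[R]_d) (U : (set 'rV[R]_d)^nat) (s delta : R).

Definition hausdorff_content s delta A : \bar R :=
  ereal_inf [set (\sum_(0 <= k <oo) eucl_diam (U k) `^ s)%E | U in
    [set U | A `<=` \bigcup_k U k /\
             forall k, (eucl_diam (U k) <= delta%:E)%E]].

Definition hausdorff_measure s A : \bar R :=
  ereal_sup [set hausdorff_content s delta A | delta in [set delta | 0 < delta]].

(* Only positive exponents are considered because [0 `^ 0 = 1] in the library;
   omitting s = 0 does not change the infimum. *)
Definition hausdorff_dim A : \bar R :=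
  ereal_inf [set s%:E | s in [set s | 0 < s /\ hausdorff_measure s A = 0%E]].

End hausdorff_dimension.

Notation borel_rV R d := (g_sigma_algebraType (@open 'rV[R]_d)).

Section power_probability.
Context (disp : measure_display) (T : measurableType disp) (R : realType).
Variable P : probability T R.

Definition tuple_cons n (p : T * n.-tuple T) : n.+1.-tuple T :=
  [the n.+1.-tuple T of p.1 :: p.2].

Lemma measurable_tuple_cons n : measurable_fun [set: _] (@tuple_cons n).
Proof. exact: measurable_cons. Qed.

HB.instance Definition _ n :=
  isMeasurableFun.Build _ _ _ _ (@tuple_cons n) (@measurable_tuple_cons n).

(* n-fold product of [P], on the product sigma-algebra that the library puts on
   [n.-tuple T]. *)
Fixpoint power_probability n : probability (n.-tuple T) R :=
  if n is m.+1 then distribution (P \x power_probability m)%E (@tuple_cons m)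
  else \d_[tuple].

Lemma power_probabilityE n (A : 'I_n -> set T) :
  (forall i, measurable (A i)) ->
  power_probability n [set x | forall i, A i (tnth x i)] = (\prod_i P (A i))%E.
Proof.
elim: n A => [|n IHn] A mA /=.
  rewrite big_ord0 diracE (_ : _ \in _ = true)//.
  by apply/mem_set => /= -[].
rewrite /distribution /pushforward big_ord_recl -IHn; last by move=> i; apply: mA.
rewrite -product_measure1E//; last first.
  rewrite (_ : mkset _ = \bigcap_(i in [set: 'I_n])
      (@tnth _ T ^~ i @^-1` A (lift ord0 i))); last first.
    by apply/seteqP; split => x /= Ax i; [move=> _|]; exact: Ax.
  apply: fin_bigcap_measurable; first exact: finite_finset.
  by move=> i _; rewrite -[X in measurable X]setTI; exact: measurable_tnth.
congr (_ _); apply/seteqP; split=> -[x y] /=.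
  move=> Axy; split; first exact: (Axy ord0).
  by move=> i; have := Axy (lift ord0 i); rewrite tnthS.
move=> [Ax Ay] i; case: (unliftP ord0 i) => [j ->|->//].
by rewrite tnthS; exact: Ay.
Qed.

End power_probability.

Section circumradius.
Context (R : realType) (d : nat).
Implicit Types (c : 'rV[R]_d) (r : R) (S : set 'rV[R]_d).

Definition eucl_sphere c r : set 'rV[R]_d := [set y | eucl_dist c y = r].

Definition is_sphere S := exists c r, 0 < r /\ S = eucl_sphere c r.

Definition determines_sphere (x : d.+1.-tuple 'rV[R]_d) S :=
  (is_sphere S /\ forall i, S (tnth x i)) /\
  forall S', is_sphere S' -> (forall i, S' (tnth x i)) -> S' = S.

Definition circumradius (x : d.+1.-tuple 'rV[R]_d) : R :=
  xget 0 [set r | 0 < r /\ exists c, determines_sphere x (eucl_sphere c r)].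

End circumradius.

Definition frostman (R : realType) (d : nat) (E : set 'rV[R]_d) (s : R)
    (nu : probability (borel_rV R d) R) :=
  nu (~` E) = 0%E /\
  exists C : R, forall (x : 'rV[R]_d) (r : R), 0 < r ->
    (nu (eucl_ball x r) <= (C * r `^ s)%:E)%E.

Definition circumradius_estimate (R : realType) (d : nat)
    (nu : probability (borel_rV R d) R) :=
  forall T : set R, bounded_set T ->
  exists2 C : R, 0 < C & forall t e : R, T t -> 0 < e ->
    (power_probability nu d.+1 [set x | (`|circumradius x - t| < e)%R] <=
     (C * e)%:E)%E.

(* Main.v *)
Require Import Defs.
From HB Require Import structures.
From mathcomp Require Import all_boot all_order all_algebra.
From mathcomp Require Import all_classical all_reals all_analysis.
From mathcomp Require Import measurable_realfun complex zify ring lra.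

(* Upper bound. Scale the points by [1/t]. A tuple with [|R - t| < e] lies within
   [O(e/t)] of a unit sphere, and so it does when the centre [c] is moved by [e/t];
   averaging over [c] bounds the probability by
     [(e/t)^(-d) \int nu {x : |X| < 6 e/t}^(d+1) dc], with [X = |x - c|^2 - 1].
   The mass of the annulus is dominated by an average over [Y = e + u^(2 M)], [u]
   in [0,1], of the fields [F_Y(c) = \int (X - i Y)^(-(d+1)/2) dnu(x)]. The growth of
   [nu] gives [sup |F_Y| = O(Y^(s-d+1-(d+1)/2))]. Writing
   [X - i Y = |x - c|^2 + (a - i b)^2], the kernel is a wave in [(c, b)] whose energy
   is conserved in [b]; moving to [b = 0], where the kernel is positive, gives
   [\int |F_Y|^2 dc = O(Y^(s-d))]. Interpolating and integrating in [u] by Jensen's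
   inequality with [M] large yields a bounded [L^(d+1)] norm exactly when
   [s > d - 1 + 1/d]. A null set of radii could be covered by intervals of small
   total length, hence would have a null preimage, whereas [E^(d+1)] has measure 1.

   Sharpness. Translate an arc of the unit circle horizontally along a Cantor set
   made at stage [n] of [M^n] intervals of length [N^-n], [N = 4 M^2]. Three points
   in the same interval, which happens with probability [M^(-2 n)], have a
   circumradius in [1 + O(N^-n)], and [N^-n = 4^-n M^(-2 n)]. *)

Set Implicit Arguments.
Unset Strict Implicit.
Unset Printing Implicit Defensive.

Import Order.TTheory GRing.Theory Num.Theory.
Import numFieldNormedType.Exports.

Local Open Scope classical_set_scope.
Local Open Scope ring_scope.

(** * Product measures on tuples *)

(** The ratio $\nu\{|X|<e\}/e$, as a function of the centre $c$, has to be bounded in $L^{d+1}$ with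
    no loss as $e\to0$. The natural majorant $\mathrm{Im}\,(X-ie)^{-1}=e/(X^2+e^2)$ carries no
    conserved energy. The power that does is $(d+1)/2$: the function
    $\varphi=(|x-c|^2+(a-ib)^2)^{-(d-1)/2}$ is the fundamental harmonic function of $d+1$ variables
    at imaginary time, so it solves the wave equation in $(c,b)$, and its gradient is
    $(|x-c|^2+(a-ib)^2)^{-(d+1)/2}$ times multiples of $x-c$ and $a-ib$. An exact identity links the
    two powers: with $w(Y)=(X-iY)^{-1/2}$, the $u$-derivative of $(u^Mw(e+u^{2M}))^k$ is
    $Mk\,u^{Mk-1}w^{k+2}(X-ie)$. For $k=d-1$, integration over $[0,1]$ recovers $(X-ie)^{-1}$ up to
    the harmless factor $w(1+e)^k$. The freedom in $M$ makes Jensen's inequality affordable: as $M$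
    grows, averaging in $u$ approaches averaging over dyadic scales of $Y$. *)

Section tuple_product_measure.
Context (disp : measure_display) (T : measurableType disp) (R : realType).

Definition tuple_uncons n (x : n.+1.-tuple T) : T * n.-tuple T :=
  (thead x, [tuple of behead x]).

Lemma tuple_consK n : cancel (@tuple_cons _ T n) (@tuple_uncons n).
Proof. by case=> a x; congr pair; apply/val_inj. Qed.

Lemma measurable_tuple_uncons n : measurable_fun [set: _] (@tuple_uncons n).
Proof.
apply: measurable_fun_pair; last exact: measurable_behead.
by apply: measurable_tnth.
Qed.

(** Built by the same recursion as [power_probability], but for sigma-finite factors, so that it
    also yields Lebesgue measure on R^n and splits off one coordinate at a time. *)
Definition cons_measure n (m1 : {sigma_finite_measure set T -> \bar R})
    (m2 : {sigma_finite_measure set (n.-tuple T) -> \bar R}) :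
    set (n.+1.-tuple T) -> \bar R :=
  pushforward (m1 \x m2)%E (@tuple_cons _ T n).

Section cons_measure.
Context n (m1 : {sigma_finite_measure set T -> \bar R})
  (m2 : {sigma_finite_measure set (n.-tuple T) -> \bar R}).

Let cons_measure0 : cons_measure m1 m2 set0 = 0%E.
Proof. by rewrite /cons_measure /pushforward preimage_set0 measure0. Qed.

Let cons_measure_ge0 A : (0 <= cons_measure m1 m2 A)%E.
Proof. exact: measure_ge0. Qed.

Let cons_measure_sigma_additive : semi_sigma_additive (cons_measure m1 m2).
Proof.
move=> F mF tF mUF; rewrite /cons_measure /pushforward preimage_bigcup.
apply: measure_semi_sigma_additive.
- by move=> k; rewrite -[X in measurable X]setTI; exact: measurable_tuple_cons.
- apply/trivIsetP => i j _ _ ij; rewrite -preimage_setI.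
  by move/trivIsetP : tF => /(_ _ _ _ _ ij) ->//; rewrite preimage_set0.
- rewrite -preimage_bigcup -[X in measurable X]setTI.
  exact: measurable_tuple_cons.
Qed.

HB.instance Definition _ := isMeasure.Build _ _ _ (cons_measure m1 m2)
  cons_measure0 cons_measure_ge0 cons_measure_sigma_additive.

Lemma cons_measure_sigma_finite : sigma_finite [set: _] (cons_measure m1 m2).
Proof.
have /sigma_finiteP[F [TF ndF Foo]] := sigma_finiteT m1.
have /sigma_finiteP[G [TG ndG Goo]] := sigma_finiteT m2.
exists (fun k => @tuple_uncons n @^-1` (F k `*` G k)).
  rewrite -preimage_bigcup (_ : \bigcup_k (F k `*` G k) = setT) ?preimage_setT//.
  rewrite -setXTT TF TG predeqE => -[x y]; split.
    by move=> [k _ []/= ? ?]; split; exists k.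
  move=> [/= [i _ Fx] [k _ Gy]]; exists (maxn i k) => //; split.
    by move: x Fx; exact/subsetPset/ndF/leq_maxl.
  by move: y Gy; exact/subsetPset/ndG/leq_maxr.
move=> k; have [mF Fk] := Foo k; have [mG Gk] := Goo k; split.
  rewrite -[X in measurable X]setTI; apply: measurable_tuple_uncons => //.
  exact: measurableX.
rewrite /cons_measure /pushforward (_ : _ @^-1` _ = F k `*` G k).
  by rewrite product_measure1E// lte_mul_pinfty// ge0_fin_numE.
by apply/seteqP; split => x; rewrite /preimage/mkset tuple_consK.
Qed.

HB.instance Definition _ :=
  Measure_isSigmaFinite.Build _ _ _ (cons_measure m1 m2)
    cons_measure_sigma_finite.

End cons_measure.

Fixpoint power_measure (m : {sigma_finite_measure set T -> \bar R}) n :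
    {sigma_finite_measure set (n.-tuple T) -> \bar R} :=
  if n is k.+1 then cons_measure m (power_measure m k) else \d_[tuple].

End tuple_product_measure.

Section tuple_fubini.
Context (disp : measure_display) (T : measurableType disp) (R : realType) (n : nat).
Variables (m1 : {sigma_finite_measure set T -> \bar R})
  (m2 : {sigma_finite_measure set (n.-tuple T) -> \bar R}).
Local Open Scope ereal_scope.
Let cons := @tuple_cons _ T n.
Implicit Types f : n.+1.-tuple T -> \bar R.

Lemma ge0_integral_tuple_cons f : measurable_fun [set: n.+1.-tuple T] f ->
  (forall x, 0 <= f x) ->
  \int[cons_measure m1 m2]_x f x = \int[m1]_t \int[m2]_y f (cons (t, y)).
Proof.
move=> mf f0; have mc := @measurable_tuple_cons _ T n.
rewrite ge0_integral_pushforward// preimage_setT.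
rewrite (fubini_tonelli1 (m1 := m1) (m2 := m2) (f \o cons))//; last by move=> x; exact: f0.
exact: measurableT_comp.
Qed.

Lemma ge0_integral_tuple_cons_swap f : measurable_fun [set: n.+1.-tuple T] f ->
  (forall x, 0 <= f x) ->
  \int[cons_measure m1 m2]_x f x = \int[m2]_y \int[m1]_t f (cons (t, y)).
Proof.
move=> mf f0; rewrite ge0_integral_tuple_cons//.
have mfc : measurable_fun [set: T * n.-tuple T] (f \o cons).
  by apply: measurableT_comp => //; exact: measurable_tuple_cons.
have fc0 x : 0 <= (f \o cons) x by exact: f0.
exact: (fubini_tonelli (f \o cons)).
Qed.

Lemma integrable_tuple_cons f : (cons_measure m1 m2).-integrable [set: n.+1.-tuple T] f ->
  (m1 \x m2).-integrable [set: _] (f \o cons).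
Proof.
move=> /integrableP[mf foo]; apply/integrableP; split.
  by apply: measurableT_comp => //; exact: measurable_tuple_cons.
move: foo; have mc := @measurable_tuple_cons _ T n.
by rewrite ge0_integral_pushforward ?preimage_setT//; exact: measurableT_comp.
Qed.

Lemma integral_cons_measure f : (cons_measure m1 m2).-integrable [set: n.+1.-tuple T] f ->
  \int[cons_measure m1 m2]_x f x = \int[(m1 \x m2)%E]_z f (cons z).
Proof.
move=> intf; have mf := measurable_int _ intf.
have mc := @measurable_tuple_cons _ T n.
rewrite [LHS]integralE [RHS]integralE !ge0_integral_pushforward//.
- by rewrite !preimage_setT -funepos_comp -funeneg_comp.
- exact: measurable_funeneg.
- exact: measurable_funepos.
Qed.

Lemma integral_tuple_cons f : (cons_measure m1 m2).-integrable [set: n.+1.-tuple T] f ->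
  \int[cons_measure m1 m2]_x f x = \int[m1]_t \int[m2]_y f (cons (t, y)).
Proof.
move=> intf; rewrite integral_cons_measure//.
by rewrite -(integral12_prod_meas1 (integrable_tuple_cons intf)).
Qed.

Lemma integral_tuple_cons_swap f :
  (cons_measure m1 m2).-integrable [set: n.+1.-tuple T] f ->
  \int[cons_measure m1 m2]_x f x = \int[m2]_y \int[m1]_t f (cons (t, y)).
Proof.
move=> intf; rewrite integral_cons_measure//.
by rewrite -(integral21_prod_meas1 (integrable_tuple_cons intf)).
Qed.

End tuple_fubini.

(* [measurableTypeR R] is [R] with its Borel sets, so this is R^n with its
   product sigma-algebra; ['rV[R]_n] carries no measurable structure. *)
Notation pt R n := (n.-tuple (measurableTypeR R)).

(** * Lebesgue measure on R^n and integrals of partial derivatives *)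

Section vol.
Context (R : realType).

Local Notation T := (measurableTypeR R).

Definition vol n : {sigma_finite_measure set (n.-tuple T) -> \bar R} :=
  power_measure (@lebesgue_measure R) n.

Definition upd n (c : n.-tuple T) (j : 'I_n) (t : R) : n.-tuple T :=
  [tuple if i == j then t else tnth c i | i < n].

Lemma tnth_upd n (c : n.-tuple T) j t i :
  tnth (upd c j t) i = if i == j then t else tnth c i.
Proof. by rewrite tnth_mktuple. Qed.

Lemma upd_cons0 n t (y : n.-tuple T) s :
  upd (tuple_cons (t, y)) ord0 s = tuple_cons (s, y).
Proof.
apply: eq_from_tnth => i; rewrite tnth_upd /tuple_cons /=.
by case: (unliftP ord0 i) => [k ->|->]; rewrite ?eqxx//= ?tnthS// tnth0.
Qed.

Lemma upd_consS n t (y : n.-tuple T) j s :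
  upd (tuple_cons (t, y)) (lift ord0 j) s = tuple_cons (t, upd y j s).
Proof.
apply: eq_from_tnth => i; rewrite tnth_upd /tuple_cons /=.
case: (unliftP ord0 i) => [k ->|->]; rewrite ?tnth0//.
by rewrite !tnthS tnth_upd (inj_eq lift_inj).
Qed.

(** The fundamental theorem of calculus on $[-k-1,k+1]$ leaves boundary values of [g], which tend to
    0; dominated convergence replaces these intervals by the line. *)
Lemma integral_derive_eq0 (f g : R -> R) :
  (@lebesgue_measure R).-integrable [set: _] (EFin \o f) -> continuous f ->
  (forall t : R, is_derive t (1 : R) g (f t)) ->
  g t @[t --> +oo%R] --> (0 : R) -> g t @[t --> -oo%R] --> (0 : R) ->
  (\int[lebesgue_measure]_t (f t)%:E = 0)%E.
Proof.
move=> intf cf df gy gNy; pose mu : {measure set T -> \bar R} := @lebesgue_measure R.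
have ftc k : (\int[mu]_(t in `[(- k.+1%:R)%R, k.+1%:R%R]) (f t)%:E =
    (g k.+1%:R - g (- k.+1%:R))%:E)%E.
  have cg : continuous g.
    by move=> t; apply/differentiable_continuous/derivable1_diffP/(df t).(ex_derive).
  rewrite EFinB (continuous_FTC2 (F := g))//.
  - by rewrite (@lt_trans _ _ 0)// oppr_lt0.
  - exact: continuous_subspaceT.
  - split => [t _||]; first exact: (df t).(ex_derive).
      by apply: cvg_at_right_filter; exact: cg.
    by apply: cvg_at_left_filter; exact: cg.
  - by move=> t _; rewrite derive1E; exact: (df t).(derive_val).
have mitv k : measurable [set` `[- k.+1%:R, k.+1%:R : R]] by [].
have lim0 : (\int[mu]_(t in `[(- k.+1%:R)%R, k.+1%:R%R]) (f t)%:E @[k --> \oo] --> 0)%E.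
  under eq_fun do rewrite ftc.
  apply: cvg_EFin; first exact: nearW.
  rewrite -[X in _ --> X](subr0 0); apply: cvgB.
    have -> : (fun k : nat => fine (g k.+1%:R)%:E) = g \o (fun k => k.+1%:R) by [].
    apply: cvg_comp gy; apply/cvgryPge => A.
    near=> k; rewrite (le_trans (_ : A <= k%:R))// ?ler_nat//.
    by near: k; exact: nbhs_infty_ger.
  apply: (cvg_comp (fun k : nat => - k.+1%:R)) gNy.
  apply/cvgrNyPle => A; near=> k.
  rewrite lerNl (le_trans (_ : - A <= k%:R))// ?ler_nat//.
  by near: k; exact: nbhs_infty_ger.
apply: (@cvg_unique _ _ _ _ _ _ _ lim0) => //.
rewrite [X in X @ _](_ : _ = fun k : nat => \int[mu]_t
    ((EFin \o f) \_ `[(- k.+1%:R)%R, k.+1%:R%R]) t)%E; last first.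
  by apply/funext => k; rewrite integral_mkcond.
apply: (@dominated_cvg _ _ _ mu _ _ _ _ (fun t => `|f t|%:E)) => //.
- move=> k; apply/(measurable_restrictT _ (mitv k)).
  by apply/measurable_funTS; exact: measurable_int intf.
- move=> t _; apply: cvg_near_cst; near=> k; rewrite patchE mem_set//=.
  rewrite in_itv/= -ler_norml (le_trans (_ : _ <= k%:R))// ?ler_nat//.
  by near: k; exact: nbhs_infty_ger.
- by apply: integrable_norm.
- move=> k t _; rewrite patchE; case: ifPn => _ //=.
  by rewrite lee_fin normr0.
Unshelve. all: by end_near. Qed.

(** This is the divergence theorem for one component of a vector field. Fubini isolates coordinate
    [j]; the sections of [f] are integrable only almost everywhere, which is why the inner integrals
    are compared with 0 by [ae_eq_integral]. *)
Lemma integral_partial_eq0 n (j : 'I_n) (f g : n.-tuple T -> R) :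
  (vol n).-integrable [set: _] (EFin \o f) ->
  (forall c, continuous (fun t => f (upd c j t))) ->
  (forall c (t : R), is_derive t (1 : R) (fun t => g (upd c j t)) (f (upd c j t))) ->
  (forall c, g (upd c j t) @[t --> +oo%R] --> (0 : R)) ->
  (forall c, g (upd c j t) @[t --> -oo%R] --> (0 : R)) ->
  (\int[vol n]_c (f c)%:E = 0)%E.
Proof.
elim: n j f g => [[]//|n IHn] j f g intf cf df gy gNy.
case: (unliftP ord0 j) => [k jk|j0]; subst j.
- transitivity (\int[lebesgue_measure]_t
    \int[vol n]_y (f (tuple_cons (t, y)))%:E)%E.
    exact: (integral_tuple_cons (m1 := lebesgue_measure) intf).
  have aei := ae_integrable1 (integrable_tuple_cons intf).
  transitivity (\int[lebesgue_measure]_t (cst 0 (t : R)))%E; last first.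
    exact: integral0.
  apply: ae_eq_integral => //.
    exact: (measurable_fubini_F (integrable_tuple_cons intf)).
  apply: filterS aei => t it _ /=.
  apply: (IHn k _ (fun y => g (tuple_cons (t, y)))) => //.
  + by move=> c; have := cf (tuple_cons (t, c)); under eq_fun do rewrite upd_consS.
  + move=> c s; have := df (tuple_cons (t, c)) s.
    by under eq_fun do rewrite upd_consS; rewrite upd_consS.
  + by move=> c; have := gy (tuple_cons (t, c)); under eq_fun do rewrite upd_consS.
  + by move=> c; have := gNy (tuple_cons (t, c)); under eq_fun do rewrite upd_consS.
- transitivity (\int[vol n]_y
    \int[lebesgue_measure]_t (f (tuple_cons (t, y)))%:E)%E.
    exact: (integral_tuple_cons_swap (m1 := lebesgue_measure) intf).
  have aei := ae_integrable2 (integrable_tuple_cons intf).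
  transitivity (\int[vol n]_y (cst 0 (y : n.-tuple T)))%E; last first.
    exact: integral0.
  apply: ae_eq_integral => //.
    exact: (measurable_fubini_G (integrable_tuple_cons intf)).
  apply: filterS aei => y iy _ /=.
  apply: (@integral_derive_eq0 _ (fun t => g (tuple_cons (t, y)))) => //.
  + have := cf (@tuple_cons _ T n (0, y)); under eq_fun do rewrite upd_cons0.
    by [].
  + move=> t; have := df (@tuple_cons _ T n (0, y)) t; rewrite upd_cons0.
    by under eq_fun do rewrite upd_cons0.
  + by have := gy (@tuple_cons _ T n (0, y)); under eq_fun do rewrite upd_cons0.
  + by have := gNy (@tuple_cons _ T n (0, y)); under eq_fun do rewrite upd_cons0.
Qed.

End vol.

(** * Sections and boxes of product measures *)

Section power_measure_theory.
Context (disp : measure_display) (T : measurableType disp) (R : realType).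
Variable m : {sigma_finite_measure set T -> \bar R}.
Local Open Scope ereal_scope.

Lemma measurable_tuple_section1 n (A : set (n.+1.-tuple T)) t :
  measurable A -> measurable [set y | A (tuple_cons (t, y))].
Proof.
move=> mA; rewrite -[X in measurable X]setTI.
suff : measurable_fun [set: n.-tuple T] (fun y => tuple_cons (t, y)) by exact.
by apply: measurable_cons => //; exact: measurable_id.
Qed.

Lemma measurable_tuple_section2 n (A : set (n.+1.-tuple T)) (y : n.-tuple T) :
  measurable A -> measurable [set t | A (tuple_cons (t, y))].
Proof.
move=> mA; rewrite -[X in measurable X]setTI.
suff : measurable_fun [set: T] (fun t => tuple_cons (t, y)) by exact.
by apply: measurable_cons; [exact: measurable_id|exact: measurable_cst].
Qed.

Lemma measurable_power_measure_section n (A : set (n.+1.-tuple T)) :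
  measurable A -> measurable_fun [set: T]
    (fun t => power_measure m n [set y | A (tuple_cons (t, y))]).
Proof.
move=> mA; have mB : measurable (@tuple_cons _ T n @^-1` A).
  by rewrite -[X in measurable X]setTI; exact: measurable_tuple_cons.
have := measurable_fun_xsection (power_measure m n) mB.
congr (measurable_fun _ _); apply/funext => t /=; congr (_ _).
by apply/seteqP; split => y /=; rewrite /xsection/= inE.
Qed.

Lemma measurable_measure_section n (A : set (n.+1.-tuple T)) :
  measurable A -> measurable_fun [set: n.-tuple T]
    (fun y => m [set t | A (tuple_cons (t, y))]).
Proof.
move=> mA; have mB : measurable (@tuple_cons _ T n @^-1` A).
  by rewrite -[X in measurable X]setTI; exact: measurable_tuple_cons.
have := measurable_fun_ysection m mB.
congr (measurable_fun _ _); apply/funext => t /=; congr (_ _).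
by apply/seteqP; split => y /=; rewrite /ysection/= inE.
Qed.

Lemma power_measure_cons n (A : set (n.+1.-tuple T)) : measurable A ->
  power_measure m n.+1 A =
  \int[m]_t power_measure m n [set y | A (tuple_cons (t, y))].
Proof.
move=> mA; transitivity (\int[power_measure m n.+1]_x (\1_A x)%:E).
  by rewrite integral_indic// setIT.
rewrite [LHS](ge0_integral_tuple_cons m (power_measure m n))//; last first.
  exact/measurable_EFinP/measurable_indic.
apply: eq_integral => t _.
rewrite -[X in power_measure m n X]setIT -integral_indic//.
exact: measurable_tuple_section1.
Qed.

Lemma power_measure_cons_swap n (A : set (n.+1.-tuple T)) : measurable A ->
  power_measure m n.+1 A =
  \int[power_measure m n]_y m [set t | A (tuple_cons (t, y))].
Proof.
move=> mA; transitivity (\int[power_measure m n.+1]_x (\1_A x)%:E).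
  by rewrite integral_indic// setIT.
rewrite [LHS](ge0_integral_tuple_cons_swap m (power_measure m n))//; last first.
  exact/measurable_EFinP/measurable_indic.
apply: eq_integral => t _.
rewrite -[X in m X]setIT -integral_indic//.
exact: measurable_tuple_section2.
Qed.

Lemma measurable_tuple_box n (A : 'I_n -> set T) :
  (forall i, measurable (A i)) ->
  measurable [set x : n.-tuple T | forall i, A i (tnth x i)].
Proof.
move=> mA; rewrite (_ : mkset _ = \bigcap_(i in [set: 'I_n])
    (@tnth _ T ^~ i @^-1` A i)); last first.
  by apply/seteqP; split => x /= Ax i; [move=> _|]; exact: Ax.
apply: fin_bigcap_measurable; first exact: finite_finset.
by move=> i _; rewrite -[X in measurable X]setTI; exact: measurable_tnth.
Qed.

Lemma power_measureE n (A : 'I_n -> set T) : (forall i, measurable (A i)) ->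
  power_measure m n [set x | forall i, A i (tnth x i)] = \prod_i m (A i).
Proof.
elim: n A => [|n IHn] A mA.
  rewrite big_ord0 /= diracE (_ : _ \in _ = true)//.
  by apply/mem_set => /= -[].
rewrite big_ord_recl -IHn; last by move=> i; apply: mA.
rewrite /= /cons_measure/pushforward -product_measure1E//; last first.
  exact: (measurable_tuple_box (A := fun i => A (lift ord0 i))).
congr (_ _); apply/seteqP; split=> -[x y] /=.
  move=> Axy; split; first exact: (Axy ord0).
  by move=> i; have := Axy (lift ord0 i); rewrite tnthS.
move=> [Ax Ay] i; case: (unliftP ord0 i) => [j ->|->//].
by rewrite tnthS; exact: Ay.
Qed.

End power_measure_theory.

(** * Volumes of balls and of sets with short slices *)

Section vol_theory.
Context (R : realType).

(** Kept squared so that it is a polynomial in the coordinates, smooth also on the diagonal. *)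
Definition sqd n (x y : pt R n) : R := \sum_(i < n) (tnth x i - tnth y i) ^+ 2.

Lemma sqdC n (x y : pt R n) : sqd x y = sqd y x.
Proof. by apply: eq_bigr => i _; rewrite -sqrrN opprB. Qed.

Lemma sqd_ge0 n (x y : pt R n) : 0 <= sqd x y.
Proof. by apply: sumr_ge0 => i _; exact: sqr_ge0. Qed.

Lemma sqd_coord_le n (x y : pt R n) i : (tnth x i - tnth y i) ^+ 2 <= sqd x y.
Proof.
by rewrite /sqd (bigD1 i)//= lerDl; apply: sumr_ge0 => j _; exact: sqr_ge0.
Qed.

Lemma measurable_sqd n d (S : measurableType d) (f g : S -> pt R n) :
  measurable_fun setT f -> measurable_fun setT g ->
  measurable_fun setT (fun s => sqd (f s) (g s)).
Proof.
move=> mf mg; apply: measurable_sum => i; apply: measurable_funX.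
by apply: measurable_funB; apply: (measurableT_comp (measurable_tnth i)).
Qed.

Lemma vol_box n (x : pt R n) (r : R) : 0 <= r ->
  vol R n [set c | forall i, `|tnth c i - tnth x i| <= r] = ((2 * r) ^+ n)%:E.
Proof.
move=> r0; have itvE i : [set t : R | `|t - tnth x i| <= r] =
    [set` `[tnth x i - r, tnth x i + r]].
  by apply/seteqP; split => t /=; rewrite in_itv/= ler_distl.
have := @power_measureE _ _ _ (@lebesgue_measure R) n
  (fun i => [set t : R | `|t - tnth x i| <= r]).
rewrite /vol => ->; last by move=> i; rewrite itvE; exact: measurable_itv.
rewrite (eq_bigr (fun=> (2 * r)%:E)); last first.
  move=> i _; transitivity (lebesgue_measure [set` `[tnth x i - r, tnth x i + r]]).
    by rewrite -itvE.
  rewrite (lebesgue_measure_itv `[tnth x i - r, tnth x i + r])/= lte_fin.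
  have [_|] := ltP (_ - _) (_ + _); first by rewrite -EFinD; congr EFin; ring.
  move=> ?; congr EFin; lra.
by rewrite prodEFin prodr_const card_ord.
Qed.

Lemma measurable_sqd_lt n (x : pt R n) r : measurable [set c | sqd c x < r].
Proof.
rewrite -[X in measurable X]setTI (_ : mkset _ = (fun c => sqd c x) @^-1` `]-oo, r[).
  by apply: measurable_sqd => //; exact: measurable_cst.
by apply/seteqP; split => c /=; rewrite in_itv.
Qed.

Lemma vol_ball_le n (x : pt R n) r : 0 <= r ->
  (vol R n [set c | sqd c x < r ^+ 2]%R <= ((2 * r) ^+ n)%:E)%E.
Proof.
move=> r0; rewrite -(vol_box x r0); apply: le_measure; rewrite ?inE.
- exact: measurable_sqd_lt.
- apply: (@measurable_tuple_box _ _ _ (fun i => [set t : R | `|t - tnth x i| <= r])).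
  move=> i; rewrite (_ : mkset _ = [set` `[tnth x i - r, tnth x i + r]])//.
  by apply/seteqP; split => t /=; rewrite in_itv/= ler_distl.
- move=> c /= cx i; rewrite -ler_sqr ?nnegrE// real_normK ?num_real//.
  exact: le_trans (sqd_coord_le _ _ _) (ltW cx).
Qed.

(** Cavalieri's principle: slices in direction [j] contribute at most [m], each of the [n.-1] other
    coordinates an interval of length [2 * L]. Coordinates before [j] are integrated out one by one;
    when [j] comes first, the others form a box of known volume. *)
Lemma vol_slices n (j : 'I_n) (A : set (pt R n)) (a : 'I_n -> R) (L m : R) :
  0 <= L -> 0 <= m -> measurable A ->
  (forall c, A c -> forall i, `|tnth c i - a i| <= L) ->
  (forall c, (lebesgue_measure [set t | A (upd c j t)] <= m%:E)%E) ->
  (vol R n A <= ((2 * L) ^+ n.-1 * m)%:E)%E.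
Proof.
move=> L0 m0 mA AL sA; elim: n j A a mA AL sA => [[]//|n IHn] j A a mA AL sA.
case: (unliftP ord0 j) => [k jk|j0]; subst j.
- have [n' nE] : exists n', n = n'.+1 by case: n k {IHn mA AL sA A a} => [[]//|n'] _; exists n'.
  rewrite [leLHS](power_measure_cons _ mA).
  have K0 : 0 <= (2 * L) ^+ n.-1 * m by rewrite mulr_ge0// exprn_ge0// mulr_ge0.
  apply: (@le_trans _ _ (\int[lebesgue_measure]_(t in `[(a ord0 - L)%R, (a ord0 + L)%R])
      ((2 * L) ^+ n.-1 * m)%:E)%E); last first.
    rewrite integral_cst//= lebesgue_measure_itv/= lte_fin.
    move: (a ord0) => a0; rewrite nE exprS.
    case: ifPn => _; last by rewrite mule0 lee_fin !mulr_ge0// exprn_ge0// mulr_ge0.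
    rewrite -EFinD -EFinM lee_fin /= (_ : _ * (a0 + L - (a0 - L)) = 2 * L * (2 * L) ^+ n' * m)//.
    by ring.
  rewrite [leRHS]integral_mkcond; apply: ge0_le_integral => //.
  + exact: measurable_power_measure_section.
  + have mL : measurable [set` `[a ord0 - L, a ord0 + L]] by exact: measurable_itv.
    apply/(measurable_restrictT _ mL).
    exact: measurable_cst.
  + move=> t _; rewrite patchE; case: ifPn => [_|tL].
      apply: (IHn k _ (fun i => a (lift ord0 i))).
      * exact: measurable_tuple_section1.
      * by move=> y /AL + i => /(_ (lift ord0 i)); rewrite tnthS.
      * by move=> y; have := sA (tuple_cons (t, y)); under eq_set do rewrite upd_consS.
    rewrite (_ : [set y | _] = set0) ?measure0//.
    apply/seteqP; split => y //= /AL /(_ ord0).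
    by move/negP : tL; rewrite inE/= in_itv/= -ler_distl tnth0.
- rewrite [leLHS](power_measure_cons_swap _ mA).
  pose Q : set (pt R n) := [set c | forall i, `|tnth c i - tnth [tuple a (lift ord0 i) | i < n] i| <= L].
  have mQ : measurable Q.
    apply: (@measurable_tuple_box _ _ _ (fun i => [set t : R | `|t - tnth [tuple a (lift ord0 i) | i < n] i| <= L])).
    move=> i; rewrite (_ : mkset _ = [set` `[tnth [tuple a (lift ord0 i) | i < n] i - L, tnth [tuple a (lift ord0 i) | i < n] i + L]])//.
    by apply/seteqP; split => t /=; rewrite in_itv/= ler_distl.
  apply: (@le_trans _ _ (\int[vol R n]_(y in Q) m%:E)%E); last first.
    by rewrite integral_cst//= vol_box// -EFinM lee_fin mulrC.
  rewrite [leRHS]integral_mkcond; apply: ge0_le_integral => //.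
  + exact: measurable_measure_section.
  + have mc : measurable_fun Q (cst m%:E) by [].
    by move/(measurable_restrictT _ mQ) : mc.
  + move=> y _; rewrite patchE; case: ifPn => [_|yQ].
      by have := sA (@tuple_cons _ (measurableTypeR R) n (0, y)); under eq_set do rewrite upd_cons0.
    rewrite (_ : [set t | _] = set0) ?measure0//.
    apply/seteqP; split => t //= /AL tL; move/negP : yQ; apply; rewrite inE/= => i.
    by have := tL (lift ord0 i); rewrite tnthS tnth_mktuple.
Qed.

End vol_theory.

(** * Measures of power growth *)

Lemma powR_lt1 (R : realType) (a x : R) : 1 < a -> x < 0 -> a `^ x < 1.
Proof.
move=> a1 x0; rewrite /powR gt_eqF ?(lt_trans ltr01)// expR_lt1.
by rewrite pmulr_llt0// ln_gt0.
Qed.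

Lemma powR_exprn (R : realType) (x y : R) k : 0 <= x ->
  (x `^ y) ^+ k = (x ^+ k) `^ y.
Proof.
move=> x0; rewrite -(powR_mulrn k (powR_ge0 x y)) -(powR_mulrn k x0) -!powRrM.
by rewrite mulrC.
Qed.

Lemma geometric_nneseries (R : realType) (a q : R) : 0 <= q < 1 ->
  (\sum_(0 <= k <oo) (a * q ^+ k)%:E = (a / (1 - q))%:E)%E.
Proof.
move=> /andP[q0 q1]; apply/cvg_lim => //.
rewrite (_ : (fun n => _) = EFin \o series (geometric a q)); last first.
  by apply/funext => n /=; rewrite sumEFin.
apply: cvg_EFin; first exact: nearW.
by apply: cvg_geometric_series; rewrite ger0_norm.
Qed.

Section layer_cake.
Context (disp : measure_display) (T : measurableType disp) (R : realType).
Variable mu : {measure set T -> \bar R}.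

(** Sum of a geometric series of ratio [2 ^ (sg - kap)]; the factor [2 ^ kap] appears because a
    point of the [k]-th dyadic layer satisfies only $1+g/a\ge2^{k-1}$. *)
Definition layer_cst (kap sg : R) : R := 2 `^ kap / (1 - 2 `^ (sg - kap)).

Lemma layer_cst_ge0 kap sg : sg < kap -> 0 <= layer_cst kap sg.
Proof.
move=> sk; rewrite divr_ge0// ?powR_ge0// subr_ge0.
by rewrite ltW// powR_lt1 ?ltr1n ?subr_lt0.
Qed.

(** Dyadic decomposition: if $k$ is least with $g(x)<a2^k$, the integrand at $x$ is at most the
    [k]-th term [f k x], and the masses of the sublevel sets grow more slowly than these terms decay
    because $sg<kap$. *)
Lemma layer_integral_le (g : T -> R) (a M sg kap : R) :
  measurable_fun setT g -> (forall x, 0 <= g x) -> 0 < a -> 0 <= M ->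
  sg < kap -> 0 <= kap ->
  (forall k, (mu [set x | g x < a * 2 ^+ k]%R <= (M * (2 `^ sg) ^+ k)%:E)%E) ->
  (\int[mu]_x ((1 + g x / a) `^ (- kap))%:E <= (layer_cst kap sg * M)%:E)%E.
Proof.
move=> mg g0 a0 M0 sk k0 muM.
pose S k := [set x | g x < a * 2 ^+ k].
have mS k : measurable (S k).
  rewrite -[X in measurable X]setTI (_ : S k = g @^-1` `]-oo, a * 2 ^+ k[).
    exact: mg.
  by apply/seteqP; split => x; rewrite /S/= in_itv.
pose f k x : \bar R := (2 `^ kap * (2 `^ (- kap)) ^+ k * \1_(S k) x)%:E.
have f0 k x : (0 <= f k x)%E.
  by rewrite lee_fin !mulr_ge0// ?exprn_ge0// powR_ge0.
have mf k : measurable_fun setT (f k).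
  by apply/measurable_EFinP; apply: measurable_funM => //; exact: measurable_indic.
have q1 : 2 `^ (sg - kap) < 1 :> R.
  by rewrite powR_lt1 ?ltr1n ?subr_lt0.
apply: (@le_trans _ _ (\int[mu]_x \sum_(0 <= k <oo) f k x)%E).
  apply: ge0_le_integral => //.
  - by move=> x _; rewrite lee_fin powR_ge0.
  - apply/measurable_EFinP; apply: (measurableT_comp (measurable_powR _)).
    by apply: measurable_funD => //; apply: measurable_funM.
  - by apply: ge0_emeasurable_sum => // k x _ _; exact: f0.
  - move=> x _.
    have : exists k, g x < a * 2 ^+ k.
      exists (Num.bound (g x / a)); rewrite mulrC -ltr_pdivrMr//.
      exact: upper_nthrootP.
    move=> exk; case: (ex_minnP exk) => k gk mink.
    have sum_le : (f k x <= \sum_(0 <= k <oo) f k x)%E.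
      apply: le_trans (nneseries_lim_ge k.+1 _); last by move=> i _ _; exact: f0.
      by rewrite big_nat_recr//= leeDr// sume_ge0.
    apply: le_trans sum_le; rewrite lee_fin indicE mem_set// mulr1.
    have ga0 : 0 <= g x / a by rewrite divr_ge0// ltW.
    have -> : 2 `^ kap * (2 `^ (- kap)) ^+ k = (2 ^+ k / 2 : R) `^ (- kap).
      rewrite powRM ?invr_ge0 ?exprn_ge0// mulrC; congr (_ * _).
        exact: powR_exprn.
      by rewrite -(powR_inv1 (ler0n _ 2)) -powRrM mulrNN mul1r.
    rewrite !powRN lef_pV2 ?posrE ?powR_gt0// ?(lt_le_trans ltr01) ?lerDl//.
    rewrite ge0_ler_powR// ?nnegrE ?divr_ge0 ?exprn_ge0 ?addr_ge0//.
    case: k gk mink => [|k] gk mink; first by rewrite expr0; lra.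
    rewrite exprS mulrAC divff// mul1r ler_wpDl// ler_pdivlMr// mulrC leNgt.
    by apply/negP => /mink; rewrite ltnn.
rewrite integral_nneseries//.
have le k : (\int[mu]_x f k x <= (2 `^ kap * M * (2 `^ (sg - kap)) ^+ k)%:E)%E.
  rewrite /f; under eq_integral do rewrite EFinM.
  rewrite ge0_integralZl//; last first.
    by apply/measurable_EFinP; exact: measurable_indic.
  rewrite integral_indic// setIT.
  have c0 : 0 <= 2 `^ kap * (2 `^ (- kap)) ^+ k :> R.
    by rewrite mulr_ge0// ?exprn_ge0// powR_ge0.
  apply: (@le_trans _ _ ((2 `^ kap * (2 `^ (- kap)) ^+ k)%:E *
      (M * (2 `^ sg) ^+ k)%:E)%E); first by apply: lee_wpmul2l; [rewrite lee_fin|exact: muM].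
  rewrite -EFinM lee_fin (_ : sg - kap = - kap + sg); last by ring.
  rewrite powRD; last by apply/implyP.
  by rewrite exprMn le_eqVlt; apply/orP; left; apply/eqP; ring.
apply: (@le_trans _ _
    (\sum_(0 <= k <oo) (2 `^ kap * M * (2 `^ (sg - kap)) ^+ k)%:E)%E).
  by apply: lee_nneseries => [k _ _|k _]; [apply: integral_ge0 => x _; exact: f0|exact: le].
rewrite geometric_nneseries ?powR_ge0//= lee_fin /layer_cst.
by rewrite mulrAC.
Qed.

End layer_cake.

Lemma le_measure_bigsetU (R : realType) (disp : measure_display)
    (T : measurableType disp) (mu : {measure set T -> \bar R}) (I : Type) (r : seq I)
    (F : I -> set T) : (forall i, measurable (F i)) ->
  (mu (\big[setU/set0]_(i <- r) F i) <= \sum_(i <- r) mu (F i))%E.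
Proof.
move=> mF; elim: r => [|i r IH]; first by rewrite !big_nil measure0.
rewrite !big_cons; apply: le_trans (measureU2 _ _ _) _ => //.
  by apply: bigsetU_measurable => j _; exact: mF.
exact: leeD.
Qed.

Section frostman_growth.
Context (R : realType).

(** The constant [A] stays explicit because dilating by $1/t$ multiplies it by $t^s$, and the
    estimate for circumradii near [t] has to keep track of this power. *)
Definition ball_growth n (mu : set (pt R n) -> \bar R) (A s : R) :=
  forall x r, 0 < r -> (mu [set y | sqd y x < r ^+ 2]%R <= (A * r `^ s)%:E)%E.

Lemma vol_growth n : ball_growth (vol R n) (2 ^+ n) n%:R.
Proof.
move=> x r r0; rewrite powR_mulrn; last exact: ltW.
rewrite -exprMn.
exact: (vol_ball_le x (ltW r0)).
Qed.

(** Layers of the squared distance are balls of radius $a\sqrt2^k$, so both exponents are halved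
    before [layer_integral_le] applies. *)
Lemma ball_growth_integral_le n (mu : {measure set (pt R n) -> \bar R})
    (A s kap a : R) (x : pt R n) :
  ball_growth mu A s -> 0 <= A -> 0 < a -> s < kap -> 0 <= kap ->
  (\int[mu]_y ((1 + sqd y x / a ^+ 2) `^ (- (kap / 2)))%:E <=
   (layer_cst (kap / 2) (s / 2) * (A * a `^ s))%:E)%E.
Proof.
move=> gmu A0 a0 sk k0; apply: layer_integral_le => //.
- by apply: measurable_sqd => //; exact: measurable_cst.
- by move=> y; exact: sqd_ge0.
- by rewrite exprn_gt0.
- by rewrite mulr_ge0// powR_ge0.
- by rewrite ltr_pM2r.
- by rewrite divr_ge0.
move=> k; have r2 : (a * Num.sqrt 2 ^+ k) ^+ 2 = a ^+ 2 * 2 ^+ k :> R.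
  by rewrite exprMn exprAC sqr_sqrtr.
rewrite -r2; apply: le_trans (gmu _ _ _) _.
  by rewrite mulr_gt0// exprn_gt0// sqrtr_gt0.
rewrite lee_fin powRM ?exprn_ge0 ?sqrtr_ge0 ?(ltW a0)//.
rewrite -powR_exprn ?sqrtr_ge0// -powR12_sqrt// -powRrM mulrC.
by rewrite (mulrC _ s) (mulrC _ A) mulrA.
Qed.

Lemma measurable_sqd_near n (x : pt R n) (b h : R) :
  measurable [set c | `|sqd c x - b| < h].
Proof.
rewrite -[X in measurable X]setTI
  (_ : mkset _ = (fun c => sqd c x) @^-1` [set` `]b - h, b + h[]); last first.
  by apply/seteqP; split => c /=; rewrite in_itv/= ltr_distl.
by apply: measurable_sqd => //; exact: measurable_cst.
Qed.

Lemma lebesgue_measure_diam_le (S : set (measurableTypeR R)) (D : R) :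
  measurable S -> 0 <= D -> (forall t u : R, S t -> S u -> `|t - u| <= D) ->
  (lebesgue_measure S <= (2 * D)%:E)%E.
Proof.
move=> mS D0 SD; have [->|/set0P[t0 St0]] := eqVneq S set0.
  by rewrite measure0 lee_fin mulr_ge0.
have := @lebesgue_measure_itv R `[t0 - D, t0 + D].
rewrite /= lte_fin => mE; apply: (@le_trans _ _ (lebesgue_measure [set` `[t0 - D, t0 + D]])).
  apply: le_measure; rewrite ?inE//.
  by move=> t St /=; rewrite in_itv/= -ler_distl; exact: SD.
rewrite mE; case: ifPn => _; last by rewrite lee_fin mulr_ge0.
by rewrite -EFinD lee_fin (_ : _ - _ = 2 * D)//; ring.
Qed.

Lemma measurable_upd n (c : pt R n) j :
  measurable_fun [set: measurableTypeR R] (fun t => upd c j t : pt R n).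
Proof.
apply/measurable_fun_tnthP => i; rewrite (_ : _ \o _ = fun t : measurableTypeR R =>
    if i == j then t else tnth c i); last first.
  by apply/funext => t /=; rewrite tnth_upd.
by case: (i == j); [exact: measurable_id|exact: measurable_cst].
Qed.

Lemma sqd_upd n (c x : pt R n) j t :
  sqd (upd c j t) x = (t - tnth x j) ^+ 2 +
    \sum_(i < n | i != j) (tnth c i - tnth x i) ^+ 2.
Proof.
rewrite /sqd (bigD1 j)//= tnth_upd eqxx; congr (_ + _).
by apply: eq_bigr => i /negPf ij; rewrite tnth_upd ij.
Qed.

(** The first summand collects the slice bounds over the [n] directions for thin annuli. The second
    serves for $h\ge1/2$, where the annulus is simply put into a ball of radius 3. *)
Definition annulus_cst n : R := n%:R * (4 ^+ n.-1 * (8 * n%:R)) + 2 * 6 ^+ n.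

Lemma annulus_cst_ge0 n : 0 <= annulus_cst n.
Proof. by rewrite addr_ge0 ?mulr_ge0 ?exprn_ge0. Qed.

(** Near the unit sphere some coordinate of $c-x$ is not small. Along that axis the squared distance
    has derivative bounded below, so the annulus meets each line in two sets of diameter $O(h)$. *)
Lemma vol_annulus_le n (x : pt R n) (h : R) : (0 < n)%N -> 0 < h <= 6 ->
  (vol R n [set c | `|sqd c x - 1| < h]%R <= (annulus_cst n * h)%:E)%E.
Proof.
move=> n0 /andP[h0 h6]; have n0R : 0 < n%:R :> R by rewrite ltr0n.
pose S : set (pt R n) := [set c | `|sqd c x - 1| < h].
have mS : measurable S by exact: measurable_sqd_near.
have [hl|hs] := leP (1 / 2) h.
  apply: (@le_trans _ _ (vol R n [set c | sqd c x < 3 ^+ 2]%R)).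
    apply: le_measure; rewrite ?inE//; first exact: measurable_sqd_lt.
    by move=> c; rewrite /S/= ltr_distl => /andP[_ ?]; lra.
  apply: le_trans (vol_ball_le _ _) _ => //; rewrite lee_fin.
  rewrite (_ : 2 * 3 = 6 :> R); last by ring.
  apply: (@le_trans _ _ (2 * 6 ^+ n * h)).
    by rewrite mulrAC ler_peMl ?exprn_ge0//; lra.
  by rewrite ler_pM2r// lerDr !mulr_ge0// exprn_ge0.
(* If every coordinate were below $1/(2n)$, the squared distance would be at most $1/(4n)\le1/4$,
   whereas it exceeds $1-h>1/2$ on [S]. *)
pose F (j : 'I_n) : set (pt R n) := S `&` [set c | (2 * n%:R)^-1 <= `|tnth c j - tnth x j|].
have mcoord j : measurable_fun [set: pt R n] (fun c => `|tnth c j - tnth x j| : R).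
  apply: measurableT_comp => //; apply: measurable_funB => //.
  exact: measurable_tnth.
have mF j : measurable (F j).
  apply: measurableI => //; rewrite -[X in measurable X]setTI.
  rewrite (_ : mkset _ = (fun c : pt R n => `|tnth c j - tnth x j| : R) @^-1`
    [set` `[(2 * n%:R)^-1, +oo[]).
    exact: mcoord.
  by apply/seteqP; split => c /=; rewrite in_itv/= andbT.
have SF : S `<=` \big[setU/set0]_(j < n) F j.
  move=> c Sc; rewrite -bigcup_seq/=; apply: contrapT => noj.
  have small j : (tnth c j - tnth x j) ^+ 2 <= ((2 * n%:R)^-1) ^+ 2.
    rewrite -ler_sqrt ?exprn_ge0 ?invr_ge0 ?mulr_ge0// !sqrtr_sqr.
    rewrite [leRHS]ger0_norm ?invr_ge0 ?mulr_ge0// leNgt; apply/negP => big.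
    by apply: noj; exists j => /=; [exact: mem_index_enum|split=> //; exact: ltW].
  have : sqd c x <= n%:R * ((2 * n%:R)^-1) ^+ 2.
    apply: le_trans (ler_sum _ (fun j _ => small j)) _.
    by rewrite sumr_const card_ord -[leLHS]mulr_natl.
  have -> : n%:R * ((2 * n%:R)^-1) ^+ 2 = (4 * n%:R)^-1 :> R.
    by field; rewrite gt_eqF.
  have n1 : 1 <= n%:R :> R by rewrite ler1n.
  have : (4 * n%:R)^-1 <= 4^-1 :> R by rewrite lef_pV2 ?posrE ?mulr_gt0//; lra.
  by move: Sc; rewrite /S/= ltr_distl => /andP[? _] ? ?; lra.
have volF j : (vol R n (F j) <= ((2 * 2) ^+ n.-1 * (8 * n%:R * h))%:E)%E.
  apply: (@vol_slices _ _ j _ (tnth x)) => //.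
  - by rewrite !mulr_ge0// ltW.
  - move=> c [Sc _] i; rewrite -ler_sqr ?nnegrE// real_normK ?num_real//.
    apply: le_trans (sqd_coord_le _ _ _) _.
    by move: Sc; rewrite /S/= ltr_distl => /andP[_ ?]; lra.
  - move=> c; set G := [set t | _].
    have mG : measurable G.
      rewrite -[X in measurable X]setTI; exact: (@measurable_upd n c j).
    pose Gp := G `&` [set t | tnth x j <= t].
    pose Gn := G `&` [set t | t <= tnth x j].
    have mGp : measurable Gp by apply: measurableI => //; rewrite -set_itvcy.
    have mGn : measurable Gn by apply: measurableI => //; rewrite -set_itvNyc.
    have D0 : 0 <= 2 * n%:R * h by rewrite !mulr_ge0// ltW.
    (* On one side of $x_j$ both distances are at least $1/(2n)$, so their sum is at least $1/n$,
       and dividing the difference of squares by it costs a factor [n]. *)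
    have key (p q : R) : (2 * n%:R)^-1 <= p -> (2 * n%:R)^-1 <= q ->
        `|p ^+ 2 - q ^+ 2| <= 2 * h -> `|p - q| <= 2 * n%:R * h.
      move=> p0 q0; rewrite subr_sqr normrM => pq.
      have pq0 : n%:R^-1 <= p + q.
        have -> : n%:R^-1 = (2 * n%:R)^-1 + (2 * n%:R)^-1 :> R by field; rewrite gt_eqF.
        exact: lerD.
      have pq1 : 0 < p + q by apply: lt_le_trans pq0; rewrite invr_gt0.
      rewrite (gtr0_norm pq1) in pq.
      rewrite -(ler_pM2r (_ : 0 < n%:R^-1)) ?invr_gt0//.
      rewrite [leRHS](_ : _ = 2 * h); last by field; rewrite gt_eqF.
      by apply: le_trans pq; rewrite ler_wpM2l.
    have GE t u : G t -> G u -> `|(t - tnth x j) ^+ 2 - (u - tnth x j) ^+ 2| <= 2 * h.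
      rewrite /G/= => -[+ _] [+ _]; rewrite /S/= !sqd_upd !ltr_distl ler_norml.
      by move=> /andP[? ?] /andP[? ?]; apply/andP; split; lra.
    have Gb t : G t -> (2 * n%:R)^-1 <= `|t - tnth x j|.
      by move=> [_] /=; rewrite tnth_upd eqxx.
    rewrite (_ : 8 * n%:R * h = 2 * (2 * n%:R * h) + 2 * (2 * n%:R * h)); last by ring.
    rewrite EFinD; apply: (@le_trans _ _ (lebesgue_measure (Gp `|` Gn))).
      apply: le_measure; rewrite ?inE//; first exact: measurableU.
      by move=> t Gt; have [tx|xt] := leP (tnth x j) t; [left|right]; split => //=; exact: ltW.
    apply: le_trans (measureU2 _ _ _) _ => //; apply: leeD.
    + apply: lebesgue_measure_diam_le => // t u [Gt /= xt] [Gu /= xu].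
      rewrite -[t - u](_ : (t - tnth x j) - (u - tnth x j) = _); last by ring.
      apply: key; last exact: GE.
        by have := Gb _ Gt; rewrite ger0_norm ?subr_ge0.
      by have := Gb _ Gu; rewrite ger0_norm ?subr_ge0.
    + apply: lebesgue_measure_diam_le => // t u [Gt /= xt] [Gu /= xu].
      rewrite distrC -[u - t](_ : (tnth x j - t) - (tnth x j - u) = _); last by ring.
      apply: key.
      * by have := Gb _ Gt; rewrite ler0_norm ?subr_le0// opprB.
      * by have := Gb _ Gu; rewrite ler0_norm ?subr_le0// opprB.
      * by rewrite -(sqrrN (_ - t)) -(sqrrN (_ - u)) !opprB; exact: GE.
apply: (@le_trans _ _ (\sum_(j < n) vol R n (F j))%E).
  apply: le_trans (le_measure_bigsetU _ _ mF); apply: le_measure; rewrite ?inE//.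
  by apply: bigsetU_measurable => j _; exact: mF.
apply: (@le_trans _ _ (\sum_(j < n) ((2 * 2) ^+ n.-1 * (8 * n%:R * h))%:E)%E).
  by apply: lee_sum => j _; exact: volF.
rewrite sumEFin lee_fin sumr_const card_ord -[_ *+ n]mulr_natl.
rewrite (_ : 2 * 2 = 4 :> R); last by ring.
rewrite [leLHS](_ : _ = n%:R * (4 ^+ n.-1 * (8 * n%:R)) * h); last by ring.
by rewrite ler_pM2r// lerDl mulr_ge0// exprn_ge0.
Qed.

End frostman_growth.

Section measure_section.
Context d1 d2 (T1 : measurableType d1) (T2 : measurableType d2) (R : realType).
Variables (m1 : {sigma_finite_measure set T1 -> \bar R})
  (m2 : {sigma_finite_measure set T2 -> \bar R}) (W : set (T1 * T2)).
Hypothesis mW : measurable W.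

Let xsectionE x : [set y | W (x, y)] = xsection W x.
Proof. by apply/seteqP; split => y /=; rewrite /xsection/= inE. Qed.

Let ysectionE y : [set x | W (x, y)] = ysection W y.
Proof. by apply/seteqP; split => x /=; rewrite /ysection/= inE. Qed.

Lemma measurable_measure_xsection :
  measurable_fun [set: T1] (fun x => m2 [set y | W (x, y)]).
Proof. by under eq_fun do rewrite xsectionE; exact: measurable_fun_xsection. Qed.

Lemma measurable_measure_ysection :
  measurable_fun [set: T2] (fun y => m1 [set x | W (x, y)]).
Proof. by under eq_fun do rewrite ysectionE; exact: measurable_fun_ysection. Qed.

Lemma integral_measure_section :
  (\int[m1]_x m2 [set y | W (x, y)] = \int[m2]_y m1 [set x | W (x, y)])%E.
Proof.
transitivity (\int[m1]_x \int[m2]_y (\1_W (x, y))%:E)%E.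
  apply: eq_integral => x _; rewrite xsectionE -[X in m2 X]setIT.
  rewrite -integral_indic//; last exact: measurable_xsection.
  apply: eq_integral => y _; rewrite !indicE; congr ((nat_of_bool _)%:R%:E).
  by rewrite mem_xsection.
have mf : measurable_fun setT (fun z => (\1_W z)%:E : \bar R).
  by apply/measurable_EFinP; exact: measurable_indic.
rewrite (fubini_tonelli (fun z => (\1_W z)%:E) mf)//.
apply: eq_integral => y _; rewrite ysectionE -[X in m1 X]setIT.
rewrite -integral_indic//; last exact: measurable_ysection.
apply: eq_integral => x _; rewrite !indicE; congr ((nat_of_bool _)%:R%:E).
by rewrite mem_ysection.
Qed.

End measure_section.

(** * Comparing a Frostman measure with volume *)

Section frostman_thickening.
Context (R : realType) (n : nat).
Variables (mu : probability (pt R n) R) (A s : R).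
Hypotheses (n0 : (0 < n)%N) (A0 : 0 <= A) (gmu : ball_growth mu A s).

Lemma vol_ball_ge (x : pt R n) (r : R) : 0 < r ->
  (((r / n%:R) ^+ n)%:E <= vol R n [set c | sqd c x < r ^+ 2]%R)%E.
Proof.
move=> r0; have n0R : 0 < n%:R :> R by rewrite ltr0n.
rewrite (_ : r / n%:R = 2 * (r / (2 * n%:R))); last by field; rewrite gt_eqF.
have r'0 : 0 <= r / (2 * n%:R) by rewrite divr_ge0 ?mulr_ge0// ltW.
rewrite -(vol_box x r'0); apply: le_measure; rewrite ?inE.
- apply: (@measurable_tuple_box _ _ _
    (fun i => [set t : R | `|t - tnth x i| <= r / (2 * n%:R)])) => i.
  rewrite (_ : mkset _ =
    [set` `[tnth x i - r / (2 * n%:R), tnth x i + r / (2 * n%:R)]])//.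
  by apply/seteqP; split => t /=; rewrite in_itv/= ler_distl.
- exact: measurable_sqd_lt.
move=> c /= cx.
have n1 : 1 <= n%:R :> R by rewrite ler1n.
apply: (@le_lt_trans _ _ (n%:R * (r / (2 * n%:R)) ^+ 2)).
  rewrite mulr_natl -[X in _ *+ X]card_ord -sumr_const; apply: ler_sum => i _.
  by rewrite -real_normK ?num_real// ler_sqr ?nnegrE.
have -> : n%:R * (r / (2 * n%:R)) ^+ 2 = r ^+ 2 * (4 * n%:R)^-1.
  by field; rewrite gt_eqF.
rewrite gtr_pMr ?exprn_gt0// invf_lt1 ?mulr_gt0//; lra.
Qed.

Lemma measurable_near_graph (S : set (pt R n)) r : measurable S ->
  measurable [set z : pt R n * pt R n | S z.1 /\ sqd z.2 z.1 < r].
Proof.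
move=> mS; apply: (@measurableI _ _ (fst @^-1` S) [set z | sqd z.2 z.1 < r]).
  by rewrite -[X in measurable X]setTI; exact: measurable_fst.
rewrite -[X in measurable X]setTI (_ : mkset _ =
    (fun z : pt R n * pt R n => sqd z.2 z.1) @^-1` `]-oo, r[).
  by apply: measurable_sqd.
by apply/seteqP; split => c /=; rewrite in_itv.
Qed.

(* Both sides are compared with the [mu \x vol]-measure of the pairs at distance
   less than [r] whose first point is in [S]. *)
Lemma frostman_thicken (S S' : set (pt R n)) (r : R) : 0 < r ->
  measurable S -> measurable S' ->
  (forall x c, S x -> sqd c x < r ^+ 2 -> S' c) ->
  (mu S * ((r / n%:R) ^+ n)%:E <= (A * r `^ s)%:E * vol R n S')%E.
Proof.
move=> r0 mS mS' SS'.
pose W := [set z : pt R n * pt R n | S z.1 /\ sqd z.2 z.1 < r ^+ 2].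
have mW : measurable W by exact: measurable_near_graph.
apply: (@le_trans _ _ (\int[mu]_x vol R n [set c | W (x, c)])%E).
  rewrite muleC -integral_cst// integral_mkcond; apply: ge0_le_integral => //.
  - move=> x _; apply: erestrict_ge0 => y _.
    by rewrite lee_fin exprn_ge0// divr_ge0// ltW.
  - by apply/(measurable_restrictT _ mS); exact: measurable_cst.
  - exact: measurable_measure_xsection.
  - move=> x _; rewrite patchE; case: ifPn => [/set_mem Sx|_]; last exact: measure_ge0.
    apply: le_trans (vol_ball_ge x r0) _; apply: le_measure; rewrite ?inE.
    + exact: measurable_sqd_lt.
    + rewrite (_ : mkset _ = [set c | sqd c x < r ^+ 2]); last first.
        by apply/seteqP; split => c; [case|split].
      exact: measurable_sqd_lt.
    + by move=> c.
rewrite integral_measure_section// -integral_cst// [leRHS]integral_mkcond.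
apply: ge0_le_integral => //.
- exact: measurable_measure_ysection.
- by apply/(measurable_restrictT _ mS'); exact: measurable_cst.
- move=> c _; rewrite patchE; case: ifPn => [_|/negP cS'].
    apply: le_trans (gmu c r0); apply: le_measure; rewrite ?inE.
    + rewrite (_ : mkset _ = S `&` [set x | sqd x c < r ^+ 2]); last first.
        by apply/seteqP; split => x []; rewrite /= sqdC.
      by apply: measurableI => //; exact: measurable_sqd_lt.
    + exact: measurable_sqd_lt.
    + by move=> x [_] /=; rewrite sqdC.
  rewrite (_ : mkset _ = set0) ?measure0//.
  by apply/seteqP; split => x // [Sx xc]; apply: cS'; rewrite inE; exact: SS' xc.
Qed.

End frostman_thickening.

(** * Frostman mass of spherical annuli *)

Section annulus_growth.
Context (R : realType).

(** Young's inequality $|2pq|\le p^2/e+eq^2$ in each coordinate. The weight [e] is free, so that a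
    displacement of size [e] costs only $O(e)$ in the squared distance. *)
Lemma sqd_perturb n (c x y : pt R n) (e : R) : 0 < e ->
  `|sqd c y - sqd x y| <= (1 + e^-1) * sqd c x + e * sqd x y.
Proof.
move=> e0; rewrite /sqd -sumrB !mulr_sumr -big_split/=.
apply: le_trans (ler_norm_sum _ _ _) _; apply: ler_sum => i _.
set p := tnth c i - tnth x i; set q := tnth x i - tnth y i.
have -> : tnth c i - tnth y i = p + q by rewrite /p /q; ring.
have -> : (p + q) ^+ 2 - q ^+ 2 = p ^+ 2 + 2 * p * q by ring.
have key : `|2 * p * q| <= e^-1 * p ^+ 2 + e * q ^+ 2.
  have e'0 : e != 0 by rewrite gt_eqF.
  have e'1 : 0 <= e^-1 by rewrite invr_ge0 ltW.
  have h1 : 0 <= e^-1 * (p + e * q) ^+ 2 by rewrite mulr_ge0// sqr_ge0.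
  have h2 : 0 <= e^-1 * (p - e * q) ^+ 2 by rewrite mulr_ge0// sqr_ge0.
  have e1 : e^-1 * (p + e * q) ^+ 2 = e^-1 * p ^+ 2 + e * q ^+ 2 + 2 * p * q by field.
  have e2 : e^-1 * (p - e * q) ^+ 2 = e^-1 * p ^+ 2 + e * q ^+ 2 - 2 * p * q by field.
  by rewrite ler_norml; apply/andP; split; lra.
apply: le_trans (ler_normD _ _) _; rewrite ger0_norm ?sqr_ge0//.
have -> : (1 + e^-1) * p ^+ 2 + e * q ^+ 2 = p ^+ 2 + (e^-1 * p ^+ 2 + e * q ^+ 2).
  by ring.
by rewrite lerD2l.
Qed.

Variables (n : nat) (mu : probability (pt R n) R) (A s : R).
Hypotheses (n2 : (1 < n)%N) (A0 : 0 <= A) (gmu : ball_growth mu A s).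
Hypotheses (sn1 : n%:R - 1 < s) (sn : s <= n%:R).

(** The 5 arises because, for $e\le1$, thickening by [e] widens the annulus from [e] to $e+2e+2e$;
    the power of [n] comes from the lower bound for the volume of a ball in [vol_ball_ge]. *)
Definition annulus_growth_cst : R := 5 * annulus_cst R n * n%:R ^+ n.

Lemma annulus_growth_cst_ge0 : 0 <= annulus_growth_cst.
Proof. by rewrite !mulr_ge0 ?annulus_cst_ge0 ?exprn_ge0. Qed.

(** The [e]-thickening of the annulus has volume $O(e)$, and [mu] gives a ball of radius [e] at most
    $Ae^s$ where volume gives a multiple of $e^n$; the quotient yields the exponent $s-n+1$. *)
Lemma annulus_growth_le1 (c : pt R n) (e : R) : 0 < e <= 1 ->
  (mu [set x | `|sqd x c - 1| < e]%R <=
   (annulus_growth_cst * (A * e `^ (s - n%:R + 1)))%:E)%E.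
Proof.
move=> /andP[e0 e1]; have n0 : (0 < n)%N by exact: ltn_trans n2.
pose S : set (pt R n) := [set x | `|sqd x c - 1| < e].
have mS : measurable S by exact: measurable_sqd_near.
have := @frostman_thicken R n mu A s n0 gmu S
  [set x | `|sqd x c - 1| < 5 * e] e e0 mS (measurable_sqd_near _ _ _).
have SS' x y : S x -> sqd y x < e ^+ 2 -> `|sqd y c - 1| < 5 * e.
  rewrite /S/= => Sx yx; have := sqd_perturb y x c e0.
  have x2 : sqd x c < 2 by move: Sx; rewrite ltr_distl => /andP[_ ?]; lra.
  have : (1 + e^-1) * sqd y x <= 2 * e.
    apply: (@le_trans _ _ ((1 + e^-1) * e ^+ 2)).
      by rewrite ler_wpM2l ?(ltW yx)// addr_ge0// invr_ge0 ltW.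
    have -> : (1 + e^-1) * e ^+ 2 = e ^+ 2 + e by field; rewrite gt_eqF.
    have : e ^+ 2 <= e by rewrite expr2 ler_piMl// ltW.
    lra.
  have : e * sqd x c < 2 * e by rewrite mulrC ltr_pM2r.
  move: Sx; rewrite !ltr_norml ler_norml => /andP[? ?] ? ? /andP[? ?].
  by apply/andP; split; lra.
move=> /(_ SS'); have -> : mu S = (fine (mu S))%:E by rewrite fineK// fin_num_measure.
have h6 : 0 < 5 * e <= 6 by apply/andP; split; lra.
move=> /le_trans/(_ (lee_wpmul2l _ (vol_annulus_le c n0 h6))).
rewrite lee_fin mulr_ge0 ?powR_ge0// => /(_ isT); rewrite -!EFinM !lee_fin.
have en0 : 0 < (e / n%:R) ^+ n by rewrite exprn_gt0// divr_gt0// ltr0n.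
rewrite -ler_pdivlMr// => /le_trans; apply.
rewrite le_eqVlt; apply/orP; left; apply/eqP.
rewrite powRD ?(gt_eqF e0) ?implybT// powRD ?(gt_eqF e0) ?implybT//.
rewrite powRr1 ?(ltW e0)// powR_invn ?(ltW e0)// /annulus_growth_cst expr_div_n.
by field; rewrite !expf_neq0 ?gt_eqF// ltr0n.
Qed.

Lemma annulus_growth_ge1 (c : pt R n) (e : R) : 1 <= e ->
  (mu [set x | `|sqd x c - 1| < e]%R <= (A * (2 * e) `^ (s / 2))%:E)%E.
Proof.
move=> e1; have e20 : 0 <= 2 * e by rewrite mulr_ge0//; lra.
apply: (@le_trans _ _ (mu [set x | sqd x c < Num.sqrt (2 * e) ^+ 2]%R)).
  apply: le_measure; rewrite ?inE; [exact: measurable_sqd_near|exact: measurable_sqd_lt|].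
  by move=> x /=; rewrite sqr_sqrtr// ltr_distl => /andP[_ ?]; lra.
apply: le_trans (gmu _ _) _; first by rewrite sqrtr_gt0; lra.
by rewrite -powR12_sqrt// -powRrM (mulrC _ s).
Qed.

Definition sup_kernel_cst : R :=
  layer_cst ((n%:R + 1) / 2) (n%:R / 2) * (annulus_growth_cst + 2 `^ n%:R).

Lemma sup_kernel_cst_ge0 : 0 <= sup_kernel_cst.
Proof.
rewrite mulr_ge0 ?addr_ge0 ?annulus_growth_cst_ge0 ?powR_ge0//.
by apply: layer_cst_ge0; lra.
Qed.

(** Split $|X|$ at the heights $Y2^k$. Thin layers have growth exponent $s-n+1\le1\le n/2$, thick
    ones $s/2\le n/2$. Both stay below the decay $(n+1)/2$ of the kernel, so the series converges
    with the size of its first layer. *)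
Lemma sup_kernel_le (c : pt R n) (Y : R) : 0 < Y <= 2 ->
  (\int[mu]_x ((1 + `|sqd x c - 1| / Y) `^ (- ((n%:R + 1) / 2)))%:E <=
   (sup_kernel_cst * (A * Y `^ (s - n%:R + 1)))%:E)%E.
Proof.
move=> /andP[Y0 Y2]; have n2R : 2 <= n%:R :> R by rewrite ler_nat.
have sn2 : s - n%:R + 1 <= n%:R / 2.
  apply: (@le_trans _ _ 1); last by rewrite ler_pdivlMr// mul1r.
  by rewrite -lerBrDr subrr subr_le0.
have two1 : 1 <= 2 :> R by rewrite ler1n.
have sn0 : 0 <= s - n%:R + 1 by rewrite -lerBlDr sub0r lerBrDr addrC ltW.
have sn' : s / 2 <= n%:R / 2 by rewrite ler_pM2r.
rewrite /sup_kernel_cst -[X in (X%:E)]mulrA.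
apply: layer_integral_le => //.
- apply: measurableT_comp => //; apply: measurable_funB => //.
  by apply: measurable_sqd => //; exact: measurable_cst.
- rewrite mulr_ge0 ?addr_ge0 ?annulus_growth_cst_ge0 ?powR_ge0// mulr_ge0//.
  exact: powR_ge0.
- lra.
move=> k; have k1 : 1 <= 2 ^+ k :> R by rewrite exprn_ege1// ler1n.
have r0 : 0 < Y * 2 ^+ k by rewrite mulr_gt0// exprn_gt0.
have AY : 0 <= A * Y `^ (s - n%:R + 1) by rewrite mulr_ge0// powR_ge0.
have [r1|r1] := leP (Y * 2 ^+ k) 1.
  apply: le_trans (annulus_growth_le1 _ _) _; first by rewrite r0.
  rewrite lee_fin powRM ?exprn_ge0 ?(ltW Y0)// -powR_exprn//.
  apply: (@le_trans _ _ (annulus_growth_cst * (A * Y `^ (s - n%:R + 1)) *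
      (2 `^ (n%:R / 2)) ^+ k)).
    rewrite -mulrA ler_wpM2l ?annulus_growth_cst_ge0// -mulrA ler_wpM2l//.
    rewrite ler_wpM2l ?powR_ge0// lerXn2r ?nnegrE ?powR_ge0//.
    exact: ler_powR.
  rewrite ler_wpM2r ?exprn_ge0 ?powR_ge0// ler_wpM2r//.
  by rewrite lerDl powR_ge0.
apply: le_trans (annulus_growth_ge1 _ (ltW r1)) _; rewrite lee_fin.
(* A layer with $Y2^k>1$ must be charged to $Y^{s-n+1}$ as well. Halving [Y] brings the base below
   1, where lowering the exponent increases the power. *)
have YY : Y `^ (n%:R / 2) <= 2 `^ (n%:R / 2) * Y `^ (s - n%:R + 1).
  have -> : Y = 2 * (Y / 2) by field.
  have Y20 : 0 < Y / 2 by rewrite divr_gt0.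
  rewrite (powRM _ _ (ltW Y20))// (powRM _ _ (ltW Y20))//.
  rewrite ler_wpM2l ?powR_ge0//.
  apply: (@le_trans _ _ ((Y / 2) `^ (s - n%:R + 1))).
    by apply: ger_powR => //; rewrite Y20 ler_pdivrMr//; lra.
  rewrite ler_peMl ?powR_ge0// -[leLHS](powRr0 2).
  exact: ler_powR.
apply: (@le_trans _ _ (A * (2 `^ n%:R * Y `^ (s - n%:R + 1) * (2 `^ (n%:R / 2)) ^+ k))).
  rewrite ler_wpM2l//; apply: (@le_trans _ _ ((2 * (Y * 2 ^+ k)) `^ (n%:R / 2))).
    by apply: ler_powR => //; lra.
  rewrite !powRM ?exprn_ge0 ?mulr_ge0 ?(ltW Y0)// ?exprn_ge0// -powR_exprn//.
  rewrite mulrA ler_wpM2r ?exprn_ge0 ?powR_ge0//.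
  have -> : 2 `^ n%:R = 2 `^ (n%:R / 2) * 2 `^ (n%:R / 2) :> R.
    by rewrite -powRD ?pnatr_eq0 ?implybT//; congr (_ `^ _); field.
  by rewrite -mulrA ler_wpM2l ?powR_ge0.
rewrite [leLHS](_ : _ = 2 `^ n%:R * (A * Y `^ (s - n%:R + 1)) * (2 `^ (n%:R / 2)) ^+ k).
  rewrite ler_wpM2r ?exprn_ge0 ?powR_ge0// ler_wpM2r//.
  by rewrite lerDr annulus_growth_cst_ge0.
by ring.
Qed.

End annulus_growth.

(** * The complex inverse square root *)

Section real_derivative.
Context (R : realType).
Implicit Types (f g : R -> R) (t a b : R).

Local Notation rd f t a := (is_derive (t : R) (1 : R) (f : R -> R) a).

Lemma is_derive_funD f g t a b : rd f t a -> rd g t b ->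
  rd (fun u => f u + g u) t (a + b).
Proof. exact: is_deriveD. Qed.

Lemma is_derive_funM f g t a b : rd f t a -> rd g t b ->
  rd (fun u => f u * g u) t (a * g t + f t * b).
Proof.
move=> fa gb; apply: (is_derive_eq (is_deriveM fa gb)).
by rewrite addrC /GRing.scale/= (mulrC (g t)).
Qed.

Lemma is_derive_funV f t a : f t != 0 -> rd f t a ->
  rd (fun u => (f u)^-1) t (- a / f t ^+ 2).
Proof.
move=> f0 fa; have df : derivable f t 1 by exact: fa.(ex_derive).
apply: DeriveDef; first exact: derivableV.
rewrite deriveV// fa.(derive_val) /GRing.scale/=.
by rewrite !mulNr mulrC.
Qed.

Lemma is_derive_fun_sqrt f t a : 0 < f t -> rd f t a ->
  rd (fun u => Num.sqrt (f u)) t (a / (2 * Num.sqrt (f t))).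
Proof.
move=> f0 fa.
apply: (is_derive_eq (is_derive1_comp (is_derive1_sqrt f0) fa)).
by rewrite /GRing.scale/= mulrC.
Qed.

Lemma is_derive_continuous f t a : rd f t a -> {for t, continuous f}.
Proof.
by move=> fa; apply/differentiable_continuous/derivable1_diffP; exact: fa.(ex_derive).
Qed.

End real_derivative.

Section complex_derivative.
Context (R : realType).
Local Notation C := (complex R).
Local Notation Re := (@complex.Re R).
Local Notation Im := (@complex.Im R).

Lemma complex_eqP (x y : C) : Re x = Re y -> Im x = Im y -> x = y.
Proof. by case: x y => a b [c d] /= -> ->. Qed.

Lemma Re_mul (x y : C) : Re (x * y) = Re x * Re y - Im x * Im y.
Proof. by case: x y => a b [c d]. Qed.

Lemma Im_mul (x y : C) : Im (x * y) = Re x * Im y + Im x * Re y.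
Proof. by case: x y => a b [c d]. Qed.

Lemma Re_add (x y : C) : Re (x + y) = Re x + Re y.
Proof. by case: x y => a b [c d]. Qed.

Lemma Im_add (x y : C) : Im (x + y) = Im x + Im y.
Proof. by case: x y => a b [c d]. Qed.

Definition cmod (x : C) : R := Num.sqrt (Re x ^+ 2 + Im x ^+ 2).

Lemma cmod_ge0 x : 0 <= cmod x. Proof. exact: sqrtr_ge0. Qed.

Lemma cmodM x y : cmod (x * y) = cmod x * cmod y.
Proof.
rewrite /cmod -sqrtrM ?addr_ge0 ?sqr_ge0// Re_mul Im_mul; congr Num.sqrt.
by ring.
Qed.

Lemma cmodX x k : cmod (x ^+ k) = cmod x ^+ k.
Proof.
elim: k => [|k IH]; last by rewrite !exprS cmodM IH.
by rewrite !expr0 /cmod /= expr1n expr0n addr0 sqrtr1.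
Qed.

Lemma normRe_le_cmod x : `|Re x| <= cmod x.
Proof. by rewrite -sqrtr_sqr ler_wsqrtr// lerDl sqr_ge0. Qed.

Lemma normIm_le_cmod x : `|Im x| <= cmod x.
Proof. by rewrite -sqrtr_sqr ler_wsqrtr// lerDr sqr_ge0. Qed.

Lemma cmodJ x : cmod (conjc x) = cmod x.
Proof. by case: x => a b; rewrite /cmod/= sqrrN. Qed.

Definition cderiv (f : R -> C) (t : R) (df : C) :=
  is_derive t (1 : R) (Re \o f) (Re df) /\ is_derive t (1 : R) (Im \o f) (Im df).

Lemma cderiv_eq f t (a b : C) : cderiv f t a -> a = b -> cderiv f t b.
Proof. by move=> + <-. Qed.

Lemma cderivM f g t (a b : C) : cderiv f t a -> cderiv g t b ->
  cderiv (fun u => f u * g u) t (a * g t + f t * b).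
Proof.
move=> [fr fi] [gr gi]; split.
- have -> : Re \o (fun u => f u * g u) =
      fun u => (Re \o f) u * (Re \o g) u - (Im \o f) u * (Im \o g) u.
    by apply/funext => u /=; rewrite Re_mul.
  by apply: is_derive_eq; rewrite Re_add !Re_mul /GRing.scale/=; ring.
- have -> : Im \o (fun u => f u * g u) =
      fun u => (Re \o f) u * (Im \o g) u + (Im \o f) u * (Re \o g) u.
    by apply/funext => u /=; rewrite Im_mul.
  by apply: is_derive_eq; rewrite Im_add !Im_mul /GRing.scale/=; ring.
Qed.

Lemma cderivX f t (a : C) k : cderiv f t a ->
  cderiv (fun u => f u ^+ k.+1) t (k.+1%:R * f t ^+ k * a).
Proof.
move=> fa; elim: k => [|k IH].
  by apply: (cderiv_eq fa); rewrite expr0; ring.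
under eq_fun do rewrite exprS.
apply: (cderiv_eq (cderivM fa IH)); rewrite !exprS -[in RHS]natr1; ring.
Qed.

Lemma cderivJ f t (a : C) : cderiv f t a -> cderiv (fun u => conjc (f u)) t (conjc a).
Proof.
move=> [fr fi]; split.
  have -> : Re \o (fun u => conjc (f u)) = Re \o f.
    by apply/funext => u /=; case: (f u).
  by case: a fr fi.
have -> : Im \o (fun u => conjc (f u)) = fun u => - (Im \o f) u.
  by apply/funext => u /=; case: (f u).
by apply: is_derive_eq; case: a {fr fi}.
Qed.

Definition wmod (X Y : R) : R := Num.sqrt (X ^+ 2 + Y ^+ 2).

Definition wrho (X Y : R) : R := Num.sqrt ((wmod X Y + X) / 2).

(* The branch of [(X - i Y)^(-1/2)] that is smooth off the half-line
   [Y = 0, X <= 0]. *)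
Definition wroot (X Y : R) : C :=
  Complex (wrho X Y / wmod X Y) (Y / (2 * wrho X Y * wmod X Y)).

(** Here $p+iq$ is the principal square root of $X+iY$, and [wroot X Y] is
    $1/(p-iq)=(p+iq)/(p^2+q^2)$. In terms of [p] and [q] all identities about [wroot] are rational,
    so [field] settles them. *)
Lemma wroot_param (X Y : R) : 0 < wmod X Y + X ->
  exists p q, [/\ 0 < p, wrho X Y = p, Y = 2 * p * q, X = p ^+ 2 - q ^+ 2 &
    wmod X Y = p ^+ 2 + q ^+ 2].
Proof.
move=> mX; set m := wmod X Y in mX *.
have m2 : m ^+ 2 = X ^+ 2 + Y ^+ 2 by rewrite sqr_sqrtr// addr_ge0 ?sqr_ge0.
have p0 : 0 < wrho X Y by rewrite sqrtr_gt0 divr_gt0.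
have p2 : wrho X Y ^+ 2 = (m + X) / 2 by rewrite sqr_sqrtr// divr_ge0// ltW.
exists (wrho X Y), (Y / (2 * wrho X Y)).
have pn0 : wrho X Y != 0 by rewrite gt_eqF.
have q2 : (Y / (2 * wrho X Y)) ^+ 2 = (m - X) / 2.
  have -> : (Y / (2 * wrho X Y)) ^+ 2 = Y ^+ 2 / (4 * wrho X Y ^+ 2) by field.
  have -> : Y ^+ 2 = (m - X) * (m + X) by rewrite -subr_sqr m2; ring.
  by rewrite p2; field; rewrite gt_eqF.
by split => //; [field|rewrite q2 p2; field|rewrite q2 p2; field].
Qed.

Lemma wroot_sqr (X Y : R) : 0 < wmod X Y + X ->
  wroot X Y ^+ 2 * Complex X (- Y) = 1.
Proof.
move=> mX; have [p [q [p0 pE YE XE mE]]] := wroot_param mX.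
have pn0 : p != 0 by rewrite gt_eqF.
have mn0 : p ^+ 2 + q ^+ 2 != 0 by rewrite gt_eqF// ltr_wpDr ?sqr_ge0// exprn_gt0.
rewrite /wroot pE mE YE XE expr2; apply: complex_eqP; rewrite !(Re_mul, Im_mul) /=.
  by field; rewrite mn0 pn0.
by field; rewrite mn0 pn0.
Qed.

Lemma cmod_wroot (X Y : R) : 0 < wmod X Y + X ->
  cmod (wroot X Y) ^+ 2 = (wmod X Y)^-1.
Proof.
move=> mX; have [p [q [p0 pE YE XE mE]]] := wroot_param mX.
have pn0 : p != 0 by rewrite gt_eqF.
have mn0 : p ^+ 2 + q ^+ 2 != 0 by rewrite gt_eqF// ltr_wpDr ?sqr_ge0// exprn_gt0.
rewrite /cmod sqr_sqrtr ?addr_ge0 ?sqr_ge0// /wroot/= pE mE YE.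
by field; rewrite mn0 pn0.
Qed.

Lemma cderiv_wroot (X Y : R -> R) (t X' Y' : R) :
  is_derive t (1 : R) X X' -> is_derive t (1 : R) Y Y' ->
  0 < wmod (X t) (Y t) + X t ->
  cderiv (fun u => wroot (X u) (Y u)) t
    (Complex (- 2^-1) 0 * (wroot (X t) (Y t) ^+ 3 * Complex X' (- Y'))).
Proof.
move=> dX dY mX; have [p [q [p0 pE YE XE mE]]] := wroot_param mX.
have pn0 : p != 0 by rewrite gt_eqF.
have m0 : 0 < p ^+ 2 + q ^+ 2 by rewrite ltr_wpDr ?sqr_ge0// exprn_gt0.
have mn0 : p ^+ 2 + q ^+ 2 != 0 by rewrite gt_eqF.
have dm : is_derive t (1 : R) (fun u => wmod (X u) (Y u))
    ((X t * X' + Y t * Y') / wmod (X t) (Y t)).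
  have h0 : 0 < X t * X t + Y t * Y t.
    by rewrite -!expr2 -sqrtr_gt0 -/(wmod _ _) mE.
  have := is_derive_fun_sqrt (f := fun u => X u * X u + Y u * Y u) h0
    (is_derive_funD (is_derive_funM dX dX) (is_derive_funM dY dY)).
  rewrite (_ : (fun u => Num.sqrt _) = fun u => wmod (X u) (Y u)); last first.
    by apply/funext => u; rewrite /wmod !expr2.
  move=> H; apply: (is_derive_eq H).
  rewrite -!expr2 -/(wmod (X t) (Y t)) mE; field; exact: mn0.
have dr : is_derive t (1 : R) (fun u => wrho (X u) (Y u))
    (((X t * X' + Y t * Y') / wmod (X t) (Y t) + X') / (4 * wrho (X t) (Y t))).
  have h0 : 0 < (wmod (X t) (Y t) + X t) * 2^-1 by rewrite divr_gt0.
  have := is_derive_fun_sqrt (f := fun u => (wmod (X u) (Y u) + X u) * 2^-1) h0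
    (is_derive_funM (is_derive_funD dm dX) (is_derive_cst (2^-1 : R) t (1 : R))).
  move=> H; apply: (is_derive_eq H).
  by rewrite /cst -/(wrho (X t) (Y t)) pE mE; field; rewrite mn0 pn0.
have mVn0 : wmod (X t) (Y t) != 0 by rewrite mE.
have rVn0 : 2 * wrho (X t) (Y t) * wmod (X t) (Y t) != 0.
  by rewrite !mulf_neq0// pE.
split.
- have := is_derive_funM dr
    (is_derive_funV (f := fun u => wmod (X u) (Y u)) mVn0 dm).
  move=> H; apply: (is_derive_eq H).
  rewrite /cst !exprS expr0 !(Re_mul, Im_mul) /= pE mE XE YE.
  by field; rewrite mn0 pn0.
- have := is_derive_funM dY (is_derive_funV
    (f := fun u => 2 * wrho (X u) (Y u) * wmod (X u) (Y u)) rVn0 (is_derive_funM (is_derive_funM (is_derive_cst (2 : R) t (1 : R)) dr) dm)).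
  move=> H; apply: (is_derive_eq H).
  rewrite /cst !exprS expr0 !(Re_mul, Im_mul) /= pE mE XE YE.
  by field; rewrite mn0 pn0.
Qed.

End complex_derivative.

(** * Conservation of the wave energy *)

Section wave_kernel.
Context (R : realType) (n : nat) (a : R).
Hypothesis a0 : 0 < a.
Local Notation C := (complex R).
Local Notation Re := (@complex.Re R).
Local Notation Im := (@complex.Im R).
Implicit Types (b S t : R) (c x y : pt R n) (j : 'I_n).

(* [(S + (a - i b)^2)^(-1/2)] *)
Definition wave b S : C := wroot (S + (a ^+ 2 - b ^+ 2)) (2 * a * b).

(** The branch cut is avoided: $S+(a-ib)^2$ is real only for $b=0$, and then it is positive. *)
Lemma wave_dom b S : 0 <= S ->
  0 < wmod (S + (a ^+ 2 - b ^+ 2)) (2 * a * b) + (S + (a ^+ 2 - b ^+ 2)).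
Proof.
move=> S0; set X := S + _; have [bE|b0] := eqVneq b 0.
  have X0 : 0 < X by rewrite /X bE expr0n/= subr0 ltr_wpDl// exprn_gt0.
  by apply: ltr_wpDl; [exact: sqrtr_ge0|exact: X0].
have : `|X| < wmod X (2 * a * b).
  rewrite -sqrtr_sqr ltr_sqrt ?ltrDl.
    by rewrite exprn_even_gt0//= !mulf_neq0// gt_eqF.
  by rewrite ltr_wpDl ?sqr_ge0// exprn_even_gt0//= !mulf_neq0// gt_eqF.
by rewrite ltr_norml => /andP[? _]; lra.
Qed.

Lemma wave_sqr b S : 0 <= S ->
  wave b S ^+ 2 * Complex (S + (a ^+ 2 - b ^+ 2)) (- (2 * a * b)) = 1.
Proof. by move=> S0; exact: wroot_sqr (wave_dom b S0). Qed.

(** The factor $b+ia=i(a-ib)$ is $-1/2$ times the [b]-derivative of $(a-ib)^2$. *)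
Lemma cderiv_wave_b b S k : 0 <= S ->
  cderiv (fun u => wave u S ^+ k.+1) b
    (k.+1%:R * Complex b a * wave b S ^+ k.+3).
Proof.
move=> S0.
have dX : is_derive b (1 : R) (fun u => S + (a ^+ 2 - u ^+ 2)) (- (2 * b)).
  by apply: is_derive_eq; rewrite /GRing.scale/=; ring.
have dY : is_derive b (1 : R) (fun u => 2 * a * u) (2 * a).
  by apply: is_derive_eq; rewrite /GRing.scale/=; ring.
apply: (cderiv_eq (cderivX k (cderiv_wroot dX dY (wave_dom b S0)))).
rewrite -/(wave b S).
have -> : Complex (- (2 * b)) (- (2 * a)) = Complex (- 2) 0 * Complex b a.
  by apply: complex_eqP; rewrite !(Re_mul, Im_mul) /=; ring.
have e : Complex (- 2^-1 : R) 0 * Complex (- 2) 0 = 1.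
  by apply: complex_eqP; rewrite !(Re_mul, Im_mul) /=; field.
rewrite [LHS](_ : _ = Complex (- 2^-1) 0 * Complex (- 2) 0 *
  (k.+1%:R * Complex b a * wave b S ^+ k.+3)); first by rewrite e mul1r.
by rewrite !exprS; ring.
Qed.

Lemma cderiv_wave_S b (S : R -> R) t S' k : 0 <= S t ->
  is_derive t (1 : R) S (2 * S') ->
  cderiv (fun u => wave b (S u) ^+ k.+1) t
    (Complex (- (k.+1%:R * S')) 0 * wave b (S t) ^+ k.+3).
Proof.
move=> S0 dS.
have dX : is_derive t (1 : R) (fun u => S u + (a ^+ 2 - b ^+ 2)) (2 * S').
  by apply: is_derive_eq; rewrite ?addr0.
have dY : is_derive t (1 : R) (fun _ : R => 2 * a * b) 0.
  exact: is_derive_cst.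
apply: (cderiv_eq (cderivX k (cderiv_wroot dX dY (wave_dom b S0)))).
rewrite -/(wave b (S t)) oppr0.
have -> : Complex (- (k.+1%:R * S')) 0 = k.+1%:R * (Complex (- 2^-1) 0 * Complex (2 * S') 0).
  have -> : (k.+1%:R : C) = Complex k.+1%:R 0.
    elim: k.+1 => [|m IH]; first by apply: complex_eqP.
    by rewrite -natr1 IH -[in RHS]natr1; apply: complex_eqP; rewrite /= ?addr0.
  by apply: complex_eqP; rewrite !(Re_mul, Im_mul) /=; field.
by rewrite !exprS; ring.
Qed.

(** The value of the wave kernel at $b=0$, where it is positive; up to [wave_cst] it majorizes the
    modulus at every [b]. *)
Definition rad S : R := (Num.sqrt (S + a ^+ 2))^-1.

Definition wave_cst b : R := 1 + b ^+ 2 / a ^+ 2.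

Lemma wave_cst_ge1 b : 1 <= wave_cst b.
Proof. by rewrite lerDl divr_ge0 ?sqr_ge0. Qed.

Lemma rad_gt0 S : 0 <= S -> 0 < rad S.
Proof. by move=> S0; rewrite invr_gt0 sqrtr_gt0 ltr_wpDl// exprn_gt0. Qed.

Lemma rad_le S : 0 <= S -> rad S <= a^-1.
Proof.
move=> S0; rewrite lef_pV2 ?posrE//; last first.
  by rewrite sqrtr_gt0 ltr_wpDl// exprn_gt0.
by rewrite -[leLHS]ger0_norm ?(ltW a0)// -sqrtr_sqr ler_wsqrtr// lerDr.
Qed.

Lemma rad_sqr S : 0 <= S -> rad S ^+ 2 = (S + a ^+ 2)^-1.
Proof. by move=> S0; rewrite exprVn sqr_sqrtr// addr_ge0// sqr_ge0. Qed.

Lemma mul_rad_le1 u S : u ^+ 2 <= S -> `|u| * rad S <= 1.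
Proof.
move=> uS; have S0 : 0 <= S by exact: le_trans (sqr_ge0 _) uS.
rewrite ler_pdivrMr ?mul1r ?sqrtr_gt0 ?ltr_wpDl ?exprn_gt0//.
by rewrite -sqrtr_sqr ler_wsqrtr// (le_trans uS)// lerDl sqr_ge0.
Qed.

(** The point is that $|S+(a-ib)^2|$ is at least $S+a^2$ over [wave_cst]; after squaring, the
    difference is an explicit sum of nonnegative terms. The constant explodes as [a] tends to 0, but
    it only serves integrability and domination: the quantitative bound is read off at $b=0$, where
    it equals 1. *)
Lemma cmod_wave_le b S : 0 <= S -> cmod (wave b S) <= wave_cst b * rad S.
Proof.
move=> S0; have K1 := wave_cst_ge1 b; have K0 : 0 < wave_cst b by apply: lt_le_trans K1.
have Sa0 : 0 < S + a ^+ 2 by rewrite ltr_wpDl// exprn_gt0.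
rewrite -ler_sqr ?nnegrE ?cmod_ge0 ?mulr_ge0 ?(ltW K0)//; last exact/ltW/rad_gt0.
rewrite (cmod_wroot (wave_dom b S0)) exprMn rad_sqr//.
set m := wmod _ _.
have mK : (S + a ^+ 2) / wave_cst b <= m.
  rewrite -[leLHS]ger0_norm ?divr_ge0 ?(ltW K0) ?(ltW Sa0)// -sqrtr_sqr.
  apply: ler_wsqrtr; rewrite expr_div_n.
  apply: (@le_trans _ _ ((S + a ^+ 2) ^+ 2 / wave_cst b)).
    rewrite ler_wpM2l ?sqr_ge0// lef_pV2 ?posrE ?exprn_gt0//.
    by rewrite expr2 ler_peMl// ltW.
  rewrite ler_pdivrMr// /wave_cst -(ler_pM2r (exprn_gt0 2 a0)).
  have e1 : ((S + (a ^+ 2 - b ^+ 2)) ^+ 2 + (2 * a * b) ^+ 2) *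
    (1 + b ^+ 2 / a ^+ 2) * a ^+ 2 =
    ((S + (a ^+ 2 - b ^+ 2)) ^+ 2 + (2 * a * b) ^+ 2) * (a ^+ 2 + b ^+ 2).
    by field; rewrite gt_eqF.
  rewrite e1 -subr_ge0 [leRHS](_ : _ =
    b ^+ 2 * (S - (a ^+ 2 + b ^+ 2)) ^+ 2 + a ^+ 2 * b ^+ 2 * (2 * S + 2 * a ^+ 2 + b ^+ 2)).
    apply: addr_ge0; first exact: mulr_ge0 (sqr_ge0 _) (sqr_ge0 _).
    apply: mulr_ge0; first exact: mulr_ge0 (sqr_ge0 _) (sqr_ge0 _).
    by have := sqr_ge0 a; have := sqr_ge0 b; lra.
  by ring.
have m0 : 0 < m by apply: lt_le_trans mK; rewrite divr_gt0.
apply: (@le_trans _ _ (wave_cst b / (S + a ^+ 2))).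
  by rewrite -invf_div lef_pV2 ?posrE ?divr_gt0.
by rewrite ler_pM2r ?invr_gt0// expr2 ler_peMl// ltW.
Qed.

End wave_kernel.

(** * Energy density, flux and their local conservation law *)

Section wave_energy.
Context (R : realType) (n : nat) (a : R) (x y : pt R n).
Hypothesis a0 : 0 < a.
Local Notation C := (complex R).
Local Notation Re := (@complex.Re R).
Local Notation Im := (@complex.Im R).
Implicit Types (b t : R) (c : pt R n) (j : 'I_n).

Definition wave_pair k l b c : C :=
  wave a b (sqd c x) ^+ k * conjc (wave a b (sqd c y) ^+ l).

Definition dot c : R :=
  \sum_(i < n) (tnth c i - tnth x i) * (tnth c i - tnth y i).

(* The wave energy of the fields emitted by [x] and [y]. Its [b]-derivative is the
   divergence in [c] of [flux], so its integral over [c] does not depend on [b]. *)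
Definition energy_density b c : R :=
  (a ^+ 2 + b ^+ 2 + dot c) * Re (wave_pair n.+1 n.+1 b c).

Definition denergy_density b c : R :=
  2 * b * Re (wave_pair n.+1 n.+1 b c) + (a ^+ 2 + b ^+ 2 + dot c) * n.+1%:R *
  Re (Complex b a * wave_pair n.+3 n.+1 b c + Complex b (- a) * wave_pair n.+1 n.+3 b c).

(** Let $\varphi,\psi$ be the waves $(S+(a-ib)^2)^{-(n-1)/2}$ emitted by [x] and [y]. Up to the
    factor $(n-1)^2$, this is component [j] of the energy current,
    $\mathrm{Re}(\bar\psi_b\varphi_j+\varphi_b\bar\psi_j)$. *)
Definition flux j b c : R :=
  - b * (2 * tnth c j - tnth x j - tnth y j) * Re (wave_pair n.+1 n.+1 b c) +
  a * (tnth x j - tnth y j) * Im (wave_pair n.+1 n.+1 b c).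

Definition dwave_pair j b c : C :=
  Complex (- (n.+1%:R * (tnth c j - tnth x j))) 0 * wave_pair n.+3 n.+1 b c +
  Complex (- (n.+1%:R * (tnth c j - tnth y j))) 0 * wave_pair n.+1 n.+3 b c.

Definition dflux j b c : R :=
  - (2 * b) * Re (wave_pair n.+1 n.+1 b c) +
  (- b * (2 * tnth c j - tnth x j - tnth y j) * Re (dwave_pair j b c) +
   a * (tnth x j - tnth y j) * Im (dwave_pair j b c)).

Lemma conjcM (u v : C) : conjc (u * v) = conjc u * conjc v.
Proof. by case: u v => p q [r s]; apply: complex_eqP => /=; ring. Qed.

Lemma natrC (k : nat) : (k%:R : C) = Complex k%:R 0.
Proof.
elim: k => [|m IH]; first exact: complex_eqP.
by rewrite -natr1 IH -[in RHS]natr1; apply: complex_eqP; rewrite /= ?addr0.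
Qed.

(** Trading two powers of the kernel for the quadratic $S+(a-ib)^2$ makes terms of orders $n+1$ and
    $n+3$ comparable; this is how the wave equation enters. *)
Lemma wave_pair_dom k l b c :
  (wave_pair k l b c = Complex (sqd c x + (a ^+ 2 - b ^+ 2)) (- (2 * a * b)) *
     wave_pair k.+2 l b c) /\
  (wave_pair k l b c = Complex (sqd c y + (a ^+ 2 - b ^+ 2)) (2 * a * b) *
     wave_pair k l.+2 b c).
Proof.
have hx := wave_sqr a0 b (sqd_ge0 c x); have hy := wave_sqr a0 b (sqd_ge0 c y).
split; rewrite /wave_pair.
  rewrite -[wave a b (sqd c x) ^+ k]mulr1 -hx !exprS expr0; ring.
rewrite -[wave a b (sqd c y) ^+ l]mulr1 -hy !exprS expr0 mulr1 !conjcM /=.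
by rewrite opprK; ring.
Qed.

(** Summing the components of the divergence produces the two squared distances and [dot]; the
    squared distances are then eliminated with [wave_pair_dom], after which the two sides agree. *)
Lemma energy_identity b c :
  denergy_density b c = \sum_(j < n) dflux j b c.
Proof.
have [T1 T2] := wave_pair_dom n.+1 n.+1 b c.
rewrite /denergy_density /dflux /dwave_pair.
move: (wave_pair n.+1 n.+1 b c) T1 T2 => T.
move: (wave_pair n.+3 n.+1 b c) (wave_pair n.+1 n.+3 b c) => P N TP TN.
have r1 : Re T = (sqd c x + (a ^+ 2 - b ^+ 2)) * Re P + 2 * a * b * Im P.
  by rewrite TP Re_mul /=; ring.
have i1 : Im T = (sqd c x + (a ^+ 2 - b ^+ 2)) * Im P - 2 * a * b * Re P.
  by rewrite TP Im_mul /=; ring.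
have r2 : Re T = (sqd c y + (a ^+ 2 - b ^+ 2)) * Re N - 2 * a * b * Im N.
  by rewrite TN Re_mul /=; ring.
have i2 : Im T = (sqd c y + (a ^+ 2 - b ^+ 2)) * Im N + 2 * a * b * Re N.
  by rewrite TN Im_mul /=; ring.
set u := fun i => tnth c i - tnth x i; set v := fun i => tnth c i - tnth y i.
have -> : \sum_(j < n) (- (2 * b) * Re T +
    (- b * (2 * tnth c j - tnth x j - tnth y j) *
     Re (Complex (- (n.+1%:R * (tnth c j - tnth x j))) 0 * P +
         Complex (- (n.+1%:R * (tnth c j - tnth y j))) 0 * N) +
     a * (tnth x j - tnth y j) *
     Im (Complex (- (n.+1%:R * (tnth c j - tnth x j))) 0 * P +
         Complex (- (n.+1%:R * (tnth c j - tnth y j))) 0 * N))) =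
  \sum_(j < n) (- (2 * b) * Re T) +
  \sum_(j < n) (n.+1%:R * (b * Re P + a * Im P) * (tnth c j - tnth x j) ^+ 2) +
  \sum_(j < n) (n.+1%:R * (b * (Re P + Re N) + a * (Im N - Im P)) *
     ((tnth c j - tnth x j) * (tnth c j - tnth y j))) +
  \sum_(j < n) (n.+1%:R * (b * Re N - a * Im N) * (tnth c j - tnth y j) ^+ 2).
  rewrite -!big_split/=; apply: eq_bigr => j _.
  by rewrite Re_add Im_add !(Re_mul, Im_mul) /=; ring.
rewrite -!mulr_sumr sumr_const card_ord -!/(sqd _ _) -/(dot c).
rewrite Re_add !Re_mul /= -[_ *+ n]mulr_natr.
rewrite -[n.+1%:R]natr1.
apply/eqP; rewrite -subr_eq0; apply/eqP.
(* The difference of the two sides is a combination of the four relations [r1], [r2], [i1], [i2],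
   each of which vanishes. *)
transitivity ((n%:R + 1) *
  (b * (Re T - ((sqd c x + (a ^+ 2 - b ^+ 2)) * Re P + 2 * a * b * Im P)) +
   b * (Re T - ((sqd c y + (a ^+ 2 - b ^+ 2)) * Re N - 2 * a * b * Im N)) +
   a * (Im T - ((sqd c x + (a ^+ 2 - b ^+ 2)) * Im P - 2 * a * b * Re P)) -
   a * (Im T - ((sqd c y + (a ^+ 2 - b ^+ 2)) * Im N + 2 * a * b * Re N)))).
  by ring.
by rewrite -r1 -r2 -i1 -i2; ring.
Qed.

Lemma cderiv_wave_pair_b b c : cderiv (fun u => wave_pair n.+1 n.+1 u c) b
  (n.+1%:R * (Complex b a * wave_pair n.+3 n.+1 b c +
              Complex b (- a) * wave_pair n.+1 n.+3 b c)).
Proof.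
have hx := cderiv_wave_b a0 b n (sqd_ge0 c x).
have hy := cderivJ (cderiv_wave_b a0 b n (sqd_ge0 c y)).
apply: (cderiv_eq (cderivM hx hy)).
rewrite /wave_pair !conjcM natrC /= oppr0; ring.
Qed.

Lemma is_derive_energy_density b c :
  is_derive b (1 : R) (fun u => energy_density u c) (denergy_density b c).
Proof.
have [hr _] := cderiv_wave_pair_b b c.
have dq : is_derive b (1 : R) (fun u => a ^+ 2 + u ^+ 2 + dot c) (2 * b).
  by apply: is_derive_eq; rewrite /GRing.scale/=; ring.
apply: (is_derive_eq (is_derive_funM dq hr)).
by rewrite natrC Re_mul /denergy_density /=; ring.
Qed.

Lemma is_derive_sqd_upd c j (p : pt R n) t :
  is_derive t (1 : R) (fun u => sqd (upd c j u) p) (2 * (t - tnth p j)).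
Proof.
under eq_fun do rewrite sqd_upd.
by apply: is_derive_eq; rewrite /GRing.scale/=; ring.
Qed.

Lemma cderiv_wave_pair_upd k l c j b t :
  cderiv (fun u => wave_pair k.+1 l.+1 b (upd c j u)) t
  (Complex (- (k.+1%:R * (t - tnth x j))) 0 * wave_pair k.+3 l.+1 b (upd c j t) +
   Complex (- (l.+1%:R * (t - tnth y j))) 0 * wave_pair k.+1 l.+3 b (upd c j t)).
Proof.
have hx := cderiv_wave_S a0 b k (sqd_ge0 (upd c j t) x) (is_derive_sqd_upd c j x t).
have hy := cderivJ (cderiv_wave_S a0 b l (sqd_ge0 (upd c j t) y)
  (is_derive_sqd_upd c j y t)).
apply: (cderiv_eq (cderivM hx hy)).
by rewrite /wave_pair !conjcM /= oppr0; ring.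
Qed.

Lemma is_derive_flux c j b t :
  is_derive t (1 : R) (fun u => flux j b (upd c j u)) (dflux j b (upd c j t)).
Proof.
have [hr hi] := cderiv_wave_pair_upd n n c j b t.
have -> : (fun u => flux j b (upd c j u)) = fun u =>
    (- b * (2 * u - tnth x j - tnth y j)) * Re (wave_pair n.+1 n.+1 b (upd c j u)) +
    a * (tnth x j - tnth y j) * Im (wave_pair n.+1 n.+1 b (upd c j u)).
  by apply/funext => u; rewrite /flux tnth_upd eqxx.
have dl : is_derive t (1 : R) (fun u => - b * (2 * u - tnth x j - tnth y j)) (- (2 * b)).
  by apply: is_derive_eq; rewrite /GRing.scale/=; ring.
have dc : is_derive t (1 : R) (fun _ : R => a * (tnth x j - tnth y j)) 0.
  exact: is_derive_cst.
apply: (is_derive_eq (is_derive_funD (is_derive_funM dl hr) (is_derive_funM dc hi))).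
rewrite /dflux /dwave_pair tnth_upd eqxx; ring.
Qed.

Lemma continuous_wave_pair_upd k l c j b :
  continuous (fun t => Re (wave_pair k.+1 l.+1 b (upd c j t))) /\
  continuous (fun t => Im (wave_pair k.+1 l.+1 b (upd c j t))).
Proof.
by split=> t; have [hr hi] := cderiv_wave_pair_upd k l c j b t;
  [exact: is_derive_continuous hr|exact: is_derive_continuous hi].
Qed.

Lemma continuous_dflux c j b : continuous (fun t => dflux j b (upd c j t)).
Proof.
have [r1 _] := continuous_wave_pair_upd n n c j b.
have [r2 i2] := continuous_wave_pair_upd n.+2 n c j b.
have [r3 i3] := continuous_wave_pair_upd n n.+2 c j b.
have cl (p q r : R) : continuous (fun t : R => p * (q * t - r)).
  move=> t; apply: (@is_derive_continuous R _ _ (p * q)).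
  by apply: is_derive_eq; rewrite /GRing.scale/=; ring.
have cM (f g : R -> R) : continuous f -> continuous g -> continuous (fun t => f t * g t).
  by move=> cf cg t; apply: continuousM; [exact: cf|exact: cg].
have cD (f g : R -> R) : continuous f -> continuous g -> continuous (fun t => f t + g t).
  by move=> cf cg t; apply: continuousD; [exact: cf|exact: cg].
have cc (r : R) : continuous (fun _ : R => r) by move=> t; exact: cvg_cst.
have -> : (fun t => dflux j b (upd c j t)) = fun t =>
    - (2 * b) * Re (wave_pair n.+1 n.+1 b (upd c j t)) +
    ((- b * (2 * t - (tnth x j + tnth y j))) *
       ((- n.+1%:R * (1 * t - tnth x j)) * Re (wave_pair n.+3 n.+1 b (upd c j t)) +
        (- n.+1%:R * (1 * t - tnth y j)) * Re (wave_pair n.+1 n.+3 b (upd c j t))) +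
     a * (tnth x j - tnth y j) *
       ((- n.+1%:R * (1 * t - tnth x j)) * Im (wave_pair n.+3 n.+1 b (upd c j t)) +
        (- n.+1%:R * (1 * t - tnth y j)) * Im (wave_pair n.+1 n.+3 b (upd c j t)))).
  apply/funext => t; rewrite /dflux /dwave_pair tnth_upd eqxx.
  by rewrite Re_add Im_add !(Re_mul, Im_mul) /=; ring.
apply: (cD); first by apply: (cM); [exact: cc|exact: r1].
apply: (cD); apply: (cM); [exact: cl| |exact: cc|]; apply: (cD); apply: (cM);
  [exact: cl|exact: r2|exact: cl|exact: r3|exact: cl|exact: i2|exact: cl|exact: i3].
Qed.

End wave_energy.

(** * Majorants for the energy and its flux *)

Section wave_bounds.
Context (R : realType) (n : nat) (a : R).
Hypotheses (a0 : 0 < a) (n0 : (0 < n)%N).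
Local Notation C := (complex R).
Local Notation Re := (@complex.Re R).
Local Notation Im := (@complex.Im R).
Implicit Types (b t B : R) (c x y : pt R n) (j : 'I_n).

Local Notation q c x := (rad a (sqd c x)).

Let qx0 c x : 0 < q c x. Proof. by apply: rad_gt0 => //; exact: sqd_ge0. Qed.
Let qxa c x : q c x <= a^-1. Proof. by apply: rad_le => //; exact: sqd_ge0. Qed.
Let uq c x j : `|tnth c j - tnth x j| * q c x <= 1.
Proof. exact: mul_rad_le1 (sqd_coord_le _ _ _). Qed.

Lemma wave_cst_le b B : `|b| <= B -> wave_cst a b <= wave_cst a B.
Proof.
move=> bB; rewrite lerD2l ler_wpM2r ?invr_ge0 ?sqr_ge0//.
by rewrite -real_normK ?num_real// ler_sqr ?nnegrE// (le_trans _ bB).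
Qed.

Lemma cmod_wave_pair_le k l b B c x y : `|b| <= B ->
  cmod (wave_pair a x y k l b c) <=
  wave_cst a B ^+ (k + l) * (q c x ^+ k * q c y ^+ l).
Proof.
move=> bB; rewrite /wave_pair cmodM cmodJ !cmodX exprD mulrACA -!exprMn.
have K x' : cmod (wave a b (sqd c x')) <= wave_cst a B * q c x'.
  apply: le_trans (cmod_wave_le a0 b (sqd_ge0 c x')) _.
  by rewrite ler_wpM2r ?(ltW (qx0 _ _))// wave_cst_le.
by apply: ler_pM; rewrite ?exprn_ge0 ?cmod_ge0// lerXn2r ?nnegrE ?cmod_ge0//
  (le_trans (cmod_ge0 _) (K _)).
Qed.

(** One factor [rad] of each wave absorbs $a^2+b^2$ or a product of coordinates in [dot], since
    $a\cdot rad\le1$ and $|c_i-x_i|\cdot rad\le1$. The power [n] that remains on each wave is still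
    integrable in [c] for the product. *)
Lemma energy_density_le b c x y :
  `|energy_density a x y b c| <=
  (wave_cst a b + n%:R) * wave_cst a b ^+ (n.+1 + n.+1) * (q c x * q c y) ^+ n.
Proof.
rewrite /energy_density normrM.
have T := cmod_wave_pair_le n.+1 n.+1 c x y (lexx `|b|).
have {}T : `|Re (wave_pair a x y n.+1 n.+1 b c)| <=
    wave_cst a b ^+ (n.+1 + n.+1) * (q c x * q c y) ^+ n.+1.
  apply: le_trans (normRe_le_cmod _) _; apply: le_trans T _.
  by rewrite /wave_cst real_normK ?num_real// exprMn.
have r0 : 0 < q c x * q c y by rewrite mulr_gt0.
have D : `|a ^+ 2 + b ^+ 2 + dot x y c| * (q c x * q c y) <= wave_cst a b + n%:R.
  apply: (@le_trans _ _ ((a ^+ 2 + b ^+ 2) * (q c x * q c y) +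
      `|dot x y c| * (q c x * q c y))).
    rewrite -mulrDl ler_wpM2r ?(ltW r0)// (le_trans (ler_normD _ _))//.
    by rewrite lerD2r ger0_norm// addr_ge0 ?sqr_ge0.
  apply: lerD.
    have -> : a ^+ 2 + b ^+ 2 = wave_cst a b * (a * a).
      by rewrite /wave_cst; field; rewrite gt_eqF.
    rewrite -mulrA ler_piMr ?(le_trans ler01 (wave_cst_ge1 _ _))//.
    rewrite mulrACA -[leRHS](mulr1 1).
    have qa x' : a * q c x' <= 1.
      by rewrite -(divff (lt0r_neq0 a0)) ler_pM2l.
    by apply: ler_pM; rewrite ?mulr_ge0 ?(ltW a0) ?(ltW (qx0 _ _)).
  rewrite -[n%:R in leRHS]mulr1 mulr_natl -[X in _ *+ X]card_ord -sumr_const.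
  apply: (@le_trans _ _ ((\sum_(i < n) `|(tnth c i - tnth x i) *
      (tnth c i - tnth y i)|) * (q c x * q c y))).
    by rewrite ler_wpM2r ?(ltW r0)//; exact: ler_norm_sum.
  rewrite mulr_suml; apply: ler_sum => i _.
  rewrite normrM mulrACA -[leRHS](mulr1 1).
  by apply: ler_pM; rewrite ?mulr_ge0 ?(ltW (qx0 _ _)).
apply: (@le_trans _ _ (`|a ^+ 2 + b ^+ 2 + dot x y c| *
  (wave_cst a b ^+ (n.+1 + n.+1) * (q c x * q c y) ^+ n.+1))).
  by rewrite ler_wpM2l.
rewrite [(_ * _) ^+ n.+1]exprS.
rewrite [leLHS](_ : _ = `|a ^+ 2 + b ^+ 2 + dot x y c| * (q c x * q c y) *
  (wave_cst a b ^+ (n.+1 + n.+1) * (q c x * q c y) ^+ n)); last by ring.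
rewrite -[leRHS]mulrA ler_wpM2r// mulr_ge0 ?exprn_ge0 ?(ltW r0)//.
exact: le_trans ler01 (wave_cst_ge1 _ _).
Qed.

Let M B := wave_cst a B ^+ (n.+1 + n.+3).

Let M_ge b B : `|b| <= B -> 0 <= M B.
Proof. by move=> _; rewrite exprn_ge0// (le_trans ler01 (wave_cst_ge1 _ _)). Qed.

Lemma cmod_pair_le b B c x y : `|b| <= B ->
  cmod (wave_pair a x y n.+1 n.+1 b c) <= M B * (q c x * q c y) ^+ n.+1.
Proof.
move=> bB; apply: le_trans (cmod_wave_pair_le _ _ _ _ _ bB) _.
rewrite -exprMn ler_wpM2r ?exprn_ge0 ?mulr_ge0 ?(ltW (qx0 _ _))//.
by apply: ler_weXn2l; [exact: wave_cst_ge1|lia].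
Qed.

Definition dflux_cst B := a^-1 ^+ 2 * M B * (2 * B + (B + a) * (4 * n.+1%:R)).

(** Every coordinate factor is absorbed by a factor [rad], and two further factors are bounded by
    $a^{-1}$ so as to reach the same integrable majorant as for the energy. *)
Lemma dflux_le j b B c x y : `|b| <= B ->
  `|dflux a x y j b c| <= dflux_cst B * (q c x * q c y) ^+ n.
Proof.
move=> bB; have B0 : 0 <= B by exact: le_trans (normr_ge0 _) bB.
have MB := M_ge bB; have a'0 : 0 <= a^-1 by rewrite invr_ge0 ltW.
have T := cmod_pair_le c x y bB.
have P := cmod_wave_pair_le n.+3 n.+1 c x y bB.
have N := cmod_wave_pair_le n.+1 n.+3 c x y bB.
rewrite (addnC n.+3) -/(M B) in P; rewrite -/(M B) in N.
have [[[p0 q0] pa] qa] := (qx0 c x, qx0 c y, qxa c x, qxa c y).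
have [ux vy] := (uq c x j, uq c y j).
rewrite /dflux /dwave_pair.
move: (wave_pair a x y n.+1 n.+1 b c) T => T T_le.
move: (wave_pair a x y n.+3 n.+1 b c) P => P P_le.
move: (wave_pair a x y n.+1 n.+3 b c) N => N N_le.
set s := (q c x * q c y) ^+ n.
set u := tnth c j - tnth x j in ux *; set v := tnth c j - tnth y j in vy *.
have -> : 2 * tnth c j - tnth x j - tnth y j = u + v by rewrite /u /v; ring.
have -> : tnth x j - tnth y j = v - u by rewrite /u /v; ring.
move: (q c x) (q c y) p0 q0 pa qa ux vy @s T_le P_le N_le => p q p0 q0 pa qa ux vy s T_le P_le N_le.
have [p0' q0'] := (ltW p0, ltW q0).
have s0 : 0 <= s by rewrite exprn_ge0// mulr_ge0.
have T2 : cmod T <= a^-1 ^+ 2 * M B * s.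
  apply: le_trans T_le _; rewrite exprS mulrCA -mulrA ler_wpM2r ?mulr_ge0//.
  by rewrite expr2; apply: ler_pM.
have L : (`|u| + `|v|) * (`|u| * cmod P + `|v| * cmod N) <= 4 * (a^-1 ^+ 2 * M B * s).
  apply: (@le_trans _ _ ((`|u| + `|v|) *
      (`|u| * (M B * (p ^+ n.+3 * q ^+ n.+1)) + `|v| * (M B * (p ^+ n.+1 * q ^+ n.+3))))).
    by rewrite ler_wpM2l ?addr_ge0// lerD// ler_wpM2l.
  rewrite [leLHS](_ : _ = ((`|u| * p) * (`|u| * p) * (p * q) + (`|u| * p) * (`|v| * q) * (q * q)
    + (`|u| * p) * (`|v| * q) * (p * p) + (`|v| * q) * (`|v| * q) * (p * q)) * (M B * s)); last first.
    by rewrite /s !exprS exprMn; ring.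
  rewrite [leRHS](_ : _ = (a^-1 ^+ 2 + a^-1 ^+ 2 + a^-1 ^+ 2 + a^-1 ^+ 2) * (M B * s)); last by ring.
  rewrite ler_wpM2r ?mulr_ge0//.
  have key (e f g h : R) : 0 <= e <= 1 -> 0 <= f <= 1 -> 0 <= g <= a^-1 -> 0 <= h <= a^-1 ->
      e * f * (g * h) <= a^-1 ^+ 2.
    move=> /andP[e0 e1] /andP[f0 f1] /andP[g0 g1] /andP[h0 h1].
    rewrite -[leRHS]mul1r; apply: ler_pM; rewrite ?mulr_ge0//.
      by rewrite -[leRHS](mulr1 1) ler_pM.
    by rewrite expr2 ler_pM.
  have pP : 0 <= p <= a^-1 by rewrite p0'.
  have qP : 0 <= q <= a^-1 by rewrite q0'.
  have up : 0 <= `|u| * p <= 1 by rewrite mulr_ge0.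
  have vq : 0 <= `|v| * q <= 1 by rewrite mulr_ge0.
  by rewrite !lerD ?key.
have nC (r : R) : `|- (n.+1%:R * r)| = n.+1%:R * `|r| :> R.
  by rewrite normrN normrM ger0_norm.
have ReP (r r' : R) : `|Re (Complex (- (n.+1%:R * r)) 0 * P + Complex (- (n.+1%:R * r')) 0 * N)|
    <= n.+1%:R * (`|r| * cmod P + `|r'| * cmod N).
  rewrite Re_add !Re_mul /= !mul0r !subr0 (le_trans (ler_normD _ _))// !normrM !nC.
  by rewrite mulrDr !mulrA lerD// ler_wpM2l ?mulr_ge0 ?normRe_le_cmod.
have ImP (r r' : R) : `|Im (Complex (- (n.+1%:R * r)) 0 * P + Complex (- (n.+1%:R * r')) 0 * N)|
    <= n.+1%:R * (`|r| * cmod P + `|r'| * cmod N).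
  rewrite Im_add !Im_mul /= !mul0r !addr0 (le_trans (ler_normD _ _))// !normrM !nC.
  by rewrite mulrDr !mulrA lerD// ler_wpM2l ?mulr_ge0 ?normIm_le_cmod.
rewrite (le_trans (ler_normD _ _))// (le_trans (lerD (lexx _) (ler_normD _ _)))//.
rewrite !normrM !normrN normrM normr_nat (ger0_norm (ltW a0)).
rewrite [leRHS](_ : _ = 2 * B * (a^-1 ^+ 2 * M B * s) +
  (B * (n.+1%:R * (4 * (a^-1 ^+ 2 * M B * s))) +
   a * (n.+1%:R * (4 * (a^-1 ^+ 2 * M B * s))))); last by rewrite /dflux_cst; ring.
apply: lerD.
  apply: ler_pM; rewrite ?mulr_ge0 ?ler_wpM2l//.
  exact: le_trans (normRe_le_cmod _) T2.
have XL (X Y : R) : `|X| <= `|u| + `|v| -> `|Y| <= n.+1%:R * (`|u| * cmod P + `|v| * cmod N) ->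
    `|X| * `|Y| <= n.+1%:R * (4 * (a^-1 ^+ 2 * M B * s)).
  move=> Xl Yl; apply: (@le_trans _ _ ((`|u| + `|v|) * (n.+1%:R * (`|u| * cmod P + `|v| * cmod N)))).
    by rewrite ler_pM.
  by rewrite mulrCA ler_wpM2l.
apply: lerD; rewrite -mulrA; apply: ler_pM; rewrite ?mulr_ge0 ?(ltW a0)// XL ?ReP ?ImP//.
  exact: ler_normD.
by rewrite [leRHS]addrC; exact: ler_normB.
Qed.

(** The decay $|c_j-x_j|^{-1}$ is what makes the boundary terms vanish in [integral_partial_eq0]. *)
Lemma flux_le j b B c x y : `|b| <= B ->
  `|flux a x y j b c| * `|tnth c j - tnth x j| <=
  (B + a) * (2 * (M B * a^-1 ^+ (n + n))).
Proof.
move=> bB; have B0 : 0 <= B by exact: le_trans (normr_ge0 _) bB.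
have MB := M_ge bB; have a'0 : 0 <= a^-1 by rewrite invr_ge0 ltW.
have T_le := cmod_pair_le c x y bB.
have [[[p0 q0] pa] qa] := (qx0 c x, qx0 c y, qxa c x, qxa c y).
have [ux vy] := (uq c x j, uq c y j).
rewrite /flux; move: (wave_pair a x y n.+1 n.+1 b c) T_le => T T_le.
set u := tnth c j - tnth x j in ux *; set v := tnth c j - tnth y j in vy *.
have -> : 2 * tnth c j - tnth x j - tnth y j = u + v by rewrite /u /v; ring.
have -> : tnth x j - tnth y j = v - u by rewrite /u /v; ring.
move: (q c x) (q c y) p0 q0 pa qa ux vy T_le => p q p0 q0 pa qa ux vy T_le.
have [p0' q0'] := (ltW p0, ltW q0).
have up : 0 <= `|u| * p <= 1 by rewrite mulr_ge0.
have vq : 0 <= `|v| * q <= 1 by rewrite mulr_ge0.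
have L : (`|u| + `|v|) * cmod T * `|u| <= 2 * (M B * a^-1 ^+ (n + n)).
  apply: (@le_trans _ _ ((`|u| + `|v|) * (M B * (p * q) ^+ n.+1) * `|u|)).
    by rewrite ler_wpM2r// ler_wpM2l// addr_ge0.
  have [m nE] : exists m, n = m.+1 by case: (n) n0 => // m _; exists m.
  rewrite [leLHS](_ : _ = M B * ((`|u| * p) * (`|u| * p) * (p ^+ m * q ^+ n.+1) +
    (`|u| * p) * (`|v| * q) * (p ^+ n * q ^+ n))); last first.
    by rewrite exprMn [X in p ^+ X.+1 * _]nE [X in _ + _ * (p ^+ X * _)]nE !exprS nE !exprS; ring.
  rewrite [leRHS]mulrCA ler_wpM2l// mulr_natl mulr2n.
  have key (e f : R) k l : 0 <= e <= 1 -> 0 <= f <= 1 -> (k + l = n + n)%N ->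
      e * f * (p ^+ k * q ^+ l) <= a^-1 ^+ (n + n).
    move=> /andP[e0 e1] /andP[f0 f1] <-.
    rewrite -[leRHS]mul1r; apply: ler_pM; rewrite ?mulr_ge0 ?exprn_ge0//.
      by rewrite -[leRHS](mulr1 1) ler_pM.
    by rewrite exprD; apply: ler_pM; rewrite ?exprn_ge0// lerXn2r ?nnegrE// invr_ge0 ltW.
  apply: lerD; apply: key => //.
  by rewrite nE addSnnS.
apply: (@le_trans _ _ ((B + a) * ((`|u| + `|v|) * cmod T * `|u|))); last first.
  by rewrite ler_wpM2l// addr_ge0// ltW.
rewrite [leRHS]mulrA ler_wpM2r// (le_trans (ler_normD _ _))// !normrM normrN (ger0_norm (ltW a0)).
rewrite mulrDl -!mulrA; apply: lerD; apply: ler_pM; rewrite ?mulr_ge0 ?(ltW a0)//;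
  apply: ler_pM; rewrite ?normr_ge0 ?normRe_le_cmod ?normIm_le_cmod// ?ler_normD//.
by rewrite [leRHS]addrC; exact: ler_normB.
Qed.

End wave_bounds.

(** * Conservation of the total energy *)

Section wave_invariance.
Context (R : realType) (n : nat) (a : R).
Hypotheses (a0 : 0 < a) (n0 : (0 < n)%N).
Local Notation C := (complex R).
Local Notation Re := (@complex.Re R).
Local Notation Im := (@complex.Im R).
Implicit Types (b t B : R) (c x y : pt R n) (j : 'I_n).

Section measurability.
Context (d : measure_display) (S : measurableType d).

Lemma measurable_funV_pos (f : S -> R) : (forall s, 0 < f s) ->
  measurable_fun setT f -> measurable_fun setT (fun s => (f s)^-1).
Proof.
move=> f0 mf; under eq_fun do rewrite -powR_inv1 ?(ltW (f0 _))//.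
exact: (measurableT_comp (measurable_powR _)).
Qed.

Lemma measurable_fun_sqrt (f : S -> R) :
  measurable_fun setT f -> measurable_fun setT (fun s => Num.sqrt (f s)).
Proof.
move=> mf; apply: (measurableT_comp (f := @Num.sqrt R)) => //.
exact: (continuous_measurable_fun (@sqrt_continuous R)).
Qed.

Lemma measurable_cpow (f : S -> C) k :
  measurable_fun setT (fun s => Re (f s)) -> measurable_fun setT (fun s => Im (f s)) ->
  measurable_fun setT (fun s => Re (f s ^+ k)) /\
  measurable_fun setT (fun s => Im (f s ^+ k)).
Proof.
move=> mr mi; elim: k => [|k [IHr IHi]].
  by under eq_fun do rewrite expr0; under [X in _ /\ measurable_fun _ X]eq_fun do rewrite expr0.
split.
  under eq_fun do rewrite exprS Re_mul.
  by apply: measurable_funB; exact: measurable_funM.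
under eq_fun do rewrite exprS Im_mul.
by apply: measurable_funD; exact: measurable_funM.
Qed.

Lemma measurable_wroot_pow (X Y : S -> R) k : (forall s, 0 < wmod (X s) (Y s) + X s) ->
  measurable_fun setT X -> measurable_fun setT Y ->
  measurable_fun setT (fun s => Re (wroot (X s) (Y s) ^+ k)) /\
  measurable_fun setT (fun s => Im (wroot (X s) (Y s) ^+ k)).
Proof.
move=> dom mX mY.
have mm : measurable_fun setT (fun s => wmod (X s) (Y s)).
  by apply: measurable_fun_sqrt; apply: measurable_funD; exact: measurable_funX.
have mr : measurable_fun setT (fun s => wrho (X s) (Y s)).
  apply: measurable_fun_sqrt; apply: measurable_funM => //.
  exact: measurable_funD.
have m0 s : 0 < wmod (X s) (Y s).
  have [p [q [p0 _ _ _ ->]]] := wroot_param (dom s).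
  by rewrite ltr_wpDr ?sqr_ge0// exprn_gt0.
have r0 s : 0 < wrho (X s) (Y s).
  by have [p [q [p0 -> _ _ _]]] := wroot_param (dom s).
apply: measurable_cpow.
  by apply: measurable_funM => //; exact: measurable_funV_pos.
apply: measurable_funM => //; apply: measurable_funV_pos.
  by move=> s; rewrite !mulr_gt0.
by apply: measurable_funM => //; exact: measurable_funM.
Qed.

Lemma measurable_wave_pow (f : S -> R) b k : (forall s, 0 <= f s) ->
  measurable_fun setT f ->
  measurable_fun setT (fun s => Re (wave a b (f s) ^+ k)) /\
  measurable_fun setT (fun s => Im (wave a b (f s) ^+ k)).
Proof.
move=> f0 mf; apply: measurable_wroot_pow => //; last exact: measurable_funD.
by move=> s; exact: wave_dom.
Qed.

Lemma measurable_wave_pair (fc fx fy : S -> pt R n) k l b :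
  measurable_fun setT fc -> measurable_fun setT fx -> measurable_fun setT fy ->
  measurable_fun setT (fun s => Re (wave_pair a (fx s) (fy s) k l b (fc s))) /\
  measurable_fun setT (fun s => Im (wave_pair a (fx s) (fy s) k l b (fc s))).
Proof.
move=> mc mx my.
have [r1 i1] := measurable_wave_pow b k (fun s => sqd_ge0 (fc s) (fx s))
  (measurable_sqd mc mx).
have [r2 i2] := measurable_wave_pow b l (fun s => sqd_ge0 (fc s) (fy s))
  (measurable_sqd mc my).
have ReJ (z : C) : Re (conjc z) = Re z by case: z.
have ImJ (z : C) : Im (conjc z) = - Im z by case: z.
split; rewrite /wave_pair.
  under eq_fun do rewrite Re_mul ReJ ImJ.
  apply: measurable_funB; apply: measurable_funM => //.
  exact: measurable_funN.
under eq_fun do rewrite Im_mul ReJ ImJ.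
apply: measurable_funD; apply: measurable_funM => //.
exact: measurable_funN.
Qed.

Lemma measurable_energy_density (fc fx fy : S -> pt R n) b :
  measurable_fun setT fc -> measurable_fun setT fx -> measurable_fun setT fy ->
  measurable_fun setT (fun s => energy_density a (fx s) (fy s) b (fc s)).
Proof.
move=> mc mx my; have mt (f : S -> pt R n) i : measurable_fun setT f ->
    measurable_fun setT (fun s => tnth (f s) i : R).
  by move=> mf; apply: (measurableT_comp (measurable_tnth i)).
apply: measurable_funM; last by have [] := measurable_wave_pair n.+1 n.+1 b mc mx my.
apply: measurable_funD => //; apply: measurable_sum => i.
by apply: measurable_funM; apply: measurable_funB; exact: mt.
Qed.

Lemma measurable_dflux (fc : S -> pt R n) x y j b : measurable_fun setT fc ->
  measurable_fun setT (fun s => dflux a x y j b (fc s)).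
Proof.
move=> mc; have mt i : measurable_fun setT (fun s => tnth (fc s) i : R).
  by apply: (measurableT_comp (measurable_tnth i)).
have mx := @measurable_cst _ _ S _ setT x; have my := @measurable_cst _ _ S _ setT y.
have [r1 i1] := measurable_wave_pair n.+1 n.+1 b mc mx my.
have [r2 i2] := measurable_wave_pair n.+3 n.+1 b mc mx my.
have [r3 i3] := measurable_wave_pair n.+1 n.+3 b mc mx my.
have gen (A P N P' N' : S -> R) : measurable_fun setT A -> measurable_fun setT P ->
    measurable_fun setT N -> measurable_fun setT P' -> measurable_fun setT N' ->
    measurable_fun setT (fun s => - (2 * b) * A s +
      (- b * (2 * tnth (fc s) j - (tnth x j + tnth y j)) *
         (- (n.+1%:R * (tnth (fc s) j - tnth x j)) * P s +
          - (n.+1%:R * (tnth (fc s) j - tnth y j)) * N s) +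
       a * (tnth x j - tnth y j) *
         (- (n.+1%:R * (tnth (fc s) j - tnth x j)) * P' s +
          - (n.+1%:R * (tnth (fc s) j - tnth y j)) * N' s))).
  move=> mA mP mN mP' mN'.
  by repeat first [exact: measurable_cst|assumption|exact: mt|
    apply: measurable_funD|apply: measurable_funM|apply: measurable_funN].
have := gen _ _ _ _ _ r1 r2 r3 i2 i3; congr (measurable_fun _ _).
apply/funext => s; rewrite /dflux /dwave_pair /cst.
by rewrite Re_add Im_add !(Re_mul, Im_mul) /=; ring.
Qed.

End measurability.

Lemma rad_powE x c : (rad a (sqd c x)) ^+ (n + n) =
  a^-1 ^+ (n + n) * (1 + sqd c x / a ^+ 2) `^ (- ((n + n)%:R / 2)).
Proof.
have S0 := sqd_ge0 c x; have an0 : a != 0 by rewrite gt_eqF.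
have p0 : 0 <= 1 + sqd c x / a ^+ 2 by rewrite addr_ge0// divr_ge0// sqr_ge0.
have -> : (n + n)%:R / 2 = n%:R :> R by rewrite natrD; field.
rewrite powR_invn// !exprD -!exprMn -!expr2 rad_sqr// -exprVn -exprMn.
have -> : sqd c x + a ^+ 2 = a ^+ 2 * (1 + sqd c x / a ^+ 2) by field.
by rewrite invfM exprVn.
Qed.

Lemma integrable_rad_pow x :
  (vol R n).-integrable setT (fun c => ((rad a (sqd c x)) ^+ (n + n))%:E).
Proof.
have mr : measurable_fun setT (fun c : pt R n => (rad a (sqd c x)) ^+ (n + n)).
  apply: measurable_funX; apply: measurable_funV_pos.
    by move=> c; rewrite sqrtr_gt0 ltr_wpDl ?sqd_ge0// exprn_gt0.
  apply: measurable_fun_sqrt; apply: measurable_funD => //.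
  by apply: measurable_sqd => //; exact: measurable_cst.
apply/integrableP; split; first exact/measurable_EFinP.
under eq_integral => c _.
  rewrite gee0_abs; last by rewrite lee_fin exprn_ge0// ltW// rad_gt0 ?sqd_ge0.
  rewrite rad_powE EFinM; over.
rewrite ge0_integralZl//=; last 3 first.
- apply/measurable_EFinP; apply: (measurableT_comp (measurable_powR _)).
  apply: measurable_funD => //; apply: measurable_funM => //.
  by apply: measurable_sqd => //; exact: measurable_cst.
- by move=> c _; rewrite lee_fin powR_ge0.
- by rewrite lee_fin exprn_ge0// invr_ge0 ltW.
rewrite lte_mul_pinfty// ?lee_fin ?exprn_ge0 ?invr_ge0 ?(ltW a0)//.
apply: le_lt_trans (ball_growth_integral_le x (@vol_growth R n) _ a0 _ _) _ => //.
- by rewrite ltr_nat -[ltnLHS]addn0 ltn_add2l.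
- exact: ltry.
Qed.

Definition rad_dom x y c : R :=
  (rad a (sqd c x)) ^+ (n + n) + (rad a (sqd c y)) ^+ (n + n).

(** From $pq\le p^2+q^2$: the powers become $2n>n$ of a single [rad], each integrable over R^n. *)
Lemma rad_mul_le_dom x y c :
  (rad a (sqd c x) * rad a (sqd c y)) ^+ n <= rad_dom x y c.
Proof.
rewrite /rad_dom !exprD exprMn; set p := _ ^+ n; set q := _ ^+ n.
have := sqr_ge0 (p - q); rewrite sqrrB -!expr2.
have : 0 <= p * q by rewrite mulr_ge0// exprn_ge0// ltW// rad_gt0 ?sqd_ge0.
lra.
Qed.

Lemma integrable_rad_dom x y (K : R) :
  (vol R n).-integrable setT (fun c => (K * rad_dom x y c)%:E).
Proof.
under eq_fun do rewrite EFinM EFinD.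
by apply: integrableZl => //; apply: integrableD => //; exact: integrable_rad_pow.
Qed.

Lemma integrable_dominated (f : pt R n -> R) x y K :
  measurable_fun setT f -> 0 <= K ->
  (forall c, `|f c| <= K * (rad a (sqd c x) * rad a (sqd c y)) ^+ n) ->
  (vol R n).-integrable setT (EFin \o f).
Proof.
move=> mf K0 fK; apply: le_integrable (integrable_rad_dom x y K) => //.
  exact/measurable_EFinP.
move=> c _ /=; rewrite lee_fin (le_trans (fK c))//.
by rewrite (le_trans _ (ler_norm _))// ler_wpM2l// rad_mul_le_dom.
Qed.

Lemma integrable_energy_density x y b :
  (vol R n).-integrable setT (EFin \o energy_density a x y b).
Proof.
apply: (integrable_dominated (x := x) (y := y) _ _ (fun c => energy_density_le a0 b c x y)).
  by apply: (measurable_energy_density b) => //; exact: measurable_cst.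
have K1 := le_trans ler01 (wave_cst_ge1 a b).
by apply: mulr_ge0; [exact: addr_ge0|exact: exprn_ge0].
Qed.

Lemma dflux_cst_ge0 b B : `|b| <= B -> 0 <= dflux_cst n a B.
Proof.
move=> bB; have B0 : 0 <= B by exact: le_trans (normr_ge0 _) bB.
have K1 := le_trans ler01 (wave_cst_ge1 a B).
by rewrite !mulr_ge0 ?addr_ge0 ?mulr_ge0 ?addr_ge0 ?exprn_ge0 ?invr_ge0 ?(ltW a0).
Qed.

Lemma integrable_dflux x y j b :
  (vol R n).-integrable setT (EFin \o dflux a x y j b).
Proof.
apply: (@integrable_dominated (dflux a x y j b) x y (dflux_cst n a `|b|)).
- exact: (measurable_dflux x y j b (@measurable_id _ _ setT)).
- exact: dflux_cst_ge0 (lexx _).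
- by move=> c; exact: dflux_le.
Qed.

Lemma cvg_dist_bound (g : R -> R) (x K : R) : (forall t, `|g t| * `|t - x| <= K) ->
  g t @[t --> +oo%R] --> (0 : R) /\ g t @[t --> -oo%R] --> (0 : R).
Proof.
move=> gK; have K0 : 0 <= K by apply: le_trans (gK x); rewrite subrr normr0 mulr0.
have aux e t : 0 < e -> (K + 1) / e <= `|t - x| -> `|0 - g t| < e.
  move=> e0 et; rewrite sub0r normrN.
  have d0 : 0 < `|t - x| by apply: lt_le_trans et; rewrite divr_gt0// ltr_wpDl.
  rewrite -(ltr_pM2r d0); apply: le_lt_trans (gK t) _.
  apply: (@lt_le_trans _ _ (K + 1)); first by rewrite ltrDl.
  by rewrite mulrC -ler_pdivrMr.
split; apply/cvgrPdist_lt => e e0; near=> t; apply: aux => //.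
  rewrite (le_trans _ (ler_norm _))// lerBrDr.
  by near: t; apply: nbhs_pinfty_ge; rewrite num_real.
rewrite distrC (le_trans _ (ler_norm _))// lerBrDl -lerBrDr.
by near: t; apply: nbhs_ninfty_le; rewrite num_real.
Unshelve. all: by end_near. Qed.

Lemma integral_dflux x y j b : (\int[vol R n]_c (dflux a x y j b c)%:E = 0)%E.
Proof.
apply: (@integral_partial_eq0 _ _ j _ (flux a x y j b)).
- exact: integrable_dflux.
- by move=> c; exact: continuous_dflux.
- by move=> c t; exact: is_derive_flux.
- move=> c; apply: (proj1 (cvg_dist_bound (x := tnth x j) _)) => t.
  by have := flux_le a0 n0 j (upd c j t) x y (lexx `|b|); rewrite tnth_upd eqxx; exact.
- move=> c; apply: (proj2 (cvg_dist_bound (x := tnth x j) _)) => t.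
  by have := flux_le a0 n0 j (upd c j t) x y (lexx `|b|); rewrite tnth_upd eqxx; exact.
Qed.

Lemma integral_denergy_density x y b :
  \int[vol R n]_c (denergy_density a x y b c) = 0.
Proof.
rewrite /Rintegral; under eq_integral do rewrite energy_identity// -sumEFin.
rewrite integral_sum//=; last by move=> j; exact: integrable_dflux.
by rewrite big1// => j _; exact: integral_dflux.
Qed.

(** The derivative in [b] may be taken under the integral, because on the interval $|b|<B$ the
    density's derivative has one integrable majorant. It is then the integral of a divergence, hence
    0. *)
Theorem energy_invariance x y b :
  \int[vol R n]_c (energy_density a x y b c) =
  \int[vol R n]_c (energy_density a x y 0 c).
Proof.
pose F b := \int[vol R n]_c (energy_density a x y b c).
apply: (@is_derive_0_is_cst R F) => {}b.
pose B := `|b| + 1.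
have B0 : 0 <= B by rewrite addr_ge0.
have Ib : [set` `](- B), B[] b.
  by rewrite /= in_itv/= -ltr_norml ltrDl.
have IB u : [set` `](- B), B[] u -> `|u| <= B.
  by rewrite /= in_itv/= -ltr_norml => /ltW.
pose G c := n%:R * dflux_cst n a B * rad_dom x y c.
have dc0 : 0 <= dflux_cst n a B by exact: (@dflux_cst_ge0 b B (IB b Ib)).
have G0 c : 0 <= G c.
  have r0 z : 0 <= rad a (sqd c z) ^+ (n + n).
    by rewrite exprn_ge0// ltW// rad_gt0// sqd_ge0.
  by apply: mulr_ge0; [exact: mulr_ge0|exact: addr_ge0].
have d1E u c : partial1of2 (energy_density a x y) u c = denergy_density a x y u c.
  by rewrite partial1of2E; exact: (is_derive_energy_density x y a0 u c).(derive_val).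
have dle u c : [set` `](- B), B[] u -> setT c ->
    `|partial1of2 (energy_density a x y) u c| <= G c.
  move=> Bu _; rewrite d1E energy_identity// (le_trans (ler_norm_sum _ _ _))//.
  rewrite /G -mulrA mulr_natl -[X in _ *+ X]card_ord -sumr_const.
  apply: ler_sum => j _; apply: (@le_trans _ _ (dflux_cst n a B *
    (rad a (sqd c x) * rad a (sqd c y)) ^+ n)).
    by apply: dflux_le => //; exact: IB.
  by rewrite ler_wpM2l// rad_mul_le_dom.
have der u c : [set` `](- B), B[] u -> setT c ->
    derivable (fun v => energy_density a x y v c) u 1.
  by move=> _ _; exact: (is_derive_energy_density x y a0 u c).(ex_derive).
have inte u : [set` `](- B), B[] u ->
    (vol R n).-integrable setT (EFin \o energy_density a x y u).
  by move=> _; exact: integrable_energy_density.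
have dF := derivable_under_integral measurableT Ib inte der G0
  (integrable_rad_dom x y _) dle.
have vF := differentiation_under_integral measurableT Ib inte der G0
  (integrable_rad_dom x y _) dle.
apply: DeriveDef; first exact: dF.
rewrite -derive1E [LHS]vF; transitivity (\int[vol R n]_c (denergy_density a x y b c)).
  by apply: eq_Rintegral => c _; exact: d1E.
exact: integral_denergy_density.
Qed.

End wave_invariance.

(** * Integrals over sections and over products *)

Section integral_section.
Context d1 d2 (T1 : measurableType d1) (T2 : measurableType d2) (R : realType).
Local Open Scope ereal_scope.

Lemma measurable_integral_section (m2 : {sigma_finite_measure set T2 -> \bar R})
    (f : T1 * T2 -> \bar R) : measurable_fun setT f ->
  measurable_fun setT (fun x => \int[m2]_y f (x, y)).
Proof.
move=> mf; under eq_fun do rewrite integralE.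
apply: emeasurable_funB.
- rewrite (_ : (fun x => _) = fubini_F m2 (f^\+)); last first.
    by apply/funext => x; rewrite /fubini_F; under eq_integral do rewrite funepos_comp/=.
  by apply: measurable_fun_fubini_tonelli_F => //; exact: measurable_funepos.
- rewrite (_ : (fun x => _) = fubini_F m2 (f^\-)); last first.
    by apply/funext => x; rewrite /fubini_F; under eq_integral do rewrite funeneg_comp/=.
  by apply: measurable_fun_fubini_tonelli_F => //; exact: measurable_funeneg.
Qed.

Lemma integrable_integral_section (m1 : {sigma_finite_measure set T1 -> \bar R})
    (m2 : {sigma_finite_measure set T2 -> \bar R}) (f : T1 * T2 -> \bar R) :
  (m1 \x m2).-integrable setT f ->
  m2.-integrable setT (fun y => \int[m1]_x f (x, y)).
Proof.
move=> intf; have [mf _] := integrableP _ _ _ intf.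
have mG := measurable_fubini_G intf.
apply/integrableP; split => //.
apply: le_lt_trans ((integrable21ltyP m1 m2 mf).1 intf).
apply: ge0_le_integral => //.
- exact: measurableT_comp.
- apply: (@measurable_fun_fubini_tonelli_G _ _ _ _ _ m1 (abse \o f)).
    exact: measurableT_comp.
  by move=> ?; exact: abse_ge0.
- move=> y _; apply: le_abse_integral => //.
  by apply: measurableT_comp => //; exact: pair2_measurable.
Qed.

End integral_section.

Section product_integrals.
Context d1 (T1 : measurableType d1) (R : realType).
Local Open Scope ereal_scope.

Lemma integrable_bounded d (T : measurableType d) (P : probability T R) (f : T -> R)
    (K : R) :
  measurable_fun setT f -> (forall x, (`|f x| <= K)%R) ->
  P.-integrable setT (EFin \o f).
Proof.
move=> mf fK; apply: (@le_integrable _ _ _ P setT _ _ (cst K%:E)) => //.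
- exact/measurable_EFinP.
- by move=> x _ /=; rewrite lee_fin (le_trans (fK x))// ler_norm.
- by apply: finite_measure_integrable_cst.
Qed.

Lemma integral_prod_mul (P : probability T1 R) (f : T1 -> R) (K : R) :
  measurable_fun setT f -> (forall x, (`|f x| <= K)%R) ->
  \int[(P \x P)]_z (f z.1 * f z.2)%:E = ((\int[P]_x f x)%R ^+ 2)%:E.
Proof.
move=> mf fK; have intf := integrable_bounded P mf fK.
have fin : (\int[P]_x f x)%R%:E = \int[P]_x (f x)%:E.
  by rewrite fineK//; exact: integrable_fin_num.
have K0 : (0 <= K)%R by exact: le_trans (normr_ge0 _) (fK point).
have intff : (P \x P).-integrable setT (fun z => (f z.1 * f z.2)%:E).
  apply: (@integrable_bounded _ _ (P \x P) _ (K * K)%R) => [|z].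
    apply: measurable_funM; exact: measurableT_comp.
  by rewrite normrM ler_pM.
rewrite -(integral12_prod_meas1 intff).
under eq_integral => x _.
  rewrite /fubini_F; under eq_integral => y _ do rewrite /= EFinM.
  rewrite integralZl// -fin muleC; over.
by rewrite integralZl// -fin -EFinM expr2.
Qed.

Lemma ge0_integral_prod_mul (P : probability T1 R) (f g : T1 -> R) :
  measurable_fun setT f -> measurable_fun setT g ->
  (forall x, (0 <= f x)%R) -> (forall x, (0 <= g x)%R) ->
  \int[(P \x P)]_z (f z.1 * g z.2)%:E = \int[P]_x (f x)%:E * \int[P]_x (g x)%:E.
Proof.
move=> mf mg f0 g0.
rewrite (fubini_tonelli1 (m1 := P) (m2 := P) (fun z => (f z.1 * g z.2)%:E)); last 2 first.
- by apply/measurable_EFinP; apply: measurable_funM; exact: measurableT_comp.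
- by move=> z; rewrite lee_fin mulr_ge0.
rewrite -ge0_integralZr//=; last 3 first.
- exact/measurable_EFinP.
- by move=> x _; rewrite lee_fin.
- by apply: integral_ge0 => y _; rewrite lee_fin.
apply: eq_integral => x _; rewrite /fubini_F -ge0_integralZl//=; last 3 first.
- exact/measurable_EFinP.
- by move=> y _; rewrite lee_fin.
- by rewrite lee_fin.
Qed.

(** A finite sum of products of the same function in both variables integrates to a weighted sum of
    squares, the form in which positivity of the energy is read off. *)
Lemma integral_sum_prod_mul (I : Type) (r : seq I) (P : probability T1 R) (w : I -> R)
    (f : I -> T1 -> R) (K : I -> R) :
  (forall i, measurable_fun setT (f i)) -> (forall i x, (`|f i x| <= K i)%R) ->
  \int[(P \x P)]_z (\sum_(i <- r) w i * (f i z.1 * f i z.2))%R%:E =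
  (\sum_(i <- r) w i * (\int[P]_x f i x)%R ^+ 2)%R%:E.
Proof.
move=> mf fK.
have int i : (P \x P).-integrable setT (fun z => (w i * (f i z.1 * f i z.2))%:E).
  apply: (@integrable_bounded _ _ (P \x P) _ (`|w i| * (K i * K i))%R) => [|z].
    apply: measurable_funM => //.
    by apply: measurable_funM; exact: measurableT_comp.
  by rewrite normrM ler_wpM2l// normrM ler_pM.
under eq_integral do rewrite -sumEFin.
rewrite integral_sum// -sumEFin; apply: eq_bigr => i _.
rewrite EFinM -(integral_prod_mul P (mf i) (fK i)) -integralZl//.
apply: (@integrable_bounded _ _ (P \x P) _ (K i * K i)%R) => [|z].
  by apply: measurable_funM; exact: measurableT_comp.
by rewrite normrM ler_pM.
Qed.

End product_integrals.

Lemma integral_energy_density (R : realType) (n : nat) (a b : R) (x y : pt R n) :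
  0 < a -> (0 < n)%N ->
  (\int[vol R n]_c (energy_density a x y b c)%:E =
   \int[vol R n]_c (energy_density a x y 0 c)%:E)%E.
Proof.
move=> a0 n0.
have fin t : (\int[vol R n]_c (energy_density a x y t c))%:E =
    (\int[vol R n]_c (energy_density a x y t c)%:E)%E.
  apply: fineK; apply: integrable_fin_num => //.
  exact: (integrable_energy_density a0 n0 x y t).
exact (etrans (esym (fin b)) (etrans (congr1 EFin (energy_invariance a0 n0 x y b)) (fin 0))).
Qed.

(** * Square norm of a field from energy conservation *)

Section l2_bound.
Context (R : realType) (n : nat) (a : R) (mu : probability (pt R n) R) (A s : R).
Hypotheses (a0 : 0 < a) (n0 : (0 < n)%N) (A0 : 0 <= A) (gmu : ball_growth mu A s).
Hypotheses (s0 : 0 <= s) (sn : s < n%:R).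
Local Notation C := (complex R).
Local Notation Re := (@complex.Re R).
Local Notation Im := (@complex.Im R).
Implicit Types (b : R) (c x y : pt R n).
Local Notation q c x := (rad a (sqd c x)).
Local Notation h p c x := ((1 + sqd c x / a ^+ 2) `^ (- (p / 2))).

(** Half of the gap between [s] and [n]: the exponent $n-\eta$ still exceeds [s], hence is
    integrable against [mu], and $n+\eta$ exceeds [n], hence is integrable against volume. *)
Let eta : R := (n%:R - s) / 2.

Let etaP : [/\ 0 < eta, s < n%:R - eta, n%:R < n%:R + eta & 0 <= n%:R - eta].
Proof. by rewrite /eta; move: sn s0; move: (n%:R : R) => N ? ?; split; lra. Qed.

Let h0 c x : 0 < 1 + sqd c x / a ^+ 2.
Proof. by rewrite ltr_pwDl// divr_ge0 ?sqd_ge0 ?sqr_ge0. Qed.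

(** The exponent [n] is borderline for volume, where a logarithm would appear. Giving $n+\eta$ to
    the smaller base and $n-\eta$ to the larger one only increases the product; which base is
    smaller is unknown, hence the two summands. *)
Let rad_mul_le c x y : (q c x * q c y) ^+ n <=
  a^-1 ^+ (n + n) * (h (n%:R - eta) c x * h (n%:R + eta) c y +
                     h (n%:R + eta) c x * h (n%:R - eta) c y).
Proof.
have radE z : q c z ^+ n = a^-1 ^+ n * h n%:R c z.
  have an0 : a != 0 by rewrite gt_eqF.
  have S0 := sqd_ge0 c z.
  have -> : q c z = a^-1 * (1 + sqd c z / a ^+ 2) `^ (- 2^-1).
    rewrite /rad powRN powR12_sqrt ?(ltW (h0 _ _))// -invfM; congr _^-1.
    have -> : sqd c z + a ^+ 2 = a ^+ 2 * (1 + sqd c z / a ^+ 2) by field.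
    by rewrite sqrtrM ?sqr_ge0// sqrtr_sqr ger0_norm// ltW.
  rewrite exprMn; congr (_ * _).
  rewrite -(powR_mulrn n (powR_ge0 _ _)) -powRrM; congr (_ `^ _).
  by field.
rewrite exprMn !radE mulrACA -exprD ler_wpM2l ?exprn_ge0 ?invr_ge0 ?(ltW a0)//.
have [eta0 _ _ _] := etaP; have e0 : 0 <= eta / 2 by lra.
have key (p r : R) : 0 < p -> p <= r -> 0 < r ->
    p `^ (- (n%:R / 2)) * r `^ (- (n%:R / 2)) <=
    p `^ (- ((n%:R + eta) / 2)) * r `^ (- ((n%:R - eta) / 2)).
  move=> p0 pr r0.
  have -> : - ((n%:R + eta) / 2) = - (n%:R / 2) + - (eta / 2) by field.
  have -> : - ((n%:R - eta) / 2) = - (n%:R / 2) + eta / 2 by field.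
  rewrite !powRD ?(gt_eqF p0) ?(gt_eqF r0) ?implybT//.
  rewrite mulrACA ler_peMr ?mulr_ge0 ?powR_ge0//.
  rewrite powRN mulrC ler_pdivlMr ?powR_gt0// mul1r.
  by rewrite ge0_ler_powR// nnegrE ltW.
have [xy|yx] := leP (1 + sqd c x / a ^+ 2) (1 + sqd c y / a ^+ 2).
  apply: le_trans (key _ _ (h0 _ _) xy (h0 _ _)) _.
  by rewrite lerDr mulr_ge0// powR_ge0.
rewrite mulrC; apply: le_trans (key _ _ (h0 _ _) (ltW yx) (h0 _ _)) _.
by rewrite mulrC lerDl mulr_ge0// powR_ge0.
Qed.

Let mh p (d : measure_display) (S : measurableType d) (f g : S -> pt R n) :
  measurable_fun setT f -> measurable_fun setT g ->
  measurable_fun setT (fun z => h p (f z) (g z)).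
Proof.
move=> mf mg; apply: (measurableT_comp (measurable_powR _)).
by apply: measurable_funD => //; apply: measurable_funM => //; exact: measurable_sqd.
Qed.

Let pairs : probability (pt R n * pt R n)%type R := (mu \x mu)%E.

(** For fixed [c] the first factor is integrated against [mu], which gives $a^s$; then, for a fixed
    second point, the other factor is integrated over [c], which gives $a^n$. *)
Let int_rad_half :
  (\int[vol R n]_c \int[pairs]_z (h (n%:R - eta) c z.1 * h (n%:R + eta) c z.2)%:E <=
   (layer_cst ((n%:R - eta) / 2) (s / 2) * (A * a `^ s) *
    (layer_cst ((n%:R + eta) / 2) (n%:R / 2) * (2 ^+ n * a `^ n%:R)))%:E)%E.
Proof.
have [eta0 eta1 eta2 eta3] := etaP.
set L1 := _ * (A * _); set L2 := _ * (2 ^+ n * _).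
have L1E c : (\int[mu]_x (h (n%:R - eta) c x)%:E <= L1%:E)%E.
  under eq_integral do rewrite sqdC.
  exact: ball_growth_integral_le.
have L2E x : (\int[vol R n]_c (h (n%:R + eta) c x)%:E <= L2%:E)%E.
  apply: ball_growth_integral_le => //; first exact: vol_growth.
  - by rewrite addr_ge0// ltW.
have L10 : 0 <= L1.
  rewrite -lee_fin (le_trans _ (L1E point))//.
  by apply: integral_ge0 => x _; rewrite lee_fin powR_ge0.
apply: (@le_trans _ _ (\int[vol R n]_c (L1%:E * \int[mu]_y (h (n%:R + eta) c y)%:E))%E).
  apply: ge0_le_integral => //.
  - by move=> c _; apply: integral_ge0 => z _; rewrite lee_fin mulr_ge0// powR_ge0.
  - apply: (@measurable_integral_section _ _ _ _ _ pairs
      (fun cz => (h (n%:R - eta) cz.1 cz.2.1 * h (n%:R + eta) cz.1 cz.2.2)%:E)).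
    apply/measurable_EFinP; apply: measurable_funM; apply: mh => //.
      by apply: (measurableT_comp measurable_fst).
    by apply: (measurableT_comp measurable_snd).
  - apply: measurable_funeM.
    apply: (@measurable_integral_section _ _ _ _ _ mu (fun cy => (h (n%:R + eta) cy.1 cy.2)%:E)).
    by apply/measurable_EFinP; exact: mh.
  move=> c _.
  have mc : measurable_fun setT (fun y : pt R n => (h (n%:R + eta) c y)%:E).
    by apply/measurable_EFinP; apply: mh => //; exact: measurable_cst.
  have mc1 : measurable_fun setT (fun y : pt R n => (h (n%:R - eta) c y)%:E).
    by apply/measurable_EFinP; apply: mh => //; exact: measurable_cst.
  rewrite (@ge0_integral_prod_mul _ _ _ mu (fun x => h (n%:R - eta) c x) (fun x => h (n%:R + eta) c x)).
  - apply: lee_wpmul2r => //.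
    by apply: integral_ge0 => y _; rewrite lee_fin powR_ge0.
  - exact/measurable_EFinP.
  - exact/measurable_EFinP.
  - by move=> x; exact: powR_ge0.
  - by move=> x; exact: powR_ge0.
have mhy : measurable_fun setT (fun cy : pt R n * pt R n => (h (n%:R + eta) cy.1 cy.2)%:E).
  by apply/measurable_EFinP; exact: mh.
rewrite ge0_integralZl//=.
- rewrite (fubini_tonelli (m1 := vol R n) (m2 := mu) (fun cy => (h (n%:R + eta) cy.1 cy.2)%:E))//=.
    rewrite (EFinM L1 L2); apply: lee_wpmul2l; first by rewrite lee_fin.
    apply: (@le_trans _ _ (\int[mu]_x L2%:E)%E).
      apply: ge0_le_integral => //.
      + by move=> x _; apply: integral_ge0 => c _; rewrite lee_fin powR_ge0.
      + apply: (@measurable_integral_section _ _ _ _ _ (vol R n)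
          (fun yc => (h (n%:R + eta) yc.2 yc.1)%:E)).
        by apply/measurable_EFinP; exact: mh.
    rewrite integral_cst//.
    apply: le_trans (lee_wpmul2l _ (probability_le1 mu measurableT)) _; last by rewrite mule1.
    apply: le_trans (L2E point); apply: integral_ge0 => c _; rewrite lee_fin.
    exact: powR_ge0.
  by move=> cy; rewrite lee_fin powR_ge0.
- exact: (measurable_integral_section mu mhy).
- by move=> c _; apply: integral_ge0 => y _; rewrite lee_fin powR_ge0.
Qed.

Definition l2_cst : R := 
  2 * (layer_cst ((n%:R - eta) / 2) (s / 2) *
  (layer_cst ((n%:R + eta) / 2) (n%:R / 2) * 2 ^+ n)).

Let mpow (f g k : pt R n * (pt R n * pt R n) -> pt R n) :
  measurable_fun setT f -> measurable_fun setT g -> measurable_fun setT k ->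
  measurable_fun setT (fun z => (q (f z) (g z) * q (f z) (k z)) ^+ n).
Proof.
move=> mf mg mk; apply: measurable_funX; apply: measurable_funM;
  (apply: measurable_funV_pos => [z|]; [rewrite sqrtr_gt0 ltr_wpDl ?sqd_ge0 ?exprn_gt0//
   |apply: measurable_fun_sqrt; apply: measurable_funD => //; exact: measurable_sqd]).
Qed.

Let mpow0 : measurable_fun setT (fun cz : pt R n * (pt R n * pt R n) =>
  ((q cz.1 cz.2.1 * q cz.1 cz.2.2) ^+ n)%:E).
Proof.
apply/measurable_EFinP; apply: mpow => //.
  by apply: (measurableT_comp measurable_fst).
by apply: (measurableT_comp measurable_snd).
Qed.

Let int_rad_pow :
  (\int[vol R n]_c \int[pairs]_z ((q c z.1 * q c z.2) ^+ n)%:E <=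
   (l2_cst * A * a `^ (s - n%:R))%:E)%E.
Proof.
pose J c : \bar R := (\int[pairs]_z (h (n%:R - eta) c z.1 * h (n%:R + eta) c z.2)%:E)%E.
have mhc p c : measurable_fun setT (fun x : pt R n => h p c x).
  by apply: mh => //; exact: measurable_cst.
have mJ : measurable_fun setT J.
  apply: (@measurable_integral_section _ _ _ _ _ pairs
      (fun cz => (h (n%:R - eta) cz.1 cz.2.1 * h (n%:R + eta) cz.1 cz.2.2)%:E)).
  apply/measurable_EFinP; apply: measurable_funM; apply: mh => //.
    by apply: (measurableT_comp measurable_fst).
  by apply: (measurableT_comp measurable_snd).
have J0 c : (0 <= J c)%E.
  by apply: integral_ge0 => z _; rewrite lee_fin mulr_ge0// powR_ge0.
apply: (@le_trans _ _ (\int[vol R n]_c ((2 * a^-1 ^+ (n + n))%:E * J c))%E).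
  apply: ge0_le_integral => //.
  - move=> c _; apply: integral_ge0 => z _; rewrite lee_fin exprn_ge0// mulr_ge0// ltW//;
    by rewrite rad_gt0// sqd_ge0.
  - exact: (@measurable_integral_section _ _ _ _ _ pairs _ mpow0).
  - exact: measurable_funeM.
  move=> c _.
  have mq : measurable_fun setT (fun z : pt R n * pt R n =>
      h (n%:R - eta) c z.1 * h (n%:R + eta) c z.2).
    by apply: measurable_funM; apply: mh => //; exact: measurable_cst.
  have mq' : measurable_fun setT (fun z : pt R n * pt R n =>
      h (n%:R + eta) c z.1 * h (n%:R - eta) c z.2).
    by apply: measurable_funM; apply: mh => //; exact: measurable_cst.
  apply: (@le_trans _ _ (\int[pairs]_z ((a^-1 ^+ (n + n))%:E *
     ((h (n%:R - eta) c z.1 * h (n%:R + eta) c z.2)%:E +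
      (h (n%:R + eta) c z.1 * h (n%:R - eta) c z.2)%:E)))%E).
    apply: ge0_le_integral => //.
    - move=> z _; rewrite lee_fin exprn_ge0// mulr_ge0// ltW//;
      by rewrite rad_gt0// sqd_ge0.
    - apply: (measurableT_comp (f := fun cz : pt R n * (pt R n * pt R n) =>
        ((q cz.1 cz.2.1 * q cz.1 cz.2.2) ^+ n)%:E) (g := fun z => (c, z)) mpow0).
      exact: pair1_measurable.
    - apply: measurable_funeM; apply: emeasurable_funD; exact/measurable_EFinP.
    - by move=> z _; rewrite -EFinD -EFinM lee_fin rad_mul_le.
  rewrite ge0_integralZl//=; last 3 first.
  - by apply: emeasurable_funD; exact/measurable_EFinP.
  - by move=> z _; rewrite -EFinD lee_fin addr_ge0 ?mulr_ge0 ?powR_ge0.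
  - by rewrite lee_fin exprn_ge0// invr_ge0 ltW.
  rewrite [in leRHS]mulrC EFinM -muleA lee_wpmul2l//.
    by rewrite lee_fin exprn_ge0// invr_ge0 ltW.
  rewrite ge0_integralD//=; last 4 first.
  - by move=> z _; rewrite lee_fin mulr_ge0 ?powR_ge0.
  - exact/measurable_EFinP.
  - by move=> z _; rewrite lee_fin mulr_ge0 ?powR_ge0.
  - exact/measurable_EFinP.
  have h0' p x : 0 <= h p c x by exact: powR_ge0.
  rewrite /J (ge0_integral_prod_mul mu (mhc (n%:R - eta) c) (mhc (n%:R + eta) c))//.
  rewrite (ge0_integral_prod_mul mu (mhc (n%:R + eta) c) (mhc (n%:R - eta) c))//.
  rewrite [X in (_ + X)%E]muleC; set JJ := (_ * _)%E.
  by rewrite -[X in (X + _ <= _)%E]mul1e -[X in (_ + X <= _)%E]mul1e -ge0_muleDl.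
have a00 := ltW a0.
rewrite ge0_integralZl//; last by rewrite lee_fin mulr_ge0 ?exprn_ge0 ?invr_ge0.
apply: le_trans (lee_wpmul2l _ int_rad_half) _.
  by rewrite lee_fin mulr_ge0 ?exprn_ge0 ?invr_ge0.
rewrite -EFinM lee_fin le_eqVlt; apply/orP; left; apply/eqP.
rewrite powRD ?(gt_eqF a0) ?implybT// powRN powR_mulrn// exprD -exprVn /l2_cst.
have : a * a^-1 = 1 by rewrite divff// gt_eqF.
move=> aa; have {}aa : a ^+ n * a^-1 ^+ n = 1 by rewrite -exprMn aa expr1n.
move: (a `^ s) (a ^+ n) (a^-1 ^+ n) aa (2 ^+ n : R) (layer_cst _ _) (layer_cst _ _) => B p m pm t l1 l2.
transitivity (2 * l1 * l2 * t * A * B * m * (p * m)); first by ring.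
by rewrite pm; ring.
Qed.

Let energy0_le x y : (\int[vol R n]_c (energy_density a x y 0 c)%:E <=
  \int[vol R n]_c ((1 + n%:R) * (q c x * q c y) ^+ n)%:E)%E.
Proof.
have key c : `|energy_density a x y 0 c| <= (1 + n%:R) * (q c x * q c y) ^+ n.
  have := energy_density_le a0 0 c x y.
  by rewrite /wave_cst expr0n/= mul0r addr0 expr1n mulr1.
apply: le_integral => //.
- exact: (integrable_energy_density a0 n0 x y 0).
- apply: (integrable_dominated a0 n0 (x := x) (y := y) (K := 1 + n%:R)).
  + have [mx my] := (@measurable_cst _ _ (pt R n) _ setT x, @measurable_cst _ _ (pt R n) _ setT y).
    apply: measurable_funM => //; apply: measurable_funX; apply: measurable_funM;
    (apply: measurable_funV_pos => [c|]; [rewrite sqrtr_gt0 ltr_wpDl ?sqd_ge0 ?exprn_gt0//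
    |apply: measurable_fun_sqrt; apply: measurable_funD => //; exact: measurable_sqd]).
  + by rewrite addr_ge0.
  + move=> c; rewrite ger0_norm//; exact: le_trans (normr_ge0 _) (key c).
- by move=> c _; rewrite lee_fin (le_trans (ler_norm _)).
Qed.

Let Fr b c : R := \int[mu]_x Re (wave a b (sqd c x) ^+ n.+1).
Let Fi b c : R := \int[mu]_x Im (wave a b (sqd c x) ^+ n.+1).

(** The energy is a form of positive type in the two points, so its integral over [pairs] is a sum
    of squares of [mu]-integrals. The squares weighted by $a^2+b^2$ give the field; those containing
    $c_i-x_i$, the spatial gradient, are dropped. *)
Let energy_ge b c : (((a ^+ 2 + b ^+ 2) * (Fr b c ^+ 2 + Fi b c ^+ 2))%:E <=
  \int[pairs]_z (energy_density a z.1 z.2 b c)%:E)%E.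
Proof.
(* Index [ord0] stands for the time derivative and the others for the coordinates; the boolean
   selects real or imaginary part. *)
pose u (k : 'I_n.+1) x : R := if unlift ord0 k is Some i then tnth c i - tnth x i else 1.
pose v (t : bool) (x : pt R n) : R := if t then Re (wave a b (sqd c x) ^+ n.+1)
  else Im (wave a b (sqd c x) ^+ n.+1).
pose f (p : 'I_n.+1 * bool) x : R := u p.1 x * v p.2 x.
pose w (p : 'I_n.+1 * bool) : R := if unlift ord0 p.1 is Some i then 1 else a ^+ 2 + b ^+ 2.
have K1 := wave_cst_ge1 a b; have K0 := le_trans ler01 K1.
pose K := wave_cst a b ^+ n.+1 * (1 + a^-1) ^+ n.+1.
have mf p : measurable_fun setT (f p).
  apply: measurable_funM.
    rewrite /u; case: unliftP => [i _|_]; last exact: measurable_cst.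
    by apply: measurable_funB => //; exact: measurable_tnth.
  have [mr mi] := measurable_wave_pow a0 b n.+1 (fun x => sqd_ge0 c x)
    (measurable_sqd (@measurable_cst _ _ _ _ setT c) (@measurable_id _ (pt R n) setT)).
  by rewrite /v; case: p.2.
have fK p x : `|f p x| <= K.
  have q0 : 0 <= q c x by rewrite ltW// rad_gt0// sqd_ge0.
  have qa : q c x <= a^-1 by rewrite rad_le ?sqd_ge0.
  have uq : `|u p.1 x| * q c x <= 1 + a^-1.
    rewrite /u; case: unliftP => [i _|_].
      by rewrite (le_trans (mul_rad_le1 a0 (sqd_coord_le c x i)))// lerDl invr_ge0 ltW.
    by rewrite normr1 mul1r (le_trans qa)// lerDr.
  have vq : `|v p.2 x| <= wave_cst a b ^+ n.+1 * q c x ^+ n.+1.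
    rewrite -exprMn; apply: (@le_trans _ _ (cmod (wave a b (sqd c x) ^+ n.+1))).
      by rewrite /v; case: p.2; [exact: normRe_le_cmod|exact: normIm_le_cmod].
    by rewrite cmodX lerXn2r ?nnegrE ?cmod_ge0 ?mulr_ge0// cmod_wave_le// sqd_ge0.
  rewrite normrM (le_trans (ler_wpM2l (normr_ge0 _) vq))//.
  rewrite mulrCA ler_wpM2l ?exprn_ge0// exprS mulrA exprS.
  apply: ler_pM; rewrite ?mulr_ge0 ?exprn_ge0//.
  by rewrite lerXn2r ?nnegrE ?(le_trans qa) ?lerDr// addr_ge0 ?invr_ge0 ?ltW.
have -> : (\int[pairs]_z (energy_density a z.1 z.2 b c)%:E =
    \int[pairs]_z (\sum_(p : 'I_n.+1 * bool) w p * (f p z.1 * f p z.2))%R%:E)%E.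
  apply: eq_integral => -[x y] _ /=; congr EFin.
  rewrite -(pair_bigA _ (fun k t => w (k, t) * (f (k, t) x * f (k, t) y)))/=.
  rewrite big_ord_recl big_bool /w /f /u /v /= unlift_none.
  rewrite /energy_density /wave_pair mulrDl.
  case: (wave a b (sqd c x) ^+ _) => xr xi; case: (wave a b (sqd c y) ^+ _) => yr yi.
  rewrite Re_mul /= !mul1r; congr (_ + _); first by ring.
  rewrite /dot mulr_suml; apply: eq_bigr => i _.
  by rewrite big_bool /= liftK; ring.
rewrite (integral_sum_prod_mul _ _ _ mf fK) lee_fin.
rewrite -(pair_bigA _ (fun k t => w (k, t) * (\int[mu]_x f (k, t) x) ^+ 2))/=.
rewrite big_ord_recl big_bool /w /f /u /v /= unlift_none mulrDr.
under [X in _ <= _ * X ^+ 2 + _ + _]eq_Rintegral do rewrite mul1r.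
under [X in _ <= _ + _ * X ^+ 2 + _]eq_Rintegral do rewrite mul1r.
rewrite lerDl; apply: sumr_ge0 => i _; apply: sumr_ge0 => t _.
by rewrite liftK mul1r sqr_ge0.
Qed.

Let integrable_qq : (vol R n \x pairs)%E.-integrable setT
  (fun cz => ((q cz.1 cz.2.1 * q cz.1 cz.2.2) ^+ n)%:E).
Proof.
have q0 c x : 0 <= q c x by rewrite ltW// rad_gt0// sqd_ge0.
apply/integrableP; split; first exact: mpow0.
under eq_integral => cz _ do rewrite gee0_abs ?lee_fin ?exprn_ge0 ?mulr_ge0//.
rewrite (fubini_tonelli1 (m1 := vol R n) (m2 := pairs)
  (fun cz => ((q cz.1 cz.2.1 * q cz.1 cz.2.2) ^+ n)%:E) mpow0).
  exact: le_lt_trans int_rad_pow (ltry _).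
by move=> cz; rewrite lee_fin exprn_ge0// mulr_ge0.
Qed.

(** Conservation holds for each pair of points separately. Fubini therefore moves the [c]-integral
    inside, where time [b] is replaced by time 0; there the density is controlled by powers of
    [rad], whose total integral is $O(a^{s-n})$. *)
Theorem l2_wave_le b :
  (\int[vol R n]_c ((a ^+ 2 + b ^+ 2) * (Fr b c ^+ 2 + Fi b c ^+ 2))%:E <=
   ((1 + n%:R) * l2_cst * A * a `^ (s - n%:R))%:E)%E.
Proof.
have q0 c x : 0 <= q c x by rewrite ltW// rad_gt0// sqd_ge0.
have K1 := wave_cst_ge1 a b; have K0 := le_trans ler01 K1.
have men t : measurable_fun setT (fun cz : pt R n * (pt R n * pt R n) =>
    (energy_density a cz.2.1 cz.2.2 t cz.1)%:E).
  apply/measurable_EFinP; apply: measurable_energy_density => //.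
    by apply: (measurableT_comp measurable_fst).
  by apply: (measurableT_comp measurable_snd).
pose e (cz : pt R n * (pt R n * pt R n)) : \bar R := (energy_density a cz.2.1 cz.2.2 b cz.1)%:E.
have ie : (vol R n \x pairs)%E.-integrable setT e.
  pose L := (wave_cst a b + n%:R) * wave_cst a b ^+ (n.+1 + n.+1).
  have L0 : 0 <= L by apply: mulr_ge0; [exact: addr_ge0|exact: exprn_ge0].
  apply: (@le_integrable _ _ _ _ setT _ _
    (fun cz => L%:E * ((q cz.1 cz.2.1 * q cz.1 cz.2.2) ^+ n)%:E)%E) => //.
  - exact: men.
  - move=> cz _; rewrite -EFinM lee_fin.
    by rewrite (le_trans (energy_density_le a0 _ _ _ _))// ler_norm.
  - by apply: integrableZl => //; exact: integrable_qq.
have [mr mi] := measurable_wave_pow a0 b n.+1 (fun z : pt R n * pt R n => sqd_ge0 z.1 z.2)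
  (measurable_sqd measurable_fst measurable_snd).
have mF : measurable_fun setT (fun c => (a ^+ 2 + b ^+ 2) * (Fr b c ^+ 2 + Fi b c ^+ 2)).
  apply: measurable_funM => //; apply: measurable_funD; apply: measurable_funX.
    apply: (measurableT_comp (f := fine)) => //.
    apply: (@measurable_integral_section _ _ _ _ _ mu
      (fun p => (Re (wave a b (sqd p.1 p.2) ^+ n.+1))%:E)).
    exact/measurable_EFinP.
  apply: (measurableT_comp (f := fine)) => //.
  apply: (@measurable_integral_section _ _ _ _ _ mu
      (fun p => (Im (wave a b (sqd p.1 p.2) ^+ n.+1))%:E)).
    exact/measurable_EFinP.
apply: (@le_trans _ _ (\int[vol R n]_c \int[pairs]_z e (c, z))%E).
  apply: ge0_le_integral => //.
  - by move=> c _; rewrite lee_fin mulr_ge0// addr_ge0// sqr_ge0.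
  - exact/measurable_EFinP.
  - by apply: (measurable_integral_section pairs (men b)).
have -> : (\int[vol R n]_c \int[pairs]_z e (c, z) = \int[pairs]_z \int[vol R n]_c e (c, z))%E.
  exact: (Fubini ie).
have intq : (vol R n \x pairs)%E.-integrable setT (fun cz =>
   ((1 + n%:R) * (q cz.1 cz.2.1 * q cz.1 cz.2.2) ^+ n)%:E).
  by under eq_fun do rewrite EFinM; apply: integrableZl => //; exact: integrable_qq.
apply: (@le_trans _ _ (\int[pairs]_z \int[vol R n]_c
    ((1 + n%:R) * (q c z.1 * q c z.2) ^+ n)%:E)%E).
  apply: le_integral => //.
  - exact: (integrable_integral_section ie).
  - exact: (integrable_integral_section intq).
  by move=> z _; rewrite integral_energy_density//; exact: energy0_le.
rewrite -(Fubini intq)/=.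
under eq_integral => c _.
  under eq_integral do rewrite EFinM.
  rewrite ge0_integralZl//.
  - over.
  - apply: (measurableT_comp (f := fun cz : pt R n * (pt R n * pt R n) =>
      ((q cz.1 cz.2.1 * q cz.1 cz.2.2) ^+ n)%:E) (g := fun z => (c, z)) mpow0).
    exact: pair1_measurable.
  - by move=> z _; rewrite lee_fin exprn_ge0// mulr_ge0.
rewrite ge0_integralZl//.
- rewrite (_ : _ * _ * _ * _ = (1 + n%:R) * (l2_cst * A * a `^ (s - n%:R))); last by rewrite !mulrA.
  rewrite [leRHS]EFinM; apply: lee_wpmul2l; last exact: int_rad_pow.
  by rewrite lee_fin addr_ge0.
- exact: (measurable_integral_section pairs mpow0).
- by move=> c _; apply: integral_ge0 => z _; rewrite lee_fin exprn_ge0// mulr_ge0.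
Qed.

End l2_bound.

(** * The L^(d+1) bound for thin annuli *)

Section kernel.
Context (R : realType).
Local Notation C := (complex R).
Local Notation Re := (@complex.Re R).
Local Notation Im := (@complex.Im R).
Implicit Types (X Y e u t : R) (k M : nat).

Lemma cmod_sqr (x : C) : cmod x ^+ 2 = Re x ^+ 2 + Im x ^+ 2.
Proof. by rewrite sqr_sqrtr// addr_ge0// sqr_ge0. Qed.

Lemma cmodD_le (x y : C) : cmod (x + y) <= cmod x + cmod y.
Proof.
rewrite -(@ler_pXn2r _ 2)// ?nnegrE ?addr_ge0 ?cmod_ge0//.
rewrite sqrrD !cmod_sqr Re_add Im_add.
have := le_trans (ler_norm _) (normRe_le_cmod (x * conjc y)).
rewrite cmodM cmodJ; case: x y => a b [c d]; rewrite Re_mul /=.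
by move=> h; rewrite mulr2n; nra.
Qed.

Lemma cmod_exp_sub_le (x y : C) k : cmod x <= 1 -> cmod y <= 1 ->
  cmod (x ^+ k - y ^+ k) <= k%:R * cmod (x - y).
Proof.
move=> x1 y1; elim: k => [|k IH].
  by rewrite !expr0 subrr /cmod /= expr0n/= addr0 sqrtr0 mul0r.
have -> : x ^+ k.+1 - y ^+ k.+1 = x * (x ^+ k - y ^+ k) + (x - y) * y ^+ k.
  by rewrite !exprS; ring.
apply: le_trans (cmodD_le _ _) _; rewrite !cmodM -natr1 mulrDl mul1r lerD//.
  by rewrite (le_trans _ IH)// ler_piMl// cmod_ge0.
by rewrite ler_piMr ?cmod_ge0// cmodX exprn_ile1// cmod_ge0.
Qed.

Lemma wmod_ge_norm X Y : `|X| <= wmod X Y.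
Proof. by rewrite -sqrtr_sqr ler_wsqrtr// lerDl sqr_ge0. Qed.

Lemma wmod_ge_imag X Y : Y <= wmod X Y.
Proof.
by rewrite (le_trans (ler_norm _))// -sqrtr_sqr ler_wsqrtr// lerDr sqr_ge0.
Qed.

Lemma wmod_dom X Y : 0 < Y -> 0 < wmod X Y + X.
Proof.
move=> Y0; have : `|X| < wmod X Y.
  by rewrite -sqrtr_sqr ltr_sqrt ?ltrDl ?exprn_gt0// ltr_wpDl ?sqr_ge0 ?exprn_gt0.
by have := ler_norm (- X); rewrite normrN; lra.
Qed.

Lemma cmod_wroot_le X Y : 0 < Y -> 
  cmod (wroot X Y) ^+ 2 <= Y^-1 /\ cmod (wroot X Y) ^+ 2 * `|X| <= 1.
Proof.
move=> Y0; have Xw := wmod_ge_norm X Y; have Yw := wmod_ge_imag X Y.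
have w0 : 0 < wmod X Y by exact: lt_le_trans Yw.
rewrite cmod_wroot ?wmod_dom//; split; first by rewrite lef_pV2 ?posrE.
by rewrite mulrC ler_pdivrMr ?mul1r.
Qed.

Lemma cmod_wroot_powR X Y : 0 < Y -> cmod (wroot X Y) = wmod X Y `^ (- 2^-1).
Proof.
move=> Y0; have w0 : 0 < wmod X Y by exact: lt_le_trans (wmod_ge_imag X Y).
rewrite powRN powR12_sqrt ?ltW// -sqrtrV ?ltW//.
rewrite -(cmod_wroot (wmod_dom X Y0)) sqrtr_sqr ger0_norm//; exact: cmod_ge0.
Qed.

(* The [u]-derivative of [u^(M k) w(e + u^(2 M))^k w(e)^2], [w(Y)] being
   [(X - i Y)^(-1/2)]. *)
Definition kern X e k M u : C :=
  Complex ((M * k)%:R * u ^+ (M * k).-1) 0 * wroot X (e + u ^+ (2 * M)) ^+ k.+2.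

(** The value at $u=1$ of the primitive of [kern]; at $u=0$ that primitive vanishes. *)
Definition kern_total X e k : C := wroot X (1 + e) ^+ k * wroot X e ^+ 2.

Let pow_even_ge0 u M : 0 <= u ^+ (2 * M).
Proof. by rewrite exprM exprn_ge0// sqr_ge0. Qed.

Let pos_dom X e M u : 0 < e -> 0 < wmod X (e + u ^+ (2 * M)) + X.
Proof. by move=> e0; apply: wmod_dom; rewrite ltr_wpDr. Qed.

Let is_derive_pow m t : is_derive t (1 : R) (fun u => u ^+ m) (m%:R * t ^+ m.-1).
Proof.
apply: DeriveDef; first exact: exprn_derivable.
by rewrite exp_derive [LHS]mulr1.
Qed.

Let cderiv_real f t a : is_derive t (1 : R) f a ->
  cderiv (fun u => Complex (f u) 0) t (Complex a 0).
Proof. by move=> fa; split => //=; exact: is_derive_cst. Qed.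

Let cderiv_root X e M t : 0 < e -> (0 < M)%N ->
  cderiv (fun u => wroot X (e + u ^+ (2 * M))) t
  (Complex 0 (M%:R * t ^+ (2 * M).-1) * wroot X (e + t ^+ (2 * M)) ^+ 3).
Proof.
move=> e0 M0; have dY := is_derive_funD (is_derive_cst e t (1 : R)) (is_derive_pow (2 * M) t).
apply: (cderiv_eq (cderiv_wroot (is_derive_cst X t (1 : R)) dY (pos_dom X M t e0))).
move: (wroot _ _ ^+ 3) => W.
by rewrite /cst natrM; apply: complex_eqP; rewrite !(Re_mul, Im_mul) /=; field.
Qed.

(** The product rule gives two terms, and $X-i(e+u^{2M})$ plus $iu^{2M}$ is $X-ie$, independent of
    [u]. This cancellation is the reason for pairing the power $u^{M}$ with the depth $u^{2M}$. *)
Let cderiv_prim X e k M t : 0 < e -> (0 < M)%N -> 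
  cderiv (fun u => Complex (u ^+ (M * k.+1)) 0 * wroot X (e + u ^+ (2 * M)) ^+ k.+1) t
    (kern X e k.+1 M t * Complex X (- e)).
Proof.
move=> e0 M0.
have d := cderivM (cderiv_real (is_derive_pow (M * k.+1) t)) (cderivX k (cderiv_root X t e0 M0)).
apply: (cderiv_eq d); rewrite /kern.
have w := wroot_sqr (pos_dom X M t e0).
set W := wroot X _ in w *.
have -> : Complex X (- e) = Complex X (- (e + t ^+ (2 * M))) + Complex 0 (t ^+ (2 * M)).
  by apply: complex_eqP; rewrite /= ?addr0//; ring.
rewrite mulrDr; congr (_ + _).
  by rewrite -[in LHS](mulr1 (W ^+ k.+1)) -w !exprS; ring.
have -> : (2 * M).-1 = (M.-1 + M)%N by lia.
have -> : (M * k.+1).-1 = (M * k + M.-1)%N by lia.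
rewrite mul2n -addnn mulnS natrC natrD natrM !exprD !exprS expr0 -[in LHS](natr1 k).
rewrite mulr1; move: (W ^+ k) (t ^+ (M * k)) (t ^+ M) (t ^+ M.-1) => V p q r.
by apply: complex_eqP; rewrite !(Re_mul, Im_mul) /=; ring.
Qed.

Lemma integral_kern X e k M (z : C) : 0 < e -> (0 < M)%N ->
  (\int[lebesgue_measure]_(u in `[0%R, 1%R]) (Im (z * kern X e k.+1 M u))%:E =
   (Im (z * kern_total X e k.+1))%:E)%E.
Proof.
move=> e0 M0; pose H u : C := Complex (u ^+ (M * k.+1)) 0 *
  wroot X (e + u ^+ (2 * M)) ^+ k.+1.
pose F u : R := Im ((z * wroot X e ^+ 2) * H u).
have cst (w : C) t : cderiv (fun=> w) t 0.
  by split; exact: is_derive_cst.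
have dF t : is_derive t (1 : R) F (Im (z * kern X e k.+1 M t)).
  have [_] := cderivM (cst (z * wroot X e ^+ 2) t) (cderiv_prim X k t e0 M0).
  rewrite mul0r add0r => d; apply: (is_derive_eq d).
  rewrite -[in RHS](mulr1 z) -(wroot_sqr (wmod_dom X e0)); congr (Im _); ring.
have cF : continuous F by move=> t; exact: is_derive_continuous (dF t).
rewrite (continuous_FTC2 (F := F) ltr01)//.
- rewrite -EFinB /F /H !expr1n !expr0n !muln_eq0 (gtn_eqF M0)/= (addrC e 1).
  have -> : (Complex 0 0 : C) = 0 by [].
  rewrite mul0r mulr0 subr0 /kern_total; congr (Im _)%:E.
  by have -> : (Complex 1 0 : C) = 1 by []; rewrite mul1r; ring.
- apply: continuous_subspaceT => t.
  have dp := cderiv_real (is_derive_funM (is_derive_cst ((M * k.+1)%:R : R) t (1 : R))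
    (is_derive_pow (M * k.+1).-1 t)).
  have [_] := cderivM (cst z t) (cderivM dp (cderivX k.+2 (cderiv_root X t e0 M0))).
  exact: is_derive_continuous.
- split=> [t _||]; first exact: (dF t).(ex_derive).
    by apply: cvg_at_right_filter; exact: cF.
  by apply: cvg_at_left_filter; exact: cF.
- by move=> t _; rewrite derive1E; exact: (dF t).(derive_val).
Qed.

(** Conjugate of the factor $w(1+e)^k$ at $X=0$. It removes the phase there, so that for small [X]
    the kernel [kern_total] becomes nearly a positive multiple of $(X-ie)^{-1}$. *)
Definition kern_phase e k : C := conjc (wroot 0 (1 + e) ^+ k).

Lemma cmod_kern_phase e k : 0 < e -> cmod (kern_phase e k) <= 1.
Proof.
move=> e0; have e1 : 0 < 1 + e by rewrite addr_gt0.
rewrite cmodJ cmodX exprn_ile1 ?cmod_ge0//.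
rewrite -(@ler_pXn2r _ 2)// ?nnegrE ?cmod_ge0// expr1n.
by rewrite (le_trans (cmod_wroot_le 0 e1).1)// invf_le1// lerDl ltW.
Qed.

(** For $|X|>1$ the left side is 0 and the modulus of the kernel decays like the error term. For
    $|X|\le1$ the imaginary part is a positive multiple of $e/(X^2+e^2)$, which is at least $1/(2e)$
    when $|X|<e$, plus an error bounded by $2k$. *)
Lemma kern_lower X e k : 0 < e <= 1 ->
  (if `|X| < e then e^-1 else 0) <=
  2 ^+ k.+1 * (Im (kern_phase e k * kern_total X e k) +
    2 * k.+1%:R * 2 `^ ((k%:R + 2) / 2) * (1 + `|X|) `^ (- ((k%:R + 2) / 2))).
Proof.
move=> /andP[e0 e1]; set p := (k%:R + 2) / 2.
have p0 : 0 <= p by rewrite divr_ge0// addr_ge0.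
have Y0 : 0 < 1 + e by rewrite addr_gt0.
have w01 : cmod (wroot 0 (1 + e)) <= 1.
  rewrite -(@ler_pXn2r _ 2)// ?nnegrE ?cmod_ge0// expr1n.
  by rewrite (le_trans (cmod_wroot_le 0 Y0).1)// invf_le1// lerDl ltW.
have w1 : cmod (wroot X (1 + e)) <= 1.
  rewrite -(@ler_pXn2r _ 2)// ?nnegrE ?cmod_ge0// expr1n.
  by rewrite (le_trans (cmod_wroot_le X Y0).1)// invf_le1// lerDl ltW.
have k1 : 1 <= k.+1%:R :> R by rewrite ler1n.
rewrite -ler_pdivrMl ?exprn_gt0//.
set Z := kern_phase e k * kern_total X e k.
have e1w : cmod (wroot X e) ^+ 2 = (wmod X e)^-1 by rewrite cmod_wroot ?wmod_dom.
have [X1|X1] := leP `|X| 1; last first.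
  rewrite ltNge (le_trans e1 (ltW X1)) /= mulr0.
  have Zp : cmod Z <= `|X| `^ (- p).
    rewrite cmodM (le_trans (ler_piMl (cmod_ge0 _) (cmod_kern_phase k e0)))//.
    rewrite /kern_total cmodM !cmodX !cmod_wroot_powR//.
    have X0 : 0 < `|X| by exact: lt_trans X1.
    have -> : - p = (- 2^-1) * k%:R + (- 2^-1) * 2 by rewrite /p; field.
    rewrite powRD ?(gt_eqF X0) ?implybT// !powRrM !powR_mulrn ?powR_ge0//.
    have lew Y : 0 < Y -> wmod X Y `^ (- 2^-1) <= `|X| `^ (- 2^-1).
      move=> Y'0; rewrite !powRN lef_pV2 ?posrE ?powR_gt0//.
        by rewrite ge0_ler_powR ?nnegrE ?wmod_ge_norm// sqrtr_ge0.
      exact: lt_le_trans (wmod_ge_imag X Y).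
    apply: ler_pM; rewrite ?exprn_ge0 ?powR_ge0//.
      by rewrite lerXn2r ?nnegrE ?powR_ge0// lew.
    by rewrite lerXn2r ?nnegrE ?powR_ge0// lew.
  have Xp : `|X| `^ (- p) <= 2 `^ p * (1 + `|X|) `^ (- p).
    have X0 : 0 < `|X| by exact: lt_trans X1.
    have : (1 + `|X|) `^ p <= (2 * `|X|) `^ p.
      rewrite ge0_ler_powR ?nnegrE ?mulr_ge0 ?addr_ge0//; last by lra.
    rewrite powRM// !powRN => h.
    rewrite ler_pdivlMr ?powR_gt0 ?addr_gt0// mulrC ler_pdivrMr ?powR_gt0//.
  have ImZ := le_trans (normIm_le_cmod Z) (le_trans Zp Xp).
  apply: le_trans (_ : 0 <= - `|Im Z| + `|Im Z|) _; first by rewrite addNr.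
  apply: lerD; first by rewrite lerNl; rewrite -normrN; exact: ler_norm.
  apply: (le_trans ImZ); rewrite -mulrA ler_peMl//; last by lra.
have errp : 1 <= 2 `^ p * (1 + `|X|) `^ (- p).
  rewrite powRN ler_pdivlMr ?powR_gt0 ?ltr_wpDr// mul1r.
  by rewrite ge0_ler_powR ?nnegrE ?addr_ge0//; lra.
set w0 := wroot 0 (1 + e) in w01; set W := wroot X (1 + e) in w1.
have W2 : W ^+ 2 * Complex X (- (1 + e)) = 1 by exact: wroot_sqr (wmod_dom _ _).
have w02 : w0 ^+ 2 * Complex 0 (- (1 + e)) = 1 by exact: wroot_sqr (wmod_dom _ _).
have cmod_real (r : R) : cmod (Complex r 0) = `|r|.
  by rewrite /cmod /= expr0n addr0 sqrtr_sqr.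
(* $W-w_0=(W^2-w_0^2)/(W+w_0)$: the squares are inverses of $X-i(1+e)$ and $-i(1+e)$, which differ
   by [X], and $W+w_0$ has real part at least $1/2$. *)
have dWX : cmod (W - w0) <= 2 * `|X|.
  have sqE : (W - w0) * (W + w0) = W ^+ 2 * w0 ^+ 2 * Complex (- X) 0.
    have -> : (W - w0) * (W + w0) = W ^+ 2 * 1 - w0 ^+ 2 * 1 by ring.
    rewrite -{1}w02 -W2 /=.
    have -> : Complex (- X) 0 = Complex 0 (- (1 + e)) - Complex X (- (1 + e)).
      by apply: complex_eqP; rewrite /=; ring.
    ring.
  have sq_le : cmod (W - w0) * cmod (W + w0) <= `|X|.
    rewrite -cmodM sqE cmodM (cmodM (W ^+ 2)) !cmodX cmod_real normrN ler_piMl//.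
    by rewrite mulr_ile1 ?exprn_ge0 ?cmod_ge0// exprn_ile1 ?cmod_ge0.
  have half : 2^-1 <= cmod (W + w0).
    apply: le_trans (le_trans (ler_norm _) (normRe_le_cmod _)).
    have ReW : 0 <= Re W by rewrite /= divr_ge0// sqrtr_ge0.
    have wY : wmod 0 (1 + e) = 1 + e.
      by rewrite /wmod expr0n add0r sqrtr_sqr ger0_norm// ltW.
    rewrite Re_add -[leLHS]add0r lerD//= /wrho wY addr0.
    rewrite ler_pdivlMr//; set y := (1 + e) / 2.
    have y0 : 0 < y by rewrite divr_gt0.
    have y1 : y <= 1 by rewrite /y; lra.
    have -> : 2^-1 * (1 + e) = Num.sqrt (y ^+ 2) by rewrite sqrtr_sqr ger0_norm ?ltW// mulrC.
    by rewrite ler_wsqrtr// expr2 ler_piMr// ltW.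
  have := ler_wpM2l (cmod_ge0 (W - w0)) half; lra.
pose v := w0 ^+ k.
have v0 : 2 ^- k <= cmod v ^+ 2.
  rewrite cmodX exprAC cmod_wroot ?wmod_dom// -exprVn lerXn2r ?nnegrE ?invr_ge0 ?sqrtr_ge0//.
  have -> : wmod 0 (1 + e) = 1 + e.
    by rewrite /wmod expr0n add0r sqrtr_sqr ger0_norm// ltW.
  by rewrite lef_pV2 ?posrE//; lra.
pose D := conjc v * (W ^+ k - v) * wroot X e ^+ 2.
have ZE : Im Z = cmod v ^+ 2 * Im (wroot X e ^+ 2) + Im D.
  rewrite /Z /kern_phase /kern_total -/v -/w0 -/W cmod_sqr /D.
  have -> : conjc v * (W ^+ k * wroot X e ^+ 2) =
      conjc v * v * wroot X e ^+ 2 + conjc v * (W ^+ k - v) * wroot X e ^+ 2 by ring.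
  rewrite Im_add; congr (_ + _); case: (v) => vr vi; rewrite Im_mul !Re_mul !Im_mul /=.
  ring.
have wm0 : 0 < wmod X e by exact: lt_le_trans (wmod_ge_imag X e).
(* The factor $|X|$ gained by the phase correction compensates $|w(e)|^2\le1/|X|$, so the error
   stays bounded as [e] tends to 0. *)
have D2 : `|Im D| <= 2 * k%:R.
  apply: le_trans (normIm_le_cmod _) _; rewrite /D cmodM (cmodM (conjc v)) cmodJ (cmodX (wroot X e)) e1w.
  rewrite ler_pdivrMr//.
  have v1 : cmod v <= 1 by rewrite cmodX exprn_ile1// cmod_ge0.
  apply: le_trans (ler_piMl (cmod_ge0 _) v1) _.
  apply: le_trans (cmod_exp_sub_le k w1 w01) _.
  rewrite (mulrC 2) -mulrA ler_wpM2l//.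
  by rewrite (le_trans dWX)// ler_wpM2l// wmod_ge_norm.
have q0 : 0 < X ^+ 2 + e ^+ 2 by rewrite ltr_wpDl ?sqr_ge0 ?exprn_gt0.
have ImE : Im (wroot X e ^+ 2) = e / (X ^+ 2 + e ^+ 2).
  have qn0 : X ^+ 2 + e ^+ 2 != 0 by rewrite gt_eqF.
  apply: (mulIf qn0); rewrite divfK//.
  have := wroot_sqr (wmod_dom X e0); case: (_ ^+ 2) => pr pi h.
  have h1 := congr1 Re h; have h2 := congr1 Im h.
  move: h1 h2; rewrite Re_mul Im_mul /= => h1 h2.
  have -> : pi * (X ^+ 2 + e ^+ 2) = e * (pr * X - pi * - e) + X * (pr * - e + pi * X) by ring.
  by rewrite h1 h2 mulr1 mulr0 addr0.
have Im0 : 0 <= Im (wroot X e ^+ 2) by rewrite ImE divr_ge0// ltW.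
have errk : 2 * k.+1%:R <= 2 * k.+1%:R * 2 `^ p * (1 + `|X|) `^ (- p).
  by rewrite -mulrA ler_peMr// mulr_ge0.
have DL : - (2 * k%:R) <= Im D by move: D2; rewrite ler_norml => /andP[].
rewrite ZE; case: ifPn => [Xe|_]; last first.
  rewrite mulr0; have : 0 <= cmod v ^+ 2 * Im (wroot X e ^+ 2) by rewrite mulr_ge0// sqr_ge0.
  by move: errk DL; rewrite -natr1; lra.
have : 2 ^- k * (2 * e)^-1 <= cmod v ^+ 2 * Im (wroot X e ^+ 2).
  apply: ler_pM; rewrite ?invr_ge0 ?exprn_ge0 ?mulr_ge0 ?(ltW e0)//.
  rewrite ImE ler_pdivlMr// mulrC ler_pdivrMr ?mulr_gt0//.
  have : X ^+ 2 <= e ^+ 2 by rewrite -(@real_normK _ X) ?num_real// lerXn2r ?nnegrE// ltW.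
  nra.
have -> : 2 ^- k.+1 * e^-1 = 2 ^- k * (2 * e)^-1 by rewrite exprS !invfM; ring.
by move: errk DL; rewrite -natr1; lra.
Qed.

End kernel.

(** * Supremum and square norm of the fields *)

Section lp_bound.
Context (R : realType) (k : nat) (mu : probability (pt R k.+2) R) (A s : R).
Local Notation n := k.+2.
Hypotheses (A0 : 0 <= A) (gmu : ball_growth mu A s) (s1 : n%:R - 1 < s) (sn : s < n%:R).
Local Notation C := (complex R).
Local Notation Re := (@complex.Re R).
Local Notation Im := (@complex.Im R).
Implicit Types (Y e u : R) (c x : pt R n).
Local Notation defect c x := (sqd c x - 1).

Let s0 : 0 <= s.
Proof. by rewrite ltW// (le_lt_trans _ s1)// subr_ge0 ler1n. Qed.

Definition wave_field Y c : C :=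
  Complex (\int[mu]_x Re (wroot (defect c x) Y ^+ n.+1)) (\int[mu]_x Im (wroot (defect c x) Y ^+ n.+1)).

Lemma measurable_wave_field d (S : measurableType d) (f : S -> R) (g : S -> pt R n) :
  (forall t, 0 < f t) -> measurable_fun setT f -> measurable_fun setT g ->
  measurable_fun setT (fun t => Re (wave_field (f t) (g t))) /\
  measurable_fun setT (fun t => Im (wave_field (f t) (g t))).
Proof.
move=> f0 mf mg.
have mX : measurable_fun setT (fun p : S * pt R n => defect (g p.1) p.2).
  apply: measurable_funB => //; apply: measurable_sqd => //.
  by apply: (measurableT_comp mg).
have mY : measurable_fun setT (fun p : S * pt R n => f p.1) by exact: measurableT_comp.
have [mr mi] := measurable_wroot_pow n.+1 (fun p => wmod_dom _ (f0 p.1)) mX mY.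
split; apply: (measurableT_comp (f := fine)) => //.
  apply: (@measurable_integral_section _ _ _ _ _ mu
    (fun p => (Re (wroot (defect (g p.1) p.2) (f p.1) ^+ n.+1))%:E)).
  exact/measurable_EFinP.
apply: (@measurable_integral_section _ _ _ _ _ mu
  (fun p => (Im (wroot (defect (g p.1) p.2) (f p.1) ^+ n.+1))%:E)).
exact/measurable_EFinP.
Qed.

Definition sup_field_cst : R := 2 * (2 `^ ((n%:R + 1) / 2) * sup_kernel_cst R n).

Lemma cmod_wroot_ker Y c x : 0 < Y ->
  cmod (wroot (defect c x) Y) ^+ n.+1 <=
  (2 / Y) `^ ((n%:R + 1) / 2) * (1 + `|sqd x c - 1| / Y) `^ (- ((n%:R + 1) / 2)).
Proof.
move=> Y0; rewrite sqdC.
set Z := sqd x c - 1; set p := (n%:R + 1) / 2.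
have p0 : 0 <= p by rewrite divr_ge0// addr_ge0.
have w2 : Y / 2 * (1 + `|Z| / Y) <= wmod Z Y.
  have := wmod_ge_norm Z Y; have := wmod_ge_imag Z Y.
  have -> : Y / 2 * (1 + `|Z| / Y) = (Y + `|Z|) / 2 by field; rewrite gt_eqF.
  lra.
have w0 : 0 < wmod Z Y by exact: lt_le_trans (wmod_ge_imag Z Y).
have Z0 : 0 < 1 + `|Z| / Y by rewrite ltr_wpDr// divr_ge0// ltW.
rewrite cmod_wroot_powR// -powR_mulrn ?powR_ge0// -powRrM.
have -> : - 2^-1 * n.+1%:R = - p by rewrite /p -[n.+1%:R]natr1; field.
have -> : (2 / Y) `^ p = (Y / 2) `^ (- p).
  by rewrite -[2 / Y]invf_div -(powR_inv1 (divr_ge0 (ltW Y0) _))// -powRrM mulN1r.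
rewrite -powRM ?(ltW Z0) ?divr_ge0 ?(ltW Y0)// !powRN lef_pV2 ?posrE ?powR_gt0 ?mulr_gt0 ?divr_gt0//.
by rewrite ge0_ler_powR ?nnegrE// ?(ltW w0)// mulr_ge0 ?divr_ge0// ltW.
Qed.

Let cmod_ReIm (z : C) : cmod z <= `|Re z| + `|Im z|.
Proof.
rewrite -(@ler_pXn2r _ 2)// ?nnegrE ?cmod_ge0 ?addr_ge0//.
rewrite cmod_sqr -(real_normK (num_real (Re z))) -(real_normK (num_real (Im z))).
rewrite sqrrD mulr2n; have := mulr_ge0 (normr_ge0 (Re z)) (normr_ge0 (Im z)); lra.
Qed.

(** The kernel is at most $(2/Y)^{(n+1)/2}$ times the profile integrated in [sup_kernel_le]. Real
    and imaginary parts are bounded separately, whence the factor 2 in [sup_field_cst]. *)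
Lemma cmod_wave_field_le Y c : 0 < Y <= 2 ->
  cmod (wave_field Y c) <=
  sup_field_cst * A * Y `^ (s - n%:R + 1 - (n%:R + 1) / 2).
Proof.
move=> /andP[Y0 Y2].
have n2 : (1 < n)%N by [].
have sup := sup_kernel_le n2 A0 gmu s1 (ltW sn) c (Y := Y).
rewrite Y0 Y2 in sup; have {}sup := sup isT.
set p := (n%:R + 1) / 2 in sup *.
set B := (2 / Y) `^ p * (sup_kernel_cst R n * (A * Y `^ (s - n%:R + 1))).
have key (f : pt R n -> R) : measurable_fun setT f ->
    (forall x, `|f x| <= cmod (wroot (defect c x) Y) ^+ n.+1) -> `|\int[mu]_x f x| <= B.
  move=> mf fw; have p2 : 0 <= (2 / Y) `^ p by exact: powR_ge0.
  have fk x := le_trans (fw x) (cmod_wroot_ker c x Y0).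
  have p0 : 0 <= p by rewrite divr_ge0// addr_ge0.
  have ker1 x : (1 + `|sqd x c - 1| / Y) `^ (- p) <= 1.
    rewrite powRN invf_le1; last first.
      by rewrite powR_gt0// ltr_wpDr// divr_ge0// ltW.
    by rewrite -[leLHS](powRr0 (1 + `|sqd x c - 1| / Y)) ler_powR// lerDl divr_ge0// ltW.
  have intf : mu.-integrable setT (EFin \o f).
    apply: (@integrable_bounded _ _ _ mu _ ((2 / Y) `^ p)%R) => // x.
    by rewrite (le_trans (fk x))// ler_piMr.
  rewrite -lee_fin EFin_normr_Rintegral//.
  apply: le_trans (le_abse_integral _ _ _) _ => //; first exact/measurable_EFinP.
  have mk : measurable_fun setT (fun x => (1 + `|sqd x c - 1| / Y) `^ (- p)).
    apply: (measurableT_comp (measurable_powR _)).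
    apply: measurable_funD => //; apply: measurable_funM => //.
    apply: measurableT_comp => //; apply: measurable_funB => //.
    by apply: measurable_sqd => //; exact: measurable_cst.
  apply: (@le_trans _ _ (\int[mu]_x (((2 / Y) `^ p)%:E * ((1 + `|sqd x c - 1| / Y) `^ (- p))%:E))%E).
    apply: ge0_le_integral => //.
    - by apply: measurableT_comp => //; exact/measurable_EFinP.
    - by apply: measurable_funeM; exact/measurable_EFinP.
    - by move=> x _; rewrite -EFinM lee_fin; exact: fk.
  rewrite ge0_integralZl//.
  - by rewrite /B EFinM; apply: lee_wpmul2l => //; rewrite lee_fin.
  - exact/measurable_EFinP.
  - by move=> x _; rewrite lee_fin powR_ge0.
have mX : measurable_fun setT (fun x => defect c x).
  by apply: measurable_funB => //; apply: measurable_sqd => //; exact: measurable_cst.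
have [mr mi] := measurable_wroot_pow n.+1 (fun x => wmod_dom (defect c x) Y0) mX
  (@measurable_cst _ _ _ _ setT Y).
apply: le_trans (cmod_ReIm _) _.
apply: (@le_trans _ _ (B + B)).
  apply: lerD; apply: key => // x; rewrite -cmodX.
    exact: normRe_le_cmod.
  exact: normIm_le_cmod.
rewrite le_eqVlt; apply/orP; left; apply/eqP.
rewrite /B /sup_field_cst -/p powRM ?invr_ge0 ?(ltW Y0)//.
rewrite (@powRD _ Y (s - n%:R + 1) (- p)) ?(gt_eqF Y0) ?implybT//.
by rewrite -(powR_inv1 (ltW Y0)) -powRrM mulN1r; ring.
Qed.

Let l2_cst_ge0 : 0 <= l2_cst n s.
Proof.
have lt1 : s / 2 < (n%:R - (n%:R - s) / 2) / 2.
  by move: sn; move: (n%:R : R) => N; lra.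
have lt2 : n%:R / 2 < (n%:R + (n%:R - s) / 2) / 2.
  by move: sn; move: (n%:R : R) => N; lra.
apply: mulr_ge0 => //; apply: mulr_ge0; first exact: layer_cst_ge0.
by apply: mulr_ge0; [exact: layer_cst_ge0|exact: exprn_ge0].
Qed.

Definition l2_field_cst : R := (1 + n%:R) * l2_cst n s * 4 `^ (n%:R - s).

Lemma l2_field_cst_ge0 : 0 <= l2_field_cst.
Proof.
apply: mulr_ge0; last exact: powR_ge0.
by apply: mulr_ge0 => //; exact: addr_ge0.
Qed.

Lemma sup_field_cst_ge0 : 0 <= sup_field_cst.
Proof.
apply: mulr_ge0 => //; apply: mulr_ge0; [exact: powR_ge0|exact: sup_kernel_cst_ge0].
Qed.

Lemma l2_wave_field_le Y : 0 < Y <= 2 ->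
  (\int[vol R n]_c (cmod (wave_field Y c) ^+ 2)%:E <=
   (l2_field_cst * A * Y `^ (s - n%:R))%:E)%E.
Proof.
move=> /andP[Y0 Y2]; set r := Num.sqrt (1 + Y ^+ 2).
have r0 : 0 <= r by exact: sqrtr_ge0.
have r1 : 1 <= r by rewrite -[leLHS]sqrtr1 ler_wsqrtr// lerDl sqr_ge0.
have r2 : r ^+ 2 = 1 + Y ^+ 2 by rewrite sqr_sqrtr// addr_ge0 ?sqr_ge0.
have r3 : r <= 3 by rewrite -(@ler_pXn2r _ 2)// ?nnegrE// r2; nra.
have r1' : 1 < r by rewrite -(@ltr_pXn2r _ 2)// ?nnegrE// r2 expr1n ltrDl exprn_gt0.
(* Chosen so that $b^2-a^2=1$ and $2ab=Y$, whence $S+(a-ib)^2=S-1-iY$. Then $a^2+b^2=r\ge1$, and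
   $a\ge Y/4$ converts $a^{s-n}$ into $Y^{s-n}$. *)
pose a := Num.sqrt ((r - 1) / 2); pose b := Num.sqrt ((r + 1) / 2).
have a2 : a ^+ 2 = (r - 1) / 2 by rewrite sqr_sqrtr//; lra.
have b2 : b ^+ 2 = (r + 1) / 2 by rewrite sqr_sqrtr//; lra.
have a0 : 0 < a by rewrite sqrtr_gt0; lra.
have b0 : 0 < b by rewrite sqrtr_gt0; lra.
have ab : 2 * a * b = Y.
  have : (2 * a * b) ^+ 2 = Y ^+ 2 by rewrite !exprMn a2 b2; nra.
  move/eqP; rewrite eqrXn2 ?mulr_ge0 ?(ltW a0) ?(ltW b0) ?(ltW Y0)//; move/eqP; apply.
have waveE S : wave a b S = wroot (S - 1) Y.
  by rewrite /wave ab a2 b2; congr (wroot _ _); field.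
have aY : Y / 4 <= a.
  rewrite -(@ler_pXn2r _ 2)// ?nnegrE ?(ltW a0) ?divr_ge0 ?(ltW Y0)// a2.
  have : Y ^+ 2 = (r - 1) * (r + 1) by rewrite -subr_sqr expr1n r2; ring.
  by rewrite exprMn => ->; nra.
have E c : (a ^+ 2 + b ^+ 2) *
    ((\int[mu]_x Re (wave a b (sqd c x) ^+ n.+1)) ^+ 2 +
     (\int[mu]_x Im (wave a b (sqd c x) ^+ n.+1)) ^+ 2) =
    (a ^+ 2 + b ^+ 2) * cmod (wave_field Y c) ^+ 2.
  have -> : \int[mu]_x Re (wave a b (sqd c x) ^+ n.+1) = Re (wave_field Y c).
    by apply: eq_Rintegral => x _; rewrite waveE.
  have -> : \int[mu]_x Im (wave a b (sqd c x) ^+ n.+1) = Im (wave_field Y c).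
    by apply: eq_Rintegral => x _; rewrite waveE.
  by rewrite cmod_sqr.
have := l2_wave_le a0 (isT : (0 < n)%N) A0 gmu s0 sn b.
rewrite (eq_integral _ _ (fun c _ => congr1 EFin (E c))) => L2.
have mc : measurable_fun setT (fun c => cmod (wave_field Y c) ^+ 2).
  have [mr mi] := measurable_wave_field (fun _ : pt R n => Y0)
    (@measurable_cst _ _ (pt R n) _ setT Y) (@measurable_id _ (pt R n) setT).
  under eq_fun do rewrite cmod_sqr.
  by apply: measurable_funD; exact: measurable_funX.
apply: (@le_trans _ _ (\int[vol R n]_c ((a ^+ 2 + b ^+ 2) * cmod (wave_field Y c) ^+ 2)%:E)%E).
  apply: ge0_le_integral => //.
  - by move=> c _; rewrite lee_fin sqr_ge0.
  - exact/measurable_EFinP.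
  - by apply/measurable_EFinP; exact: measurable_funM.
  - by move=> c _; rewrite lee_fin ler_peMl ?sqr_ge0// a2 b2; lra.
apply: (le_trans L2).
rewrite lee_fin /l2_field_cst.
have C0 : 0 <= (1 + n%:R) * l2_cst n s * A.
  by apply: mulr_ge0 => //; apply: mulr_ge0 => //; apply: addr_ge0.
have -> : (1 + n%:R) * l2_cst n s * 4 `^ (n%:R - s) * A * Y `^ (s - n%:R) =
    (1 + n%:R) * l2_cst n s * A * (4 `^ (n%:R - s) * Y `^ (s - n%:R)) by ring.
rewrite ler_wpM2l//.
have -> : s - n%:R = - (n%:R - s) by rewrite opprB.
have ns : 0 <= n%:R - s by rewrite subr_ge0 ltW.
have -> : 4 `^ (n%:R - s) * Y `^ (- (n%:R - s)) = (Y / 4) `^ (- (n%:R - s)).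
  by rewrite !powRN powRM ?(ltW Y0)// invfM -[4^-1]powR_inv1// -powRrM mulN1r powRN invrK mulrC.
rewrite !powRN lef_pV2 ?posrE ?powR_gt0 ?divr_gt0//.
by rewrite ge0_ler_powR ?nnegrE ?(ltW a0)// divr_ge0// ltW.
Qed.

End lp_bound.

(** * Jensen's inequality and the averaging weight *)

Section jensen.
Context d (T : measurableType d) (R : realType) (P : probability T R).

Lemma expr_tangent_le (x m : R) N : 0 <= x -> 0 <= m ->
  m ^+ N.+1 + N.+1%:R * m ^+ N * (x - m) <= x ^+ N.+1.
Proof.
move=> x0 m0; elim: N => [|N IH]; first by rewrite !expr1 expr0; lra.
rewrite exprS [leRHS]exprS; apply: le_trans (ler_wpM2l x0 IH).
rewrite -subr_ge0.
have -> : x * (m ^+ N.+1 + N.+1%:R * m ^+ N * (x - m)) -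
    (m * m ^+ N.+1 + N.+2%:R * m ^+ N.+1 * (x - m)) =
    N.+1%:R * m ^+ N * (x - m) ^+ 2.
  by rewrite -(natr1 N.+1) exprS; ring.
by rewrite mulr_ge0 ?sqr_ge0// mulr_ge0// exprn_ge0.
Qed.

(** Integrate the tangent-line inequality at the mean [m]; its linear term has integral 0. *)
Lemma jensen_expr (f : T -> R) (K : R) N : measurable_fun setT f ->
  (forall x, 0 <= f x <= K) ->
  (\int[P]_x f x) ^+ N.+1 <= \int[P]_x (f x ^+ N.+1).
Proof.
move=> mf fK; have f0 x : 0 <= f x by case/andP: (fK x).
have intX j : P.-integrable setT (EFin \o (fun x => f x ^+ j)).
  apply: (@integrable_bounded _ _ _ P _ (K ^+ j)); first exact: measurable_funX.
  move=> x; have /andP[_ fx] := fK x.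
  by rewrite ger0_norm ?exprn_ge0// lerXn2r ?nnegrE// (le_trans (f0 x)).
have intf : P.-integrable setT (EFin \o f) by have := intX 1; under eq_fun do rewrite expr1.
set m := \int[P]_x f x; have m0 : 0 <= m by apply: Rintegral_ge0 => x _.
have cst1 (r : R) : P.-integrable setT (EFin \o cst r) by exact: finite_measure_integrable_cst.
have icst (r : R) : \int[P]_x r = r.
  rewrite Rintegral_cst//; transitivity (r * fine (P setT)) => //.
  by rewrite probability_setT mulr1.
have iB : P.-integrable setT (EFin \o (fun x => f x - m)).
  exact: (integrableB measurableT intf (cst1 m)).
have iZ : P.-integrable setT (EFin \o (fun x => N.+1%:R * m ^+ N * (f x - m))).
  exact: (integrableZl measurableT (N.+1%:R * m ^+ N) iB).
have iD : P.-integrable setT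
    (EFin \o (fun x => m ^+ N.+1 + N.+1%:R * m ^+ N * (f x - m))).
  exact: (integrableD measurableT (cst1 _) iZ).
have -> : m ^+ N.+1 = \int[P]_x (m ^+ N.+1 + N.+1%:R * m ^+ N * (f x - m)).
  rewrite RintegralD; [|by []|exact: cst1|exact: iZ].
  rewrite RintegralZl; [|by []|exact: iB].
  rewrite RintegralB; [|by []|exact: intf|exact: cst1].
  by rewrite !icst subrr mulr0 addr0.
apply: le_Rintegral => //.
by move=> x _; exact: expr_tangent_le.
Qed.

End jensen.

Lemma exprD_le (R : realDomainType) (x y : R) N : 0 <= x -> 0 <= y ->
  (x + y) ^+ N <= 2 ^+ N * (x ^+ N + y ^+ N).
Proof.
move=> x0 y0; wlog xy : x y x0 y0 / x <= y.
  move=> H; have [xy|yx] := leP x y; first exact: H.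
  by rewrite addrC (addrC (x ^+ N)) H// ltW.
apply: (@le_trans _ _ ((2 * y) ^+ N)).
  by rewrite lerXn2r ?nnegrE ?addr_ge0 ?mulr_ge0//; lra.
by rewrite exprMn ler_wpM2l ?exprn_ge0// lerDr exprn_ge0.
Qed.

Section unit_interval.
Context (R : realType).

(** The uniform probability is a measure on all of R. Clamping keeps depth and weight bounded
    everywhere while leaving $[0,1]$, which carries the mass, untouched. *)
Definition clamp (u : R) : R := Num.max 0 (Num.min u 1).

Lemma clamp_itv u : 0 <= clamp u <= 1.
Proof. by rewrite /clamp le_max lexx/= ge_max ler01/= ge_min lexx orbT. Qed.

Lemma clamp_id u : 0 <= u <= 1 -> clamp u = u.
Proof. by move=> /andP[u0 u1]; rewrite /clamp min_l// max_r. Qed.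

Lemma measurable_clamp : measurable_fun setT clamp.
Proof. by apply: measurable_maxr => //; exact: measurable_minr. Qed.

Lemma integral_uniform01 (f : R -> R) : measurable_fun setT f ->
  (\int[uniform_prob (@ltr01 R)]_u (f u)%:E =
   \int[lebesgue_measure]_(u in `[0%R, 1%R]) (f u)%:E)%E.
Proof.
move=> mf; have mf' : measurable_fun setT (EFin \o f) by exact/measurable_EFinP.
rewrite integralE [RHS]integralE.
rewrite !integral_uniform//; [|exact: measurable_funeneg|exact: measurable_funepos].
by rewrite subr0 invr1 !mul1e.
Qed.

(** Dropping [e] from the base leaves $v^{N-2Mb}$, at most 1 as soon as $2Mb\le N$. The bound is
    thus uniform in [e]. *)
Lemma weight_le (v e b : R) M N : 0 <= v <= 1 -> 0 < e -> 0 <= b -> (0 < N)%N ->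
  b * (2 * M)%:R <= N%:R -> v ^+ N * (e + v ^+ (2 * M)) `^ (- b) <= 1.
Proof.
move=> /andP[v0 v1] e0 b0 N0 bN.
have [->|vn0] := eqVneq v 0; first by rewrite expr0n gtn_eqF// mul0r.
have vp : 0 < v by rewrite lt_neqAle eq_sym vn0.
rewrite powRN ler_pdivrMr; last by rewrite powR_gt0// ltr_wpDr// exprn_ge0.
rewrite mul1r; apply: (@le_trans _ _ ((v ^+ (2 * M)) `^ b)).
  rewrite -!powR_mulrn// -powRrM.
  by apply: ger_powR; [rewrite vp|rewrite mulrC].
by rewrite ge0_ler_powR ?nnegrE ?exprn_ge0// ?addr_ge0 ?exprn_ge0 ?(ltW e0)// lerDr ltW.
Qed.

End unit_interval.

(** * The L^(d+1) norm of annulus masses *)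

Section energy.
Context (R : realType) (k M : nat) (mu : probability (pt R k.+2) R) (A s e : R).
Local Notation n := k.+2.
Hypotheses (A0 : 0 <= A) (gmu : ball_growth mu A s) (s1 : n%:R - 1 < s) (sn : s < n%:R).
Hypotheses (e01 : 0 < e <= 1) (M0 : (0 < M)%N).
Local Notation C := (complex R).
Local Notation Re := (@complex.Re R).
Local Notation Im := (@complex.Im R).
Implicit Types (Y u : R) (c x : pt R n).
Local Notation defect c x := (sqd c x - 1).
Local Notation U := (uniform_prob (@ltr01 R)).
Local Notation p := ((n%:R + 1) / 2 : R).

Let e0 : 0 < e. Proof. by case/andP: e01. Qed.

Definition depth u : R := e + clamp u ^+ (2 * M).

Lemma depth_itv u : 0 < depth u <= 2.
Proof.
have /andP[v0 v1] := clamp_itv u; have /andP[_ e1] := e01.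
rewrite ltr_wpDr ?exprn_ge0//=.
have := exprn_ile1 (2 * M) v0 v1; rewrite /depth; lra.
Qed.

Lemma measurable_depth : measurable_fun setT depth.
Proof. by apply: measurable_funD => //; apply: measurable_funX; exact: measurable_clamp. Qed.

Definition weight u : R := (M * k.+1)%:R * clamp u ^+ (M * k.+1).-1.

Lemma weight_itv u : 0 <= weight u <= (M * k.+1)%:R.
Proof.
have /andP[v0 v1] := clamp_itv u.
by rewrite /weight mulr_ge0 ?exprn_ge0//= ler_piMr// exprn_ile1.
Qed.

Lemma measurable_weight : measurable_fun setT weight.
Proof. by apply: measurable_funM => //; apply: measurable_funX; exact: measurable_clamp. Qed.

Let kernE c x u : kern (defect c x) e k.+1 M (clamp u) =
  Complex (weight u) 0 * wroot (defect c x) (depth u) ^+ n.+1.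
Proof. by []. Qed.

Let Er c : R := \int[mu]_x (1 + `|defect c x|) `^ (- p).
Let G c : R := \int[U]_u (weight u * cmod (wave_field mu (depth u) c)).

Let mdefect c : measurable_fun setT (fun x => defect c x).
Proof. by apply: measurable_funB => //; apply: measurable_sqd => //; exact: measurable_cst. Qed.

Let root_bound c x u : cmod (wroot (defect c x) (depth u)) <= e^-1.
Proof.
have /andP[d0 _] := depth_itv u; have /andP[_ e1] := e01.
rewrite -(@ler_pXn2r _ 2)// ?nnegrE ?cmod_ge0 ?invr_ge0 ?(ltW e0)//.
apply: le_trans (cmod_wroot_le _ d0).1 _.
apply: (@le_trans _ _ e^-1).
  by rewrite lef_pV2 ?posrE// lerDl exprn_ge0//; case/andP: (clamp_itv u).
by rewrite expr2 ler_peMl ?invr_ge0 ?(ltW e0)// invf_ge1.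
Qed.

Let kern_bound (z : C) c x u : cmod z <= 1 ->
  `|Im (z * kern (defect c x) e k.+1 M (clamp u))| <= (M * k.+1)%:R * e^-1 ^+ n.+1.
Proof.
move=> z1; have /andP[d0 _] := depth_itv u; have /andP[m0 m1] := weight_itv u.
apply: le_trans (normIm_le_cmod _) _; rewrite cmodM.
apply: le_trans (ler_piMl (cmod_ge0 _) z1) _; rewrite kernE cmodM cmodX.
have -> : cmod (Complex (weight u) 0) = weight u.
  by rewrite /cmod /= expr0n addr0 sqrtr_sqr ger0_norm.
apply: ler_pM; rewrite ?exprn_ge0 ?cmod_ge0//.
by rewrite lerXn2r ?nnegrE ?cmod_ge0 ?invr_ge0 ?(ltW e0).
Qed.

(** This bound may depend on [e]: it is used only for integrability in [u]. *)
Let field_bound c : exists K, forall u, cmod (wave_field mu (depth u) c) <= K.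
Proof.
set q := s - n%:R + 1 - p; exists (sup_field_cst R k * A * (2 `^ q + e `^ q)) => u.
have /andP[d0 d2] := depth_itv u.
apply: le_trans (cmod_wave_field_le A0 gmu s1 sn c (depth_itv u)) _; rewrite -/q.
apply: ler_wpM2l.
  by apply: mulr_ge0 => //; exact: sup_field_cst_ge0.
have [q0|q0] := leP 0 q.
  apply: (@le_trans _ _ (2 `^ q)); last by rewrite lerDl powR_ge0.
  by rewrite ge0_ler_powR ?nnegrE// ltW.
apply: (@le_trans _ _ (e `^ q)); last by rewrite lerDr powR_ge0.
rewrite -[q]opprK !(powRN _ (- q)) lef_pV2 ?posrE ?powR_gt0//.
rewrite ge0_ler_powR ?nnegrE ?oppr_ge0 ?(ltW q0) ?(ltW e0) ?(ltW d0)//.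
by rewrite lerDl exprn_ge0//; case/andP: (clamp_itv u).
Qed.

Let mfield c : measurable_fun setT (fun u => Re (wave_field mu (depth u) c)) /\
  measurable_fun setT (fun u => Im (wave_field mu (depth u) c)).
Proof.
apply: measurable_wave_field.
- by move=> u; case/andP: (depth_itv u).
- exact: measurable_depth.
- exact: measurable_cst.
Qed.

Let mcmod d (T : measurableType d) (f : T -> C) :
  measurable_fun setT (fun t => Re (f t)) -> measurable_fun setT (fun t => Im (f t)) ->
  measurable_fun setT (fun t => cmod (f t)).
Proof.
move=> mr mi; apply: measurable_fun_sqrt.
by apply: measurable_funD; exact: measurable_funX.
Qed.

Let mroot c : measurable_fun setT (fun q : pt R n * R =>
    Re (wroot (defect c q.1) (depth q.2) ^+ n.+1)) /\
  measurable_fun setT (fun q : pt R n * R =>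
    Im (wroot (defect c q.1) (depth q.2) ^+ n.+1)).
Proof.
apply: measurable_wroot_pow.
- by move=> q; apply: wmod_dom; case/andP: (depth_itv q.2).
- by apply: (measurableT_comp (mdefect c)).
- by apply: (measurableT_comp measurable_depth).
Qed.

(** Fubini in [(x, u)]: for fixed [x] the integral over [u] collapses to [kern_total], and for fixed
    [u] the integral over [x] is the field at depth [depth u]. Only the modulus of the field is
    kept. *)
Let integral_total (z : C) c : cmod z <= 1 ->
  \int[mu]_x Im (z * kern_total (defect c x) e k.+1) <= G c.
Proof.
move=> z1; pose W (q : pt R n * R) := wroot (defect c q.1) (depth q.2) ^+ n.+1.
pose f (q : pt R n * R) : R := weight q.2 * (Re z * Im (W q) + Im z * Re (W q)).
have fE x u : Im (z * kern (defect c x) e k.+1 M (clamp u)) = f (x, u).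
  by rewrite kernE /f !(Re_mul, Im_mul) /=; ring.
have [mr mi] := mroot c.
have mf : measurable_fun setT f.
  apply: measurable_funM; first by apply: (measurableT_comp measurable_weight).
  by apply: measurable_funD; exact: measurable_funM.
have intf : (mu \x U)%E.-integrable setT (EFin \o f).
  apply: (@integrable_bounded _ _ _ (mu \x U)%E _ ((M * k.+1)%:R * e^-1 ^+ n.+1)) => //.
  by move=> [x u]; rewrite -fE; exact: kern_bound.
have mfx x : measurable_fun setT (fun u => f (x, u)).
  by apply: (measurableT_comp mf); exact: pair1_measurable.
have mfu u : measurable_fun setT (fun x => f (x, u)).
  by apply: (measurableT_comp mf); exact: pair2_measurable.
have totE x : (\int[U]_u (f (x, u))%:E)%E = (Im (z * kern_total (defect c x) e k.+1))%:E.
  rewrite integral_uniform01// -(integral_kern (defect c x) k z e0 M0).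
  apply: eq_integral => u; rewrite inE/= in_itv/= => u01.
  by rewrite -fE clamp_id.
have [K fieldK] := field_bound c.
pose j u : R := weight u * Im (z * wave_field mu (depth u) c).
have jE u : (\int[mu]_x (f (x, u))%:E)%E = (j u)%:E.
  have bw x : cmod (W (x, u)) <= e^-1 ^+ n.+1.
    by rewrite cmodX lerXn2r ?nnegrE ?cmod_ge0 ?invr_ge0 ?(ltW e0).
  have iR : mu.-integrable setT (EFin \o (fun x => Re (W (x, u)))).
    apply: (@integrable_bounded _ _ _ mu _ (e^-1 ^+ n.+1)) => [|x].
      by apply: (measurableT_comp mr); exact: pair2_measurable.
    exact: le_trans (normRe_le_cmod _) (bw x).
  have iI : mu.-integrable setT (EFin \o (fun x => Im (W (x, u)))).
    apply: (@integrable_bounded _ _ _ mu _ (e^-1 ^+ n.+1)) => [|x].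
      by apply: (measurableT_comp mi); exact: pair2_measurable.
    exact: le_trans (normIm_le_cmod _) (bw x).
  have iZI : mu.-integrable setT (EFin \o (fun x => Re z * Im (W (x, u)))).
    exact: (integrableZl measurableT (Re z) iI).
  have iZR : mu.-integrable setT (EFin \o (fun x => Im z * Re (W (x, u)))).
    exact: (integrableZl measurableT (Im z) iR).
  have iD := integrableD measurableT iZI iZR.
  have -> : j u = \int[mu]_x f (x, u).
    transitivity (weight u * \int[mu]_x (Re z * Im (W (x, u)) + Im z * Re (W (x, u)))).
      rewrite /j Im_mul; congr (_ * _).
      rewrite RintegralD; [|by []|exact: iZI|exact: iZR].
      by rewrite RintegralZl; [rewrite RintegralZl; [|by []|exact: iR]|by []|exact: iI].
    by rewrite -RintegralZl; [|by []|exact: iD].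
  rewrite fineK//; apply: integrable_fin_num => //.
  exact: (integrableZl measurableT (weight u) iD).
have -> : \int[mu]_x Im (z * kern_total (defect c x) e k.+1) = \int[U]_u j u.
  congr fine.
  under eq_integral do rewrite -totE.
  rewrite [LHS](Fubini intf).
  by apply: eq_integral => u _; exact: jE.
have wb u : `|weight u * cmod (wave_field mu (depth u) c)| <= (M * k.+1)%:R * K.
  have /andP[m0 m1] := weight_itv u.
  rewrite ger0_norm; last by rewrite mulr_ge0 ?cmod_ge0.
  by apply: ler_pM => //; exact: cmod_ge0.
have jw u : `|j u| <= weight u * cmod (wave_field mu (depth u) c).
  have /andP[m0 m1] := weight_itv u.
  rewrite normrM ger0_norm// ler_wpM2l//.
  apply: le_trans (normIm_le_cmod _) _; rewrite cmodM ler_piMl//; exact: cmod_ge0.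
have [wr wi] := mfield c.
apply: le_Rintegral => //.
- apply: (@integrable_bounded _ _ _ U _ ((M * k.+1)%:R * K)) => [|u].
    apply: measurable_funM; first exact: measurable_weight.
    under eq_fun do rewrite Im_mul.
    by apply: measurable_funD; exact: measurable_funM.
  by rewrite (le_trans (jw u))// (le_trans (ler_norm _)).
- apply: (@integrable_bounded _ _ _ U _ ((M * k.+1)%:R * K)) => //.
  by apply: measurable_funM; [exact: measurable_weight|exact: mcmod].
- by move=> u _; exact: le_trans (ler_norm _) (jw u).
Qed.

Let err_cst : R := 2 * n%:R * 2 `^ p.

Let msection c : measurable [set x | `|sqd x c - 1| < e].
Proof. exact: measurable_sqd_near. Qed.

Let merr c : measurable_fun setT (fun x => (1 + `|defect c x|) `^ (- p)).
Proof.
apply: (measurableT_comp (measurable_powR _)); apply: measurable_funD => //.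
by apply: measurableT_comp.
Qed.

Let err_itv c x : 0 <= (1 + `|defect c x|) `^ (- p) <= 1.
Proof.
rewrite powR_ge0/= powRN invf_le1 ?powR_gt0 ?ltr_wpDr//.
by rewrite -[leLHS](powRr0 (1 + `|defect c x|)) ler_powR ?lerDl// divr_ge0// addr_ge0.
Qed.

Let interr c : mu.-integrable setT (EFin \o (fun x => (1 + `|defect c x|) `^ (- p))).
Proof.
apply: (@integrable_bounded _ _ _ mu _ 1) => // x.
by have /andP[a0 a1] := err_itv c x; rewrite ger0_norm.
Qed.

Let inttotal (z : C) c :
  mu.-integrable setT (EFin \o (fun x => Im (z * kern_total (defect c x) e k.+1))).
Proof.
have e1 : 0 < 1 + e by rewrite addr_gt0.
have [r1 i1] := measurable_wroot_pow k.+1 (fun x => wmod_dom (defect c x) e1)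
  (mdefect c) (@measurable_cst _ _ _ _ setT (1 + e)).
have [r2 i2] := measurable_wroot_pow 2 (fun x => wmod_dom (defect c x) e0)
  (mdefect c) (@measurable_cst _ _ _ _ setT e).
apply: (@integrable_bounded _ _ _ mu _ (cmod z * e^-1)) => [|x].
  under eq_fun do rewrite /kern_total !(Re_mul, Im_mul).
  apply: measurable_funD; apply: measurable_funM => //.
    by apply: measurable_funD; exact: measurable_funM.
  by apply: measurable_funB; exact: measurable_funM.
apply: le_trans (normIm_le_cmod _) _; rewrite cmodM ler_wpM2l ?cmod_ge0//.
rewrite /kern_total cmodM (cmodX (wroot _ e)) cmodX.
apply: le_trans (cmod_wroot_le (defect c x) e0).1.
rewrite ler_piMl ?exprn_ge0 ?cmod_ge0// exprn_ile1 ?cmod_ge0//.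
rewrite -(@ler_pXn2r _ 2)// ?nnegrE ?cmod_ge0// expr1n.
by rewrite (le_trans (cmod_wroot_le _ e1).1)// invf_le1// lerDl ltW.
Qed.

(** [kern_lower] can be integrated against [mu] because its phase does not depend on [x]. *)
Let annulus_le c : fine (mu [set x | `|sqd x c - 1| < e]) / e <=
  2 ^+ n * (G c + err_cst * Er c).
Proof.
set S := [set x | _]; set z := kern_phase e k.+1.
have z1 : cmod z <= 1 by exact: cmod_kern_phase.
have -> : fine (mu S) / e = \int[mu]_x (e^-1 * \1_S x).
  rewrite RintegralZl//; last by apply: integrable_indic => //; exact: msection.
  have -> : \int[mu]_x \1_S x = fine (mu S); last by rewrite mulrC.
  rewrite -[in RHS](setIT S); congr fine.
  exact: integral_indic (msection c).
have iZ : mu.-integrable setT (EFin \o (fun x => err_cst * (1 + `|defect c x|) `^ (- p))).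
  exact: (integrableZl measurableT err_cst (interr c)).
have iD := integrableD measurableT (inttotal z c) iZ.
apply: (@le_trans _ _ (\int[mu]_x (2 ^+ n * (Im (z * kern_total (defect c x) e k.+1) +
    err_cst * (1 + `|defect c x|) `^ (- p))))).
  apply: le_Rintegral => //.
  - apply: (@integrable_bounded _ _ _ mu _ e^-1) => [|x].
      by apply: measurable_funM => //; exact: measurable_indic (msection c).
    rewrite indicE; case: (x \in S); rewrite ?mulr1 ?mulr0 ?normr0 ?invr_ge0 ?(ltW e0)//.
    by rewrite ger0_norm// invr_ge0 ltW.
  - exact: (integrableZl measurableT (2 ^+ n : R) iD).
  move=> x _; have := kern_lower (defect c x) k.+1 e01.
  have -> : k.+1%:R + 2 = n%:R + 1 :> R by rewrite -(natr1 k.+1); ring.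
  apply: le_trans; rewrite indicE /S.
  case: ifPn => [Xe|]; first by rewrite mem_set ?mulr1//= sqdC.
  by move=> /negP Xe; rewrite memNset ?mulr0//= sqdC.
rewrite RintegralZl; [|by []|exact: iD].
rewrite RintegralD; [|by []|exact: inttotal|exact: iZ].
rewrite RintegralZl; [|by []|exact: interr].
by rewrite ler_wpM2l ?exprn_ge0// lerD2r integral_total.
Qed.

Let err_sup c : Er c <= sup_kernel_cst R n * A.
Proof.
have n2 : (1 < n)%N by [].
have := sup_kernel_le n2 A0 gmu s1 (ltW sn) c (Y := 1).
rewrite ltr01 ler1n => /(_ isT); rewrite powR1 mulr1 => H.
rewrite -lee_fin fineK; last by apply: integrable_fin_num => //; exact: interr.
apply: le_trans H; apply: ge0_le_integral => //.
- exact/measurable_EFinP.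
- apply/measurable_EFinP; under eq_fun do rewrite divr1 sqdC; exact: merr.
- by move=> x _; rewrite divr1 sqdC.
Qed.

Let err_int_cst : R := 2 `^ p * (layer_cst ((n%:R + 1) / 2) (n%:R / 2) * 2 ^+ n).

Let merr_comp d (T : measurableType d) (f g : T -> pt R n) :
  measurable_fun setT f -> measurable_fun setT g ->
  measurable_fun setT (fun t => ((1 + `|defect (f t) (g t)|) `^ (- p))%:E).
Proof.
move=> mf mg; apply/measurable_EFinP; apply: (measurableT_comp (measurable_powR _)).
apply: measurable_funD => //; apply: measurableT_comp => //.
by apply: measurable_funB => //; exact: measurable_sqd.
Qed.

Let merr2 : measurable_fun setT
  (fun cx : pt R n * pt R n => ((1 + `|defect cx.1 cx.2|) `^ (- p))%:E).
Proof. exact: merr_comp. Qed.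

(** Since $1+|x-c|^2\le2(1+|X|)$, the error decays like $|x-c|^{-(n+1)}$ and is integrable in
    [c]. *)
Let err_int : (\int[vol R n]_c (Er c)%:E <= err_int_cst%:E)%E.
Proof.
have -> : (\int[vol R n]_c (Er c)%:E =
    \int[vol R n]_c \int[mu]_x ((1 + `|defect c x|) `^ (- p))%:E)%E.
  apply: eq_integral => c _; rewrite fineK//.
  by apply: integrable_fin_num => //; exact: interr.
have ker0 (cx : pt R n * pt R n) : (0 <= ((1 + `|defect cx.1 cx.2|) `^ (- p))%:E)%E.
  by rewrite lee_fin powR_ge0.
rewrite (fubini_tonelli (m1 := vol R n) (m2 := mu) _ merr2 ker0).
have bnd x : (\int[vol R n]_c ((1 + `|defect c x|) `^ (- p))%:E <= err_int_cst%:E)%E.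
  have p0 : 0 <= p by rewrite divr_ge0// addr_ge0.
  have sx (c : pt R n) : 0 < 1 + sqd c x / 1 ^+ 2.
    by rewrite ltr_wpDr// divr_ge0 ?sqd_ge0 ?sqr_ge0.
  have mk : measurable_fun setT (fun c : pt R n => ((1 + sqd c x / 1 ^+ 2) `^ (- p))%:E).
    apply/measurable_EFinP; apply: (measurableT_comp (measurable_powR _)).
    apply: measurable_funD => //; apply: measurable_funM => //.
    by apply: measurable_sqd => //; exact: measurable_cst.
  apply: (@le_trans _ _ (\int[vol R n]_c ((2 `^ p)%:E * ((1 + sqd c x / 1 ^+ 2) `^ (- p))%:E))%E).
    apply: ge0_le_integral => //.
    - by apply: merr_comp => //; exact: measurable_cst.
    - exact: measurable_funeM.
    - move=> c _; have d0 : 0 < 1 + `|defect c x| by rewrite ltr_wpDr.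
      rewrite -EFinM lee_fin !powRN ler_pdivlMr ?powR_gt0// mulrC.
      rewrite ler_pdivrMr ?powR_gt0// -powRM ?(ltW d0)//.
      apply: (ge0_ler_powR p0); rewrite ?nnegrE ?(ltW (sx c)) ?mulr_ge0 ?(ltW d0)//.
      rewrite expr1n divr1; have := sqd_ge0 c x.
      by have := ler_norm (sqd c x - 1); have := ler_norm (- (sqd c x - 1)); rewrite normrN; lra.
  rewrite ge0_integralZl//.
  - rewrite /err_int_cst EFinM; apply: lee_wpmul2l; first by rewrite lee_fin powR_ge0.
    have n1 : n%:R < n%:R + 1 :> R by rewrite ltrDl.
    have := ball_growth_integral_le x (@vol_growth R n) (exprn_ge0 _ (ler0n _ _)) ltr01 n1
      (addr_ge0 (ler0n _ _) ler01).
    by rewrite powR1 mulr1.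
  - by move=> c _; rewrite lee_fin powR_ge0.
apply: (@le_trans _ _ (\int[mu]_x err_int_cst%:E)%E).
  apply: ge0_le_integral => //.
  - by move=> x _; apply: integral_ge0 => c _; rewrite lee_fin powR_ge0.
  - apply: (@measurable_integral_section _ _ _ _ _ (vol R n)
      (fun xc => ((1 + `|defect xc.2 xc.1|) `^ (- p))%:E)).
    exact: merr_comp.
  - by move=> x _; exact: bnd.
rewrite integral_cst//.
apply: le_trans (lee_wpmul2l _ (probability_le1 mu measurableT)) _; last by rewrite mule1.
by apply: le_trans (bnd point); apply: integral_ge0 => c _; rewrite lee_fin powR_ge0.
Qed.

Hypotheses (M1 : (1 < M)%N)
  (sM : n.+1%:R <= M%:R * (2 * n%:R * (s - (n%:R - 1 + n%:R^-1)))).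

Let field_cst : R :=
  (M * k.+1)%:R ^+ n.+1 * (sup_field_cst R k ^+ k.+1 * l2_field_cst k s).

(** Of the $n+1$ factors, $n-1$ are estimated by the supremum and two by the square norm, which
    leaves a power $Y^{-b}$. The weight contributes [clamp u] to the power $(M(n-1)-1)(n+1)$, and
    [sM] says exactly that this is at least $2Mb$. For large [M] that condition amounts to
    $s>n-1+1/n$: the threshold arises here. *)
Let field_power u :
  (\int[vol R n]_c ((weight u * cmod (wave_field mu (depth u) c)) ^+ n.+1)%:E <=
   (field_cst * A ^+ n)%:E)%E.
Proof.
have /andP[v0 v1] := clamp_itv u; have /andP[d0 d2] := depth_itv u.
have /andP[m0 m1] := weight_itv u.
set Y := depth u in d0 d2 *; set q := s - n%:R + 1 - p.
set w := weight u in m0 m1 *; set S := sup_field_cst R k * A * Y `^ q.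
have S0 : 0 <= S.
  apply: mulr_ge0; last exact: powR_ge0.
  by apply: mulr_ge0 => //; exact: sup_field_cst_ge0.
have [wr wi] := measurable_wave_field mu (fun _ : pt R n => d0)
  (@measurable_cst _ _ _ _ setT Y) (@measurable_id _ (pt R n) setT).
have mc := mcmod wr wi.
apply: (@le_trans _ _ (\int[vol R n]_c
    ((w ^+ n.+1 * S ^+ k.+1)%:E * (cmod (wave_field mu Y c) ^+ 2)%:E))%E).
  apply: ge0_le_integral => //.
  - by move=> c _; rewrite lee_fin; apply: exprn_ge0; apply: mulr_ge0 => //; exact: cmod_ge0.
  - apply/measurable_EFinP; apply: measurable_funX; exact: measurable_funM.
  - by apply: measurable_funeM; apply/measurable_EFinP; exact: measurable_funX.
  - move=> c _; rewrite -EFinM lee_fin (exprMn _ w) -[leRHS]mulrA.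
    apply: ler_wpM2l; first exact: exprn_ge0.
    rewrite (_ : n.+1 = k.+1 + 2)%N; last by rewrite addn2.
    rewrite exprD ler_wpM2r ?sqr_ge0// lerXn2r ?nnegrE ?cmod_ge0//.
    exact: cmod_wave_field_le (depth_itv u).
rewrite ge0_integralZl//.
- apply: le_trans (lee_wpmul2l _ (l2_wave_field_le A0 gmu s1 sn (depth_itv u))) _.
    by rewrite lee_fin mulr_ge0 ?exprn_ge0.
  rewrite -EFinM lee_fin /S /w /weight -/Y.
  pose b := - (q * k.+1%:R + (s - n%:R)).
  have nE : k.+1%:R = n%:R - 1 :> R by rewrite -(natr1 k.+1) addrK.
  have N2 : 2 <= n%:R :> R by rewrite ler_nat.
  have NN : n%:R * n%:R^-1 = 1 :> R by rewrite divff// pnatr_eq0.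
  have b0 : 0 <= b.
    rewrite /b /q nE; move: sn N2; move: (n%:R : R) => N sN N2; nra.
  have Nb : b * (2 * M)%:R <= ((M * k.+1).-1 * n.+1)%:R.
    have -> : ((M * k.+1).-1 * n.+1)%:R = (M%:R * (n%:R - 1) - 1) * (n%:R + 1) :> R.
      rewrite natrM -(natr1 n) -nE; congr (_ * _); apply/eqP.
      by rewrite eq_sym subr_eq natr1 prednK ?muln_gt0 ?M0// natrM.
    rewrite natrM /b /q nE -subr_ge0; move: sM; rewrite -(natr1 n).
    set N := (n%:R : R) in NN *; move: (M%:R : R) => m H.
    have -> : (m * (N - 1) - 1) * (N + 1) -
        - ((s - N + 1 - (N + 1) / 2) * (N - 1) + (s - N)) * (2 * m) =
        m * (2 * N * s - 2 * N * (N - 1) - 2 * 1) - (N + 1) by field.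
    have E : 2 * N * (s - (N - 1 + N^-1)) = 2 * N * s - 2 * N * (N - 1) - 2 * (N / N) by ring.
    by rewrite NN in E; rewrite -E subr_ge0.
  have N0 : (0 < (M * k.+1).-1 * n.+1)%N 
    by rewrite muln_gt0 andbT -ltnS prednK ?muln_gt0 ?M0// (leq_trans M1)// leq_pmulr.
  have := weight_le (clamp_itv u) e0 b0 N0 Nb; rewrite -/(depth u) -/Y => wl.
  have -> : ((M * k.+1)%:R * clamp u ^+ (M * k.+1).-1) ^+ n.+1 *
      (sup_field_cst R k * A * Y `^ q) ^+ k.+1 *
      (l2_field_cst k s * A * Y `^ (s - n%:R)) =
      field_cst * A ^+ n * (clamp u ^+ ((M * k.+1).-1 * n.+1) * Y `^ (- b)).
    rewrite /b opprK (@powRD _ Y (q * k.+1%:R)) ?(gt_eqF d0) ?implybT// powRrM powR_mulrn ?powR_ge0//.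
    rewrite (exprM (clamp u)) /field_cst (exprS A k.+1).
    move: (sup_field_cst R k) (l2_field_cst k s) (Y `^ q) => C1 C2 y.
    by rewrite !exprMn; ring.
  rewrite ler_piMr// mulr_ge0 ?exprn_ge0//; apply: mulr_ge0; first exact: exprn_ge0.
  apply: mulr_ge0; first by apply: exprn_ge0; exact: sup_field_cst_ge0.
  exact: l2_field_cst_ge0.
- by apply/measurable_EFinP; exact: measurable_funX.
- by move=> c _; rewrite lee_fin sqr_ge0.
- by rewrite lee_fin mulr_ge0 ?exprn_ge0.
Qed.

Definition energy_cst : R :=
  (2 ^+ n) ^+ n.+1 * 2 ^+ n.+1 *
  (field_cst + err_cst ^+ n.+1 * (sup_kernel_cst R n ^+ n * err_int_cst)).

Let mdepth_field d (T : measurableType d) (f : T -> pt R n) (g : T -> R) :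
  measurable_fun setT f -> measurable_fun setT g -> measurable_fun setT (fun t =>
    weight (g t) * cmod (wave_field mu (depth (g t)) (f t))).
Proof.
move=> mf mg; have [wr wi] := measurable_wave_field mu
  (fun t => proj1 (andP (depth_itv (g t)))) (measurableT_comp measurable_depth mg) mf.
apply: measurable_funM; last exact: mcmod.
exact: (measurableT_comp measurable_weight mg).
Qed.

Let mG : measurable_fun setT G.
Proof.
apply: (measurableT_comp (f := fine)) => //.
apply: (@measurable_integral_section _ _ _ _ _ U (fun cu : pt R n * R =>
  (weight cu.2 * cmod (wave_field mu (depth cu.2) cu.1))%:E)).
by apply/measurable_EFinP; exact: mdepth_field.
Qed.

Let mEr : measurable_fun setT Er.
Proof.
apply: (measurableT_comp (f := fine)) => //.
exact: (measurable_integral_section mu merr2).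
Qed.

Let G0 c : 0 <= G c.
Proof.
apply: Rintegral_ge0 => u _; apply: mulr_ge0; last exact: cmod_ge0.
by case/andP: (weight_itv u).
Qed.

Let Er0 c : 0 <= Er c.
Proof. by apply: Rintegral_ge0 => u _; exact: powR_ge0. Qed.

(** Jensen puts the power inside the [u]-average; after Tonelli, [field_power] bounds each [u] by
    the same constant. *)
Let int_G_power : (\int[vol R n]_c (G c ^+ n.+1)%:E <= (field_cst * A ^+ n)%:E)%E.
Proof.
have mw : measurable_fun setT (fun cu : pt R n * R =>
    ((weight cu.2 * cmod (wave_field mu (depth cu.2) cu.1)) ^+ n.+1)%:E).
  by apply/measurable_EFinP; apply: measurable_funX; exact: mdepth_field.
have w0 (cu : pt R n * R) :
    (0 <= ((weight cu.2 * cmod (wave_field mu (depth cu.2) cu.1)) ^+ n.+1)%:E)%E.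
  rewrite lee_fin; apply: exprn_ge0; apply: mulr_ge0; last exact: cmod_ge0.
  by case/andP: (weight_itv cu.2).
apply: (@le_trans _ _ (\int[vol R n]_c \int[U]_u
    ((weight u * cmod (wave_field mu (depth u) c)) ^+ n.+1)%:E)%E).
  apply: ge0_le_integral => //.
  - by move=> c _; rewrite lee_fin exprn_ge0.
  - by apply/measurable_EFinP; exact: measurable_funX.
  - exact: (measurable_integral_section U mw).
  - move=> c _; have [K fieldK] := field_bound c.
    have bK u : 0 <= weight u * cmod (wave_field mu (depth u) c) <= (M * k.+1)%:R * K.
      have /andP[m0 m1] := weight_itv u.
      rewrite mulr_ge0 ?cmod_ge0//=; apply: ler_pM => //; exact: cmod_ge0.
    have mc : measurable_fun setT (fun u => weight u * cmod (wave_field mu (depth u) c)).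
      by apply: mdepth_field => //; exact: measurable_cst.
    have := jensen_expr U n mc bK; rewrite -lee_fin => /le_trans; apply.
    rewrite fineK//; apply: integrable_fin_num => //.
    apply: (@integrable_bounded _ _ _ U _ (((M * k.+1)%:R * K) ^+ n.+1)) => [|u].
      exact: measurable_funX.
    have /andP[b0 b1] := bK u.
    by rewrite ger0_norm ?exprn_ge0// lerXn2r ?nnegrE// (le_trans b0).
rewrite (fubini_tonelli (m1 := vol R n) (m2 := U) _ mw w0).
apply: (@le_trans _ _ (\int[U]_u (field_cst * A ^+ n)%:E)%E).
  apply: ge0_le_integral => //.
  - by move=> u _; apply: integral_ge0 => c _; exact: (w0 (c, u)).
  - apply: (@measurable_integral_section _ _ _ _ _ (vol R n)
      (fun uc : R * pt R n => ((weight uc.1 * cmod (wave_field mu (depth uc.1) uc.2)) ^+ n.+1)%:E)).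
    by apply/measurable_EFinP; apply: measurable_funX; exact: mdepth_field.
  - by move=> u _; exact: field_power.
rewrite integral_cst//.
apply: le_trans (lee_wpmul2l _ (probability_le1 U measurableT)) _; last by rewrite mule1.
by apply: le_trans (field_power 0); apply: integral_ge0 => c _; exact: (w0 (c, 0)).
Qed.

(** [n] factors are estimated by the supremum, the last one by its integral. *)
Let int_Er_power : (\int[vol R n]_c (Er c ^+ n.+1)%:E <=
  (sup_kernel_cst R n ^+ n * err_int_cst * A ^+ n)%:E)%E.
Proof.
have SA : 0 <= sup_kernel_cst R n * A by apply: mulr_ge0 => //; exact: sup_kernel_cst_ge0.
apply: (@le_trans _ _ (\int[vol R n]_c (((sup_kernel_cst R n * A) ^+ n)%:E * (Er c)%:E))%E).
  apply: ge0_le_integral => //.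
  - by move=> c _; rewrite lee_fin exprn_ge0.
  - by apply/measurable_EFinP; exact: measurable_funX.
  - by apply: measurable_funeM; exact/measurable_EFinP.
  - move=> c _; rewrite -EFinM lee_fin exprSr; apply: ler_wpM2r => //.
    by rewrite lerXn2r ?nnegrE.
rewrite ge0_integralZl//.
- apply: le_trans (lee_wpmul2l _ err_int) _; first by rewrite lee_fin exprn_ge0.
  by rewrite -EFinM lee_fin exprMn mulrAC.
- exact/measurable_EFinP.
- by move=> c _; rewrite lee_fin.
- by rewrite lee_fin exprn_ge0.
Qed.

Theorem annulus_power_le :
  (\int[vol R n]_c ((fine (mu [set x | (`|sqd x c - 1| < e)%R]) / e) ^+ n.+1)%:E <=
   (energy_cst * A ^+ n)%:E)%E.
Proof.
pose L : R := (2 ^+ n) ^+ n.+1 * 2 ^+ n.+1.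
have L0 : 0 <= L by apply: mulr_ge0; exact: exprn_ge0.
have err0 : 0 <= err_cst by apply: mulr_ge0 => //; exact: powR_ge0.
have mS : measurable_fun setT (fun c => mu [set x | `|sqd x c - 1| < e]).
  apply: (@measurable_measure_ysection _ _ _ _ _ mu [set z : pt R n * pt R n | `|sqd z.1 z.2 - 1| < e]).
  rewrite -[X in measurable X]setTI (_ : mkset _ =
    (fun z : pt R n * pt R n => `|sqd z.1 z.2 - 1|) @^-1` `]-oo, e[).
    apply: measurableT_comp => //; apply: measurable_funB => //; exact: measurable_sqd.
  by apply/seteqP; split => z /=; rewrite in_itv.
apply: (@le_trans _ _ (\int[vol R n]_c
   (L%:E * ((G c ^+ n.+1)%:E + (err_cst ^+ n.+1)%:E * (Er c ^+ n.+1)%:E)))%E).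
  apply: ge0_le_integral => //.
  - by move=> c _; rewrite lee_fin exprn_ge0// divr_ge0 ?fine_ge0// ltW.
  - apply/measurable_EFinP; apply: measurable_funX; apply: measurable_funM => //.
    by apply: (measurableT_comp (f := fine)).
  - apply: measurable_funeM; apply: emeasurable_funD.
      by apply/measurable_EFinP; exact: measurable_funX.
    by apply: measurable_funeM; apply/measurable_EFinP; exact: measurable_funX.
  - move=> c _; rewrite (_ : (_ * _)%E =
      (L * (G c ^+ n.+1 + err_cst ^+ n.+1 * Er c ^+ n.+1))%:E)// lee_fin.
    have h0 : 0 <= fine (mu [set x | `|sqd x c - 1| < e]) / e by rewrite divr_ge0 ?fine_ge0// ltW.
    have E0 : 0 <= err_cst * Er c by apply: mulr_ge0.
    apply: (@le_trans _ _ ((2 ^+ n * (G c + err_cst * Er c)) ^+ n.+1)).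
      by rewrite lerXn2r ?nnegrE ?(le_trans h0 (annulus_le c))// annulus_le.
    rewrite exprMn /L -mulrA; apply: ler_wpM2l; first by apply: exprn_ge0; exact: exprn_ge0.
    by rewrite -(exprMn _ err_cst); exact: exprD_le.
rewrite ge0_integralZl//.
- rewrite ge0_integralD//.
  + rewrite ge0_integralZl//.
    * rewrite (_ : energy_cst * A ^+ n = L * ((field_cst +
        err_cst ^+ n.+1 * (sup_kernel_cst R n ^+ n * err_int_cst)) * A ^+ n)); last first.
        by rewrite mulrA.
      rewrite [leRHS]EFinM; apply: lee_wpmul2l; first by rewrite lee_fin.
      rewrite mulrDl EFinD; apply: leeD; first exact: int_G_power.
      rewrite -[in leRHS]mulrA [leRHS]EFinM; apply: lee_wpmul2l; first by rewrite lee_fin exprn_ge0.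
      exact: int_Er_power.
    * by apply/measurable_EFinP; exact: measurable_funX.
    * by move=> c _; rewrite lee_fin exprn_ge0.
    * by rewrite lee_fin exprn_ge0.
  + by move=> c _; rewrite lee_fin exprn_ge0.
  + by apply/measurable_EFinP; exact: measurable_funX.
  + by move=> c _; rewrite -EFinM lee_fin mulr_ge0 ?exprn_ge0.
  + by apply: measurable_funeM; apply/measurable_EFinP; exact: measurable_funX.
- apply: emeasurable_funD.
    by apply/measurable_EFinP; exact: measurable_funX.
  by apply: measurable_funeM; apply/measurable_EFinP; exact: measurable_funX.
- move=> c _; apply: adde_ge0; first by rewrite lee_fin exprn_ge0.
  by rewrite -EFinM lee_fin mulr_ge0 ?exprn_ge0.
Qed.

End energy.

Lemma annulus_power_bound (R : realType) (k : nat) (s : R) :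
  k.+2%:R - 1 + k.+2%:R^-1 < s < k.+2%:R ->
  exists2 K : R, 0 < K & forall (mu : probability (pt R k.+2) R) (A e : R),
    0 <= A -> ball_growth mu A s -> 0 < e <= 1 ->
    (\int[vol R k.+2]_c
      ((fine (mu [set x | (`|sqd x c - 1| < e)%R]) / e) ^+ k.+3)%:E <=
     (K * A ^+ k.+2)%:E)%E.
Proof.
move=> /andP[s1 sn]; set D := 2 * k.+2%:R * (s - (k.+2%:R - 1 + k.+2%:R^-1)).
have D0 : 0 < D by rewrite !mulr_gt0// subr_gt0.
(* [M] must exceed $(n+1)/D$, with $n=k+2$, for the exponent condition of [field_power]; the double
   successor also ensures $1<M$. *)
pose M := (Num.bound (k.+3%:R / D)).+2.
have M0 : (0 < M)%N by []. have M1 : (1 < M)%N by [].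
have sM : k.+3%:R <= M%:R * D.
  rewrite -ler_pdivrMr//; apply: le_trans (ltW (archi_boundP _)) _.
    by rewrite divr_ge0// ltW.
  by rewrite ler_nat; exact: leqW (leqW (leqnn _)).
have s1' : k.+2%:R - 1 < s.
  by apply: lt_trans s1; rewrite ltrDl invr_gt0.
(* Absolute value plus one guarantees positivity. The constant is fixed before [mu], [A] and [e],
   since the rescaled measures vary with the radius. *)
exists (`|energy_cst k M s| + 1); first by rewrite ltr_wpDl.
move=> mu A e A0 gmu e01.
apply: le_trans (annulus_power_le A0 gmu s1' sn e01 M0 M1 sM) _.
rewrite lee_fin; apply: ler_wpM2r; first exact: exprn_ge0.
by rewrite (le_trans (ler_norm _))// lerDl.
Qed.

(** * From annuli to circumradii *)

Section power_probability_theory.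
Context (disp : measure_display) (T : measurableType disp) (R : realType).
Variable P : probability T R.
Local Open Scope ereal_scope.

(** Nonnegative integrals are suprema over simple functions below the integrand, so monotonicity
    holds without measurability. This is what permits comparing sets defined through
    [circumradius]. *)
Lemma ge0_integral_mono (f g : T -> \bar R) :
  (forall x, 0 <= f x) -> (forall x, f x <= g x) -> \int[P]_x f x <= \int[P]_x g x.
Proof.
move=> f0 fg; have g0 x : 0 <= g x by exact: le_trans (f0 x) (fg x).
rewrite !ge0_integralE//; apply: ereal_sup_le => _ [h hf <-]; exists h => // x.
by apply: le_trans (hf x) _; rewrite !patch_setT.
Qed.

Lemma power_probability_cons n (A : set (n.+1.-tuple T)) :
  power_probability P n.+1 A =
  \int[P]_x power_probability P n [set y | A (tuple_cons (x, y))].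
Proof.
rewrite /= /distribution /pushforward /product_measure1.
apply: eq_integral => x _ /=; congr (_ _).
by apply/seteqP; split => y /=; rewrite /xsection/= inE.
Qed.

(** Valid for arbitrary sets, because the value of the product on a set is by definition an iterated
    integral of sections, and such integrals are monotone. *)
Lemma power_probability_mono n (A B : set (n.-tuple T)) : A `<=` B ->
  power_probability P n A <= power_probability P n B.
Proof.
elim: n A B => [|n IH] A B AB.
  rewrite /= !diracE lee_fin ler_nat.
  case: (boolP (_ \in A)) => // /set_mem/AB BB; by rewrite (mem_set BB).
rewrite !power_probability_cons; apply: ge0_integral_mono => // x.
by apply: IH => y; exact: AB.
Qed.

End power_probability_theory.

(** * Rescaled coordinates of row vectors *)

Section coordinates.
Context (R : realType) (d : nat).
Implicit Types (w : borel_rV R d) (y : pt R d) (t : R).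

Lemma measurable_coord (i : 'I_d) :
  measurable_fun [set: borel_rV R d] (fun w => (w : 'rV[R]_d) ord0 i).
Proof.
apply: (measurability _ (RGenOpens.measurableE R)) => _ [_ [a [b ->]] <-].
rewrite setTI; apply: sub_sigma_algebra.
have /continuousP := @coord_continuous R 1 d ord0 i; apply; exact: interval_open.
Qed.

Definition coords t w : pt R d := [tuple (w : 'rV[R]_d) ord0 i / t | i < d].

Lemma tnth_coords t w i : tnth (coords t w) i = (w : 'rV[R]_d) ord0 i / t.
Proof. by rewrite tnth_mktuple. Qed.

Lemma measurable_coords t : measurable_fun [set: borel_rV R d] (coords t).
Proof.
apply/measurable_fun_tnthP => i; rewrite (_ : _ \o _ = fun w => (w : 'rV[R]_d) ord0 i / t).
  by apply: measurable_funM => //; exact: measurable_coord.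
by apply/funext => w /=; rewrite tnth_coords.
Qed.

HB.instance Definition _ t :=
  isMeasurableFun.Build _ _ _ _ (coords t) (measurable_coords t).

Definition of_coords t y : 'rV[R]_d := \row_i (t * tnth y i).

Lemma sqd_coords t w y : 0 < t ->
  sqd (coords t w) y = (eucl_dist (of_coords t y) w / t) ^+ 2.
Proof.
move=> t0; rewrite expr_div_n sqr_sqrtr; last by apply: sumr_ge0 => i _; exact: sqr_ge0.
rewrite /sqd mulr_suml; apply: eq_bigr => i _; rewrite tnth_coords mxE.
by field; rewrite gt_eqF.
Qed.

Lemma eucl_dist_ge0 (x y : 'rV[R]_d) : 0 <= eucl_dist x y.
Proof. exact: sqrtr_ge0. Qed.

Variables (nu : probability (borel_rV R d) R) (A s : R).
Hypotheses (A0 : 0 <= A)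
  (gnu : forall (x : 'rV[R]_d) r, 0 < r -> (nu (eucl_ball x r) <= (A * r `^ s)%:E)%E).

Lemma ball_growth_coords t : 0 < t ->
  ball_growth (distribution nu (coords t)) (A * t `^ s) s.
Proof.
move=> t0 x r r0; rewrite /distribution /pushforward.
rewrite (_ : _ @^-1` _ = eucl_ball (of_coords t x) (t * r)); last first.
  apply/seteqP; split => w /=; rewrite /eucl_ball /= sqd_coords//.
    rewrite ltr_pXn2r ?nnegrE ?divr_ge0 ?eucl_dist_ge0 ?(ltW r0) ?(ltW t0)//.
    by rewrite ltr_pdivrMr// mulrC.
  rewrite ltr_pXn2r ?nnegrE ?divr_ge0 ?eucl_dist_ge0 ?(ltW r0) ?(ltW t0)//.
  by rewrite ltr_pdivrMr// mulrC.
by rewrite -mulrA -powRM ?(ltW t0) ?(ltW r0)//; apply: gnu; rewrite mulr_gt0.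
Qed.

End coordinates.

Lemma eq0_le_powR (R : realType) (x C k : R) : 0 < k -> 0 <= x ->
  (forall r, 0 < r <= 1 -> x <= C * r `^ k) -> x = 0.
Proof.
move=> k0 x0 xC; apply/eqP; rewrite eq_le x0 andbT.
have C0 : 0 <= C by have := xC 1; rewrite ltr01 lexx powR1 mulr1 => /(_ isT); exact: le_trans.
apply/ler_addgt0Pr => e e0; rewrite add0r.
pose dl := Num.min 1 (e / (C + 1)).
have dl0 : 0 < dl by rewrite lt_min ltr01 divr_gt0// ltr_wpDl.
have dl1 : dl <= 1 by rewrite ge_min lexx.
have r01 : 0 < dl `^ k^-1 <= 1.
  have k1 : 0 <= k^-1 by rewrite invr_ge0 ltW.
  have := @ge0_ler_powR _ k^-1 k1 dl 1; rewrite !nnegrE (ltW dl0) ler01 powR1.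
  by rewrite powR_gt0//=; apply.
have := xC _ r01; rewrite -powRrM mulVf ?gt_eqF// (powRr1 (ltW dl0)) => /le_trans; apply.
apply: (@le_trans _ _ (C * (e / (C + 1)))).
  by rewrite ler_wpM2l// ge_min lexx orbT.
by rewrite mulrCA ler_piMr ?(ltW e0)// ler_pdivrMr ?ltr_wpDl// mul1r lerDl.
Qed.

(** * Hyperplanes and affinely dependent tuples are null *)

Section hyperplane.
Context (R : realType) (n : nat) (mu : probability (pt R n) R) (A s : R).
Hypotheses (A0 : 0 <= A) (gmu : ball_growth mu A s) (s1 : n%:R - 1 < s).
Variables (v : 'I_n -> R) (v0 : R) (j : 'I_n).
Hypothesis vj : v j != 0.

Let form (y : pt R n) := v0 + \sum_(i < n) v i * tnth y i.

Let mform : measurable_fun setT form.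
Proof.
apply: measurable_funD => //; apply: measurable_sum => i.
by apply: measurable_funM => //; exact: measurable_tnth.
Qed.

Let strip (e rho : R) := [set y : pt R n | `|form y| <= e /\ forall i, `|tnth y i| <= rho].

Let mstrip e rho : measurable (strip e rho).
Proof.
apply: measurableI.
  rewrite -[X in measurable X]setTI (_ : (fun y => is_true _) = (fun y => `|form y|) @^-1` `]-oo, e]).
    by apply: measurableT_comp.
  by apply/seteqP; split => y /=; rewrite in_itv.
have := @measurable_tuple_box _ (measurableTypeR R) n (fun _ => `[- rho, rho]%classic)
  (fun _ => measurable_itv _).
rewrite (_ : mkset _ = [set x | forall i, `|tnth x i| <= rho])//.
by apply/seteqP; split => x /= H i; have := H i; rewrite /= in_itv/= ler_norml.
Qed.

Let V := \sum_(i < n) `|v i|.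

Let form_upd c t u : form (upd c j t) - form (upd c j u) = v j * (t - u).
Proof.
rewrite /form (bigD1 j)//= [in X in _ - X](bigD1 j)//= !tnth_upd eqxx.
rewrite (eq_bigr (fun i => v i * tnth c i)); last first.
  by move=> i /negbTE ij; rewrite tnth_upd ij.
rewrite [in X in _ - X](eq_bigr (fun i => v i * tnth c i)); last first.
  by move=> i /negbTE ij; rewrite tnth_upd ij.
by ring.
Qed.

Let vol_strip (r rho : R) : 0 < r -> 0 <= rho ->
  (vol R n (strip (r * V) rho) <=
   ((2 * rho) ^+ n.-1 * (2 * (2 * (r * V) / `|v j|)))%:E)%E.
Proof.
move=> r0 rho0; have V0 : 0 <= V by apply: sumr_ge0.
have vj0 : 0 < `|v j| by rewrite normr_gt0.
have D0 : 0 <= 2 * (r * V) / `|v j|.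
  by rewrite divr_ge0//; apply: mulr_ge0 => //; apply: mulr_ge0 => //; exact: ltW.
apply: (@vol_slices _ _ j _ (fun=> 0)) => //; first exact: mulr_ge0.
  by move=> c [_ H] i; rewrite subr0.
move=> c; apply: lebesgue_measure_diam_le => //.
  by rewrite -[X in measurable X]setTI; exact: (measurable_upd c j).
move=> t u [Ht _] [Hu _]; rewrite ler_pdivlMr// -normrM mulrC -(form_upd c).
apply: le_trans (ler_normB _ _) _; lra.
Qed.

Let near_strip r rho y c : 0 < r -> strip 0 rho y -> sqd c y < r ^+ 2 ->
  strip (r * V) (rho + r) c.
Proof.
move=> r0 [fy yr] cy.
have cyi i : `|tnth c i - tnth y i| <= r.
  rewrite -(@ler_pXn2r _ 2)// ?nnegrE ?(ltW r0)// real_normK ?num_real//.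
  exact: le_trans (sqd_coord_le c y i) (ltW cy).
split=> [|i]; last first.
  rewrite -[tnth c i](subrK (tnth y i)) (le_trans (ler_normD _ _))// addrC.
  by apply: lerD.
have -> : form c = form y + \sum_(i < n) v i * (tnth c i - tnth y i).
  rewrite /form -addrA; congr (_ + _); rewrite -big_split/=.
  by apply: eq_bigr => i _; ring.
have -> : form y = 0 by apply/eqP; rewrite -normr_le0.
rewrite add0r (le_trans (ler_norm_sum _ _ _))// mulr_sumr; apply: ler_sum => i _.
by rewrite normrM mulrC ler_wpM2r.
Qed.

(** An [r]-neighbourhood of a bounded piece of the hyperplane lies in a strip of thickness $O(r)$,
    [V] bounding the variation of [form]. Then [frostman_thicken] gives mass $O(r^{s-n+1})$, which
    tends to 0 because $s>n-1$. *)
Let strip_null rho : 0 <= rho -> mu (strip 0 rho) = 0%E.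
Proof.
move=> rho0; have n0 : (0 < n)%N by case: (n) j => // -[].
have V0 : 0 <= V by apply: sumr_ge0.
have fin : mu (strip 0 rho) \is a fin_num by exact: fin_num_measure.
rewrite -(fineK fin); congr EFin.
pose C := A * ((2 * (rho + 1)) ^+ n.-1 * (2 * (2 * V / `|v j|))) * n%:R ^+ n.
apply: (@eq0_le_powR _ _ C (s - n%:R + 1)).
- by move: s1; move: (n%:R : R) => N; lra.
- exact: fine_ge0.
move=> r /andP[r0 r1].
have := frostman_thicken n0 gmu r0 (mstrip 0 rho) (mstrip (r * V) (rho + r))
  (fun y c => near_strip r0).
have vs : (vol R n (strip (r * V) (rho + r)) <=
   ((2 * (rho + 1)) ^+ n.-1 * (2 * (2 * (r * V) / `|v j|)))%:E)%E.
  apply: le_trans (vol_strip r0 _) _; first by rewrite addr_ge0// ltW.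
  rewrite lee_fin; apply: ler_wpM2r.
    rewrite mulr_ge0// divr_ge0//; apply: mulr_ge0 => //; apply: mulr_ge0 => //; exact: ltW.
  rewrite lerXn2r ?nnegrE ?mulr_ge0 ?addr_ge0 ?(ltW r0)//; lra.
have Ar : 0 <= A * r `^ s by rewrite mulr_ge0// powR_ge0.
move=> /le_trans /(_ (lee_wpmul2l _ vs)); rewrite lee_fin => /(_ Ar).
rewrite -(fineK fin) -!EFinM lee_fin -ler_pdivlMr; last by rewrite exprn_gt0// divr_gt0 ?ltr0n.
move=> /le_trans; apply; rewrite le_eqVlt; apply/orP; left; apply/eqP.
rewrite /C powRD ?(gt_eqF r0) ?implybT// powRr1 ?(ltW r0)//.
rewrite powRD ?(gt_eqF r0) ?implybT// powRN powR_mulrn ?(ltW r0)// expr_div_n.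
by field; rewrite ?normr_eq0 vj/= ?expf_neq0 ?pnatr_eq0 -?lt0n ?(gt_eqF r0).
Qed.

Lemma hyperplane_null : mu [set y | form y = 0] = 0%E.
Proof.
apply/eqP; rewrite eq_le measure_ge0 andbT.
apply: (@le_trans _ _ (\sum_(0 <= k <oo) mu (strip 0 k%:R))%E).
  apply: measure_sigma_subadditive => //.
  - rewrite -[X in measurable X]setTI (_ : [set y | form y = 0] = form @^-1` [set 0])//.
    exact: mform.
  - move=> y /= fy; pose m := \sum_(i < n) `|tnth y i|.
    exists (Num.bound m) => //; split; first by rewrite fy normr0.
    move=> i; apply: le_trans (ltW (archi_boundP _)); last by apply: sumr_ge0.
    by rewrite /m (bigD1 i)//= lerDl; apply: sumr_ge0.
by rewrite eseries0// => k _ _; exact: strip_null.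
Qed.

End hyperplane.

Section degenerate.
Context (R : realType) (d : nat) (nu : probability (borel_rV R d) R) (A s : R).
Hypotheses (A0 : 0 <= A) (s1 : d%:R - 1 < s)
  (gnu : forall (x : 'rV[R]_d) r, 0 < r -> (nu (eucl_ball x r) <= (A * r `^ s)%:E)%E).

(** Homogeneous coordinates: affine dependence of points becomes linear dependence of rows. *)
Definition homog (w : 'rV[R]_d) : 'rV[R]_d.+1 :=
  \row_(j < d.+1) if unlift ord0 j is Some i then w ord0 i else 1.

Lemma homog_mul (w : 'rV[R]_d) (u : 'cV[R]_d.+1) : homog w *m u =
  (u ord0 ord0 + \sum_(i < d) u (lift ord0 i) ord0 * w ord0 i)%:M.
Proof.
apply/matrixP => i j; rewrite !ord1 !mxE big_ord_recl mxE unlift_none mul1r mulr1n.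
by congr (_ + _); apply: eq_bigr => l _; rewrite mxE liftK mulrC.
Qed.

Let affine_null (u : 'cV[R]_d.+1) : u != 0 ->
  nu [set w | homog w *m u = 0] = 0%E /\ measurable [set w : borel_rV R d | homog w *m u = 0].
Proof.
move=> u0; pose f (w : borel_rV R d) :=
  u ord0 ord0 + \sum_(i < d) u (lift ord0 i) ord0 * (w : 'rV[R]_d) ord0 i.
have setE : [set w | homog w *m u = 0] = f @^-1` [set 0].
  apply/seteqP; split => w /=; rewrite homog_mul => fw.
    by have /matrixP/(_ ord0 ord0) := fw; rewrite !mxE mulr1n.
  by rewrite -/(f w) fw; apply/matrixP => i j; rewrite !mxE mul0rn.
split; last first.
  rewrite setE -[X in measurable X]setTI.
  have mf : measurable_fun setT f; last exact: mf.
  apply: measurable_funD => //; apply: measurable_sum => i.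
  by apply: measurable_funM => //; exact: measurable_coord.
have [[j uj]|noj] := pselect (exists j : 'I_d, u (lift ord0 j) ord0 != 0).
  have := hyperplane_null (mulr_ge0 A0 (powR_ge0 1 s)) (ball_growth_coords gnu ltr01) s1
    (u ord0 ord0) (v := fun i => u (lift ord0 i) ord0) uj.
  rewrite /distribution /pushforward => <-; congr (nu _); rewrite setE.
  have E w : f w = u ord0 ord0 + \sum_(i < d) u (lift ord0 i) ord0 * tnth (coords 1 w) i.
    by congr (_ + _); apply: eq_bigr => i _; rewrite tnth_coords divr1.
  by apply/seteqP; split => w /=; rewrite E.
rewrite setE (_ : _ @^-1` _ = set0) ?measure0//.
apply/seteqP; split => // w /=; rewrite /f big1 => [|i _]; last first.
  have [->|ui] := eqVneq (u (lift ord0 i) ord0) 0; first by rewrite mul0r.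
  by case: noj; exists i.
rewrite addr0 => u00; move: u0; rewrite -subr_eq0 subr0 => /eqP; apply.
apply/matrixP => i j; rewrite ord1 mxE; case: (unliftP ord0 i) => [l ->|->//].
by apply/eqP/negP => /negP ul; case: noj; exists l.
Qed.

(** Points are drawn one at a time. While its rank is at most [d], the span [W] is annihilated by
    some nonzero column, taken from its cokernel. A point outside the corresponding affine null set
    raises the rank by one, and the induction continues from the larger span. *)
Let dependent_null k (W : 'M[R]_d.+1) : (\rank W + k <= d.+1)%N ->
  power_probability nu k [set x |
    (\rank (W + \sum_(i < k) <<homog (tnth x i)>>)%MS < \rank W + k)%N] = 0%E.
Proof.
elim: k W => [|k IH] W rW.
  rewrite (_ : mkset _ = set0) ?measure0//; apply/seteqP; split => // x /=.
  by rewrite big_ord0 addsmx0 addn0 ltnn.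
have [u u0 Wu] : exists2 u : 'cV[R]_d.+1, u != 0 & W *m u = 0.
  have c0 : cokermx W != 0.
    apply/eqP => c0; have := mxrank_coker W; rewrite c0 mxrank0 => /esym/eqP.
    by rewrite subn_eq0 leqNgt (leq_trans _ rW)// addnS ltnS leq_addr.
  have [j cj] : exists j, col j (cokermx W) != 0.
    apply/existsP; apply: contraNT c0; rewrite negb_exists => /forallP c0.
    apply/eqP/matrixP => i j; rewrite mxE.
    by have := c0 j; rewrite negbK => /eqP/matrixP/(_ i ord0); rewrite !mxE.
  exists (col j (cokermx W)) => //.
  by rewrite colE mulmxA mulmx_coker mul0mx.
have [H0 mH] := affine_null u0; set H := [set w | _] in H0 mH.
apply/eqP; rewrite eq_le measure_ge0 andbT power_probability_cons -H0.
have -> : nu H = (\int[nu]_w (\1_H w)%:E)%E by rewrite integral_indic// setIT.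
apply: ge0_integral_mono => w //.
rewrite indicE; have [wH|wH] := boolP (w \in H).
  apply: le_trans (power_probability_mono nu (@subsetT _ _)) _.
  by rewrite probability_setT.
have hW : ~~ (homog w <= W)%MS.
  apply: contra wH => /submxP[D hD]; apply/mem_set => /=.
  by change (homog w *m u = 0); rewrite hD -mulmxA Wu mulmx0.
set W' := (W + homog w)%MS.
have rW' : \rank W' = (\rank W).+1.
  apply/eqP; rewrite eqn_leq; apply/andP; split.
    apply: leq_trans (mxrank_adds_leqif _ _).1 _.
    by rewrite -[leqRHS]addn1 leq_add2l rank_leq_row.
  rewrite ltn_neqAle (mxrankS (addsmxSl _ _)) andbT; apply: contra hW => /eqP rE.
  have := mxrank_leqif_sup (addsmxSl W (homog w)); rewrite -/W' => -[_].
  by rewrite rE eqxx => /esym/(submx_trans (addsmxSr _ _)).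
have kW' : (\rank W' + k <= d.+1)%N by rewrite rW' addSnnS.
rewrite (_ : _%:E = 0%E)// -(IH _ kW'); apply: power_probability_mono => x /=.
rewrite rW' addSnnS big_ord_recl; apply: leq_ltn_trans; apply: mxrankS.
rewrite tnth0 addsmx_sub; apply/andP; split.
  rewrite addsmx_sub addsmxSl/=; apply: submx_trans (addsmxSr _ _).
  by apply: submx_trans (addsmxSl _ _); rewrite genmxE.
apply: submx_trans (addsmxSr _ _); apply: submx_trans (addsmxSr _ _).
apply/sumsmx_subP => i _; by rewrite (sumsmx_sup i)// tnthS submx_refl.
Qed.

Lemma degenerate_null : power_probability nu d.+1
  [set x | \det (\matrix_(i < d.+1) homog (tnth x i)) = 0] = 0%E.
Proof.
have r0 : (\rank (0%R : 'M[R]_d.+1) + d.+1 <= d.+1)%N by rewrite mxrank0.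
apply/eqP; rewrite eq_le measure_ge0 andbT -(dependent_null r0).
apply: power_probability_mono => x /= detx; set M := \matrix_(i < d.+1) _ in detx.
have : (\rank M < d.+1)%N.
  rewrite ltn_neqAle rank_leq_row andbT; apply: contraPneq detx => rM.
  have : M \in unitmx by rewrite -row_free_unit /row_free rM.
  by rewrite unitmxE unitfE => /eqP.
rewrite mxrank0 add0n adds0mx; apply: leq_ltn_trans; apply: mxrankS.
apply/sumsmx_subP => i _; rewrite genmxE.
have -> : homog (tnth x i) = row i M by rewrite rowK.
exact: row_sub.
Qed.

Lemma measurable_degenerate : measurable
  [set x : d.+1.-tuple (borel_rV R d) | \det (\matrix_(i < d.+1) homog (tnth x i)) = 0].
Proof.
pose f (x : d.+1.-tuple (borel_rV R d)) := \det (\matrix_(i < d.+1) homog (tnth x i)).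
have mf : measurable_fun setT f.
  apply: measurable_sum => p; apply: measurable_funM => //; apply: measurable_prod => i _.
  move: (perm.fun_of_perm.body p i) => q.
  have -> : (fun x => (\matrix_(i < d.+1) homog (tnth x i)) i q) = fun x =>
      if unlift ord0 q is Some l then (tnth x i : 'rV[R]_d) ord0 l else 1.
    by apply/funext => x; rewrite !mxE.
  case: (unlift ord0 q) => [l|] //.
  by apply: (measurableT_comp (measurable_coord l)); exact: measurable_tnth.
rewrite -[X in measurable X]setTI (_ : mkset _ = f @^-1` [set 0])//; exact: mf.
Qed.

End degenerate.

(** * Circumscribed spheres as solutions of a linear system *)

Section circumscribed_sphere.
Context (R : realType) (d : nat).
Implicit Types (c w : 'rV[R]_d) (r : R) (x : d.+1.-tuple 'rV[R]_d).

Let sqn w := \sum_(i < d) w ord0 i ^+ 2.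

Let eucl_dist_sqr c w : eucl_dist c w ^+ 2 =
  sqn w - \sum_(i < d) 2 * c ord0 i * w ord0 i + sqn c.
Proof.
rewrite sqr_sqrtr; last by apply: sumr_ge0 => i _; exact: sqr_ge0.
rewrite /sqn -sumrB -big_split/=; apply: eq_bigr => i _; ring.
Qed.

Lemma eucl_dist_double_le c w w' r : eucl_dist c w <= r -> eucl_dist c w' <= r ->
  eucl_dist w w' <= 2 * r.
Proof.
move=> cw cw'; have r0 : 0 <= r by exact: le_trans (eucl_dist_ge0 _ _) cw.
have sq u : eucl_dist c u <= r -> \sum_(i < d) (c ord0 i - u ord0 i) ^+ 2 <= r ^+ 2.
  rewrite -(@ler_pXn2r _ 2)// ?nnegrE ?eucl_dist_ge0// sqr_sqrtr//.
  by apply: sumr_ge0 => i _; exact: sqr_ge0.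
rewrite -(@ler_pXn2r _ 2)// ?nnegrE ?eucl_dist_ge0 ?mulr_ge0//.
rewrite sqr_sqrtr; last by apply: sumr_ge0 => i _; exact: sqr_ge0.
apply: (@le_trans _ _ (\sum_(i < d) (2 * (c ord0 i - w ord0 i) ^+ 2 +
    2 * (c ord0 i - w' ord0 i) ^+ 2))).
  apply: ler_sum => i _; rewrite -subr_ge0.
  set a := c ord0 i; set p := w ord0 i; set q := w' ord0 i.
  have -> : 2 * (a - p) ^+ 2 + 2 * (a - q) ^+ 2 - (p - q) ^+ 2 = (2 * a - p - q) ^+ 2 by ring.
  exact: sqr_ge0.
rewrite big_split/= -!mulr_sumr; have := sq _ cw; have := sq _ cw'; rewrite exprMn; lra.
Qed.

(** The sphere equation reads $|w|^2=2c\cdot w+(r^2-|c|^2)$, which is linear in the unknown with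
    entries $r^2-|c|^2$ and $2c_i$. *)
Let center_col c r : 'cV[R]_d.+1 := \col_(k < d.+1)
  if unlift ord0 k is Some i then 2 * c ord0 i else r ^+ 2 - sqn c.

Let sphereE c r w : 0 <= r ->
  eucl_dist c w = r <-> homog w *m center_col c r = (sqn w)%:M.
Proof.
move=> r0; have -> : (homog w *m center_col c r = (sqn w)%:M) <->
    (eucl_dist c w ^+ 2 = r ^+ 2).
  rewrite homog_mul eucl_dist_sqr mxE unlift_none.
  under eq_bigr do rewrite mxE liftK.
  set D := \sum_(i < d) _; split => [/matrixP/(_ ord0 ord0)|h].
    by rewrite !mxE !mulr1n => <-; ring.
  by congr (_%:M); rewrite -h; ring.
split=> [->//|/eqP]; rewrite eqrXn2// ?eucl_dist_ge0//; exact: eqP.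
Qed.

Lemma circumradius_sphere x : circumradius x != 0 ->
  0 < circumradius x /\ exists c, forall i, eucl_dist c (tnth x i) = circumradius x.
Proof.
rewrite /circumradius; case: xgetP => [r -> [r0 [c [[_ cx] _]]] _|_]; last by rewrite eqxx.
by split => //; exists c => i; exact: cx.
Qed.

(** Centre and radius solve a linear system whose matrix consists of the homogenized points, so
    invertibility gives existence and uniqueness of the sphere. Radius 0 would make all points
    coincide and two rows equal, which $d>0$ turns into a zero determinant. *)
Lemma circumradius_neq0 x : (0 < d)%N ->
  \det (\matrix_(i < d.+1) homog (tnth x i)) != 0 -> circumradius x != 0.
Proof.
move=> d0 detx; set M := \matrix_(i < d.+1) _ in detx.
have Mu : M \in unitmx by rewrite unitmxE unitfE.
pose b : 'cV[R]_d.+1 := \col_i sqn (tnth x i).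
have ME z : M *m z = b <-> forall i, homog (tnth x i) *m z = (sqn (tnth x i))%:M.
  have rowE i : row i (M *m z) = homog (tnth x i) *m z by rewrite row_mul rowK.
  have rowb i : row i b = (sqn (tnth x i))%:M.
    by apply/matrixP => p q; rewrite !ord1 !mxE mulr1n.
  split=> [Mz i|Mz]; first by rewrite -rowE Mz rowb.
  by apply/row_matrixP => i; rewrite rowE rowb.
have [z Mz] : exists z, M *m z = b by exists (invmx M *m b); rewrite mulKVmx.
pose c : 'rV[R]_d := \row_i (z (lift ord0 i) ord0 / 2).
pose r := eucl_dist c (tnth x ord0).
have r0 : 0 <= r by exact: eucl_dist_ge0.
have zE : z = center_col c r.
  have z0 := (ME z).1 Mz ord0; move: z0; rewrite homog_mul => /matrixP/(_ ord0 ord0).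
  rewrite !mxE !mulr1n => z0.
  apply/matrixP => i j; rewrite ord1 mxE; case: (unliftP ord0 i) => [l ->|->].
    by rewrite mxE mulrC divfK.
  rewrite eucl_dist_sqr -z0 addrK.
  have -> : \sum_(i < d) 2 * c ord0 i * tnth x ord0 ord0 i =
      \sum_(i < d) z (lift ord0 i) ord0 * tnth x ord0 ord0 i.
    by apply: eq_bigr => l _; rewrite mxE; field.
  by rewrite addrK.
have sph i : eucl_dist c (tnth x i) = r.
  by apply/sphereE => //; rewrite -zE; exact: (ME z).1.
have rpos : 0 < r.
  rewrite lt_neqAle eq_sym r0 andbT; apply: contraNneq detx => r00.
  have xc i : tnth x i = c.
    have := sph i; rewrite r00 => /eqP; rewrite sqrtr_eq0 => le0.
    apply/rowP => l; have : (c ord0 l - tnth x i ord0 l) ^+ 2 <= 0.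
      apply: le_trans le0; rewrite (bigD1 l)//= lerDl.
      by apply: sumr_ge0 => ? _; exact: sqr_ge0.
    move=> h; have : (c ord0 l - tnth x i ord0 l) ^+ 2 == 0 by rewrite eq_le h sqr_ge0.
    by rewrite sqrf_eq0 subr_eq0 => /eqP.
  apply/eqP; pose i1 : 'I_d.+1 := lift ord0 (Ordinal d0).
  apply: (determinant_alternate (i1 := ord0) (i2 := i1)) => // l.
  by rewrite !mxE !xc.
have det : determines_sphere x (eucl_sphere c r).
  split; first by split=> //; exists c, r.
  move=> S' [c' [r' [r'0 ->]]] Sx.
  have : center_col c' r' = z.
    have Mc' : M *m center_col c' r' = b.
      apply/ME => i; apply/sphereE; first exact: ltW.
      exact: Sx.
    by rewrite -[LHS](mulKmx Mu) Mc' -Mz mulKmx.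
  rewrite zE => ccE; have cE : c' = c.
    apply/rowP => l; have /matrixP/(_ (lift ord0 l) ord0) := ccE.
    have cc c0 q : center_col c0 q (lift ord0 l) ord0 = 2 * c0 ord0 l by rewrite mxE liftK.
    have n2 : (2 : R) != 0 by rewrite pnatr_eq0.
    by rewrite !cc => /(mulfI n2).
  by rewrite cE; congr eucl_sphere; rewrite -(Sx ord0) cE sph.
rewrite /circumradius; case: xgetP => [t -> [t0 _]|/(_ r)]; first by rewrite gt_eqF.
by case; split => //; exists c.
Qed.

End circumscribed_sphere.

Lemma measurable_eucl_dist (R : realType) (d : nat) disp (S : measurableType disp)
    (f g : S -> borel_rV R d) : measurable_fun setT f -> measurable_fun setT g ->
  measurable_fun setT (fun t => eucl_dist (f t : 'rV[R]_d) (g t)).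
Proof.
move=> mf mg; apply: measurable_fun_sqrt; apply: measurable_sum => i.
apply: measurable_funX; apply: measurable_funB.
  exact: (measurableT_comp (measurable_coord i) mf).
exact: (measurableT_comp (measurable_coord i) mg).
Qed.

Lemma measurable_eucl_dist_lt (R : realType) (d : nat) disp (S : measurableType disp)
    (f g : S -> borel_rV R d) (r : R) : measurable_fun setT f -> measurable_fun setT g ->
  measurable [set t | eucl_dist (f t : 'rV[R]_d) (g t) < r].
Proof.
move=> mf mg; rewrite -[X in measurable X]setTI (_ : mkset _ =
  (fun t => eucl_dist (f t : 'rV[R]_d) (g t)) @^-1` `]-oo, r[).
  exact: measurable_eucl_dist.
by apply/seteqP; split => t /=; rewrite in_itv.
Qed.

(** * Probability that the circumradius is close to t *)

Section circumradius_cover.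
Context (R : realType) (k : nat) (nu : probability (borel_rV R k.+2) R) (A s : R).
Local Notation d := k.+2.
Hypotheses (A0 : 0 <= A) (s1 : d%:R - 1 + d%:R^-1 < s) (sd : s < d%:R)
  (gnu : forall (x : 'rV[R]_d) r, 0 < r -> (nu (eucl_ball x r) <= (A * r `^ s)%:E)%E).
Implicit Types (t e : R).
Local Notation P := (power_probability nu d.+1).
Local Notation points := (d.+1.-tuple (borel_rV R d)).

Let sd1 : 1 <= s * d%:R.
Proof.
have N2 : 2 <= d%:R :> R by rewrite ler_nat.
have N0 : 0 < d%:R :> R by [].
apply: le_trans (ltW (_ : (d%:R - 1 + d%:R^-1) * d%:R < _)); last by rewrite ltr_pM2r.
have -> : (d%:R - 1 + d%:R^-1) * d%:R = d%:R * (d%:R - 1) + 1 :> R.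
  by field; rewrite gt_eqF.
by rewrite lerDr mulr_ge0// subr_ge0 (le_trans _ N2)// ler1n.
Qed.

Let s1' : d%:R - 1 < s.
Proof. by apply: lt_trans s1; rewrite ltrDl invr_gt0. Qed.

Let near_sphere t e : set (points * pt R d) :=
  [set z | forall i, `|sqd (coords t (tnth z.1 i)) z.2 - 1| < 6 * (e / t)].

Let measurable_near_sphere t e : measurable (near_sphere t e).
Proof.
rewrite (_ : near_sphere t e = \bigcap_(i in [set: 'I_d.+1])
   [set z | `|sqd (coords t (tnth z.1 i)) z.2 - 1| < 6 * (e / t)]); last first.
  by apply/seteqP; split => z /= H i; [move=> _; exact: H|exact: H].
apply: fin_bigcap_measurable; first exact: finite_finset.
move=> i _; rewrite -[X in measurable X]setTI (_ : mkset _ =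
  (fun z : points * pt R d => `|sqd (coords t (tnth z.1 i)) z.2 - 1|) @^-1`
  `]-oo, 6 * (e / t)[); last by apply/seteqP; split => z /=; rewrite in_itv.
have mf : measurable_fun setT
    (fun z : points * pt R d => `|sqd (coords t (tnth z.1 i)) z.2 - 1|); last exact: mf.
apply: measurableT_comp => //; apply: measurable_funB => //; apply: measurable_sqd => //.
apply: (measurableT_comp (measurable_coords t)).
by apply: (measurableT_comp (measurable_tnth i)).
Qed.

Let near_sphere_section t e c : 0 < t ->
  P [set x | near_sphere t e (x, c)] =
  ((fine (distribution nu (coords t)
    [set y | (`|sqd y c - 1| < 6 * (e / t))%R])) ^+ d.+1)%:E.
Proof.
move=> t0; pose B := [set y : pt R d | `|sqd y c - 1| < 6 * (e / t)].
have mB : measurable B by exact: measurable_sqd_near.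
have mC : measurable (coords t @^-1` B).
  by rewrite -[X in measurable X]setTI; exact: (measurable_coords t).
rewrite (power_probabilityE nu (A := fun=> coords t @^-1` B))//.
rewrite /distribution /pushforward -[X in (\prod_(i < _) X)%E]fineK; last exact: fin_num_measure.
by rewrite prodEFin prodr_const card_ord.
Qed.

(** Origin of the factor 6: with $D=e/t\le1/6$, the error in the radius costs at most $3D$ in the
    squared distance and moving the centre by [D] costs at most $D^2+D+D(1+3D)$, in total
    $5D+4D^2\le6D$. *)
Let near_bound t e (c : 'rV[R]_d) (c' : pt R d) (w : 'rV[R]_d) : 0 < t -> 0 < e -> 6 * e <= t ->
  `|eucl_dist c w - t| < e -> sqd c' (coords t c) < (e / t) ^+ 2 ->
  `|sqd (coords t w) c' - 1| < 6 * (e / t).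
Proof.
move=> t0 e0 et cw cc'; pose D := e / t; pose rho := eucl_dist c w / t.
have D0 : 0 < D by rewrite divr_gt0.
have D6 : 6 * D <= 1 by rewrite mulrA ler_pdivrMr// mul1r.
have rE : sqd (coords t c) (coords t w) = rho ^+ 2.
  rewrite sqdC sqd_coords//; congr ((eucl_dist _ _ / _) ^+ 2).
  by apply/rowP => i; rewrite mxE tnth_coords mulrC divfK// gt_eqF.
have rho1 : `|rho - 1| < D.
  rewrite -(@ltr_pM2r _ t)// divfK ?gt_eqF// -[X in _ * X](gtr0_norm t0) -normrM.
  by rewrite mulrBl mul1r divfK ?gt_eqF.
have rho0 : 0 <= rho by rewrite divr_ge0 ?eucl_dist_ge0// ltW.
have := sqd_perturb c' (coords t c) (coords t w) D0.
have : (1 + D^-1) * sqd c' (coords t c) <= D ^+ 2 + D.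
  apply: (@le_trans _ _ ((1 + D^-1) * D ^+ 2)).
    by rewrite ler_wpM2l ?(ltW cc')// addr_ge0// invr_ge0 ltW.
  by rewrite le_eqVlt; apply/orP; left; apply/eqP; field; rewrite gt_eqF.
rewrite rE (sqdC c' (coords t w)) -/D.
move: rho1; rewrite !ltr_norml ler_norml => /andP[r1 r2] h /andP[h1 h2].
have rsq1 : rho ^+ 2 <= 1 + 3 * D by nra.
have rsq2 : 1 - 2 * D <= rho ^+ 2 by nra.
by apply/andP; split; nra.
Qed.

(** Each tuple in question has a set of admissible centres of volume at least $v=(e/(td))^d$.
    Markov's inequality bounds its probability by the integral over [c] of the annulus mass to the
    power $d+1$, divided by [v]. One factor $e/t$ is left, times $(t^s)^d$ from the growth constant
    of the dilated measure. *)
Let large_radius : exists2 K : R, 0 < K & forall t e, 0 < e -> 6 * e <= t ->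
  exists B : set points, [/\ measurable B,
    [set x | `|circumradius x - t| < e] `<=` B &
    (P B <= (K * t `^ (s * d%:R - 1) * e)%:E)%E].
Proof.
have [K K0 HK] := annulus_power_bound (introT andP (conj s1 sd)).
exists (K * A ^+ d * (6 ^+ d.+1 * d%:R ^+ d) + 1).
  rewrite ltr_wpDl//; apply: mulr_ge0; last by rewrite mulr_ge0 ?exprn_ge0.
  by rewrite mulr_ge0 ?exprn_ge0// ltW.
move=> t e e0 et; have t0 : 0 < t by rewrite (lt_le_trans _ et)// mulr_gt0.
have et0 : 0 < e / t by rewrite divr_gt0.
pose f (x : points) := vol R d [set c | near_sphere t e (x, c)].
have mf : measurable_fun setT f.
  exact: (measurable_measure_xsection (vol R d) (measurable_near_sphere t e)).
pose v : R := (e / t / d%:R) ^+ d.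
have v0 : 0 < v by rewrite exprn_gt0// divr_gt0.
have mB : measurable [set x : points | (v%:E <= f x)%E].
  rewrite -[X in measurable X]setTI; exact: emeasurable_fun_c_infty.
exists [set x | (v%:E <= f x)%E]; split => //.
- move=> x /= xt.
  have R0 : circumradius x != 0.
    by apply: contraTneq xt => ->; rewrite sub0r normrN gtr0_norm// -leNgt; lra.
  have [_ [c cx]] := circumradius_sphere R0.
  apply: le_trans (vol_ball_ge (isT : (0 < d)%N) (coords t c) et0) _.
  apply: le_measure; rewrite ?inE.
  + exact: measurable_sqd_lt.
  + rewrite -[X in measurable X]setTI.
    have mp : measurable_fun setT (fun c' : pt R d => (x : points, c')).
      exact: pair1_measurable.
    exact: mp (measurable_near_sphere t e).
  + by move=> c' /= cc' i; apply: (near_bound t0 e0 et _ cc'); rewrite cx.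
have : (v%:E * P [set x | (v%:E <= f x)%E] <=
    \int[vol R d]_c P [set x | near_sphere t e (x, c)])%E.
  rewrite -(integral_measure_section _ _ (measurable_near_sphere t e)).
  rewrite -integral_cst//; apply: (@le_trans _ _ (\int[P]_(x in [set x | (v%:E <= f x)%E]) f x)%E).
    apply: ge0_le_integral => //.
    + by move=> x _; rewrite lee_fin ltW.
    + exact: measurable_funTS.
  by apply: ge0_subset_integral => //.
have e6 : 0 < 6 * (e / t) <= 1.
  by rewrite mulr_gt0//= mulrA ler_pdivrMr// mul1r.
have := HK _ _ _ (mulr_ge0 A0 (powR_ge0 t s)) (ball_growth_coords gnu t0) e6.
move=> HKt.
set g := fun c => fine (distribution nu (coords t)
  [set y : pt R d | (`|sqd y c - 1| < 6 * (e / t))%R]).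
have mg : measurable_fun setT g.
  apply: (measurableT_comp (f := fine)) => //.
  apply: (@measurable_measure_ysection _ _ _ _ _ (distribution nu (coords t))
    [set z : pt R d * pt R d | (`|sqd z.1 z.2 - 1| < 6 * (e / t))%R]).
  rewrite -[X in measurable X]setTI (_ : mkset _ =
    (fun z : pt R d * pt R d => `|sqd z.1 z.2 - 1|) @^-1` `]-oo, 6 * (e / t)[).
    apply: measurableT_comp => //; apply: measurable_funB => //; exact: measurable_sqd.
  by apply/seteqP; split => z /=; rewrite in_itv.
have g0 c : 0 <= g c by apply: fine_ge0.
have -> : (\int[vol R d]_c P [set x | near_sphere t e (x, c)] =
   ((6 * (e / t)) ^+ d.+1)%:E * \int[vol R d]_c ((g c / (6 * (e / t))) ^+ d.+1)%:E)%E.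
  have e60 : 0 < 6 * (e / t) by case/andP: e6.
  rewrite -ge0_integralZl//.
  - apply: eq_integral => c _; rewrite near_sphere_section// -EFinM -exprMn.
    by rewrite (mulrC _ (g c / _)) divfK// gt_eqF.
  - by apply/measurable_EFinP; apply: measurable_funX; exact: measurable_funM.
  - by move=> c _; rewrite lee_fin exprn_ge0// divr_ge0// ltW.
  - by rewrite lee_fin exprn_ge0// ltW.
have D0 := ltW et0.
have D60 : (0 <= ((6 * (e / t)) ^+ d.+1)%:E)%E by rewrite lee_fin exprn_ge0// mulr_ge0.
move=> /le_trans /(_ (lee_wpmul2l D60 HKt)).
set B := [set x : points | _].
rewrite -(fineK (fin_num_measure P B mB)) -!EFinM !lee_fin mulrC -ler_pdivlMr//.
move=> /le_trans; apply.
apply: (@le_trans _ _ (K * A ^+ d * (6 ^+ d.+1 * d%:R ^+ d) * t `^ (s * d%:R - 1) * e)).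
  rewrite /v (exprMn _ A) -[(t `^ s) ^+ d]powR_mulrn ?powR_ge0// -powRrM.
  have -> : t `^ (s * d%:R) = t `^ (s * d%:R - 1) * t.
    rewrite -[in X in _ = _ * X](powRr1 (ltW t0)) -powRD ?subrK//.
    by rewrite (gt_eqF t0) implybT.
  rewrite le_eqVlt; apply/orP; left; apply/eqP.
  have eD : e = e / t * t by rewrite divfK// gt_eqF.
  rewrite [in RHS]eD; move: (e / t) et0 => D DD; move: (t `^ _) => q.
  rewrite (exprMn _ 6) (exprS D) expr_div_n.
  have Dd : D ^+ d != 0 by rewrite expf_neq0// gt_eqF.
  have Nd : (d%:R : R) ^+ d != 0 by rewrite expf_neq0// pnatr_eq0.
  move: (D ^+ d) (d%:R ^+ d : R) (6 ^+ d.+1 : R) (A ^+ d) Dd Nd => y1 y2 y3 y4 y10 y20.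
  by field; rewrite y10 y20.
rewrite ler_wpM2r ?(ltW e0)// ler_wpM2r ?powR_ge0// lerDl//.
Qed.

(** When $t<6e$ the radius is below $7e$, so all points lie within $15e$ of the first one, an event
    of probability $O(e^{sd})$; this is $O(e)$ because $sd\ge1$ and $e\le1$. Affinely dependent
    tuples, which need not have a circumscribed sphere, are null. *)
Let small_radius : exists2 K : R, 0 < K & forall t e, 0 < e <= 1 -> t < 6 * e ->
  exists B : set points, [/\ measurable B,
    [set x | `|circumradius x - t| < e] `<=` B & (P B <= (K * e)%:E)%E].
Proof.
exists (A ^+ d * 15 `^ (s * d%:R) + 1).
  by rewrite ltr_wpDl// mulr_ge0 ?exprn_ge0// powR_ge0.
move=> t e /andP[e0 e1] te.
pose D := [set x : points | \det (\matrix_(i < d.+1) homog (tnth x i)) = 0].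
pose G := [set x : points | forall i, eucl_dist (tnth x ord0) (tnth x (lift ord0 i)) < 15 * e].
have mD : measurable D by exact: measurable_degenerate.
have mG : measurable G.
  rewrite (_ : G = \bigcap_(i in [set: 'I_d])
     [set x | eucl_dist (tnth x ord0 : 'rV[R]_d) (tnth x (lift ord0 i)) < 15 * e]); last first.
    by apply/seteqP; split => x /= H i; [move=> _; exact: H|exact: H].
  apply: fin_bigcap_measurable; first exact: finite_finset.
  by move=> i _; apply: measurable_eucl_dist_lt; exact: measurable_tnth.
exists (D `|` G); split; first exact: measurableU.
- move=> x /= xt; have [Dx|Dx] := eqVneq (\det (\matrix_(i < d.+1) homog (tnth x i))) 0.
    by left.
  right => i; have [R0 [c cx]] := circumradius_sphere (circumradius_neq0 (isT : (0 < d)%N) Dx).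
  have R7 : circumradius x < 7 * e.
    by move: xt; rewrite ltr_distl => /andP[_]; lra.
  have := eucl_dist_double_le (w := tnth x ord0) (w' := tnth x (lift ord0 i))
    (r := circumradius x) (c := c); rewrite !cx => /(_ (lexx _) (lexx _)); lra.
apply: (@le_trans _ _ (P G)).
  have D0 : P D = 0%E by exact: degenerate_null A0 s1' gnu.
  apply: (@le_trans _ _ (P D + P G)%E); first exact: measureU2.
  by rewrite D0 add0e.
rewrite power_probability_cons.
have bs : (\int[nu]_w ((A * (15 * e) `^ s) ^+ d)%:E <= ((A * (15 * e) `^ s) ^+ d)%:E)%E.
  rewrite integral_cst//.
  apply: le_trans (lee_wpmul2l _ (probability_le1 nu measurableT)) _; last by rewrite mule1.
  by rewrite lee_fin exprn_ge0// mulr_ge0// powR_ge0.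
apply: (@le_trans _ _ ((A * (15 * e) `^ s) ^+ d)%:E).
  apply: le_trans bs; apply: ge0_integral_mono => w //.
  pose Bw := eucl_ball (w : 'rV[R]_d) (15 * e).
  have mBw : measurable (Bw : set (borel_rV R d)).
    apply: (@measurable_eucl_dist_lt _ _ _ _ (fun=> w) id) => //.
  apply: (@le_trans _ _ (power_probability nu d [set y | forall i, Bw (tnth y i)])).
    apply: power_probability_mono => y /= Gy i.
    by have := Gy i; rewrite tnth0 tnthS.
  rewrite (power_probabilityE nu (A := fun=> Bw))//.
  have e15 : 0 < 15 * e by rewrite mulr_gt0.
  have nB := gnu w e15.
  rewrite -[X in (\prod_(i < _) X)%E]fineK; last exact: fin_num_measure.
  rewrite prodEFin prodr_const card_ord lee_fin lerXn2r ?nnegrE ?fine_ge0//.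
    by rewrite mulr_ge0// powR_ge0.
  by rewrite -lee_fin fineK//; exact: fin_num_measure.
rewrite lee_fin exprMn -[(_ `^ s) ^+ d]powR_mulrn ?powR_ge0// -powRrM.
rewrite powRM ?(ltW e0)// mulrA.
apply: (@le_trans _ _ (A ^+ d * 15 `^ (s * d%:R) * e)).
  apply: ler_wpM2l; last by rewrite ge1r_powR// e0.
  by apply: mulr_ge0; [exact: exprn_ge0|exact: powR_ge0].
by rewrite ler_wpM2r ?(ltW e0)// lerDl.
Qed.

(* The set of tuples is replaced by a measurable superset, so that countable
   subadditivity applies without knowing that [circumradius] is measurable. *)
Lemma circumradius_cover (M : R) : exists2 C : R, 0 < C & forall t e, t <= M -> 0 < e ->
  exists B : set points, [/\ measurable B,
    [set x | `|circumradius x - t| < e] `<=` B & (P B <= (C * e)%:E)%E].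
Proof.
have [K1 K10 H1] := large_radius; have [K2 K20 H2] := small_radius.
pose q := s * d%:R - 1; have q0 : 0 <= q by rewrite subr_ge0.
pose M' := Num.max M 1; have M'0 : 0 < M' by rewrite lt_max ltr01 orbT.
exists (K1 * M' `^ q + K2 + 1).
  by rewrite ltr_wpDl// addr_ge0 ?(ltW K20)// mulr_ge0 ?(ltW K10)// powR_ge0.
move=> t e tM e0; have Kq : 0 <= K1 * M' `^ q by rewrite mulr_ge0 ?(ltW K10)// powR_ge0.
have [e1|e1] := leP e 1; last first.
  exists setT; split => //; rewrite probability_setT lee_fin (le_trans (ltW e1))//.
  by rewrite ler_peMl ?(ltW e0)// lerDr addr_ge0// ltW.
have [te|te] := leP (6 * e) t.
  have [B [mB SB PB]] := H1 t e e0 te; exists B; split => //.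
  apply: le_trans PB _; rewrite lee_fin ler_wpM2r ?(ltW e0)//.
  have t0 : 0 < t by rewrite (lt_le_trans _ te)// mulr_gt0.
  apply: (@le_trans _ _ (K1 * M' `^ q)).
    rewrite ler_wpM2l ?(ltW K10)// ge0_ler_powR ?nnegrE ?(ltW t0) ?(ltW M'0)//.
    by rewrite le_max tM.
  by rewrite -addrA lerDl addr_ge0// ltW.
have [|B [mB SB PB]] := H2 t e _ te; first by rewrite e0.
exists B; split => //; apply: le_trans PB _; rewrite lee_fin ler_wpM2r ?(ltW e0)//.
by rewrite addrAC lerDr addr_ge0.
Qed.

End circumradius_cover.

(** * Estimates for Frostman measures *)

Lemma negligible_approx (disp : measure_display) (T : measurableType disp)
    (R : realType) (P : probability T R) (A : set T) :
  (forall e : R, 0 < e -> exists B, [/\ measurable B, A `<=` B & (P B <= e%:E)%E]) ->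
  P.-negligible A.
Proof.
move=> AB; have n0 n : 0 < n.+1%:R^-1 :> R by rewrite invr_gt0 ltr0n.
have [B BP] := choice (fun n => AB _ (n0 n)).
exists (\bigcap_n B n); split.
- by apply: bigcap_measurable => [|n _]; [exists 0%N|case: (BP n)].
- apply/eqP; rewrite eq_le measure_ge0 andbT; apply/lee_addgt0Pr => e e0; rewrite add0e.
  pose n := Num.bound e^-1; have [mBn _ PBn] := BP n.
  apply: (@le_trans _ _ (P (B n))).
    apply: le_measure; rewrite ?inE//; last by move=> x; exact.
    by apply: bigcap_measurable => [|m _]; [exists 0%N|case: (BP m)].
  apply: le_trans PBn _; rewrite lee_fin invf_ple ?posrE//.
  apply: ltW; apply: lt_le_trans (archi_boundP _) _; first by rewrite invr_ge0 ltW.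
  by rewrite ler_nat.
- by move=> x Ax n _; case: (BP n) => _ + _; exact.
Qed.

Section null_preimage.
Context (disp : measure_display) (T : measurableType disp) (R : realType).
Variables (P : probability T R) (f : T -> R).
Hypothesis fP : forall M, exists2 C : R, 0 < C & forall t e, t <= M -> 0 < e ->
  exists B, [/\ measurable B, [set x | `|f x - t| < e] `<=` B & (P B <= (C * e)%:E)%E].

(** Cover [S] by open intervals of small total length; each is a condition $|f-t|<e$ with [t] its
    midpoint. The constant depends on an upper bound for [t], so the values of [f] are first bounded
    by an integer [M]. *)
Lemma negligible_preimage_null (S : set R) : lebesgue_measure S = 0%E ->
  P.-negligible (f @^-1` S).
Proof.
move=> S0.
rewrite (_ : _ @^-1` _ = \bigcup_M [set x | S (f x) /\ f x <= M%:R]); last first.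
  apply/seteqP; split => [x /= Sx|x [M _] []//].
  exists (Num.bound `|f x|) => //; split => //.
  by apply: le_trans (ler_norm _) (ltW (archi_boundP _)).
apply: negligible_bigcup => M; apply: negligible_approx => e e0.
have [C C0 HC] := fP (M%:R + 1).
(* Capping the total length by 1 keeps the midpoint of an interval that starts below [M] under
   $M+1$, where [C] is valid. *)
have d0 : 0 < Num.min 1 (e / C) by rewrite lt_min ltr01 divr_gt0.
have [F [Fitv SF] FS] : exists2 F : (set R)^nat, open_itv_cover S F &
    (\sum_(0 <= k <oo) wlength idfun (F k) <= (Num.min 1 (e / C))%:E)%E.
  have S0' : ((@wlength R idfun)^* S = 0)%mu := S0.
  have := S0'; rewrite outer_measure_open_itv_cover => I0.
  have fI : ereal_inf [set (\sum_(k <oo) wlength idfun (F k))%E | F in open_itv_cover S]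
     \is a fin_num by rewrite I0.
  have [_ [F SF <-]] := lb_ereal_inf_adherent d0 fI.
  by rewrite I0 add0e => /ltW; exists F.
have HB k : {B : set T | [/\ measurable B,
    [set x | F k (f x) /\ f x <= M%:R] `<=` B & (P B <= C%:E * wlength idfun (F k))%E]}.
  apply: cid; have [[a b] /= Fk] := Fitv k.
  have Fk1 : (wlength idfun (F k) <= 1%:E)%E.
    apply: le_trans (le_trans FS _); last by rewrite lee_fin ge_min lexx.
    rewrite (nneseriesD1 (n := k))//.
    by rewrite leeDl//; apply: nneseries_ge0.
  have [ab|ba] := ltP a b; last first.
    exists set0; split => //; rewrite ?measure0 ?mule_ge0 ?lee_fin ?(ltW C0) ?wlength_ge0//.
    by move=> x []; rewrite Fk /= in_itv/= => /andP[ax xb]; have := lt_trans ax xb; rewrite ltNge ba.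
  have wF : wlength idfun (F k) = (b - a)%:E by rewrite Fk wlength_itv/= lte_fin ab.
  have [aM|Ma] := leP a M%:R; last first.
    exists set0; split => //; rewrite ?measure0 ?mule_ge0 ?lee_fin ?(ltW C0) ?wlength_ge0//.
    by move=> x []; rewrite Fk /= in_itv/= => /andP[ax xb]; rewrite leNgt (lt_trans Ma).
  move: Fk1; rewrite wF lee_fin => ba1.
  have := HC ((a + b) / 2) ((b - a) / 2) => -[||B [mB HB PB]].
  - move: (M%:R : R) aM => m; lra.
  - lra.
  exists B; split => //.
    move=> x [+ _]; rewrite Fk /= in_itv/= => /andP[ax xb]; apply: HB => /=.
    by rewrite ltr_norml; apply/andP; split; lra.
  apply: le_trans PB _; rewrite -EFinM lee_fin; apply: ler_wpM2l; first exact: ltW.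
  lra.
exists (\bigcup_k projT1 (HB k)); split.
- by apply: bigcup_measurable => k _; case: (projT2 (HB k)).
- move=> x [/SF [k _ Fk] xM]; exists k => //.
  by case: (projT2 (HB k)) => _ + _; apply.
- apply: (@le_trans _ _ (\sum_(0 <= k <oo) C%:E * wlength idfun (F k))%E).
    apply: (@le_trans _ _ (\sum_(0 <= k <oo) P (projT1 (HB k)))%E).
      apply: measure_sigma_subadditive => //.
      + by move=> k; case: (projT2 (HB k)).
      + by apply: bigcup_measurable => k _; case: (projT2 (HB k)).
    by apply: lee_nneseries => // k _; case: (projT2 (HB k)).
  rewrite nneseriesZl//.
  apply: le_trans (lee_wpmul2l _ FS) _; first by rewrite lee_fin ltW.
  rewrite -EFinM lee_fin; apply: (@le_trans _ _ (C * (e / C))).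
    by rewrite ler_wpM2l ?(ltW C0)// ge_min lexx orbT.
  by rewrite mulrC divfK// gt_eqF.
Qed.

End null_preimage.

(** A smaller exponent is a weaker condition for $r\le1$; for $r>1$ total mass 1 suffices once the
    constant is at least 1. This lets the exponent be brought below the dimension. *)
Lemma frostman_growth (R : realType) (d : nat) (E : set 'rV[R]_d) (s s' : R)
    (nu : probability (borel_rV R d) R) : 0 <= s' <= s -> frostman E s nu ->
  exists2 A, 0 <= A & forall (x : 'rV[R]_d) r, 0 < r ->
    (nu (eucl_ball x r) <= (A * r `^ s')%:E)%E.
Proof.
move=> /andP[s0 ss] [_ [C gnu]]; exists (Num.max C 1).
  by rewrite le_max ler01 orbT.
have A1 : 1 <= Num.max C 1 by rewrite le_max lexx orbT.
move=> x r r0; have [r1|r1] := leP r 1.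
  apply: le_trans (gnu x r r0) _; rewrite lee_fin.
  apply: (@le_trans _ _ (Num.max C 1 * r `^ s)).
    by rewrite ler_wpM2r ?powR_ge0// le_max lexx.
  by rewrite ler_wpM2l ?(le_trans ler01)//; apply: ger_powR => //; rewrite r0.
apply: (@le_trans _ _ 1%:E).
  apply: probability_le1; exact: (@measurable_eucl_dist_lt _ _ _ _ (fun=> x) id).
rewrite lee_fin -[leLHS]mulr1 ler_pM//.
have := @ge0_ler_powR _ s' s0 1 r; rewrite !nnegrE (ltW r0) ler01 powR1; apply => //.
exact: ltW.
Qed.

Section dimension_ge2.
Context (R : realType) (d : nat) (E : set 'rV[R]_d) (s : R)
  (nu : probability (borel_rV R d) R).
Hypotheses (d2 : (2 <= d)%N) (s1 : d%:R - 1 + d%:R^-1 < s) (nuE : frostman E s nu).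

Let P := power_probability nu d.+1.

Lemma frostman_circumradius_cover (M : R) : exists2 C : R, 0 < C &
  forall t e, t <= M -> 0 < e -> exists B : set (d.+1.-tuple (borel_rV R d)), [/\ measurable B,
    [set x | `|circumradius x - t| < e] `<=` B & (P B <= (C * e)%:E)%E].
Proof.
rewrite /P; case: d E nu d2 s1 nuE => [|[|k]]// E' nu' _ s1' nuE'.
(* The midpoint between threshold and dimension caps the exponent, because the square-norm bound
   wants it strictly below the dimension. *)
pose s' := Num.min s ((k.+2%:R - 1 + k.+2%:R^-1 + k.+2%:R) / 2).
have k1 : (k.+2%:R^-1 : R) < 1 by rewrite invf_lt1 ?ltr1n ?ltr0n.
have kp : 0 < (k.+2%:R^-1 : R) by rewrite invr_gt0 ltr0n.
have k2 : 1 <= (k.+2%:R : R) by rewrite ler1n.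
have s's : s' <= s by rewrite ge_min lexx.
have s'1 : k.+2%:R - 1 + k.+2%:R^-1 < s'.
  by rewrite /s' lt_min s1'/=; move: (k.+2%:R^-1 : R) k1 => y; move: (k.+2%:R : R) => N; lra.
have s'd : s' < k.+2%:R.
  rewrite /s' gt_min; apply/orP; right.
  by move: (k.+2%:R^-1 : R) k1 => y; move: (k.+2%:R : R) => N; lra.
have s'0 : 0 <= s' <= s.
  by rewrite s's andbT; move: (k.+2%:R^-1 : R) kp s'1 => y; move: (k.+2%:R : R) k2 => N; lra.
have [A A0 gnu] := frostman_growth s'0 nuE'.
exact: circumradius_cover A0 s'1 s'd gnu M.
Qed.

Lemma frostman_circumradius_estimate : circumradius_estimate nu.
Proof.
move=> T [M [_ TM]]; have [C C0 HC] := frostman_circumradius_cover (M + 1).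
exists C => // t e Tt e0; have [|B [mB SB PB]] := HC t e _ e0.
  by apply: le_trans (ler_norm t) _; apply: (TM (M + 1)) => //; rewrite ltrDl.
by apply: le_trans PB; exact: power_probability_mono.
Qed.

Lemma circumradius_range_gt0 : compact E -> (0 < lebesgue_measure
  [set circumradius x | x in [set x : d.+1.-tuple 'rV[R]_d | forall i, E (tnth x i)]])%E.
Proof.
move=> cE; set S := [set _ | _ in _].
rewrite lt_neqAle outer_measure_ge0 andbT; apply/negP => /eqP/esym S0.
have := negligible_preimage_null frostman_circumradius_cover S0.
have mE : measurable (E : set (borel_rV R d)).
  rewrite -[E]setCK; apply: measurableC; apply: sub_sigma_algebra.
  by apply: closed_openC; apply: compact_closed => //; exact: norm_hausdorff.
have nE : nu E = 1%E.
  have := probability_setC nu (A := ~` E) (measurableC mE); rewrite setCK => ->.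
  by case: nuE => -> _; rewrite sube0.
have PE : P [set x | forall i, E (tnth x i)] = 1%E.
  by rewrite (power_probabilityE nu (A := fun=> E))// big1.
move=> [N [mN N0 SN]].
have : (P [set x | forall i, E (tnth x i)] <= P N)%E.
  by apply: power_probability_mono => x Ex; apply: SN; exists x.
by rewrite PE N0 lee_fin ler10.
Qed.

End dimension_ge2.

(** * Translates of an arc along a Cantor set *)

Section staircase.
Context (R : realType) (M : nat).
Hypothesis M0 : (0 < M)%N.
Implicit Types (u v : R) (n k : nat).

Definition level n u : nat := Num.truncn (M%:R ^+ n * u).

Definition scale n : R := (4 * M%:R ^+ 2) ^- n.

(* With [N = 4 M^2], the [M^n] jumps of level [n] on the unit interval have height
   [N^-n], so the closure of the range has dimension [log_N M < 1/2]. *)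
Definition staircase u : R := limn (series (fun k => (level k u)%:R * scale k)).

Let m1 : 1 <= (M%:R : R). Proof. by rewrite ler1n. Qed.

Let m0 : 0 < (M%:R : R). Proof. exact: lt_le_trans m1. Qed.

Lemma scale_gt0 n : 0 < scale n.
Proof. by rewrite invr_gt0 exprn_gt0// mulr_gt0// exprn_gt0. Qed.

Lemma scaleM_le n k : M%:R ^+ k * scale (n + k) <= scale n * 4^-1 ^+ k.
Proof.
rewrite /scale exprD invfM mulrCA ler_wpM2l ?(ltW (scale_gt0 n))//.
rewrite -exprVn -exprMn lerXn2r ?nnegrE ?mulr_ge0 ?invr_ge0 ?mulr_ge0 ?exprn_ge0 ?(ltW m0)//.
rewrite ler_pdivrMr ?mulr_gt0 ?exprn_gt0// mulrA mulVf// mul1r expr2.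
by rewrite ler_peMl// ltW.
Qed.

Lemma levelP n u : 0 <= u -> (level n u)%:R <= M%:R ^+ n * u < (level n u)%:R + 1.
Proof.
by move=> u0; rewrite natr1; apply: truncn_itv; rewrite mulr_ge0// exprn_ge0// ltW.
Qed.

Lemma level_le n u v : u <= v -> (level n u <= level n v)%N.
Proof. by move=> uv; apply: le_truncn; rewrite ler_wpM2l// exprn_ge0// ltW. Qed.

Lemma level_le_norm n u : (level n u)%:R <= M%:R ^+ n * `|u|.
Proof.
apply: le_trans (_ : (level n `|u|)%:R <= _); first by rewrite ler_nat level_le// ler_norm.
by case/andP: (levelP n (normr_ge0 u)).
Qed.

Lemma level_natl n (j : nat) : level n (j%:R / M%:R ^+ n) = j.
Proof.
by rewrite /level mulrC divfK ?expf_neq0 ?gt_eqF// /Num.truncn; exact: natrK.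
Qed.

Lemma is_cvg_staircase u : cvgn (series (fun k => (level k u)%:R * scale k)).
Proof.
apply: (@series_le_cvg _ _ (geometric `|u| 4^-1)) => [k|k|k|].
- by rewrite mulr_ge0// ltW// scale_gt0.
- by rewrite /geometric/= mulr_ge0// exprn_ge0// invr_ge0.
- rewrite /geometric /=; apply: (@le_trans _ _ (M%:R ^+ k * `|u| * scale k)).
    by rewrite ler_wpM2r ?(ltW (scale_gt0 _))// level_le_norm.
  rewrite mulrAC mulrC ler_wpM2l//; have := scaleM_le 0 k.
  by rewrite /scale expr0 invr1 mul1r add0n.
- by apply: is_cvg_geometric_series; rewrite ger0_norm ?invr_ge0// invf_lt1// ltr1n.
Qed.

Lemma staircase_le u v : u <= v -> staircase u <= staircase v.
Proof.
move=> uv; apply: ler_lim; [exact: is_cvg_staircase..|].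
near=> n; rewrite !seriesEord/=; apply: ler_sum => k _.
by rewrite ler_wpM2r ?(ltW (scale_gt0 _))// ler_nat level_le.
Unshelve. all: end_near.
Qed.

Lemma measurable_staircase : measurable_fun setT staircase.
Proof. by apply: nondecreasing_measurable => // u v; exact: staircase_le. Qed.

(** The [n]-th term of the series alone contributes [scale n], and all other terms are monotone. *)
Lemma staircase_gap n u v : (level n u < level n v)%N ->
  staircase u + scale n <= staircase v.
Proof.
move=> Luv; have uv : u <= v.
  by rewrite leNgt; apply: contraTN Luv => /ltW /(level_le n); rewrite leqNgt.
rewrite -lerBrDl /staircase -limB; [|exact: is_cvg_staircase..].
apply: limr_ge; first by apply: is_cvgB; exact: is_cvg_staircase.
near=> K; rewrite -[X in _ <= X]/(series _ K - series _ K) !seriesEord/= -sumrB.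
have nK : (n < K)%N by near: K; exists n.+1.
rewrite (bigD1 (Ordinal nK))//=; apply: ler_wpDr.
  apply: sumr_ge0 => k _; rewrite -mulrBl mulr_ge0 ?(ltW (scale_gt0 _))// subr_ge0 ler_nat.
  exact: level_le.
rewrite -mulrBl ler_peMl ?(ltW (scale_gt0 _))// lerBrDr addrC natr1 ler_nat.
exact: Luv.
Unshelve. all: end_near.
Qed.

(** Levels up to [n] agree, and levels $n+i$ differ by at most $M^i+1\le2M^i$. Against the scales
    this sums to at most $\sum_{i\ge1}2\cdot4^{-i}=2/3$ of [scale n], hence strictly less than
    it. *)
Lemma staircase_close n u v : 0 <= u <= v -> level n u = level n v ->
  staircase v < staircase u + scale n.
Proof.
move=> /andP[u0 uv] Luv; have v0 := le_trans u0 uv.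
apply: (@le_lt_trans _ _ (staircase u + scale n * (2 / 3))); last first.
  by rewrite ltrD2l gtr_pMr ?scale_gt0//; lra.
rewrite -lerBlDl /staircase -limB; [|exact: is_cvg_staircase..].
apply: limr_le; first by apply: is_cvgB; exact: is_cvg_staircase.
have dM : M%:R ^+ n * (v - u) <= 1.
  have /andP[a _] := levelP n u0; have /andP[_ b] := levelP n v0.
  by move: a b; rewrite Luv mulrBr; lra.
(* A coarser level is determined by a finer one: if the levels [k] differed, a multiple of $M^{n-k}$
   would separate the levels [n]. *)
have lev k : (k <= n)%N -> level k u = level k v.
  move=> kn; apply/eqP; rewrite eqn_leq level_le//= leqNgt.
  apply: contra_eqN Luv => Lk; rewrite neq_ltn; apply/orP; left.
  have pos : 0 < (M%:R : R) ^+ (n - k) by rewrite exprn_gt0.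
  have split w : M%:R ^+ n * w = M%:R ^+ (n - k) * (M%:R ^+ k * w).
    by rewrite mulrA -exprD subnK.
  have /andP[_ uk] := levelP k u0; have /andP[vk _] := levelP k v0.
  have /andP[un _] := levelP n u0; have /andP[_ vn] := levelP n v0.
  rewrite -[(_ < _)%N]ltnS; apply: (@leq_ltn_trans (M ^ (n - k) * level k v)%N); last first.
    rewrite -(ltr_nat R) natrM natrX -natr1; apply: le_lt_trans vn.
    by rewrite split ler_wpM2l// ltW.
  rewrite -(ltr_nat R) natrM natrX; apply: le_lt_trans un _.
  rewrite split ltr_pM2l//; apply: lt_le_trans uk _.
  by rewrite natr1 ler_nat.
have term i : ((level (n + i.+1) v)%:R - (level (n + i.+1) u)%:R) * scale (n + i.+1) <=
    scale n * (2 * 4^-1 ^+ i.+1).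
  rewrite mulrCA; apply: le_trans (ler_wpM2l _ (scaleM_le n i.+1)) => //.
  rewrite mulrA ler_wpM2r ?(ltW (scale_gt0 _))//.
  have /andP[a _] := levelP (n + i.+1) v0; have /andP[_ b] := levelP (n + i.+1) u0.
  have : M%:R ^+ (n + i.+1) * (v - u) <= M%:R ^+ i.+1.
    by rewrite exprD mulrAC mulrC ler_piMr// exprn_ge0// ltW.
  have : 1 <= (M%:R : R) ^+ i.+1 by exact: exprn_ege1.
  by rewrite mulrBr; move: a b; lra.
have part I : \sum_(k < n.+1 + I) ((level k v)%:R - (level k u)%:R) * scale k <=
    scale n * (2 / 3 * (1 - 4^-1 ^+ I)).
  elim: I => [|I IH].
    rewrite addn0 expr0 subrr !mulr0 big1// => k _.
    by rewrite lev ?subrr ?mul0r// -ltnS.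
  have tI := term I; rewrite (addnS n I) in tI.
  rewrite (addnS n.+1 I) big_ord_recr /=; apply: le_trans (lerD IH tI) _.
  rewrite -mulrDr ler_wpM2l ?(ltW (scale_gt0 _))// exprS.
  by move: (4^-1 ^+ I) => y; lra.
near=> K; rewrite -[X in X <= _]/(series _ K - series _ K) !seriesEord/= -sumrB.
have nK : (n < K)%N by near: K; exists n.+1.
rewrite (eq_bigr (fun k : 'I_K => ((level k v)%:R - (level k u)%:R) * scale k)); last first.
  by move=> k _; rewrite mulrBl.
rewrite -(subnKC nK); apply: le_trans (part _) _.
rewrite ler_wpM2l ?(ltW (scale_gt0 _))// ler_piMr// gerBl exprn_ge0// invr_ge0.
Unshelve. all: end_near.
Qed.

End staircase.

(** An open set is a countable union of boxes with rational centres and radii, so measurable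
    coordinates suffice. *)
Lemma measurable_rV (disp : measure_display) (T : measurableType disp) (R : realType)
    (d : nat) (f : T -> borel_rV R d) :
  (forall i, measurable_fun setT (fun x => (f x : 'rV[R]_d) ord0 i)) ->
  measurable_fun setT f.
Proof.
move=> mf; apply: (@measurability _ _ T (borel_rV R d) setT f (@open 'rV[R]_d)) => // _ [V oV <-].
rewrite setTI.
pose box (p : {ffun 'I_d -> rat} * rat) :=
  [set w : 'rV[R]_d | forall i, `|w ord0 i - ratr (p.1 i)| < ratr p.2].
have -> : f @^-1` V = \bigcup_p [set x | box p `<=` V /\ box p (f x)].
  apply/seteqP; split => [x /= Vfx|x [p _] /= [pV px]]; last exact: pV.
  have /nbhs_ballP[e /= e0 eV] := open_nbhs_nbhs (conj oV Vfx).
  have e2 : 0 < e / 2 by rewrite divr_gt0.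
  have [r /=] := rat_in_itvoo e2; rewrite in_itv/= => /andP[r0 re].
  have Ha i : exists a : rat, `|(f x : 'rV[R]_d) ord0 i - ratr a| < ratr r.
    have : (f x : 'rV[R]_d) ord0 i - ratr r < (f x : 'rV[R]_d) ord0 i + ratr r by lra.
    move=> /rat_in_itvoo[a]; rewrite in_itv/= => /andP[a1 a2]; exists a.
    by rewrite ltr_norml; apply/andP; split; lra.
  have [a aP] := choice Ha; exists ([ffun i => a i], r) => //=; split.
    move=> w /= wb; apply: eV; split => // i j; rewrite !ord1.
    have := wb j; have := aP j; rewrite ffunE /ball /= !ltr_norml => /andP[? ?] /andP[? ?].
    by apply/andP; split; lra.
  by move=> i; rewrite ffunE.
apply: countable_bigcupT_measurable => // p.
have [pV|pV] := pselect (box p `<=` V); last first.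
  by rewrite (_ : mkset _ = set0)//; apply/seteqP; split => // x /= [].
rewrite (_ : mkset _ = \bigcap_(i in [set: 'I_d])
   [set x | `|(f x : 'rV[R]_d) ord0 i - ratr (p.1 i)| < ratr p.2]); last first.
  by apply/seteqP; split => [x /= [_ H] i _|x /= H]; [exact: H|split => // i; exact: H].
apply: fin_bigcap_measurable; first exact: finite_finset.
move=> i _; rewrite -[X in measurable X]setTI (_ : mkset _ =
  (fun x => `|(f x : 'rV[R]_d) ord0 i - ratr (p.1 i)|) @^-1` `]-oo, ratr p.2[); last first.
  by apply/seteqP; split => x /=; rewrite in_itv.
have : measurable_fun setT (fun x => `|(f x : 'rV[R]_d) ord0 i - ratr (p.1 i)|).
  by apply: measurableT_comp => //; apply: measurable_funB.
by apply.
Qed.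

(** Twice the area of a triangle inscribed in the unit arc, with vertices in three separated height
    windows. Multiplying by $(a_0+a_1)(a_0+a_2)$ turns differences of the $a_j$ into differences of
    the $y_j^2$, and the gaps $1/10$, $1/10$ and $3/10$ between heights give the constant. *)
Lemma arc_det_ge (R : realType) (a0 a1 a2 y0 y1 y2 : R) :
  2^-1 <= a0 <= 1 -> 2^-1 <= a1 <= 1 -> 2^-1 <= a2 <= 1 ->
  a0 ^+ 2 = 1 - y0 ^+ 2 -> a1 ^+ 2 = 1 - y1 ^+ 2 -> a2 ^+ 2 = 1 - y2 ^+ 2 ->
  0 <= y0 <= 10^-1 -> 5^-1 <= y1 <= 5^-1 + 10^-1 -> 2 / 5 <= y2 <= 2 / 5 + 10^-1 ->
  3 / 2000 <= (a1 - a0) * (y2 - y0) - (a2 - a0) * (y1 - y0).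
Proof.
move=> /andP[l0 u0] /andP[l1 u1] /andP[l2 u2] e0 e1 e2 /andP[? ?] /andP[? ?] /andP[? ?].
set D := _ - _.
have a21 : a2 <= a1 by move: e1 e2; rewrite !expr2; nra.
have E : D * (a0 + a1) * (a0 + a2) = (y1 - y0) * (y2 - y0) *
    ((y2 + y0) * (a0 + a1) - (y1 + y0) * (a0 + a2)).
  have E1 : (a1 - a0) * (a0 + a1) = - ((y1 - y0) * (y1 + y0)) by move: e0 e1; rewrite !expr2; lra.
  have E2 : (a2 - a0) * (a0 + a2) = - ((y2 - y0) * (y2 + y0)) by move: e0 e2; rewrite !expr2; lra.
  rewrite (_ : D * _ * _ = ((a1 - a0) * (a0 + a1)) * ((y2 - y0) * (a0 + a2)) -
     ((a2 - a0) * (a0 + a2)) * ((y1 - y0) * (a0 + a1))); last by rewrite /D; ring.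
  by rewrite E1 E2; ring.
have G : (y2 - y1) * (a0 + a2) <= (y2 + y0) * (a0 + a1) - (y1 + y0) * (a0 + a2) by nra.
have H : 3 / 1000 * (a0 + a2) <= D * (a0 + a1) * (a0 + a2).
  rewrite E; apply: (@le_trans _ _ (3 / 100 * ((y2 - y1) * (a0 + a2)))); first by nra.
  have P3 : 3 / 100 <= (y1 - y0) * (y2 - y0) by nra.
  by apply: ler_pM => //; nra.
have H2 : 3 / 1000 <= D * (a0 + a1) by move: H; rewrite ler_pM2r//; lra.
have D0 : 0 <= D by rewrite leNgt; apply/negP => D0; nra.
nra.
Qed.

(** Cramer's rule: the centre $(p,q)$ solves a 2 by 2 system with right-hand side $O(e)$ and
    determinant at least $1/1000$, so it is $O(e)$-close to the origin. Comparing distances to the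
    reference point $(a,y)$, which is on the unit circle, gives the radius. *)
Lemma perturbed_radius (R : realType) (p q r e a y A1 B1 A2 B2 f1 f2 : R) :
  0 < e -> e <= 2000^-1 -> 1000^-1 <= A1 * B2 - A2 * B1 ->
  `|A1| <= 1 -> `|A2| <= 1 -> `|B1| <= 2^-1 -> `|B2| <= 2^-1 ->
  `|f1| <= 3 * e -> `|f2| <= 3 * e -> 0 <= a <= 1 -> 0 <= y <= 1 -> a ^+ 2 = 1 - y ^+ 2 ->
  2 * (p * A1 + q * B1) = f1 -> 2 * (p * A2 + q * B2) = f2 ->
  0 <= r -> (p - a) ^+ 2 + (q - y) ^+ 2 = r ^+ 2 -> `|r - 1| <= 20000 * e.
Proof.
move=> e0 e1 D A1b A2b B1b B2b f1e f2e ab yb ay F1 F2 r0 E0.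
set Dt := _ - _ in D.
have pD : 2 * p * Dt = f1 * B2 - f2 * B1 by rewrite -F1 -F2 /Dt; ring.
have qD : 2 * q * Dt = A1 * f2 - A2 * f1 by rewrite -F1 -F2 /Dt; ring.
have Dt0 : 0 <= Dt by move: D; clear; lra.
have small x K : `|2 * x * Dt| <= K -> `|x| <= 500 * K.
  rewrite 2!normrM (ger0_norm Dt0) ger0_norm// => H.
  have : `|x| * 1000^-1 <= `|x| * Dt by rewrite ler_wpM2l.
  by move: H; clear; lra.
have pe : `|p| <= 1500 * e.
  have : `|p| <= 500 * (3 * e); last by clear; lra.
  apply: small; rewrite pD; apply: le_trans (ler_normB _ _) _; rewrite !normrM.
  have : `|f1| * `|B2| <= 3 * e * 2^-1 by apply: ler_pM.
  have : `|f2| * `|B1| <= 3 * e * 2^-1 by apply: ler_pM.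
  by clear; lra.
have qe : `|q| <= 3000 * e.
  have : `|q| <= 500 * (6 * e); last by clear; lra.
  apply: small; rewrite qD; apply: le_trans (ler_normB _ _) _; rewrite !normrM.
  have : `|A1| * `|f2| <= 1 * (3 * e) by apply: ler_pM.
  have : `|A2| * `|f1| <= 1 * (3 * e) by apply: ler_pM.
  by clear; lra.
have r2 : r ^+ 2 - 1 = p * (p - 2 * a) + q * (q - 2 * y).
  by move: E0 ay; clear; rewrite !expr2; lra.
have near1 x t : 0 <= t <= 1 -> `|x| <= 3000 * e -> `|x - 2 * t| <= 4.
  move=> /andP[t0 t1] xe; apply: le_trans (ler_normB _ _) _.
  by rewrite (ger0_norm (mulr_ge0 _ t0))//; move: xe e1 t1; clear; lra.
have : `|r ^+ 2 - 1| <= 20000 * e.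
  rewrite r2; apply: le_trans (ler_normD _ _) _; rewrite !normrM.
  have : `|p| * `|p - 2 * a| <= 1500 * e * 4.
    by apply: ler_pM => //; apply: near1 => //; move: pe e0; clear; lra.
  have : `|q| * `|q - 2 * y| <= 3000 * e * 4.
    by apply: ler_pM => //; exact: near1.
  by move: e0; clear; lra.
apply: le_trans; rewrite (_ : r ^+ 2 - 1 = (r - 1) * (r + 1)); last by ring.
by rewrite normrM ler_peMr// ger0_norm ?lerDr ?addr_ge0.
Qed.

(** * Circumradius of three points on nearby unit arcs *)

Section translated_arcs.
Context (R : realType).
Implicit Types (w z : 'rV[R]_2) (a y : R).

Local Notation i1 := (lift ord0 (ord0 : 'I_1)).

Definition arc y : R := Num.sqrt (1 - y ^+ 2).

(** Abscissa of the centre, on the first axis, of the unit circle whose right half contains [w]. *)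
Definition offset w : R := w ord0 ord0 - arc (w ord0 i1).

Definition arc_point a y : 'rV[R]_2 := \row_i if i == ord0 then a + arc y else y.

Lemma arc_point0 a y : arc_point a y ord0 ord0 = a + arc y.
Proof. by rewrite mxE. Qed.

Lemma arc_point1 a y : arc_point a y ord0 i1 = y.
Proof. by rewrite mxE. Qed.

Lemma offset_arc_point a y : offset (arc_point a y) = a.
Proof. by rewrite /offset arc_point0 arc_point1 addrK. Qed.

Lemma eucl_dist2 w z :
  eucl_dist w z = Num.sqrt ((w ord0 ord0 - z ord0 ord0) ^+ 2 + (w ord0 i1 - z ord0 i1) ^+ 2).
Proof. by rewrite /eucl_dist !big_ord_recl big_ord0 addr0. Qed.

Lemma arc_spec y : 0 <= y <= 2^-1 -> 2^-1 <= arc y <= 1 /\ arc y ^+ 2 = 1 - y ^+ 2.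
Proof.
move=> /andP[y0 y1]; have a2 : arc y ^+ 2 = 1 - y ^+ 2.
  by rewrite sqr_sqrtr// expr2; nra.
have a0 : 0 <= arc y by exact: sqrtr_ge0.
by split => //; apply/andP; split; move: a2 a0; rewrite !expr2; nra.
Qed.

Lemma arc_lip y t : 0 <= y <= 2^-1 -> 0 <= t <= 2^-1 -> `|arc y - arc t| <= `|y - t|.
Proof.
move=> yb tb; have [/andP[ay _] ay2] := arc_spec yb; have [/andP[at' _] at'2] := arc_spec tb.
have E : (arc y - arc t) * (arc y + arc t) = (t - y) * (y + t).
  by move: ay2 at'2; rewrite !expr2; lra.
have s1 : 1 <= arc y + arc t by lra.
have s2 : 0 <= y + t <= 1 by case/andP: yb => ? ?; case/andP: tb => ? ?; apply/andP; split; lra.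
apply: (@le_trans _ _ (`|arc y - arc t| * (arc y + arc t))); first by rewrite ler_peMr.
rewrite -[X in _ * X]ger0_norm; last by lra.
rewrite -normrM E normrM distrC; case/andP: s2 => s20 s21.
by rewrite [X in _ * X]ger0_norm// ler_piMr.
Qed.

Lemma continuous_arc : continuous arc.
Proof.
move=> y; apply: (@continuous_comp _ _ _ (fun y : R => 1 - y ^+ 2)); last exact: sqrt_continuous.
by apply: cvgB; [exact: cvg_cst|exact: exprn_continuous].
Qed.

Lemma measurable_arc : measurable_fun setT arc.
Proof. by apply: continuous_measurable_fun; exact: continuous_arc. Qed.

(** All three points are within [e] of one unit arc, at separated heights. Their sphere equations
    give the system of [perturbed_radius], the unknown being the centre relative to that of the
    first point's arc. *)
Lemma circumradius_arc_points (x : 3.-tuple 'rV[R]_2) (G e : R) :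
  0 < e -> e <= 2000^-1 ->
  (forall i, G <= offset (tnth x i) < G + e) ->
  (forall i : 'I_3, i%:R / 5 <= tnth x i ord0 i1 <= i%:R / 5 + 10^-1) ->
  `|circumradius x - 1| <= 20000 * e.
Proof.
move=> e0 e1 Hx Hy.
pose j1 : 'I_3 := lift ord0 ord0; pose j2 : 'I_3 := lift ord0 (lift ord0 ord0).
pose y (j : 'I_3) := tnth x j ord0 i1; pose a j := arc (y j).
pose h j := offset (tnth x j) - offset (tnth x ord0).
pose B j := y j - y ord0; pose A j := a j + h j - a ord0.
have yb j : 0 <= y j <= 2^-1.
  have /andP[yl yu] := Hy j; apply/andP; split; first exact: le_trans yl.
  apply: le_trans yu _; have : (j%:R : R) <= 2 by rewrite ler_nat -ltnS.
  lra.
have [y0 y1 y2] : [/\ 0 <= y ord0 <= 10^-1, 5^-1 <= y j1 <= 5^-1 + 10^-1 &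
   2 / 5 <= y j2 <= 2 / 5 + 10^-1].
  have := Hy ord0; have := Hy j1; have := Hy j2.
  rewrite -/(y _) -/(y _) -/(y _).
  rewrite (_ : (j1 : nat) = 1%N)// (_ : (j2 : nat) = 2%N)//.
  by rewrite mul0r add0r mul1r.
have ab j := (arc_spec (yb j)).1; have ay j := (arc_spec (yb j)).2.
have ab01 j : 0 <= a j <= 1 by have /andP[al ->] := ab j; rewrite andbT; apply: le_trans al.
have he j : `|h j| <= e.
  rewrite /h; move: (Hx ord0) (Hx j); move: (offset _) (offset _) => o1 o2.
  by rewrite ler_norml => /andP[? ?] /andP[? ?]; apply/andP; lra.
have Bb j : `|B j| <= 2^-1.
  move: (yb ord0) (yb j); rewrite /B ler_norml => /andP[? ?] /andP[? ?].
  by apply/andP; lra.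
have Ab j : `|A j| <= 1.
  move: (ab ord0) (ab j) (he j); rewrite -/(a _) -/(a _) /A !ler_norml.
  by move=> /andP[? ?] /andP[? ?] /andP[? ?]; apply/andP; lra.
have hB i j : `|h i * B j| <= e * 2^-1 by rewrite normrM ler_pM.
(* Passing from a single arc to the translated ones changes the determinant by at most $e\le1/2000$,
   which leaves $3/2000-1/2000$. *)
have D : 1000^-1 <= A j1 * B j2 - A j2 * B j1.
  have := arc_det_ge (ab ord0) (ab j1) (ab j2) (ay ord0) (ay j1) (ay j2) y0 y1 y2.
  have := hB j1 j2; have := hB j2 j1; rewrite -!/(a _) -!/(B _) /A !ler_norml.
  move=> /andP[? ?] /andP[? ?]; rewrite [in X in _ -> X](_ : _ - _ =
    (a j1 - a ord0) * B j2 - (a j2 - a ord0) * B j1 + h j1 * B j2 - h j2 * B j1); last by ring.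
  lra.
have X j : tnth x j ord0 ord0 = offset (tnth x ord0) + (a j + h j).
  by rewrite /h /a /y /offset; ring.
have h0 : h ord0 = 0 by rewrite /h subrr.
have detx : \det (\matrix_(i < 3) homog (tnth x i)) != 0.
  apply/negP; rewrite -det_tr => /det0P[v v0 /matrixP vM].
  have eqn j : v ord0 ord0 + (v ord0 (lift ord0 ord0) * tnth x j ord0 ord0 +
      v ord0 (lift ord0 i1) * y j) = 0.
    have := vM ord0 j; rewrite !mxE !big_ord_recl big_ord0 addr0 !mxE.
    by rewrite unlift_none mulr1 !liftK.
  have dif j : v ord0 (lift ord0 ord0) * A j + v ord0 (lift ord0 i1) * B j = 0.
    have := eqn ord0; rewrite -[X in _ = X](eqn j) !X h0 /A /B; lra.
  have E1 : v ord0 (lift ord0 ord0) * (A j1 * B j2 - A j2 * B j1) = 0.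
    rewrite (_ : _ * _ = (v ord0 (lift ord0 ord0) * A j1 + v ord0 (lift ord0 i1) * B j1) * B j2
     - (v ord0 (lift ord0 ord0) * A j2 + v ord0 (lift ord0 i1) * B j2) * B j1); last by ring.
    by rewrite !dif !mul0r subrr.
  have E2 : v ord0 (lift ord0 i1) * (A j1 * B j2 - A j2 * B j1) = 0.
    rewrite (_ : _ * _ = (v ord0 (lift ord0 ord0) * A j2 + v ord0 (lift ord0 i1) * B j2) * A j1
     - (v ord0 (lift ord0 ord0) * A j1 + v ord0 (lift ord0 i1) * B j1) * A j2); last by ring.
    by rewrite !dif !mul0r subrr.
  have Dn0 : A j1 * B j2 - A j2 * B j1 != 0.
    by apply: lt0r_neq0; apply: lt_le_trans D; rewrite invr_gt0 ltr0n.
  have v1 : v ord0 (lift ord0 ord0) = 0.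
    by apply/eqP; move/eqP: E1; rewrite mulf_eq0 (negbTE Dn0) orbF.
  have v2 : v ord0 (lift ord0 i1) = 0.
    by apply/eqP; move/eqP: E2; rewrite mulf_eq0 (negbTE Dn0) orbF.
  have v00 : v ord0 ord0 = 0 by have := eqn ord0; rewrite v1 v2 !mul0r !addr0.
  move/eqP: v0; apply; apply/matrixP => i j; rewrite ord1 mxE.
  case: (unliftP ord0 j) => [j' ->|->//]; case: (unliftP ord0 j') => [j'' ->|->//].
  by rewrite (ord1 j'').
have [r0 [c cx]] := circumradius_sphere (circumradius_neq0 (isT : (0 < 2)%N) detx).
pose p := c ord0 ord0 - offset (tnth x ord0); pose q := c ord0 i1.
have E j : (p - (a j + h j)) ^+ 2 + (q - y j) ^+ 2 = circumradius x ^+ 2.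
  rewrite -(cx j) eucl_dist2 sqr_sqrtr ?addr_ge0 ?sqr_ge0// X -/(y j) /p /q; ring.
have E0 : (p - a ord0) ^+ 2 + (q - y ord0) ^+ 2 = circumradius x ^+ 2.
  by rewrite -(E ord0) h0 addr0.
(* Subtracting two sphere equations cancels $p^2+q^2$, and $a_j^2+y_j^2=1$ cancels the main terms
   that remain. *)
have F j : 2 * (p * A j + q * B j) = 2 * h j * a j + h j ^+ 2.
  have := ay ord0; have := ay j; have := E0; rewrite -(E j) -!/(a _) /A /B !expr2; lra.
have fe j : `|2 * h j * a j + h j ^+ 2| <= 3 * e.
  apply: le_trans (ler_normD _ _) _; rewrite normrM (normrM 2) normrX expr2.
  have ha : `|h j| * `|a j| <= e * 1.
    by apply: ler_pM => //; have /andP[al au] := ab01 j; rewrite ger0_norm.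
  have hh : `|h j| * `|h j| <= e * 1.
    by apply: ler_pM => //; apply: le_trans (he j) (le_trans e1 _); lra.
  by rewrite ger0_norm//; move: ha hh; rewrite -mulrA; lra.
have y01 : 0 <= y ord0 <= 1 by have /andP[? ?] := y0; apply/andP; lra.
exact: (perturbed_radius e0 e1 D (Ab j1) (Ab j2) (Bb j1) (Bb j2) (fe j1) (fe j2)
  (ab01 ord0) y01 (ay ord0) (F j1) (F j2) (ltW r0) E0).
Qed.

End translated_arcs.

(** * Lower bound for Hausdorff dimension *)

Section mass_distribution.
Context (R : realType) (d : nat).
Implicit Types (E : set 'rV[R]_d).

Lemma eucl_diam_le (A : set 'rV[R]_d) (D : R) : 0 <= D ->
  (forall x y, A x -> A y -> eucl_dist x y <= D) -> (eucl_diam A <= D%:E)%E.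
Proof.
move=> D0 AD; apply: ge_ereal_sup => _ [->|[x Ax [y Ay <-]]]; rewrite lee_fin//.
exact: AD.
Qed.

Lemma eucl_diam_ge (A : set 'rV[R]_d) x y : A x -> A y ->
  ((eucl_dist x y)%:E <= eucl_diam A)%E.
Proof. by move=> Ax Ay; apply: ereal_sup_ubound; right; exists x => //; exists y. Qed.

Lemma eucl_diam_ge0 (A : set 'rV[R]_d) : (0 <= eucl_diam A)%E.
Proof. by apply: ereal_sup_ubound; left. Qed.

(** Mass distribution principle: a nonempty set of diameter $0<D\le1$ lies in a ball of radius $2D$,
    of mass at most $KD^s\le KD^t$ if $t<s$. Summing over a cover bounds the content from below, so
    no such [t] has measure zero. *)
Lemma hausdorff_dim_ge E (s : R) (nu : probability (borel_rV R d) R) :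
  0 < s -> measurable (E : set (borel_rV R d)) -> frostman E s nu ->
  (s%:E <= hausdorff_dim E)%E.
Proof.
move=> s0 mE nuE; have nE : nu E = 1%E.
  have := probability_setC nu (A := ~` E) (measurableC mE); rewrite setCK => ->.
  by case: nuE => -> _; rewrite sube0.
have [|A A0 gnu] := @frostman_growth _ _ _ _ s _ _ nuE; first by rewrite ltW//=.
apply: le_ereal_inf_tmp => _ [t [t0 Ht] <-]; rewrite lee_fin leNgt; apply/negP => ts.
pose K := A * 2 `^ s; have K0 : 0 <= K by rewrite mulr_ge0// powR_ge0.
(* [K + 1] rather than [K], since only $0\le K$ is known. *)
have : ((K + 1)^-1%:E <= hausdorff_content t 1 E)%E.
  apply: le_ereal_inf_tmp => _ [U [EU U1] <-].
  have HV k : exists V : set (borel_rV R d), [/\ measurable V, U k `<=` V &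
      (nu V <= K%:E * eucl_diam (U k) `^ t)%E].
    have [U0|/set0P[x Ux]] := eqVneq (U k) set0.
      exists set0; split; [exact: measurable0|by rewrite U0|].
      by rewrite measure0 mule_ge0 ?lee_fin ?poweR_ge0.
    have [D D0 UD] : exists2 D, 0 <= D & eucl_diam (U k) = D%:E.
      have f : eucl_diam (U k) \is a fin_num.
        by rewrite ge0_fin_numE ?eucl_diam_ge0//; apply: le_lt_trans (U1 k) (ltry _).
      by exists (fine (eucl_diam (U k))); rewrite ?fineK// fine_ge0// eucl_diam_ge0.
    pose V := [set y : borel_rV R d | eucl_dist x (y : 'rV[R]_d) <= D].
    have mV : measurable V.
      rewrite -[X in measurable X]setTI (_ : V =
        (fun y : borel_rV R d => eucl_dist x (y : 'rV[R]_d)) @^-1` `]-oo, D]); last first.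
        by apply/seteqP; split => y /=; rewrite in_itv.
      have := @measurable_eucl_dist _ _ _ (borel_rV R d) (fun=> x) id.
      by apply.
    have VB r : D < r -> (nu V <= (A * r `^ s)%:E)%E.
      move=> Dr; apply: le_trans (gnu x r (le_lt_trans D0 Dr)).
      apply: le_measure; rewrite ?inE//.
        exact: (@measurable_eucl_dist_lt _ _ _ _ (fun=> x) id).
      by move=> y /= yD; exact: le_lt_trans Dr.
    exists V; split => //.
      by move=> y Uy; rewrite /V /= -lee_fin -UD; exact: eucl_diam_ge.
    rewrite UD poweR_EFin -EFinM.
    have fV : nu V \is a fin_num by exact: fin_num_measure.
    (* For diameter 0 the ball of radius $2D$ degenerates; the closed ball of radius 0 is null by
       letting the radius tend to 0. *)
    have [D00|Dn0] := eqVneq D 0.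
      have -> : nu V = 0%E.
        rewrite -(fineK fV); congr EFin; apply: (@eq0_le_powR _ _ A s) => //.
          exact: fine_ge0.
        by move=> r /andP[r0 _]; rewrite -lee_fin fineK//; apply: VB; rewrite D00.
      by rewrite lee_fin mulr_ge0// powR_ge0.
    have Dp : 0 < D by rewrite lt_neqAle eq_sym Dn0.
    apply: le_trans (VB (2 * D) _) _; first by lra.
    rewrite lee_fin powRM// mulrA ler_wpM2l//; apply: ger_powR; last exact: ltW.
    by rewrite Dp -lee_fin -UD; exact: U1.
  have [V VP] := choice HV.
  have EV : (1 <= K%:E * \sum_(0 <= k <oo) eucl_diam (U k) `^ t)%E.
    rewrite -nE -nneseriesZl; last by move=> k _; exact: poweR_ge0.
    apply: (@le_trans _ _ (\sum_(0 <= k <oo) nu (V k))%E).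
      apply: measure_sigma_subadditive => //; first by move=> k; case: (VP k).
      by apply: subset_trans EU _ => x [k _ Ux]; exists k => //; case: (VP k) => _ + _; apply.
    by apply: lee_nneseries => // k _; case: (VP k).
  have : (0 <= \sum_(0 <= k <oo) eucl_diam (U k) `^ t)%E.
    by apply: nneseries_ge0 => k _ _; exact: poweR_ge0.
  move: EV; case: (limn _) => [S| |]; rewrite ?leey//.
  rewrite -EFinM !lee_fin => KS S0; rewrite -[leLHS]mul1r ler_pdivrMr ?ltr_wpDl//.
  by rewrite mulrDr mulr1 mulrC (le_trans KS)// lerDl.
move=> /le_trans; have le0 : (hausdorff_content t 1 E <= 0)%E.
  by rewrite -Ht; apply: ereal_sup_ubound; exists 1 => //; exact: ltr01.
move=> /(_ _ le0); rewrite lee_fin leNgt invr_gt0 ltr_wpDl//.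
Qed.

End mass_distribution.

(** * The compact set of translated arcs *)

Section arc_set.
Context (R : realType) (M : nat).
Hypothesis M0 : (0 < M)%N.
Implicit Types (w : 'rV[R]_2) (u y : R) (n j : nat).

Local Notation i1 := (lift ord0 (ord0 : 'I_1)).
Local Notation m := (M%:R : R).
Local Notation scale := (scale R M).

Definition step n j : R := staircase M (j%:R / m ^+ n).

Definition arc_layer n : set 'rV[R]_2 := [set w : 'rV[R]_2 |
  0 <= w ord0 i1 <= 2^-1 /\ exists2 j, (j <= M ^ n)%N & step n j <= offset w <= step n j + scale n].

Definition arc_set : set 'rV[R]_2 := \bigcap_n arc_layer n.

Let m0 n : 0 < m ^+ n. Proof. by rewrite exprn_gt0// ltr0n. Qed.

Lemma step_level n u : 0 <= u ->
  step n (level M n u) <= staircase M u < step n (level M n u) + scale n.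
Proof.
move=> u0; have lu : 0 <= (level M n u)%:R / m ^+ n <= u.
  rewrite divr_ge0 ?(ltW (m0 n))//= ler_pdivrMr; last exact: m0.
  by rewrite mulrC; have /andP[] := levelP M n u0.
apply/andP; split; first by apply: staircase_le => //; case/andP: lu.
by apply: staircase_close => //; rewrite level_natl.
Qed.

Lemma step_gap n j j' : (j < j')%N -> step n j + scale n <= step n j'.
Proof. by move=> jj; apply: staircase_gap => //; rewrite !level_natl. Qed.

Lemma arc_set_point u y : 0 <= u <= 1 -> 0 <= y <= 2^-1 ->
  arc_set (arc_point (staircase M u) y).
Proof.
move=> /andP[u0 u1] yb n _; split; first by rewrite arc_point1.
rewrite offset_arc_point; exists (level M n u).
  rewrite -(@ler_nat R) natrX; have /andP[/le_trans + _] := levelP M n u0; apply.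
  by rewrite ler_piMr// ltW.
by have /andP[-> /ltW ->] := step_level n u0.
Qed.

Lemma continuous_offset : continuous (@offset R).
Proof.
move=> w; apply: (@continuousB _ _ _ (fun w : 'rV[R]_2 => w ord0 ord0)
  (fun w : 'rV[R]_2 => arc (w ord0 i1))); first exact: (@coord_continuous R 1 2 ord0 ord0 w).
apply: (@continuous_comp _ _ _ (fun w : 'rV[R]_2 => w ord0 i1)).
  exact: (@coord_continuous R 1 2 ord0 i1 w).
exact: continuous_arc.
Qed.

Lemma closed_arc_layer n : closed (arc_layer n).
Proof.
rewrite (_ : arc_layer n = [set w : 'rV[R]_2 | w ord0 i1 \in `[0, 2^-1]] `&`
  \bigcup_(j in `I_(M ^ n).+1) (@offset R @^-1` `[step n j, step n j + scale n])); last first.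
  apply/seteqP; split => w /=; rewrite in_itv/=.
    by move=> [wy [j jM wj]]; split => //; exists j => //=; rewrite in_itv.
  by move=> [wy [j jM]]; rewrite /= in_itv => wj; split => //; exists j.
apply: closedI.
  by apply: (@preimage_closed _ _ (fun w : 'rV[R]_2 => w ord0 i1) `[0, 2^-1]%classic);
    [move=> w _; exact: (@coord_continuous R 1 2 ord0 i1 w)|exact: interval_closed].
apply: closed_bigcup => [|j _]; first exact: finite_II.
by apply: preimage_closed; [move=> w _; exact: continuous_offset|exact: interval_closed].
Qed.

Lemma closed_arc_set : closed arc_set.
Proof. by apply: closed_bigI => n _; exact: closed_arc_layer. Qed.

Lemma compact_arc_set : compact arc_set.
Proof.
pose L := `|step 0 0| + `|step 0 1| + scale 0 + 1.
have L1 : 1 <= L by rewrite lerDr addr_ge0// ltW// scale_gt0.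
apply: (@subclosed_compact _ _ [set w : 'rV[R]_2 | forall i, `[- L, L]%classic (w ord0 i)]).
- exact: closed_arc_set.
- by apply: (@rV_compact _ _ (fun=> `[- L, L]%classic)) => i; exact: segment_compact.
move=> w Ew i /=; rewrite in_itv/=.
have [yb [j jM /andP[g1 g2]]] := Ew 0%N I.
have [/andP[a1 a2] _] := arc_spec yb.
case: (unliftP ord0 i) => [i' ->|->].
  by rewrite (ord1 i'); case/andP: yb => y0 y1; apply/andP; lra.
rewrite -ler_norml -[w ord0 ord0](subrK (arc (w ord0 i1))) -/(offset w).
have s01 : step 0 j <= step 0 1.
  by apply: staircase_le => //; rewrite expr0 !divr1 ler_nat.
have s00 : step 0 0 <= step 0 j.
  by apply: staircase_le => //; rewrite expr0 !divr1 ler_nat.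
have := ler_norm (step 0 1); have := ler_norm (- step 0 0); rewrite normrN => n0 n1.
have := normr_ge0 (step 0 0); have := normr_ge0 (step 0 1); have := scale_gt0 R M0 0.
by rewrite ler_norml /L => ? ? ?; apply/andP; lra.
Qed.

Lemma arc_layer_cover n (w : 'rV[R]_2) : arc_layer n w ->
  exists j k, [/\ (j <= M ^ n)%N, (k <= (4 * M ^ 2) ^ n)%N,
    step n j <= offset w <= step n j + scale n &
    k%:R * scale n <= w ord0 i1 <= k%:R * scale n + scale n].
Proof.
move=> [/andP[y0 y1] [j jM oj]]; have sp := scale_gt0 R M0 n.
have ds : 0 <= w ord0 i1 / scale n by rewrite divr_ge0// ltW.
exists j, (Num.truncn (w ord0 i1 / scale n)); have /andP[t1 t2] := truncn_itv ds; split => //.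
  rewrite -(ler_nat R); apply: le_trans t1 _.
  rewrite ler_pdivrMr// /scale natrX natrM natrX mulfV; first by lra.
  by rewrite expf_neq0// mulf_neq0// expf_neq0// pnatr_eq0 -lt0n.
rewrite -ler_pdivlMr// t1 /= -[X in _ + X]mul1r -mulrDl -ler_pdivrMr//.
by rewrite natr1 ltW.
Qed.

(** The arc is 1-Lipschitz on the heights considered, so the coordinates differ by at most 2 and 1
    scales, and $\sqrt5\le3$. *)
Lemma eucl_dist_cell n (w z : 'rV[R]_2) (G H : R) :
  0 <= w ord0 i1 <= 2^-1 -> 0 <= z ord0 i1 <= 2^-1 ->
  G <= offset w <= G + scale n -> G <= offset z <= G + scale n ->
  H <= w ord0 i1 <= H + scale n -> H <= z ord0 i1 <= H + scale n ->
  eucl_dist w z <= 3 * scale n.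
Proof.
move=> wb zb; have al := arc_lip wb zb.
move=> /andP[? ?] /andP[? ?] /andP[? ?] /andP[? ?].
have sp := ltW (scale_gt0 R M0 n).
have dy : `|w ord0 i1 - z ord0 i1| <= scale n by rewrite ler_norml; apply/andP; lra.
have dx : `|w ord0 ord0 - z ord0 ord0| <= 2 * scale n.
  have : `|offset w - offset z| <= scale n by rewrite ler_norml; apply/andP; lra.
  move: (le_trans al dy); rewrite /offset !ler_norml => /andP[? ?] /andP[? ?]; apply/andP; lra.
rewrite eucl_dist2 -(ger0_norm (mulr_ge0 _ sp : 0 <= 3 * scale n))// -sqrtr_sqr.
rewrite ler_wsqrtr// exprMn.
have : (w ord0 ord0 - z ord0 ord0) ^+ 2 <= (2 * scale n) ^+ 2.
  by rewrite -(real_normK (num_real (_ - _))) lerXn2r ?nnegrE ?mulr_ge0.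
have : (w ord0 i1 - z ord0 i1) ^+ 2 <= scale n ^+ 2.
  by rewrite -(real_normK (num_real (_ - _))) lerXn2r ?nnegrE.
have := exprn_ge0 2 sp; rewrite exprMn; move: (_ ^+ 2) (_ ^+ 2) (_ ^+ 2) => t1 t2 t3; lra.
Qed.

End arc_set.

Lemma near_geometric_le (R : realType) (C z e : R) : 0 <= z < 1 -> 0 < e ->
  \forall n \near \oo, C * z ^+ n <= e.
Proof.
move=> /andP[z0 z1] e0; have := @cvg_geometric R C z; rewrite ger0_norm// => /(_ z1).
move=> /cvgrPdist_le /(_ _ e0); apply: filterS => n; rewrite /geometric /= sub0r normrN.
exact: le_trans (ler_norm _).
Qed.

Lemma nneseries_le_bounded (R : realType) (f : nat -> \bar R) (c : R) (B : nat) :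
  (forall k, 0 <= f k)%E -> 0 <= c -> (forall k, (k < B)%N -> (f k <= c%:E)%E) ->
  (forall k, (B <= k)%N -> f k = 0%E) -> (\sum_(0 <= k <oo) f k <= (B%:R * c)%:E)%E.
Proof.
move=> f0 c0 fc fB; apply: lime_le; first by apply: is_cvg_nneseries => n _ _; exact: f0.
near=> K; apply: (@le_trans _ _ ((minn K B)%:R * c)%:E); last first.
  by rewrite lee_fin ler_wpM2r// ler_nat geq_minr.
elim: (K) => [|k IH]; first by rewrite big_geq// min0n mul0r.
rewrite big_nat_recr//=; have [kB|Bk] := ltnP k B.
  move: IH; rewrite (minn_idPl (ltnW kB)) (minn_idPl kB) -natr1 mulrDl mul1r EFinD => IH.
  by apply: leeD => //; exact: fc.
by move: IH; rewrite (minn_idPr Bk) (minn_idPr (leqW Bk)) fB// adde0.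
Unshelve. all: end_near.
Qed.

(** * Upper bound for the dimension of the arc set *)

Section hausdorff_dim_arc_set.
Context (R : realType) (M : nat) (b : R).
Hypotheses (M0 : (0 < M)%N) (b0 : 0 < b) (Mb : M%:R < (4 * M%:R ^+ 2) `^ b).

Local Notation i1 := (lift ord0 (ord0 : 'I_1)).
Local Notation m := (M%:R : R).
Local Notation scale := (scale R M).
Local Notation E := (@arc_set R M).
Local Notation t := (1 + b).

Let m1 : 1 <= m. Proof. by rewrite ler1n. Qed.

Let N0 : 0 < 4 * m ^+ 2.
Proof. by rewrite mulr_gt0// exprn_gt0// (lt_le_trans _ m1). Qed.

Let rho := m / (4 * m ^+ 2) `^ b.

Let rho01 : 0 <= rho < 1.
Proof.
rewrite divr_ge0 ?powR_ge0//= ltr_pdivrMr ?powR_gt0// mul1r; exact: Mb.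
Qed.

Lemma scale_powR (c : R) n : scale n `^ c = ((4 * m ^+ 2) `^ c) ^- n.
Proof.
rewrite /scale -powR_inv1 ?exprn_ge0 ?(ltW N0)// -powRrM mulN1r powRN; congr (_^-1).
by rewrite powR_exprn// ltW.
Qed.

Let cell n (p : nat * nat) : set 'rV[R]_2 := [set w : 'rV[R]_2 | [/\ 0 <= w ord0 i1 <= 2^-1,
  step R M n p.1 <= offset w <= step R M n p.1 + scale n &
  p.2%:R * scale n <= w ord0 i1 <= p.2%:R * scale n + scale n]].

(** A pair of indices is coded as one number by division with remainder; the successors appear
    because both index ranges are inclusive. *)
Let cells n k : set 'rV[R]_2 :=
  if (k < (M ^ n).+1 * ((4 * M ^ 2) ^ n).+1)%N
  then cell n (k %% (M ^ n).+1, k %/ (M ^ n).+1)%N else set0.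

Let cells_cover n : E `<=` \bigcup_k cells n k.
Proof.
move=> w Ew; have [yb _] := Ew n I.
have [j [k [jM kN oj yk]]] := arc_layer_cover M0 (Ew n I).
exists (k * (M ^ n).+1 + j)%N => //; rewrite /cells ifT; last first.
  apply: (@leq_trans (k * (M ^ n).+1 + (M ^ n).+1)%N); first by rewrite ltn_add2l ltnS.
  by rewrite addnC -mulSn mulnC leq_mul2l ltnS kN orbT.
by rewrite modnMDl modn_small// divnMDl// divn_small// addn0.
Qed.

Let cells_diam n k : (eucl_diam (cells n k) <= (3 * scale n)%:E)%E.
Proof.
have s0 := ltW (scale_gt0 R M0 n).
apply: eucl_diam_le; first by rewrite mulr_ge0.
rewrite /cells; case: ifP => // _ x y [x1 x2 x3] [y1 y2 y3].
by rewrite /= in x2 x3 y2 y3; apply: (eucl_dist_cell M0 x1 y1 x2 y2 x3 y3).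
Qed.

Let C := 4 * 3 `^ t.

Let t0 : 0 < t. Proof. by rewrite ltr_wpDl. Qed.

(** With $N=4M^2$, at most $4M^nN^n$ cells of diameter at most $3N^{-n}$ give
    $4\cdot3^t(MN^{-b})^n$, a convergent geometric sequence by the choice of [b]. *)
Let cells_sum n : (\sum_(0 <= k <oo) eucl_diam (cells n k) `^ t <= (C * rho ^+ n)%:E)%E.
Proof.
have s0 := ltW (scale_gt0 R M0 n).
apply: (@le_trans _ _ (((M ^ n).+1 * ((4 * M ^ 2) ^ n).+1)%:R * (3 * scale n) `^ t)%:E).
  apply: nneseries_le_bounded => [k||k _|k kB].
  - exact: poweR_ge0.
  - exact: powR_ge0.
  - rewrite -poweR_EFin; apply: gt0_ler_poweR; rewrite ?(ltW t0)//.
    + by rewrite in_itv/= eucl_diam_ge0 leey.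
    + by rewrite in_itv/= leey andbT lee_fin mulr_ge0.
  - rewrite /cells ltnNge kB /=.
    have -> : eucl_diam (set0 : set 'rV[R]_2) = 0%:E.
      by apply/eqP; rewrite eq_le eucl_diam_ge0 andbT; exact: eucl_diam_le.
    by rewrite poweR_EFin powR0// gt_eqF.
have sE : scale n `^ t = scale n * scale n `^ b.
  by rewrite powRD ?(gt_eqF (scale_gt0 R M0 n)) ?implybT// powRr1.
rewrite lee_fin powRM// sE scale_powR /C natrM.
have Mn : ((M ^ n).+1%:R : R) <= 2 * m ^+ n.
  by rewrite -natrX -natrM ler_nat mul2n -addnn -addn1 leq_add2l expn_gt0 M0.
have Nn : (((4 * M ^ 2) ^ n).+1%:R : R) <= 2 * (4 * m ^+ 2) ^+ n.
  have -> : 2 * (4 * m ^+ 2) ^+ n = (2 * (4 * M ^ 2) ^ n)%:R by rewrite !(natrM, natrX).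
  by rewrite ler_nat mul2n -addnn -addn1 leq_add2l expn_gt0 muln_gt0 expn_gt0 M0.
apply: (@le_trans _ _ (2 * m ^+ n * (2 * (4 * m ^+ 2) ^+ n) *
   (3 `^ t * (scale n * ((4 * m ^+ 2) `^ b) ^- n)))).
  apply: ler_wpM2r; last by apply: ler_pM.
  by rewrite !mulr_ge0 ?powR_ge0// invr_ge0 exprn_ge0// powR_ge0.
have sN : (4 * m ^+ 2) ^+ n * scale n = 1.
  by rewrite /scale mulfV// expf_neq0// gt_eqF.
rewrite /rho expr_div_n; set q := (_ ^+ n)^-1; set p := 3 `^ t.
rewrite (_ : _ * _ = 4 * p * (m ^+ n * q) * ((4 * m ^+ 2) ^+ n * scale n)); last by ring.
by rewrite sN mulr1.
Qed.

Lemma hausdorff_dim_arc_set_le : (hausdorff_dim E <= t%:E)%E.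
Proof.
apply: ereal_inf_lbound; exists t => //; split => //.
apply/eqP; rewrite eq_le; apply/andP; split; last first.
  apply: (@le_trans _ _ (hausdorff_content t 1 E)).
    by apply: le_ereal_inf_tmp => _ [U _ <-]; apply: nneseries_ge0 => k _ _; exact: poweR_ge0.
  by apply: ereal_sup_ubound; exists 1 => //; exact: ltr01.
apply: ge_ereal_sup => _ [dl dl0 <-]; apply/lee_addgt0Pr => e e0; rewrite add0e.
have z0 : 0 <= (4 * m ^+ 2)^-1 < 1.
  rewrite invr_ge0 (ltW N0)/= invf_lt1//.
  have : 1 <= m ^+ 2 by exact: exprn_ege1.
  by lra.
have [n [sn rn]] : exists n, 3 * scale n <= dl /\ C * rho ^+ n <= e.
  near \oo => n; exists n; split; near: n; last exact: near_geometric_le.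
  rewrite /scale; under eq_near do rewrite -exprVn.
  exact: near_geometric_le.
apply: le_trans (_ : (C * rho ^+ n)%:E <= _)%E; last by rewrite lee_fin.
apply: le_trans (cells_sum n); apply: ereal_inf_lbound; exists (cells n) => //; split.
  exact: cells_cover.
by move=> k; apply: le_trans (cells_diam n k) _; rewrite lee_fin.
Unshelve. all: end_near.
Qed.

End hausdorff_dim_arc_set.

Section uniform01.
Context (R : realType).

Lemma uniform01E (A : set (measurableTypeR R)) : measurable A ->
  uniform_prob (@ltr01 R) A = lebesgue_measure (A `&` `[0, 1]%classic).
Proof.
move=> mA; rewrite /uniform_prob.
have -> : lebesgue_measure (A `&` `[0, 1]%classic) =
    (\int[lebesgue_measure]_(x in A) (\1_(`[0, 1]%classic : set (measurableTypeR R)) x)%:E)%E.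
  by rewrite integral_indic//= setIC.
apply: eq_integral => x _; rewrite /uniform_pdf indicE subr0 invr1.
by rewrite mem_setE in_itv/=; case: ifP.
Qed.

Lemma uniform01_diam_le (A : set (measurableTypeR R)) (D : R) : measurable A -> 0 <= D ->
  (forall t u : R, A t -> A u -> 0 <= t <= 1 -> 0 <= u <= 1 -> `|t - u| <= D) ->
  (uniform_prob (@ltr01 R) A <= (2 * D)%:E)%E.
Proof.
move=> mA D0 AD; rewrite uniform01E//; apply: lebesgue_measure_diam_le => //.
  by apply: measurableI.
move=> t u [At] /= ti [Au] /= ui; exact: AD.
Qed.

Lemma uniform01_itv (a b : R) : 0 <= a -> a <= b -> b <= 1 ->
  uniform_prob (@ltr01 R) (`[a, b[%classic) = (b - a)%:E.
Proof.
move=> a0 ab b1; rewrite uniform01E// setIidl; last first.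
  move=> x /=; rewrite !in_itv/= => /andP[ax xb]; apply/andP; lra.
rewrite lebesgue_measure_itv/= lte_fin; have [ab'|ba] := ltP a b; first by rewrite EFinB.
by rewrite (@le_anti _ _ a b) ?ab// subrr.
Qed.

End uniform01.

(** * The measure on the translated arcs *)

Section arc_measure.
Context (R : realType) (M : nat).
Local Notation i1 := (lift ord0 (ord0 : 'I_1)).
Local Notation m := (M.+1%:R : R).
Local Notation scale := (scale R M.+1).
Local Notation U := (uniform_prob (@ltr01 R)).

Definition arc_map (p : measurableTypeR R * measurableTypeR R) : borel_rV R 2 :=
  arc_point (staircase M.+1 p.2) (p.1 / 2).

Lemma measurable_arc_map : measurable_fun setT arc_map.
Proof.
have m1 : measurable_fun setT (fun p : measurableTypeR R * measurableTypeR R => p.1 / 2).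
  by apply: measurable_funM => //; exact: measurable_fst.
apply: measurable_rV => i; case: (unliftP ord0 i) => [i' ->|->].
  rewrite (ord1 i') (_ : (fun p => _) = fun p => p.1 / 2)//.
  by apply/funext => p; rewrite /arc_map arc_point1.
rewrite (_ : (fun p => _) = fun p => staircase M.+1 p.2 + arc (p.1 / 2)); last first.
  by apply/funext => p; rewrite /arc_map arc_point0.
apply: measurable_funD.
  apply: (measurableT_comp (measurable_staircase (isT : (0 < M.+1)%N))).
  exact: measurable_snd.
exact: (measurableT_comp (@measurable_arc R)).
Qed.

HB.instance Definition _ := isMeasurableFun.Build _ _ _ _ arc_map measurable_arc_map.

Definition arc_measure : probability (borel_rV R 2) R :=
  distribution (U \x U)%E arc_map.

Lemma measurable_arc_set : measurable (@arc_set R M.+1 : set (borel_rV R 2)).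
Proof.
rewrite -[arc_set _]setCK; apply: measurableC; apply: sub_sigma_algebra.
by apply: closed_openC; exact: closed_arc_set.
Qed.

Lemma arc_measure_ge (A : set (borel_rV R 2)) (a b c e : R) : measurable A ->
  0 <= a -> a <= b -> b <= 1 -> 0 <= c -> c <= e -> e <= 1 ->
  (forall v u, a <= v < b -> c <= u < e -> A (arc_point (staircase M.+1 u) (v / 2))) ->
  (((b - a) * (e - c))%:E <= arc_measure A)%E.
Proof.
move=> mA a0 ab b1 c0 ce e1 H.
apply: (@le_trans _ _ ((U \x U)%E (`[a, b[%classic `*` `[c, e[%classic))).
  by rewrite product_measure1E//= !uniform01_itv// EFinM.
apply: le_measure; rewrite ?inE.
- exact: measurableX.
- by rewrite -[X in measurable X]setTI; exact: measurable_arc_map.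
- move=> [v u] /= [vb ue]; rewrite /arc_map /=; apply: H; [move: vb|move: ue]; by rewrite in_itv.
Qed.

Lemma arc_measure_setC : arc_measure (~` @arc_set R M.+1) = 0%E.
Proof.
have mE := measurable_arc_set; rewrite probability_setC//.
have -> : arc_measure (@arc_set R M.+1) = 1%E; last by rewrite subee.
apply/eqP; rewrite eq_le probability_le1//=.
have := @arc_measure_ge (@arc_set R M.+1) 0 1 0 1 mE (lexx 0) ler01 (lexx 1)
  (lexx 0) ler01 (lexx 1).
rewrite !subr0 mul1r; apply => v u /andP[v0 v1] /andP[u0 u1].
by apply: arc_set_point => //; apply/andP; lra.
Qed.

(** Take the first stage $n+1$ with scale at most [r]. Values closer than $r<scale(n)$ share level
    [n] by [staircase_gap], so [u] and [v] differ by at most $m^{-n}$, which is [m] times the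
    [al]-th power of the scale of stage $n+1$. *)
Lemma staircase_dist (al : R) u v (r : R) : (4 * m ^+ 2) `^ al = m -> 0 <= al -> 0 < r ->
  0 <= u <= 1 -> 0 <= v <= 1 -> `|staircase M.+1 u - staircase M.+1 v| < r ->
  `|u - v| <= m * r `^ al.
Proof.
move=> Nal al0 r0 ub vb uv.
have M0 : (0 < M.+1)%N by [].
have m1 : 1 <= m by rewrite ler1n.
have [r1|r1] := leP 1 r.
  apply: (@le_trans _ _ (1 * 1)).
    by rewrite mulr1 ler_norml; case/andP: ub => ? ?; case/andP: vb => ? ?; apply/andP; lra.
  apply: ler_pM => //; have := @ge0_ler_powR _ al al0 1 r; rewrite !nnegrE powR1; apply => //.
  exact: ltW.
have exn : exists n, scale n <= r.
  have z0 : 0 <= (4 * m ^+ 2)^-1 < 1.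
    have : 1 <= m ^+ 2 by exact: exprn_ege1.
    by rewrite invr_ge0 mulr_ge0 ?exprn_ge0//= => ?; rewrite invf_lt1; lra.
  have [n _ Hn] := near_geometric_le 1 z0 r0.
  by exists n; have := Hn n (leqnn n); rewrite mul1r exprVn.
case: (ex_minnP exn) => -[|n] rn nmin.
  by move: rn; rewrite /scale expr0 invr1 => /(lt_le_trans r1); rewrite ltxx.
have rn' : r < scale n by rewrite ltNge; apply/negP => /nmin; rewrite ltnn.
have Lev : level M.+1 n u = level M.+1 n v.
  move: uv; rewrite ltr_norml => /andP[g1 g2].
  case: (ltngtP (level M.+1 n u) (level M.+1 n v)) => // L.
    by have G := staircase_gap M0 L; exfalso; lra.
  by have G := staircase_gap M0 L; exfalso; lra.
have /andP[u0 _] := ub; have /andP[v0 _] := vb.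
have /andP[a1 a2] := levelP M.+1 n u0; have /andP[b1 b2] := levelP M.+1 n v0.
have mn : 0 < m ^+ n by rewrite exprn_gt0.
have : `|u - v| <= m ^- n.
  rewrite -(ler_pM2l mn) mulfV ?gt_eqF// -[X in X * _](ger0_norm (ltW mn)) -normrM mulrBr.
  by move: a1 a2 b1 b2; rewrite Lev ler_norml => ? ? ? ?; apply/andP; lra.
move=> /le_trans; apply; apply: (@le_trans _ _ (m * scale n.+1 `^ al)).
  rewrite scale_powR// Nal exprS invfM mulrA mulfV ?mul1r// gt_eqF//.
by rewrite ler_wpM2l// ge0_ler_powR// nnegrE ?(ltW r0)// ltW// scale_gt0.
Qed.

(** The height confines [v] to a set of measure $O(r)$. For fixed [v], two admissible [u] have
    staircase values within $2r$, hence differ by $O(r^{al})$ by [staircase_dist]. *)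
Lemma arc_measure_frostman (al : R) : (4 * m ^+ 2) `^ al = m -> 0 <= al ->
  frostman (@arc_set R M.+1) (1 + al) arc_measure.
Proof.
move=> Nal al0; split; first exact: arc_measure_setC.
exists (16 * m * 2 `^ al) => w r r0.
pose D := arc_map @^-1` (eucl_ball w r).
pose V := [set v : measurableTypeR R | `|v / 2 - w ord0 i1| < r].
have mV : measurable V.
  rewrite -[X in measurable X]setTI (_ : V = (fun v : measurableTypeR R =>
    `|v / 2 - w ord0 i1|) @^-1` `]-oo, r[); last by apply/seteqP; split => v /=; rewrite in_itv.
  have : measurable_fun setT (fun v : measurableTypeR R => `|v / 2 - w ord0 i1|).
    by apply: measurableT_comp => //; apply: measurable_funB => //; exact: measurable_funM.
  by apply.
pose K := 2 * (m * (2 * r) `^ al).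
have K0 : 0 <= K by rewrite !mulr_ge0// powR_ge0.
have mD : measurable D.
  rewrite -[X in measurable X]setTI; apply: measurable_arc_map => //.
  exact: (@measurable_eucl_dist_lt _ _ _ _ (fun=> w) id).
have coordD v u : D (v, u) -> `|v / 2 - w ord0 i1| < r /\
    `|staircase M.+1 u + arc (v / 2) - w ord0 ord0| < r.
  rewrite /D /= /eucl_ball /= eucl_dist2 /arc_map /= arc_point0 arc_point1 => H.
  have H2 : (w ord0 ord0 - (staircase M.+1 u + arc (v / 2))) ^+ 2 + (w ord0 i1 - v / 2) ^+ 2
      < r ^+ 2.
    by rewrite -ltr_sqrt ?exprn_gt0// [X in _ < X]sqrtr_sqr ger0_norm// ltW.
  rewrite (distrC (v / 2)) (distrC _ (w ord0 ord0)).
  split; rewrite -(@ltr_pXn2r _ 2)// ?nnegrE ?(ltW r0)// real_normK ?num_real//.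
    by apply: le_lt_trans H2; rewrite lerDr sqr_ge0.
  by apply: le_lt_trans H2; rewrite lerDl sqr_ge0.
have slice v : (U (xsection D v) <= (K * \1_V v)%:E)%E.
  rewrite indicE; have [vV|vV] := boolP (v \in V); last first.
    rewrite mulr0 (_ : xsection D v = set0) ?measure0//.
    apply/seteqP; split => // u; rewrite /xsection /= inE => /coordD[Vv _].
    by move/negP: vV; apply; apply/mem_set.
  rewrite mulr1; apply: uniform01_diam_le; first exact: measurable_xsection.
    by rewrite mulr_ge0// powR_ge0.
  move=> t u; rewrite /xsection /= !inE => /coordD[_ Ht] /coordD[_ Hu] tb ub.
  apply: staircase_dist => //; first by rewrite mulr_gt0.
  move: Ht Hu; rewrite !ltr_norml => /andP[? ?] /andP[? ?]; apply/andP; lra.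
apply: (@le_trans _ _ (\int[U]_v (K * \1_V v)%:E)%E).
  by apply: ge0_integral_mono => // v; exact: slice.
under eq_integral do rewrite EFinM.
rewrite ge0_integralZl//; last by apply: measurableT_comp.
rewrite integral_indic// setIT.
apply: (@le_trans _ _ (K%:E * (2 * (4 * r))%:E)%E).
  apply: lee_wpmul2l; first by rewrite lee_fin.
  apply: uniform01_diam_le => //; first by rewrite mulr_ge0// ltW.
  move=> t u; rewrite /V /= !ltr_norml => /andP[? ?] /andP[? ?] _ _.
  by rewrite ler_norml; apply/andP; lra.
rewrite -EFinM lee_fin powRD ?(gt_eqF r0) ?implybT// powRr1 ?(ltW r0)//.
rewrite /K powRM ?(ltW r0)// le_eqVlt; apply/orP; left; apply/eqP; ring.
Qed.

End arc_measure.

Lemma prode_ge (R : realType) n (f : 'I_n -> \bar R) (q : R) : 0 <= q ->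
  (forall i, q%:E <= f i)%E -> ((q ^+ n)%:E <= \prod_(i < n) f i)%E.
Proof.
move=> q0; elim: n f => [|n IH] f qf; first by rewrite big_ord0.
rewrite big_ord_recl exprS (EFinM q (q ^+ n)); apply: lee_pmul => //.
- by rewrite lee_fin exprn_ge0.
- by apply: IH => i; exact: qf.
Qed.

Section arc_measure_circumradius.
Context (R : realType) (M : nat).
Local Notation i1 := (lift ord0 (ord0 : 'I_1)).
Local Notation m := (M.+1%:R : R).
Local Notation scale := (scale R M.+1).
Local Notation step := (step R M.+1).
Local Notation P := (power_probability (arc_measure R M) 3).

Let m0 n : 0 < m ^+ n. Proof. by rewrite exprn_gt0// ltr0n. Qed.

(** Half-open in the offset, so that cells of different [j] are disjoint; the three height windows
    keep the points of a triple apart. *)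
Let cell n j (i : 'I_3) : set (borel_rV R 2) := [set w : borel_rV R 2 |
  step n j <= offset (w : 'rV[R]_2) < step n j + scale n /\
  i%:R / 5 <= (w : 'rV[R]_2) ord0 i1 <= i%:R / 5 + 10^-1].

Let measurable_offset : measurable_fun setT (fun w : borel_rV R 2 => offset (w : 'rV[R]_2)).
Proof.
apply: measurable_funB; first exact: measurable_coord.
by apply: (measurableT_comp (@measurable_arc R)); exact: measurable_coord.
Qed.

Let measurable_cell n j i : measurable (cell n j i).
Proof.
apply: measurableI.
  rewrite -[X in measurable X]setTI (_ : (fun w => is_true _) =
    (fun w : borel_rV R 2 => offset (w : 'rV[R]_2)) @^-1` `[step n j, step n j + scale n[).
    exact: measurable_offset.
  by apply/seteqP; split => w /=; rewrite in_itv.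
rewrite -[X in measurable X]setTI (_ : (fun w => is_true _) =
  (fun w : borel_rV R 2 => (w : 'rV[R]_2) ord0 i1) @^-1` `[i%:R / 5, i%:R / 5 + 10^-1]).
  exact: (measurable_coord (d := 2) i1).
by apply/seteqP; split => w /=; rewrite in_itv.
Qed.

(** The height is $v/2$, so a window of length $1/10$ pulls back to length $1/5$ in [v], and level
    [n] equals [j] on an interval of length $m^{-n}$ in [u]. *)
Let cell_ge n j i : (j < M.+1 ^ n)%N -> ((5^-1 * m ^- n)%:E <= arc_measure R M (cell n j i))%E.
Proof.
move=> jM; pose c := j%:R / m ^+ n; pose e := j.+1%:R / m ^+ n.
have ec : e - c = m ^- n by rewrite /e /c -mulrBl -natr1 addrAC subrr add0r mul1r.
have -> : 5^-1 * m ^- n = (2 * i%:R / 5 + 5^-1 - 2 * i%:R / 5) * (e - c).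
  by rewrite ec (addrC (2 * _ / _)) addrK.
have i2 : (i%:R : R) <= 2 by rewrite ler_nat -ltnS.
have i0 : 0 <= (i%:R : R) by [].
apply: arc_measure_ge => //.
- by rewrite lerDl invr_ge0.
- lra.
- by rewrite divr_ge0// ltW.
- by rewrite ler_wpM2r ?invr_ge0 ?(ltW (m0 n))// ler_nat.
- by rewrite ler_pdivrMr// mul1r -natrX ler_nat.
move=> v u /andP[v0 v1] /andP[uc ue]; rewrite /cell /= offset_arc_point arc_point1.
have u0 : 0 <= u by apply: le_trans uc; rewrite divr_ge0// ltW.
have Lu : level M.+1 n u = j.
  by apply: truncn_def; rewrite mulrC -ler_pdivrMr// -ltr_pdivlMr// uc.
have := step_level (isT : (0 < M.+1)%N) n u0; rewrite Lu => ->.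
by split => //; apply/andP; split; lra.
Qed.

Let tuples n j : set (3.-tuple (borel_rV R 2)) := [set x | forall i, cell n j i (tnth x i)].

Let measurable_tuples n j : measurable (tuples n j).
Proof.
rewrite (_ : tuples n j = \bigcap_(i in [set: 'I_3])
    ((@tnth _ (borel_rV R 2) ^~ i) @^-1` cell n j i)); last first.
  by apply/seteqP; split => x /= H i; [move=> _; exact: H|exact: H].
apply: fin_bigcap_measurable; first exact: finite_finset.
by move=> i _; rewrite -[X in measurable X]setTI; exact: measurable_tnth.
Qed.

Let tuples_ge n j : (j < M.+1 ^ n)%N -> (((5^-1 * m ^- n) ^+ 3)%:E <= P (tuples n j))%E.
Proof.
move=> jM; rewrite (power_probabilityE _ (A := cell n j))//.
by apply: prode_ge => [|i]; [rewrite mulr_ge0// invr_ge0 ltW|exact: cell_ge].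
Qed.

Let trivIset_tuples n : trivIset setT (fun j : 'I_(M.+1 ^ n) => tuples n j).
Proof.
have disj j j' x : (j < j')%N -> tuples n j x -> tuples n j' x -> False.
  move=> jj /(_ ord0)[/andP[_ a] _] /(_ ord0)[/andP[b _] _].
  by have := step_gap R (isT : (0 < M.+1)%N) n jj; lra.
apply/trivIsetP => j j' _ _ jj; apply/seteqP; split => // x [xj xj'].
move: jj; rewrite -val_eqE neq_ltn => /orP[jj|jj]; [exact: disj jj xj xj'|exact: disj jj xj' xj].
Qed.

Let c0 n : 0 < 20000 * scale n.
Proof. by apply: mulr_gt0; [rewrite ltr0n|exact: scale_gt0]. Qed.

Let dbl (q : R) : 0 < q -> q < 2 * q.
Proof. by move=> q0; rewrite mulr_natl mulr2n ltrDl. Qed.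

(** The $m^n$ disjoint sets [tuples n j] have probability at least $(m^{-n}/5)^3$ each, in total
    $m^{-2n}/125$. The factor 2 makes the inequality on the radius strict. *)
Let circumradius_ge n : scale n <= 2000^-1 ->
  (((m ^+ n * (5^-1 * m ^- n) ^+ 3))%:E <=
   P [set x | (`|circumradius (x : 3.-tuple 'rV[R]_2) - 1| < 2 * (20000 * scale n))%R])%E.
Proof.
move=> sn; have s0 := scale_gt0 R (isT : (0 < M.+1)%N) n.
apply: (@le_trans _ _ (P (\big[setU/set0]_(j < M.+1 ^ n) tuples n j))).
  rewrite measure_bigsetU_ord//.
  apply: (@le_trans _ _ (\sum_(j < M.+1 ^ n) ((5^-1 * m ^- n) ^+ 3)%:E)%E).
    by rewrite sumEFin sumr_const card_ord -natrX mulr_natl.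
  by apply: lee_sum => j _; exact: tuples_ge.
apply: power_probability_mono; rewrite -(bigcup_mkord _ (tuples n)) => x [j _ xj] /=.
have := circumradius_arc_points s0 sn (fun i => (xj i).1) (fun i => (xj i).2).
by move=> /le_lt_trans; apply; exact: dbl (c0 n).
Qed.

Lemma arc_measure_not_estimate : ~ circumradius_estimate (arc_measure R M).
Proof.
(* Only $t=1$, the common radius of the arcs, is tested. *)
move=> /(_ [set 1]); case; first by exists 1; split => // y y1 t /= ->; rewrite normr1 ltW.
move=> C C0 HC; have m1 : 1 <= m by rewrite ler1n.
have m2 : 1 <= m ^+ 2 by exact: exprn_ege1.
have z0 : 0 <= (4 * m ^+ 2)^-1 < 1.
  by rewrite invr_ge0 mulr_ge0 ?exprn_ge0//= invf_lt1; lra.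
pose K := C * (2 * 20000); have z4 : 0 <= (4^-1 : R) < 1 by apply/andP; lra.
(* 250 is twice the 125 of the lower bound $m^{-2n}/125$, so that $K4^{-n}\le1/250$ contradicts the
   estimate. *)
have [n [sn rn]] : exists n, scale n <= 2000^-1 /\ K * 4^-1 ^+ n <= 250^-1.
  near \oo => n; exists n; split; near: n.
    have e0 : 0 < 2000^-1 :> R by rewrite invr_gt0 ltr0n.
    apply: filterS (near_geometric_le 1 z0 e0) => n.
    by rewrite mul1r exprVn.
  have e0 : 0 < 250^-1 :> R by rewrite invr_gt0 ltr0n.
  exact: near_geometric_le.
have s0 := scale_gt0 R (isT : (0 < M.+1)%N) n.
have e0 : 0 < 2 * (20000 * scale n) := lt_trans (c0 n) (dbl (c0 n)).
have := HC 1 _ erefl e0.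
move=> /(le_trans (circumradius_ge sn)); rewrite lee_fin.
have -> : m ^+ n * (5^-1 * m ^- n) ^+ 3 = 125^-1 * (m ^- n) ^+ 2.
  have mn0 : m ^+ n != 0 by rewrite gt_eqF.
  by move: (m ^+ n) mn0 => q q0; field.
have -> : scale n = 4^-1 ^+ n * (m ^- n) ^+ 2.
  by rewrite /scale exprMn invfM exprVn -exprVn -exprM mulnC exprM !exprVn.
have q0 : 0 < (m ^- n) ^+ 2 by rewrite exprn_gt0// invr_gt0.
rewrite (_ : C * _ = K * 4^-1 ^+ n * (m ^- n) ^+ 2); last by rewrite /K !mulrA.
rewrite ler_pM2r//.
by move=> /le_trans /(_ rn); rewrite lef_pV2 ?posrE ?ltr0n// ler_nat.
Unshelve. all: end_near.
Qed.

End arc_measure_circumradius.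

Lemma circumradius_estimate_sharp (R : realType) (s0 : R) : s0 < 3 / 2 ->
  exists (E : set 'rV[R]_2) (s : R) (nu : probability (borel_rV R 2) R),
    [/\ compact E, (s0%:E < hausdorff_dim E < (3 / 2)%:E)%E, s0 < s,
        frostman E s nu & ~ circumradius_estimate nu].
Proof.
move=> s32; pose n := Num.bound (3 / 2 - s0)^-1.
have n0 : 0 < (n%:R : R).
  apply: le_lt_trans (archi_boundP _); by rewrite invr_ge0 subr_ge0 ltW.
pose N : R := n%:R; pose M := (2 ^ n).-1.
have MS : M.+1 = (2 ^ n)%N by rewrite prednK// expn_gt0.
(* With $m=2^n$ one has $4m^2=2^{2n+2}$, so the logarithm of [m] to the base $4m^2$ is
   $n/(2n+2)=1/2-1/(2n+2)$, which tends to $1/2$. The exponent [b] lies strictly between it and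
   $1/2$, leaving room for the upper bound on the dimension. *)
pose al := N / (2 * N + 2); pose b := (N + 2^-1) / (2 * N + 2).
have D0 : 0 < 2 * N + 2 by rewrite addr_gt0// mulr_gt0.
have al0 : 0 < al by rewrite divr_gt0.
have alb : al < b by rewrite /al /b ltr_pM2r ?invr_gt0// ltrDl invr_gt0.
have b2 : b < 2^-1 by rewrite /b ltr_pdivrMr//; lra.
have s0al : s0 < 1 + al.
  have : (3 / 2 - s0)^-1 < N by apply: archi_boundP; rewrite invr_ge0 subr_ge0 ltW.
  rewrite -[X in _ < X -> _]invrK ltf_pV2 ?posrE ?subr_gt0 ?invr_gt0// => H.
  have E : al = 2^-1 - (2 * N + 2)^-1.
    by rewrite /al; field; rewrite gt_eqF.
  have : (2 * N + 2)^-1 <= N^-1 by rewrite lef_pV2 ?posrE//; lra.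
  by rewrite E; move: H; move: (N^-1) => x; lra.
have N2 : 4 * (M.+1%:R : R) ^+ 2 = 2 `^ (2 * N + 2).
  have -> : 2 * N + 2 = (n * 2 + 2)%:R by rewrite natrD natrM mulrC.
  by rewrite powR_mulrn// MS natrX exprD exprM -(natrX _ 2 2) mulrC.
have Nal : (4 * (M.+1%:R : R) ^+ 2) `^ al = M.+1%:R.
  by rewrite N2 -powRrM /al mulrC divfK ?gt_eqF// MS powR_mulrn// natrX.
have Nb : M.+1%:R < (4 * (M.+1%:R : R) ^+ 2) `^ b.
  have ba0 : 0 < b - al by rewrite subr_gt0.
  have N1 : 1 < 4 * (M.+1%:R : R) ^+ 2.
    by have : 1 <= (M.+1%:R : R) ^+ 2; [rewrite exprn_ege1// ler1n|lra].
  rewrite -(subrK al b) powRD; last by rewrite (gt_eqF (lt_trans ltr01 N1)) implybT.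
  rewrite Nal ltr_pMl ?ltr0n//; have := gt0_ltr_powR ba0 (x := 1) (y := 4 * (M.+1%:R : R) ^+ 2).
  by rewrite powR1 !nnegrE; apply => //; exact: ltW (lt_trans ltr01 N1).
have fr := arc_measure_frostman Nal (ltW al0).
exists (@arc_set R M.+1), (1 + al), (arc_measure R M); split => //.
- exact: compact_arc_set.
- apply/andP; split.
    have al1 : 0 < 1 + al by rewrite addr_gt0.
    have := hausdorff_dim_ge al1 (@measurable_arc_set R M) fr.
    by apply: lt_le_trans; rewrite lte_fin.
  apply: le_lt_trans (hausdorff_dim_arc_set_le _ _ Nb) _ => //.
    exact: lt_trans alb.
  by rewrite lte_fin; lra.
- exact: arc_measure_not_estimate.
Qed.

Theorem theorem1p2 (R : realType) :
  (forall (d : nat) (E : set 'rV[R]_d) (s : R)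
      (nu : probability (borel_rV R d) R),
    (2 <= d)%N ->
    compact E ->
    ((d%:R - 1 + d%:R^-1)%:E < hausdorff_dim E)%E ->
    d%:R - 1 + d%:R^-1 < s ->
    (s%:E < hausdorff_dim E)%E ->
    frostman E s nu ->
    circumradius_estimate nu /\
    (0 < lebesgue_measure
           [set circumradius x | x in
              [set x : d.+1.-tuple 'rV[R]_d | forall i, E (tnth x i)]])%E) /\
  (forall s0 : R, s0 < 3 / 2 ->
    exists (E : set 'rV[R]_2) (s : R) (nu : probability (borel_rV R 2) R),
      [/\ compact E,
          (s0%:E < hausdorff_dim E < (3 / 2)%:E)%E,
          s0 < s,
          frostman E s nu &
          ~ circumradius_estimate nu]).
Proof.
split; last exact: circumradius_estimate_sharp.
move=> d E s nu d2 cE _ s1 _ nuE; split; first exact: frostman_circumradius_estimate d2 s1 nuE.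
exact: circumradius_range_gt0 d2 s1 nuE cE.
Qed.
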